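(* Let $\kappa$ be an inaccessible cardinal, let $f:\kappa\to\kappa$ be any partial function whose domain is unbounded in $\kappa$, and let $G$ be $V$-generic for the lottery preparation of $\kappa$ relative to $f$. Then $\kappa$ is inaccessible in $V[G]$.
   Context: The lottery sum of a collection $A$ of posets is $\oplus A=\{\langle\mathbb{Q},p\rangle:\mathbb{Q}\in A,\ p\in\mathbb{Q}\}\cup\{1\}$, with $1$ above everything and $\langle\mathbb{Q},p\rangle\le\langle\mathbb{Q}',q\rangle$ iff $\mathbb{Q}=\mathbb{Q}'$ and $p\le_{\mathbb{Q}}q$. A poset is ${<}\delta$-strategically closed if in the game where two players alternately play a descending sequence of conditions of length $\delta$ (the second player playing at limit stages), the second player has a strategy ensuring the play can always be continued. A poset is allowed at stage $\gamma$ if it is ${<}\delta$-strategically closed for every $\delta<\gamma$. The lottery preparation of $\kappa$ relative to $f$ is the reverse Easton support iteration of length $\kappa$ (direct limits at inaccessible limit stages, inverse limits elsewhere) in which the stage $\gamma$ forcing is nontrivial only when $\gamma\in\mathrm{dom}(f)$ and $f``\gamma\subseteq\gamma$; at such stages the forcing is the lottery sum, in $V^{\mathbb{P}_\gamma}$, of all posets in $H(f(\gamma)^+)$ allowed at stage $\gamma$. *)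

(* Defs.v *)
From Stdlib Require Import Classical Relations Wellfounded.

(** * Formulas of set theory

    [form X] is the language of set theory with parameters from [X], with
    binders represented by functions.  Each notion of set theory below is
    written once as a formula, and is then read in three ways: in the ground
    model, in its generic extension, and through the forcing relation. *)

Inductive form (X : Type) : Type :=
| fMem (x y : X)
| fEq (x y : X)
| fNot (a : form X)
| fAnd (a b : form X)
| fAll (a : X -> form X).
Arguments fMem {X}. Arguments fEq {X}. Arguments fNot {X}.
Arguments fAnd {X}. Arguments fAll {X}.

Definition fOr {X} (a b : form X) := fNot (fAnd (fNot a) (fNot b)).
Definition fImp {X} (a b : form X) := fNot (fAnd a (fNot b)).
Definition fIff {X} (a b : form X) := fAnd (fImp a b) (fImp b a).
Definition fEx {X} (a : X -> form X) := fNot (fAll (fun x => fNot (a x))).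

Declare Scope form_scope.
Delimit Scope form_scope with form.
Bind Scope form_scope with form.
Notation "x ∈ y" := (fMem x y) (at level 70) : form_scope.
Notation "x ≐ y" := (fEq x y) (at level 70) : form_scope.
Notation "¬ a" := (fNot a) (at level 75, right associativity) : form_scope.
Notation "a ∧ b" := (fAnd a b) (at level 80, right associativity) : form_scope.
Notation "a ∨ b" := (fOr a b) (at level 85, right associativity) : form_scope.
Notation "a ⇒ b" := (fImp a b) (at level 90, right associativity) : form_scope.
Notation "a ⇔ b" := (fIff a b) (at level 95, no associativity) : form_scope.
Notation "∀ x .. y , a" := (fAll (fun x => .. (fAll (fun y => a)) ..))
  (at level 200, x binder, y binder, right associativity) : form_scope.
Notation "∃ x .. y , a" := (fEx (fun x => .. (fEx (fun y => a)) ..))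
  (at level 200, x binder, y binder, right associativity) : form_scope.
Notation "∀[ x ∈ b ] a" := (fAll (fun x => fImp (fMem x b) a))
  (at level 200, x name, b at level 69, right associativity) : form_scope.
Notation "∃[ x ∈ b ] a" := (fEx (fun x => fAnd (fMem x b) a))
  (at level 200, x name, b at level 69, right associativity) : form_scope.

Fixpoint sat {X : Type} (mem eqv : X -> X -> Prop) (a : form X) : Prop :=
  match a with
  | fMem x y => mem x y
  | fEq x y => eqv x y
  | fNot b => ~ sat mem eqv b
  | fAnd b c => sat mem eqv b /\ sat mem eqv c
  | fAll b => forall x, sat mem eqv (b x)
  end.

(** ** Basic notions *)

Section Formulas.
Context {X : Type}.
Implicit Types x y z w t u v f g r s p q : X.
Local Open Scope form_scope.

Definition sub x y : form X := ∀[ z ∈ x ] z ∈ y.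
Definition is_empty x : form X := ∀ z, ¬ z ∈ x.
Definition is_upair z x y : form X := ∀ w, w ∈ z ⇔ (w ≐ x ∨ w ≐ y).
Definition is_opair z x y : form X :=
  ∃ u v, is_upair u x x ∧ is_upair v x y ∧ is_upair z u v.
(* ⟨x, y⟩ ∈ r *)
Definition related r x y : form X := ∃ z, is_opair z x y ∧ z ∈ r.

Definition is_fun f : form X :=
  (∀[ z ∈ f ] ∃ x y, is_opair z x y) ∧
  (∀ x y z, related f x y ∧ related f x z ⇒ y ≐ z).
Definition fun_on f x : form X := is_fun f ∧ (∀ z, z ∈ x ⇔ (∃ y, related f z y)).
Definition fun_to f x y : form X := fun_on f x ∧ (∀ u v, related f u v ⇒ v ∈ y).
Definition partial_fun f x y : form X :=
  is_fun f ∧ (∀ u v, related f u v ⇒ u ∈ x ∧ v ∈ y).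
Definition is_bij f x y : form X :=
  fun_to f x y ∧
  (∀ u v w, related f u w ∧ related f v w ⇒ u ≐ v) ∧
  (∀[ w ∈ y ] ∃ u, related f u w).
(* t = r ↾ x *)
Definition is_restr t r x : form X :=
  ∀ z, z ∈ t ⇔ (z ∈ r ∧ (∃[ u ∈ x ] ∃ v, is_opair z u v)).

Definition is_trans x : form X := ∀[ y ∈ x ] sub y x.
Definition is_ord x : form X := is_trans x ∧ (∀[ y ∈ x ] is_trans y).
Definition is_succ y x : form X := ∀ z, z ∈ y ⇔ (z ∈ x ∨ z ≐ x).
(* nonzero limit ordinals *)
Definition is_lim x : form X :=
  is_ord x ∧ ¬ is_empty x ∧ (∀[ y ∈ x ] ∃[ z ∈ x ] y ∈ z).
Definition is_omega x : form X := is_lim x ∧ (∀[ y ∈ x ] ¬ is_lim y).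

Definition is_card x : form X := is_ord x ∧ (∀[ y ∈ x ] ¬ ∃ g, is_bij g x y).
(* |x| < k, for a cardinal k *)
Definition card_lt x k : form X := ∃[ y ∈ k ] ∃ g, is_bij g x y.

Definition is_regular k : form X :=
  ∀[ x ∈ k ] ∀ g, fun_to g x k ⇒ (∃[ b ∈ k ] ∀ u v, related g u v ⇒ v ∈ b).
Definition is_strong_limit k : form X :=
  ∀[ x ∈ k ] ∀ u, (∀ y, y ∈ u ⇔ sub y x) ⇒ card_lt u k.
Definition inaccessible k : form X :=
  is_card k ∧ (∃[ w ∈ k ] is_omega w) ∧ is_regular k ∧ is_strong_limit k.

Definition unbounded_dom f k : form X := ∀[ a ∈ k ] ∃[ b ∈ k ] a ∈ b ∧ (∃ y, related f b y).

Definition is_tc t x : form X :=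
  is_trans t ∧ sub x t ∧ (∀ u, is_trans u ∧ sub x u ⇒ sub t u).
Definition is_card_succ k x : form X :=
  is_card k ∧ x ∈ k ∧ (∀[ y ∈ k ] is_card y ⇒ ¬ x ∈ y).
(* x ∈ H(l⁺) *)
Definition in_H_succ l x : form X :=
  ∃ k, is_card_succ k l ∧ (∃ t, is_tc t x ∧ card_lt t k).

(** ** Posets, strategic closure, lottery sums *)

(* A forcing notion q = ⟨a, r⟩: a nonempty set with a reflexive transitive
   relation.  As usual in forcing, antisymmetry is not imposed. *)
Definition is_poset q a r : form X :=
  is_opair q a r ∧ ¬ is_empty a ∧
  (∀[ z ∈ r ] ∃[ x ∈ a ] ∃[ y ∈ a ] is_opair z x y) ∧
  (∀[ x ∈ a ] related r x x) ∧
  (∀ x y z, related r x y ∧ related r y z ⇒ related r x z).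

(* t is the set of stages below d at which the second player moves: the first
   player opens the game, moves alternate, and the second player moves at
   (nonzero) limit stages. *)
Definition second_player_stages t d : form X :=
  sub t d ∧
  (∀[ x ∈ d ]
     (is_empty x ⇒ ¬ x ∈ t) ∧
     (is_lim x ⇒ x ∈ t) ∧
     (∀[ y ∈ d ] is_succ x y ⇒ (x ∈ t ⇔ ¬ y ∈ t))).

Definition descending a r b s : form X :=
  fun_to s b a ∧
  (∀ x y u v, x ∈ y ∧ related s x u ∧ related s y v ⇒ related r v u).

(* In the play s of length b, the moves at stages in t are those prescribed by
   the strategy g, a function of the sequence of earlier moves. *)
Definition follows g t b s : form X :=
  ∀[ x ∈ b ] x ∈ t ⇒ (∃ u v, is_restr u s x ∧ related s x v ∧ related g u v).

(* Only the second player can ever be stuck: at the first player's stages the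
   play is empty or has a last condition, which may be repeated. *)
Definition strategically_closed a r d : form X :=
  ∃ t, second_player_stages t d ∧
  (∃ g, is_fun g ∧
    (∀[ b ∈ d ] b ∈ t ⇒
      (∀ s, descending a r b s ∧ follows g t b s ⇒
        (∃[ p ∈ a ] related g s p ∧ (∀ x u, related s x u ⇒ related r p u))))).

Definition allowed_at c a r : form X := ∀[ d ∈ c ] strategically_closed a r d.

(* ⟨a, r⟩ is the lottery sum of the class of posets defined by A.  The extra
   top element is ∅, which is not an ordered pair. *)
Definition is_lottery_sum (A : X -> X -> X -> form X) a r : form X :=
  (∀ z, z ∈ a ⇔
     (is_empty z ∨ (∃ q b s p, A q b s ∧ p ∈ b ∧ is_opair z q p))) ∧
  (∀ w, w ∈ r ⇔
     (∃[ y ∈ a ] ∃[ z ∈ a ] is_opair w y z ∧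
        (is_empty z ∨
         (∃ q b s p p', A q b s ∧ is_opair y q p ∧ is_opair z q p' ∧
            related s p p')))).

(* the posets in H(l⁺) allowed at stage c *)
Definition lottery_ticket c l q a r : form X :=
  is_poset q a r ∧ in_H_succ l q ∧ allowed_at c a r.

(* ⟨a, r⟩ is the one-element poset {∅} *)
Definition is_trivial_poset a r : form X :=
  (∀ z, z ∈ a ⇔ is_empty z) ∧
  (∀ w, w ∈ r ⇔ (∃[ y ∈ a ] ∃[ z ∈ a ] is_opair w y z)).

End Formulas.

(** * Transitive models of ZFC *)

(* First-order syntax with de Bruijn indices, used only for the axiom schemes:
   the functions under [fAll] are arbitrary, so [form X] is not first-order. *)
Inductive fol : Type :=
| vMem (i j : nat)
| vEq (i j : nat)
| vNot (a : fol)
| vAnd (a b : fol)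
| vAll (a : fol).

Definition scons {X : Type} (x : X) (e : nat -> X) (n : nat) : X :=
  match n with O => x | S m => e m end.

Fixpoint fol_sat {X : Type} (mem : X -> X -> Prop) (e : nat -> X) (a : fol) : Prop :=
  match a with
  | vMem i j => mem (e i) (e j)
  | vEq i j => e i = e j
  | vNot b => ~ fol_sat mem e b
  | vAnd b c => fol_sat mem e b /\ fol_sat mem e c
  | vAll b => forall x, fol_sat mem (scons x e) b
  end.

(* A transitive model of ZFC, up to isomorphism: by Mostowski collapse, a
   well-founded extensional structure.  Foundation follows from
   well-foundedness. *)
Record zfc_model : Type := {
  carrier :> Type;
  mem : carrier -> carrier -> Prop;
  mem_wf : well_founded mem;
  zf_ext : forall x y, (forall z, mem z x <-> mem z y) -> x = y;
  zf_pair : forall x y, exists a, forall z, mem z a <-> z = x \/ z = y;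
  zf_union : forall x, exists a, forall z, mem z a <-> exists y, mem y x /\ mem z y;
  zf_power : forall x, exists a, forall z,
    mem z a <-> (forall w, mem w z -> mem w x);
  zf_infinity : exists a,
    (exists x, mem x a /\ forall z, ~ mem z x) /\
    (forall x, mem x a -> exists y, mem y a /\ forall z, mem z y <-> mem z x \/ z = x);
  zf_separation : forall (phi : fol) (e : nat -> carrier) x, exists a, forall z,
    mem z a <-> mem z x /\ fol_sat mem (scons z e) phi;
  zf_replacement : forall (phi : fol) (e : nat -> carrier) x,
    (forall u v w, mem u x ->
       fol_sat mem (scons u (scons v e)) phi ->
       fol_sat mem (scons u (scons w e)) phi -> v = w) ->
    exists a, forall v,
      mem v a <-> exists u, mem u x /\ fol_sat mem (scons u (scons v e)) phi;
  zf_choice : forall x,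
    (forall y, mem y x -> exists z, mem z y) ->
    (forall y y' z, mem y x -> mem y' x -> mem z y -> mem z y' -> y = y') ->
    exists c, forall y, mem y x -> exists! z, mem z y /\ mem z c
}.
Arguments mem {_}.

Notation "V ⊨ a" := (@sat (carrier V) (@mem V) (@eq (carrier V)) a%form)
  (at level 70, a at level 200).

(** * Names and generic extensions *)

(* ⟨s, p⟩ ∈ t.  Every set serves as a name: elements of t that are not of the
   form ⟨s, p⟩ with p in the poset at hand are ignored. *)
Definition in_name {V : zfc_model} (s p t : V) : Prop := V ⊨ related t s p.

Definition below (V : zfc_model) : relation V := clos_trans V mem.

Lemma below_wf (V : zfc_model) : well_founded (below V).
Proof. exact (wf_clos_trans _ _ (mem_wf V)). Qed.

Lemma in_name_below {V : zfc_model} {s p t : V} : in_name s p t -> below V s t.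
Proof.
  intros H. apply NNPP. intros N. apply H. intros z [Hz Hzt].
  apply Hz. intros u Hu. apply Hu. intros v [Huu [_ Hzz]].
  apply N.
  assert (Hs : mem s u).
  { apply NNPP. intros Hn. destruct (Huu s) as [_ K]. apply K.
    split; [intros [A _]; apply A; reflexivity | exact Hn]. }
  assert (Hu' : mem u z).
  { apply NNPP. intros Hn. destruct (Hzz u) as [_ K]. apply K.
    split; [intros [A _]; apply A; reflexivity | exact Hn]. }
  exact (t_trans _ _ _ _ _ (t_step _ _ _ _ Hs)
           (t_trans _ _ _ _ _ (t_step _ _ _ _ Hu') (t_step _ _ _ _ Hzt))).
Qed.

Lemma mem_below {V : zfc_model} {x y : V} : mem x y -> below V x y.
Proof. exact (t_step _ _ _ _). Qed.

(* val_G(t) = val_G(t'), where val_G(t) = {val_G(s) : ⟨s, p⟩ ∈ t, p ∈ G}. *)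
Fixpoint ext_eq_rec {V : zfc_model} (G : V -> Prop) (t : V) (a : Acc (below V) t)
    (t' : V) {struct a} : Prop :=
  (forall s p (h : in_name s p t), G p ->
     exists s' p', in_name s' p' t' /\ G p' /\
       ext_eq_rec G s (Acc_inv a (in_name_below h)) s') /\
  (forall s' p', in_name s' p' t' -> G p' ->
     exists s p (h : in_name s p t), G p /\
       ext_eq_rec G s (Acc_inv a (in_name_below h)) s').

Definition ext_eq {V : zfc_model} (G : V -> Prop) (t t' : V) : Prop :=
  ext_eq_rec G t (below_wf V t) t'.
(* val_G(s) ∈ val_G(t) *)
Definition ext_mem {V : zfc_model} (G : V -> Prop) (s t : V) : Prop :=
  exists s' p, in_name s' p t /\ G p /\ ext_eq G s s'.

(* Truth in V[G], the elements of V[G] being denoted by their names. *)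
Definition ext_sat {V : zfc_model} (G : V -> Prop) (a : form V) : Prop :=
  sat (ext_mem G) (ext_eq G) a.

(* t is the canonical name {⟨y̌, p⟩ : y ∈ x, p ∈ P} of x. *)
Fixpoint check_rec {V : zfc_model} (P x : V) (a : Acc (below V) x) (t : V)
    {struct a} : Prop :=
  forall z, mem z t <->
    exists y (h : mem y x) s p,
      check_rec P y (Acc_inv a (mem_below h)) s /\ mem p P /\ V ⊨ is_opair z s p.
Definition check_name {V : zfc_model} (P x t : V) : Prop :=
  check_rec P x (below_wf V x) t.

(** * The forcing relation of a poset with underlying set P and order L *)

Definition ple {V : zfc_model} (P L p q : V) : Prop :=
  mem p P /\ mem q P /\ V ⊨ related L p q.

Definition dense_below {V : zfc_model} (P L p : V) (D : V -> Prop) : Prop :=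
  forall q, ple P L q p -> exists r, ple P L r q /\ D r.

(* p ⊩ t = t': whenever ⟨s, u⟩ ∈ t and q ≤ p, u, then q ⊩ s ∈ t' (with the
   membership clause unfolded), and symmetrically. *)
Fixpoint forces_eq_rec {V : zfc_model} (P L t : V) (a : Acc (below V) t)
    (t' p : V) {struct a} : Prop :=
  (forall s u (h : in_name s u t) q, ple P L q p -> ple P L q u ->
     dense_below P L q (fun r =>
       exists s' u', in_name s' u' t' /\ ple P L r u' /\
         forces_eq_rec P L s (Acc_inv a (in_name_below h)) s' r)) /\
  (forall s' u' q, in_name s' u' t' -> ple P L q p -> ple P L q u' ->
     dense_below P L q (fun r =>
       exists s u (h : in_name s u t), ple P L r u /\
         forces_eq_rec P L s (Acc_inv a (in_name_below h)) s' r)).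

Definition forces_eq {V : zfc_model} (P L t t' p : V) : Prop :=
  forces_eq_rec P L t (below_wf V t) t' p.
Definition forces_mem {V : zfc_model} (P L s t p : V) : Prop :=
  dense_below P L p (fun r =>
    exists s' u', in_name s' u' t /\ ple P L r u' /\ forces_eq P L s s' r).

Fixpoint forces {V : zfc_model} (P L p : V) (a : form V) : Prop :=
  match a with
  | fMem s t => forces_mem P L s t p
  | fEq s t => forces_eq P L s t p
  | fNot b => forall q, ple P L q p -> ~ forces P L q b
  | fAnd b c => forces P L p b /\ forces P L p c
  | fAll b => forall t, forces P L p (b t)
  end.

Definition forced {V : zfc_model} (P L : V) (a : form V) : Prop :=
  forall p, mem p P -> forces P L p a.

Record generic {V : zfc_model} (P L : V) (G : V -> Prop) : Prop := {
  generic_sub : forall p, G p -> mem p P;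
  generic_nonempty : exists p, G p;
  generic_up : forall p q, G p -> ple P L p q -> G q;
  generic_dir : forall p q, G p -> G q ->
    exists r, G r /\ ple P L r p /\ ple P L r q;
  generic_dense : forall D : V,
    (forall p, mem p D -> mem p P) ->
    (forall p, mem p P -> exists q, mem q D /\ ple P L q p) ->
    exists p, G p /\ mem p D
}.

(** * The lottery preparation *)

Definition name_dom {V : zfc_model} (P Q t : V) : Prop :=
  exists p, mem p P /\ in_name t p Q.

(* Q is full: its domain has representatives of all names of elements of Q,
   so that a condition of the iteration may take its value from dom(Q). *)
Definition full_name {V : zfc_model} (P L Q : V) : Prop :=
  forall p t, mem p P -> forces P L p (t ∈ Q) ->
    exists s, name_dom P Q s /\ forces P L p (t ≐ s).

(* c ∈ dom(f), f(c) = l and f``c ⊆ c *)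
Definition active_stage {V : zfc_model} (f c l : V) : Prop :=
  (V ⊨ related f c l) /\
  forall x y, mem x c -> (V ⊨ related f x y) -> mem y c.

(* The names Q, R of the underlying set and order of the stage c forcing, over
   the poset (P, L).  The ordinals c and f(c) enter the forced formula by their
   canonical names. *)
Definition lottery_stage {V : zfc_model} (f c P L Q R : V) : Prop :=
  full_name P L Q /\
  (forall l, active_stage f c l ->
     exists c' l', check_name P c c' /\ check_name P l l' /\
       forced P L (is_lottery_sum (lottery_ticket c' l') Q R)) /\
  ((~ exists l, active_stage f c l) -> forced P L (is_trivial_poset Q R)).

(* Ps, Ls, Qs, Rs are the sequences of the posets (P_c, L_c) and of the names
   (Q_c, R_c) of the iterands; p is a condition of P_c.  The top element of
   every iterand is ∅. *)
Definition iteration_condition {V : zfc_model} (Ps Ls Qs c p : V) : Prop :=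
  (V ⊨ fun_on p c) /\
  (forall b P L Q r t, mem b c ->
     (V ⊨ related Ps b P) -> (V ⊨ related Ls b L) -> (V ⊨ related Qs b Q) ->
     (V ⊨ is_restr r p b) -> (V ⊨ related p b t) ->
     mem r P /\ name_dom P Q t /\ forces P L r (t ∈ Q)) /\
  (* direct limit at inaccessible stages *)
  ((V ⊨ inaccessible c) ->
     exists d, mem d c /\
       forall b P L t, mem b c -> ~ mem b d ->
         (V ⊨ related Ps b P) -> (V ⊨ related Ls b L) -> (V ⊨ related p b t) ->
         forced P L (is_empty t)).

Definition iteration_le {V : zfc_model} (Ps Ls Rs c p q : V) : Prop :=
  forall b P L R r t u, mem b c ->
    (V ⊨ related Ps b P) -> (V ⊨ related Ls b L) -> (V ⊨ related Rs b R) ->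
    (V ⊨ is_restr r p b) -> (V ⊨ related p b t) -> (V ⊨ related q b u) ->
    forces P L r (related R t u).

Record lottery_iteration {V : zfc_model} (k f Ps Ls Qs Rs : V) : Prop := {
  iter_Ps : exists k', (V ⊨ is_succ k' k) /\ (V ⊨ fun_on Ps k') /\ (V ⊨ fun_on Ls k');
  iter_Qs : (V ⊨ fun_on Qs k) /\ (V ⊨ fun_on Rs k);
  iter_cond : forall c P, (V ⊨ related Ps c P) ->
    forall p, mem p P <-> iteration_condition Ps Ls Qs c p;
  iter_order : forall c P L, (V ⊨ related Ps c P) -> (V ⊨ related Ls c L) ->
    forall w, mem w L <->
      exists p q, mem p P /\ mem q P /\ (V ⊨ is_opair w p q) /\
        iteration_le Ps Ls Rs c p q;
  iter_stage : forall c P L Q R, mem c k ->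
    (V ⊨ related Ps c P) -> (V ⊨ related Ls c L) ->
    (V ⊨ related Qs c Q) -> (V ⊨ related Rs c R) ->
    lottery_stage f c P L Q R
}.

(* (P, L) is the lottery preparation of k relative to f.  The iterands are
   determined only up to the choice of their names, hence a predicate. *)
Definition lottery_preparation {V : zfc_model} (k f P L : V) : Prop :=
  exists Ps Ls Qs Rs : V,
    lottery_iteration k f Ps Ls Qs Rs /\
    (V ⊨ related Ps k P) /\ (V ⊨ related Ls k L).

(* Main.v *)
From Stdlib Require Import Classical ClassicalEpsilon FunctionalExtensionality
  PropExtensionality ProofIrrelevance Arith Lia Wellfounded Cantor.
Require Import Defs.

(** Let [P] be the lottery preparation of [k], with initial segments [P_g].  Every iterand from stage [g] on is a
    lottery sum of posets allowed at that stage, hence strategically closed below [g]; the second player wins the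
    game on the tail of the iteration by playing coordinatewise.  Given fewer than [g] open dense subsets of [P],
    a condition of the tail can therefore be extended, one dense set after the other, so that each of them becomes
    dense in [P_g] alone.  As [P_g] has fewer than [k] conditions up to equivalence, a short function into [k] in
    the extension takes few values at each place, so it is bounded, and a subset of [x < k] in the extension is
    given by a subset in the ground model of a small set, so the power set of [x] remains small.

    The arguments with generic filters are carried out over a countable model, where these exist.  The general
    case follows since the forcing relation is definable: a failure of the theorem is a first-order statement, which
    would reflect to a countable elementary submodel. *)

(** * Definability *)

(** The iteration is never factored into [P_g] and a tail in the extension: [glue] puts a condition
    of [P_g] before the tail of a condition of [P_k], and the density arguments run in the ground
    model. The obstacle is the direct limit at inaccessible stages: a condition assembled coordinate
    by coordinate must keep bounded support there. So wherever nothing happens it takes a fixed name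
    [e b] of the top element, and strategies on lottery sums pass as long as the first player
    passes. When conditions are amalgamated over [P_g], the support at an inaccessible [c > g] is
    bounded for one of two reasons: if [f] sends an active stage below [g] outside [c], all stages
    in [[g, c)] are inactive; otherwise [P_g] has fewer than [c] conditions up to equivalence.
    Smallness can only be meant up to equivalence, because full names may have arbitrarily large
    domains; names are compared through codes of the sets that they denote. Games have a successor
    length [d] and the tail starts at [g = d + 1], so that every iterand of the tail is
    strategically closed for length [d]. *)

Fixpoint ren (f : nat -> nat) (a : fol) : fol :=
  match a with
  | vMem i j => vMem (f i) (f j)
  | vEq i j => vEq (f i) (f j)
  | vNot b => vNot (ren f b)
  | vAnd b c => vAnd (ren f b) (ren f c)
  | vAll b => vAll (ren (fun n => match n with O => O | S m => S (f m) end) b)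
  end.

Lemma fol_sat_ren {X} (m : X -> X -> Prop) a : forall f e,
  fol_sat m e (ren f a) <-> fol_sat m (fun n => e (f n)) a.
Proof.
  induction a as [i j|i j|a IH|a IHa b IHb|a IH]; intros f e; simpl; try tauto.
  - rewrite IH; tauto.
  - rewrite IHa, IHb; tauto.
  - assert (E : forall x, (fun n => scons x e (match n with O => O | S m => S (f m) end))
                        = scons x (fun n => e (f n)))
      by (intros x; apply functional_extensionality; intros [|n]; reflexivity).
    split; intros H x; specialize (H x); rewrite IH, E in *; exact H.
Qed.

(** The binders of [form X] hold arbitrary functions, so an induction on [form] cannot yield
    definability. Through [emb], statements about satisfaction and forcing become inductions on
    [fol]. *)
Fixpoint emb {X} (a : fol) (e : nat -> X) : form X :=
  match a with
  | vMem i j => fMem (e i) (e j)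
  | vEq i j => fEq (e i) (e j)
  | vNot b => fNot (emb b e)
  | vAnd b c => fAnd (emb b e) (emb c e)
  | vAll b => fAll (fun x => emb b (scons x e))
  end.

Lemma sat_emb {X} (m : X -> X -> Prop) a : forall e,
  sat m eq (emb a e) <-> fol_sat m e a.
Proof.
  induction a as [i j|i j|a IH|a IHa b IHb|a IH]; intros e; simpl; try tauto.
  - rewrite IH; tauto.
  - rewrite IHa, IHb; tauto.
  - split; intros H x; apply IH, H.
Qed.

Section Reified.
(** The index type lets one notion serve for families over all models and for families over all
    types; the latter is needed for the hull before it is known to be a model. *)
Context {I : Type} {c : I -> Type}.
Implicit Types a b : forall i : I, (nat -> c i) -> form (c i).
(* [a] is first-order: it comes from a single formula in de Bruijn form. *)
Definition reified a : Prop := exists phi, forall X e, a X e = emb phi e.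

Lemma rf_mem i j : reified (fun X e => fMem (e i) (e j)).
Proof. exists (vMem i j); reflexivity. Qed.
Lemma rf_eq i j : reified (fun X e => fEq (e i) (e j)).
Proof. exists (vEq i j); reflexivity. Qed.
Lemma rf_not a : reified a -> reified (fun X e => fNot (a X e)).
Proof. intros [phi H]; exists (vNot phi); intros; simpl; rewrite H; reflexivity. Qed.
Lemma rf_and a b : reified a -> reified b -> reified (fun X e => fAnd (a X e) (b X e)).
Proof.
  intros [phi H] [psi K]; exists (vAnd phi psi); intros; simpl; rewrite H, K; reflexivity.
Qed.
Lemma rf_all (a : forall X, (nat -> c X) -> c X -> form (c X)) :
  reified (fun X e => a X (fun n => e (S n)) (e 0)) -> reified (fun X e => fAll (a X e)).
Proof.
  intros [phi H]; exists (vAll phi); intros X e; simpl; f_equal.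
  apply functional_extensionality; intros x. exact (H X (scons x e)).
Qed.
End Reified.

Ltac rf_step :=
  cbv beta;
  first [ apply rf_mem | apply rf_eq | apply rf_not | apply rf_and | apply rf_all ].
Ltac rf := cbv delta -[reified carrier] beta; repeat rf_step.

(* Definability by one formula for all models, without parameters; [D] below is definability in one model with
   parameters, and [DT] that of a function. *)
Definition UD (A : forall V : zfc_model, (nat -> V) -> Prop) : Prop :=
  exists phi, forall V e, A V e <-> fol_sat mem e phi.

Lemma UD_mem i j : UD (fun V e => mem (e i) (e j)).
Proof. exists (vMem i j); reflexivity. Qed.
Lemma UD_not A : UD A -> UD (fun V e => ~ A V e).
Proof. intros [phi H]; exists (vNot phi); intros; simpl; rewrite <- H; tauto. Qed.
Lemma UD_and A B : UD A -> UD B -> UD (fun V e => A V e /\ B V e).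
Proof.
  intros [phi H] [psi K]; exists (vAnd phi psi); intros; simpl; rewrite <- H, <- K; tauto.
Qed.
Lemma UD_all (A : forall V : zfc_model, (nat -> V) -> V -> Prop) :
  UD (fun V e => A V (fun n => e (S n)) (e 0)) -> UD (fun V e => forall x, A V e x).
Proof.
  intros [phi H]; exists (vAll phi); intros V e; simpl.
  split; intros K x; specialize (K x); apply (H V (scons x e)); exact K.
Qed.
Lemma UD_iff A B : (forall V e, A V e <-> B V e) -> UD A -> UD B.
Proof. intros E [phi H]; exists phi; intros; rewrite <- E; apply H. Qed.
Lemma UD_imp A B : UD A -> UD B -> UD (fun V e => A V e -> B V e).
Proof.
  intros HA HB; eapply UD_iff; [|exact (UD_not _ (UD_and _ _ HA (UD_not _ HB)))].
  intros; simpl; destruct (classic (B V e)); tauto.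
Qed.
Lemma UD_ex (A : forall V : zfc_model, (nat -> V) -> V -> Prop) :
  UD (fun V e => A V (fun n => e (S n)) (e 0)) -> UD (fun V e => exists x, A V e x).
Proof.
  intros H; eapply UD_iff;
    [|exact (UD_not _ (UD_all (fun V e x => ~ A V e x) (UD_not _ H)))].
  intros V e; simpl; split.
  - intros K; apply NNPP; intros N; apply K; intros x Hx; apply N; exists x; exact Hx.
  - intros [x Hx] K; exact (K x Hx).
Qed.
Lemma UD_ren (f : nat -> nat) (A : forall V : zfc_model, (nat -> V) -> Prop) :
  UD A -> UD (fun V e => A V (fun n => e (f n))).
Proof. intros [phi H]; exists (ren f phi); intros; rewrite fol_sat_ren; apply H. Qed.
Lemma UD_sat (a : forall V : zfc_model, (nat -> V) -> form V) :
  reified a -> UD (fun V e => V ⊨ a V e).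
Proof. intros [phi H]; exists phi; intros V e; rewrite H; apply sat_emb. Qed.

Section Definable.
Context {V : zfc_model}.
Implicit Types e : nat -> V.

Definition look (v : nat -> nat + V) (e : nat -> V) (n : nat) : V :=
  match v n with inl i => e i | inr c => c end.

Definition D (A : (nat -> V) -> Prop) : Prop :=
  exists phi v, forall e, A e <-> fol_sat mem (look v e) phi.

Lemma D_iff A B : (forall e, A e <-> B e) -> D A -> D B.
Proof. intros E (phi & v & H); exists phi, v; intros; rewrite <- E; apply H. Qed.

Lemma D_UD (A : forall V : zfc_model, (nat -> V) -> Prop) : UD A -> D (A V).
Proof. intros [phi H]; exists phi, (fun n => inl n); intros e; apply H. Qed.

Lemma D_not A : D A -> D (fun e => ~ A e).
Proof. intros (phi & v & H); exists (vNot phi), v; intros; simpl; rewrite <- H; tauto. Qed.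

Lemma D_and A B : D A -> D B -> D (fun e => A e /\ B e).
Proof.
  intros (phi & v & H) (psi & w & K).
  (* The two formulas come with separate assignments of parameters. These are interleaved, even
     variables serving the first formula and odd ones the second. *)
  exists (vAnd (ren (fun n => 2 * n) phi) (ren (fun n => S (2 * n)) psi)).
  exists (fun n => if Nat.even n then v (Nat.div2 n) else w (Nat.div2 n)).
  intros e; cbn [fol_sat]; rewrite !fol_sat_ren, H, K.
  assert (E1 : (fun n => look (fun n => if Nat.even n then v (Nat.div2 n) else w (Nat.div2 n)) e (2 * n)) = look v e).
  { apply functional_extensionality; intros n; unfold look.
    rewrite Nat.even_even, Nat.div2_double; reflexivity. }
  assert (E2 : (fun n => look (fun n => if Nat.even n then v (Nat.div2 n) else w (Nat.div2 n)) e (S (2 * n))) = look w e).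
  { apply functional_extensionality; intros n; unfold look.
    replace (S (2 * n)) with (2 * n + 1) at 1 by lia.
    rewrite Nat.even_odd, Nat.div2_succ_double; reflexivity. }
  rewrite E1, E2; tauto.
Qed.

Lemma D_all (A : (nat -> V) -> V -> Prop) :
  D (fun e => A (fun n => e (S n)) (e 0)) -> D (fun e => forall x, A e x).
Proof.
  intros (phi & v & H).
  (* Every variable that [v] sends to slot 0 becomes the bound variable; the others move up past
     it. *)
  exists (vAll (ren (fun n => match v n with inl 0 => 0 | _ => S n end) phi)).
  exists (fun n => match v n with inl (S i) => inl i | w => w end).
  intros e; simpl.
  assert (E : forall x, (fun n => scons x (look (fun n => match v n with inl (S i) => inl i | w => w end) e)
      (match v n with inl 0 => 0 | _ => S n end)) = look v (scons x e)).
  { intros x; apply functional_extensionality; intros n; unfold look; simpl.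
    destruct (v n) as [[|i]|c] eqn:Ev; simpl; try rewrite Ev; reflexivity. }
  split; intros K x.
  - rewrite fol_sat_ren, E; apply (H (scons x e)), K.
  - specialize (K x); rewrite fol_sat_ren, E in K; exact (proj2 (H (scons x e)) K).
Qed.

Lemma D_imp A B : D A -> D B -> D (fun e => A e -> B e).
Proof.
  intros HA HB; eapply D_iff; [|exact (D_not _ (D_and _ _ HA (D_not _ HB)))].
  intros; simpl; destruct (classic (B e)); tauto.
Qed.
Lemma D_or A B : D A -> D B -> D (fun e => A e \/ B e).
Proof.
  intros HA HB; eapply D_iff; [|exact (D_not _ (D_and _ _ (D_not _ HA) (D_not _ HB)))].
  intros; simpl; destruct (classic (A e)); tauto.
Qed.
Lemma D_equiv A B : D A -> D B -> D (fun e => A e <-> B e).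
Proof. intros HA HB; apply D_and; apply D_imp; assumption. Qed.
Lemma D_ex (A : (nat -> V) -> V -> Prop) :
  D (fun e => A (fun n => e (S n)) (e 0)) -> D (fun e => exists x, A e x).
Proof.
  intros H; eapply D_iff; [|exact (D_not _ (D_all (fun e x => ~ A e x) (D_not _ H)))].
  intros e; simpl; split.
  - intros K; apply NNPP; intros N; apply K; intros x Hx; apply N; exists x; exact Hx.
  - intros [x Hx] K; exact (K x Hx).
Qed.
Lemma D_subst (w : nat -> nat + V) A : D A -> D (fun e => A (look w e)).
Proof.
  intros (phi & v & H).
  exists phi, (fun n => match v n with inl i => w i | inr c => inr c end).
  intros e; rewrite H.
  replace (look v (look w e)) with
    (look (fun n => match v n with inl i => w i | inr c => inr c end) e); [tauto|].
  apply functional_extensionality; intros n; unfold look.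
  destruct (v n); reflexivity.
Qed.
Lemma D_ren (f : nat -> nat) A : D A -> D (fun e => A (fun n => e (f n))).
Proof. exact (D_subst (fun n => inl (f n)) A). Qed.
Lemma D_const (Q : Prop) : D (fun _ => Q).
Proof.
  destruct (classic Q) as [q|q].
  - exists (vAll (vEq 0 0)), inl; intros; simpl; split; [auto|]; tauto.
  - exists (vNot (vAll (vEq 0 0))), inl; intros; simpl; split; [tauto|intros K; exfalso; apply K; auto].
Qed.

Definition DT (t : (nat -> V) -> V) : Prop := D (fun e => e 0 = t (fun n => e (S n))).

Lemma DT_var i : DT (fun e => e i).
Proof. exists (vEq 0 (S i)), inl; intros; simpl; tauto. Qed.
Lemma DT_const c : DT (fun _ => c).
Proof.
  exists (vEq 0 1), (fun n => match n with 0 => inl 0 | _ => inr c end); intros; reflexivity.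
Qed.

Lemma D_sub (B : (nat -> V) -> V -> Prop) t :
  DT t -> D (fun e => B (fun n => e (S n)) (e 0)) -> D (fun e => B e (t e)).
Proof.
  intros Ht HB.
  eapply D_iff; [|exact (D_ex (fun e x => x = t e /\ B e x) (D_and _ _ Ht HB))].
  intros e; simpl; split; [intros (x & -> & H); exact H | intros H; exists (t e); auto].
Qed.
Lemma DT_ren (f : nat -> nat) t : DT t -> DT (fun e => t (fun n => e (f n))).
Proof.
  intros H. exact (D_ren (fun n => match n with 0 => 0 | S m => S (f m) end) _ H).
Qed.

Lemma D_mem t u : DT t -> DT u -> D (fun e => mem (t e) (u e)).
Proof.
  intros Ht Hu. apply (D_sub (fun e x => mem x (u e)) t Ht).
  apply (D_sub (fun e y => mem (e 0) y) (fun e => u (fun n => e (S n))) (DT_ren S _ Hu)).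
  exists (vMem 1 0), inl; intros; reflexivity.
Qed.
Lemma D_eq t u : DT t -> DT u -> D (fun e => t e = u e).
Proof.
  intros Ht Hu. apply (D_sub (fun e x => x = u e) t Ht).
  apply (D_sub (fun e y => e 0 = y) (fun e => u (fun n => e (S n))) (DT_ren S _ Hu)).
  exists (vEq 1 0), inl; intros; reflexivity.
Qed.

Definition D1 (A : V -> Prop) := D (fun e => A (e 0)).
Definition D2 (A : V -> V -> Prop) := D (fun e => A (e 0) (e 1)).
Definition D3 (A : V -> V -> V -> Prop) := D (fun e => A (e 0) (e 1) (e 2)).
Definition D4 (A : V -> V -> V -> V -> Prop) := D (fun e => A (e 0) (e 1) (e 2) (e 3)).
Definition F1 (F : V -> V) := DT (fun e => F (e 0)).
Definition F2 (F : V -> V -> V) := DT (fun e => F (e 0) (e 1)).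
Definition F3 (F : V -> V -> V -> V) := DT (fun e => F (e 0) (e 1) (e 2)).

Lemma D1_lift A t : D1 A -> DT t -> D (fun e => A (t e)).
Proof. intros H Ht; exact (D_sub (fun _ x => A x) t Ht H). Qed.
Lemma D2_lift A t u : D2 A -> DT t -> DT u -> D (fun e => A (t e) (u e)).
Proof.
  intros H Ht Hu. apply (D_sub (fun e x => A x (u e)) t Ht).
  apply (D_sub (fun e y => A (e 0) y) _ (DT_ren S _ Hu)).
  exact (D_ren (fun n => match n with 0 => 1 | _ => 0 end) _ H).
Qed.
Lemma D3_lift A t u v : D3 A -> DT t -> DT u -> DT v -> D (fun e => A (t e) (u e) (v e)).
Proof.
  intros H Ht Hu Hv. apply (D_sub (fun e x => A x (u e) (v e)) t Ht).
  apply (D_sub (fun e y => A (e 0) y (v (fun n => e (S n)))) _ (DT_ren S _ Hu)).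
  apply (D_sub (fun e y => A (e 1) (e 0) y) _ (DT_ren (fun n => S (S n)) _ Hv)).
  exact (D_ren (fun n => match n with 0 => 2 | 1 => 1 | _ => 0 end) _ H).
Qed.
Lemma D4_lift A t u v w : D4 A -> DT t -> DT u -> DT v -> DT w ->
  D (fun e => A (t e) (u e) (v e) (w e)).
Proof.
  intros H Ht Hu Hv Hw. apply (D_sub (fun e x => A x (u e) (v e) (w e)) t Ht).
  apply (D_sub (fun e y => A (e 0) y (v (fun n => e (S n))) (w (fun n => e (S n)))) _ (DT_ren S _ Hu)).
  apply (D_sub (fun e y => A (e 1) (e 0) y (w (fun n => e (S (S n))))) _ (DT_ren (fun n => S (S n)) _ Hv)).
  apply (D_sub (fun e y => A (e 2) (e 1) (e 0) y) _ (DT_ren (fun n => S (S (S n))) _ Hw)).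
  exact (D_ren (fun n => match n with 0 => 3 | 1 => 2 | 2 => 1 | _ => 0 end) _ H).
Qed.
Lemma F1_lift F t : F1 F -> DT t -> DT (fun e => F (t e)).
Proof.
  intros H Ht. apply (D2_lift (fun y x => y = F x) (fun e => e 0)); [exact H|apply DT_var|].
  exact (DT_ren S _ Ht).
Qed.
Lemma F2_lift F t u : F2 F -> DT t -> DT u -> DT (fun e => F (t e) (u e)).
Proof.
  intros H Ht Hu. apply (D3_lift (fun z x y => z = F x y) (fun e => e 0));
    [exact H|apply DT_var| |]; apply (DT_ren S); assumption.
Qed.
Lemma F3_lift F t u v : F3 F -> DT t -> DT u -> DT v -> DT (fun e => F (t e) (u e) (v e)).
Proof.
  intros H Ht Hu Hv. apply (D4_lift (fun z x y w => z = F x y w) (fun e => e 0));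
    [exact H|apply DT_var| | |]; apply (DT_ren S); assumption.
Qed.
End Definable.

Arguments D {V}. Arguments DT {V}.

Create HintDb dfn.
Ltac dd_fact := solve [ assumption | auto 2 with dfn nocore ].
Ltac dd_app :=
  match goal with
  | |- D (fun e => ?A (@?t e) (@?u e) (@?v e) (@?w e)) =>
      apply (D4_lift A t u v w); [dd_fact | .. ]
  | |- D (fun e => ?A (@?t e) (@?u e) (@?v e)) => apply (D3_lift A t u v); [dd_fact | .. ]
  | |- D (fun e => ?A (@?t e) (@?u e)) => apply (D2_lift A t u); [dd_fact | .. ]
  | |- D (fun e => ?A (@?t e)) => apply (D1_lift A t); [dd_fact | .. ]
  | |- DT (fun e => ?F (@?t e) (@?u e) (@?v e)) => apply (F3_lift F t u v); [dd_fact | .. ]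
  | |- DT (fun e => ?F (@?t e) (@?u e)) => apply (F2_lift F t u); [dd_fact | .. ]
  | |- DT (fun e => ?F (@?t e)) => apply (F1_lift F t); [dd_fact | .. ]
  end.
(** A hook, redefined when further operators become available, mostly ones that take a predicate or
    a function as argument. *)
Ltac dd_ext := fail.
Ltac dd_step :=
  cbv beta;
  lazymatch goal with
  | |- DT _ => first [ apply DT_var | apply DT_const | dd_app | dd_ext | assumption ]
  | |- D _ =>
      first [ apply D_mem | apply D_eq | apply D_const | dd_app | dd_ext
            | apply D_and | apply D_or | apply D_equiv | apply D_imp | apply D_not
            | apply D_all | apply D_ex | assumption ]
  end.
Ltac dd := unfold D1, D2, D3, D4, F1, F2, F3; repeat dd_step.

(** * Set theory in a model *)

Section Sets.
Context {V : zfc_model}.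
Implicit Types x y z u v w f g s : V.

Lemma V_inh : inhabited V.
Proof. destruct (zf_infinity V) as [a _]; exact (inhabits a). Qed.

Definition the (A : V -> Prop) : V := epsilon V_inh A.
Lemma the_spec (A : V -> Prop) : (exists x, A x) -> A (the A).
Proof. apply epsilon_spec. Qed.
Lemma the_unique (A : V -> Prop) x : A x -> (forall y, A y -> y = x) -> the A = x.
Proof. intros H K; apply K, the_spec; exists x; exact H. Qed.

Lemma wf_min (A : V -> Prop) : (exists x, A x) -> exists x, A x /\ forall y, mem y x -> ~ A y.
Proof.
  intros [x Hx]; apply NNPP; intros N; revert Hx.
  induction (mem_wf V x) as [x _ IH]; intros Hx.
  apply N; exists x; split; [exact Hx|]; exact IH.
Qed.
Lemma mem_ind (A : V -> Prop) : (forall x, (forall y, mem y x -> A y) -> A x) -> forall x, A x.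
Proof. exact (well_founded_ind (mem_wf V) A). Qed.
Lemma mem_irr x : ~ mem x x.
Proof. induction x as [x IH] using mem_ind; intros H; exact (IH x H H). Qed.
Lemma mem_asym x y : mem x y -> ~ mem y x.
Proof. revert y; induction x as [x IH] using mem_ind; intros y H K; exact (IH y K x K H). Qed.

Lemma replacement_rel (R : V -> V -> Prop) x : D2 R ->
  (forall u v w, mem u x -> R u v -> R u w -> v = w) ->
  exists a, forall v, mem v a <-> exists u, mem u x /\ R u v.
Proof.
  intros (phi & v0 & H) Hf.
  (* The axiom reads its formula with [u] and [v] as variables 0 and 1. Variables of [phi] that
     stand for them are renamed accordingly, and any other variable [n] becomes the parameter at
     [S (S n)]. *)
  set (rho := fun n => match v0 n with inl 0 => 0 | inl 1 => 1 | _ => S (S n) end).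
  set (e' := fun n => match v0 n with inr c => c | _ => x end).
  assert (E : forall u v, R u v <-> fol_sat mem (scons u (scons v e')) (ren rho phi)).
  { intros u v. rewrite fol_sat_ren.
    pose proof (H (scons u (scons v (fun _ => x)))) as K; simpl in K; rewrite K.
    replace (fun n => scons u (scons v e') (rho n)) with (look v0 (scons u (scons v (fun _ => x))));
      [tauto|].
    apply functional_extensionality; intros n; unfold look, rho, e'.
    destruct (v0 n) as [[|[|i]]|c] eqn:Ev; simpl; try rewrite Ev; reflexivity. }
  destruct (zf_replacement V (ren rho phi) e' x) as [a Ha].
  - intros u v w Hu Hv Hw; rewrite <- E in Hv, Hw; eauto.
  - exists a; intros v; rewrite Ha; split; intros (u & Hu & K); exists u; rewrite E in *; auto.
Qed.

Definition sep x (A : V -> Prop) : V := the (fun a => forall z, mem z a <-> mem z x /\ A z).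
Lemma sepE x (A : V -> Prop) z : D1 A -> (mem z (sep x A) <-> mem z x /\ A z).
Proof.
  intros HA. revert z.
  refine (the_spec (fun a => forall z, mem z a <-> mem z x /\ A z) _).
  destruct (replacement_rel (fun u v => v = u /\ A u) x) as [a Ha].
  - dd.
  - intros u v w _ [-> _] [-> _]; reflexivity.
  - exists a; intros z; rewrite Ha; split.
    + intros (u & Hu & -> & K); auto.
    + intros [K1 K2]; exists z; auto.
Qed.

(** By extensionality a set is determined by the condition for membership in it, so a definable
    condition yields a definable term. *)
Lemma DT_char (t : (nat -> V) -> V) (A : (nat -> V) -> V -> Prop) :
  (forall e z, mem z (t e) <-> A e z) ->
  D (fun e => A (fun n => e (S n)) (e 0)) -> DT t.
Proof.
  intros E HA. unfold DT.
  apply (D_iff (fun e => forall z, mem z (e 0) <-> A (fun n => e (S n)) z)).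
  - intros e; split.
    + intros K; apply zf_ext; intros z; rewrite K, E; tauto.
    + intros -> z; apply E.
  - apply D_all, D_equiv; [dd|].
    exact (D_ren (fun n => match n with 0 => 0 | S m => S (S m) end) _ HA).
Qed.
Lemma D_inst (A : (nat -> V) -> V -> Prop) e :
  D (fun e => A (fun n => e (S n)) (e 0)) -> D1 (A e).
Proof.
  intros H. exact (D_subst (fun n => match n with 0 => inl 0 | S m => inr (e m) end) _ H).
Qed.
Lemma DT_inst (F : (nat -> V) -> V -> V) e :
  DT (fun e => F (fun n => e (S n)) (e 0)) -> F1 (F e).
Proof.
  intros H. exact (D_subst (fun n => match n with 0 => inl 0 | 1 => inl 1 | S (S m) => inr (e m) end) _ H).
Qed.
Lemma DT_sep (x : (nat -> V) -> V) (A : (nat -> V) -> V -> Prop) :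
  DT x -> D (fun e => A (fun n => e (S n)) (e 0)) -> DT (fun e => sep (x e) (A e)).
Proof.
  intros Hx HA. apply (DT_char _ (fun e z => mem z (x e) /\ A e z)).
  - intros e z; apply sepE, D_inst, HA.
  - apply D_and; [|exact HA]. apply D_mem; [apply DT_var|exact (DT_ren S _ Hx)].
Qed.

Definition img x (F : V -> V) : V := the (fun a => forall z, mem z a <-> exists u, mem u x /\ z = F u).
Lemma imgE x F z : F1 F -> (mem z (img x F) <-> exists u, mem u x /\ z = F u).
Proof.
  intros HF; revert z.
  refine (the_spec (fun a => forall z, mem z a <-> exists u, mem u x /\ z = F u) _).
  apply (replacement_rel (fun u v => v = F u)).
  - exact (D_ren (fun n => match n with 0 => 1 | _ => 0 end) _ HF).
  - intros u v w _ -> ->; reflexivity.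
Qed.
Lemma DT_img (x : (nat -> V) -> V) (F : (nat -> V) -> V -> V) :
  DT x -> DT (fun e => F (fun n => e (S n)) (e 0)) -> DT (fun e => img (x e) (F e)).
Proof.
  intros Hx HF. apply (DT_char _ (fun e z => exists u, mem u (x e) /\ z = F e u)).
  - intros e z; apply imgE, DT_inst, HF.
  - apply D_ex, D_and.
    + apply D_mem; [apply DT_var|exact (DT_ren (fun n => S (S n)) _ Hx)].
    + exact (D_ren (fun n => match n with 0 => 1 | 1 => 0 | S m => S m end) _ HF).
Qed.

Definition emp : V := sep (the (fun _ => True)) (fun _ => False).
Lemma empE z : ~ mem z emp.
Proof. unfold emp; rewrite sepE by dd; tauto. Qed.
Lemma emp_unique x : (forall z, ~ mem z x) -> x = emp.
Proof. intros H; apply zf_ext; intros z; split; intros K; [destruct (H z K)|destruct (empE z K)]. Qed.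
Lemma nonemp x : x <> emp -> exists z, mem z x.
Proof.
  intros H; apply NNPP; intros N; apply H, emp_unique; intros z Hz; apply N; exists z; exact Hz.
Qed.

Definition up x y : V := the (fun a => forall z, mem z a <-> z = x \/ z = y).
Lemma upE x y z : mem z (up x y) <-> z = x \/ z = y.
Proof. revert z; apply (the_spec (fun a => forall z, mem z a <-> z = x \/ z = y)), zf_pair. Qed.
Definition un x : V := the (fun a => forall z, mem z a <-> exists y, mem y x /\ mem z y).
Lemma unE x z : mem z (un x) <-> exists y, mem y x /\ mem z y.
Proof.
  revert z; apply (the_spec (fun a => forall z, mem z a <-> exists y, mem y x /\ mem z y)), zf_union.
Qed.
Definition incl x y : Prop := forall z, mem z x -> mem z y.
Definition pow x : V := the (fun a => forall z, mem z a <-> incl z x).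
Lemma powE x z : mem z (pow x) <-> incl z x.
Proof. revert z; apply (the_spec (fun a => forall z, mem z a <-> incl z x)), zf_power. Qed.

Lemma D2_incl : D2 incl. Proof. unfold incl; dd. Qed.
Lemma F2_up : F2 up.
Proof. apply (DT_char _ (fun e z => z = e 0 \/ z = e 1)); [intros; apply upE|dd]. Qed.
Lemma F1_un : F1 un.
Proof.
  apply (DT_char _ (fun e z => exists y, mem y (e 0) /\ mem z y)); [intros; apply unE|dd].
Qed.
Hint Resolve D2_incl F2_up F1_un : dfn.
Lemma F1_pow : F1 pow.
Proof. apply (DT_char _ (fun e z => incl z (e 0))); [intros; apply powE|dd]. Qed.

Definition sg x := up x x.
Lemma sgE x z : mem z (sg x) <-> z = x. Proof. unfold sg; rewrite upE; tauto. Qed.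
Definition op x y := up (sg x) (up x y).
Definition cup x y := un (up x y).
Lemma cupE x y z : mem z (cup x y) <-> mem z x \/ mem z y.
Proof.
  unfold cup; rewrite unE; split.
  - intros (w & Hw & K); apply upE in Hw; destruct Hw; subst; auto.
  - intros [K|K]; [exists x|exists y]; rewrite upE; auto.
Qed.
Definition suc x := cup x (sg x).
Lemma sucE x z : mem z (suc x) <-> mem z x \/ z = x.
Proof. unfold suc; rewrite cupE, sgE; tauto. Qed.
Lemma F1_sg : F1 sg. Proof. unfold sg; dd. Qed.
Lemma F2_cup : F2 cup. Proof. unfold cup; dd. Qed.
Hint Resolve F1_sg F2_cup F1_pow : dfn.
Lemma F1_suc : F1 suc. Proof. unfold suc; dd. Qed.
Lemma F2_op : F2 op. Proof. unfold op; dd. Qed.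
Hint Resolve F1_suc F2_op : dfn.

Lemma up_sg x y z : up x y = sg z -> x = z /\ y = z.
Proof. intros E; split; apply sgE; rewrite <- E; apply upE; auto. Qed.
Lemma up_inj x y y' : up x y = up x y' -> y = y'.
Proof.
  intros E.
  assert (H : mem y (up x y')) by (rewrite <- E; apply upE; auto).
  assert (K : mem y' (up x y)) by (rewrite E; apply upE; auto).
  apply upE in H, K; intuition congruence.
Qed.
Lemma op_inj x y x' y' : op x y = op x' y' -> x = x' /\ y = y'.
Proof.
  unfold op; intros E.
  assert (x = x').
  { assert (H : mem (sg x) (up (sg x') (up x' y'))) by (rewrite <- E; apply upE; auto).
    apply upE in H; destruct H as [H|H].
    - apply sgE; rewrite <- H; apply sgE; reflexivity.
    - symmetry in H; apply up_sg in H; symmetry; tauto. }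
  subst x'; split; [reflexivity|].
  apply up_inj in E; apply up_inj in E; exact E.
Qed.
Lemma op_nonemp x y : op x y <> emp.
Proof. intros E; apply (empE (sg x)); rewrite <- E; apply upE; auto. Qed.

Definition prod x y : V :=
  sep (pow (pow (cup x y))) (fun z => exists u v, mem u x /\ mem v y /\ z = op u v).
Lemma prodE x y z : mem z (prod x y) <-> exists u v, mem u x /\ mem v y /\ z = op u v.
Proof.
  unfold prod; rewrite sepE by dd; split; [tauto|].
  intros (u & v & Hu & Hv & ->); split; [|exists u, v; auto].
  apply powE; intros w Hw; apply powE; intros t Ht; apply cupE.
  apply upE in Hw; destruct Hw as [-> | ->]; [apply sgE in Ht|apply upE in Ht];
    intuition (subst; auto).
Qed.
Lemma prod_op x y u v : mem (op u v) (prod x y) <-> mem u x /\ mem v y.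
Proof.
  rewrite prodE; split.
  - intros (u' & v' & Hu & Hv & E); apply op_inj in E; destruct E; subst; auto.
  - intros [Hu Hv]; exists u, v; auto.
Qed.
Lemma F2_prod : F2 prod.
Proof.
  apply (DT_char _ (fun e z => exists u v, mem u (e 0) /\ mem v (e 1) /\ z = op u v));
    [intros; apply prodE|dd].
Qed.

Lemma mem_op_l x y f : mem (op x y) f -> mem x (un (un f)).
Proof.
  intros H; apply unE; exists (sg x); split; [|apply sgE; reflexivity].
  apply unE; exists (op x y); split; [exact H|apply upE; auto].
Qed.
Lemma mem_op_r x y f : mem (op x y) f -> mem y (un (un f)).
Proof.
  intros H; apply unE; exists (up x y); split; [|apply upE; auto].
  apply unE; exists (op x y); split; [exact H|apply upE; auto].
Qed.

(** The union of the singleton of the value is the value itself, so no description operator is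
    needed. Off the domain the result is empty. *)
Definition ap f x : V := un (sep (un (un f)) (fun y => mem (op x y) f)).
Lemma ap_eq f x y : mem (op x y) f -> (forall z, mem (op x z) f -> z = y) -> ap f x = y.
Proof.
  intros H K; unfold ap; apply zf_ext; intros z; rewrite unE; split.
  - intros (w & Hw & Hz); apply sepE in Hw; [|dd]; destruct Hw as [_ Hw].
    rewrite <- (K w Hw); exact Hz.
  - intros Hz; exists y; split; [|exact Hz]; apply sepE; [dd|].
    split; [exact (mem_op_r _ _ _ H)|exact H].
Qed.
Definition restr f x : V := sep f (fun z => exists u v, mem u x /\ z = op u v).
Lemma restr_op f x u v : mem (op u v) (restr f x) <-> mem (op u v) f /\ mem u x.
Proof.
  unfold restr; rewrite sepE by dd; split.
  - intros [H (u' & v' & Hu & E)]; apply op_inj in E; destruct E; subst; auto.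
  - intros [H K]; split; [exact H|exists u, v; auto].
Qed.
Lemma restrE f x z : mem z (restr f x) <-> mem z f /\ exists u v, mem u x /\ z = op u v.
Proof. unfold restr; apply sepE; dd. Qed.

Definition lam x (F : V -> V) : V := img x (fun z => op z (F z)).
Lemma lamE x F z : F1 F -> (mem z (lam x F) <-> exists u, mem u x /\ z = op u (F u)).
Proof. intros HF; unfold lam; apply imgE; dd. Qed.
Lemma lam_op x F u v : F1 F -> (mem (op u v) (lam x F) <-> mem u x /\ v = F u).
Proof.
  intros HF; rewrite lamE by dd; split.
  - intros (w & Hw & E); apply op_inj in E; destruct E; subst; auto.
  - intros [H ->]; exists u; auto.
Qed.
Lemma ap_lam x F u : F1 F -> mem u x -> ap (lam x F) u = F u.
Proof.
  intros HF Hu; apply ap_eq; [apply lam_op; auto|].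
  intros z Hz; apply lam_op in Hz; tauto.
Qed.
Lemma lam_ext x F G : F1 F -> F1 G -> (forall u, mem u x -> F u = G u) -> lam x F = lam x G.
Proof.
  intros HF HG E; apply zf_ext; intros z; rewrite !lamE by dd.
  split; intros (u & Hu & ->); exists u; rewrite E by exact Hu; auto.
Qed.
Lemma restr_lam x y F : F1 F -> incl y x -> restr (lam x F) y = lam y F.
Proof.
  intros HF Hy; apply zf_ext; intros z; rewrite restrE, !lamE by dd; split.
  - intros [(u & Hu & ->) (u' & v' & Hu' & E)]; apply op_inj in E; destruct E; subst.
    exists u'; auto.
  - intros (u & Hu & ->); split; [exists u|exists u, (F u)]; auto.
Qed.
Lemma F2_ap : F2 ap.
Proof.
  unfold ap; apply (F1_lift un); [dd_fact|]. apply DT_sep; dd.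
Qed.
Lemma F2_restr : F2 restr.
Proof. unfold restr; apply DT_sep; dd. Qed.
Lemma DT_lam (x : (nat -> V) -> V) (F : (nat -> V) -> V -> V) :
  DT x -> DT (fun e => F (fun n => e (S n)) (e 0)) -> DT (fun e => lam (x e) (F e)).
Proof. intros Hx HF; unfold lam; apply DT_img; [exact Hx|]; dd. Qed.

End Sets.

#[global] Hint Resolve D2_incl F2_up F1_un F1_sg F2_cup F1_pow F1_suc F2_op F2_prod F2_ap F2_restr : dfn.
Ltac dd_ext ::=
  match goal with
  | |- DT (fun e => sep (@?x e) (@?A e)) => apply (DT_sep x A)
  | |- DT (fun e => img (@?x e) (@?A e)) => apply (DT_img x A)
  | |- DT (fun e => lam (@?x e) (@?A e)) => apply (DT_lam x A)
  end.

(** * Transitive closures and recursion along membership *)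

Section Recursion.
Context {V : zfc_model}.
Implicit Types x y z u v w f g s : V.

Definition trans x : Prop := forall y, mem y x -> incl y x.
Lemma D1_trans : D1 trans. Proof. unfold trans; dd. Qed.
Hint Resolve D1_trans : dfn.

Definition least_trans x t : Prop :=
  trans t /\ incl x t /\ forall u, trans u -> incl x u -> incl t u.
Lemma least_trans_unique x t t' : least_trans x t -> least_trans x t' -> t = t'.
Proof.
  intros (T & I & M) (T' & I' & M'); apply zf_ext; intros z; split; intros H;
    [exact (M _ T' I' z H)|exact (M' _ T I z H)].
Qed.
Lemma least_trans_ex x : exists t, least_trans x t.
Proof.
  induction x as [x IH] using mem_ind.
  destruct (replacement_rel least_trans x) as [a Ha].
  { unfold least_trans; dd. }
  { intros; eapply least_trans_unique; eauto. }
  set (U := cup x (un a)).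
  assert (TU : trans U).
  { intros y Hy z Hz; apply cupE; right; apply unE.
    apply cupE in Hy; destruct Hy as [Hy|Hy].
    - destruct (IH y Hy) as [t Ht]; exists t; split; [apply Ha; exists y; auto|].
      exact (proj1 (proj2 Ht) z Hz).
    - apply unE in Hy; destruct Hy as (t & Ht & Hy); exists t; split; [exact Ht|].
      apply Ha in Ht; destruct Ht as (w & _ & Ht); exact (proj1 Ht y Hy z Hz). }
  (* Instead of checking that [U] is least, it is cut down to what all transitive sets including [x]
     share. *)
  exists (sep U (fun z => forall u, trans u -> incl x u -> mem z u)).
  split; [|split].
  - intros y Hy z Hz; apply sepE in Hy; [|dd]; apply sepE; [dd|].
    split; [exact (TU y (proj1 Hy) z Hz)|]. intros u Tu Iu; exact (Tu y (proj2 Hy u Tu Iu) z Hz).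
  - intros y Hy; apply sepE; [dd|]; split; [apply cupE; auto|]; intros u _ Iu; apply Iu, Hy.
  - intros u Tu Iu z Hz; apply sepE in Hz; [|dd]; apply Hz; assumption.
Qed.
Definition tc x : V := the (least_trans x).
Lemma tcP x : least_trans x (tc x).
Proof. exact (the_spec _ (least_trans_ex x)). Qed.
Lemma trans_tc x : trans (tc x). Proof. apply tcP. Qed.
Lemma tc_incl x : incl x (tc x). Proof. apply tcP. Qed.
Lemma tc_least x u : trans u -> incl x u -> incl (tc x) u. Proof. apply tcP. Qed.
Lemma F1_tc : F1 tc.
Proof.
  apply (DT_char _ (fun e z => forall u, trans u -> incl (e 0) u -> mem z u)); [|dd].
  intros e z; split.
  - intros H u Tu Iu; exact (tc_least _ u Tu Iu z H).
  - intros H; apply H; [apply trans_tc|apply tc_incl].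
Qed.

(** Partial solutions of the recursion, with domains closed under members; any two of them agree
    wherever both are defined. *)
Definition attempt (F : V -> V -> V) g : Prop :=
  forall x y, mem (op x y) g ->
    (forall x', mem x' x -> exists y', mem (op x' y') g) /\ y = F x (restr g x).
Lemma restr_agree g g' x :
  (forall u v, mem u x -> (mem (op u v) g <-> mem (op u v) g')) -> restr g x = restr g' x.
Proof.
  intros H; apply zf_ext; intros z; rewrite !restrE.
  split; intros [Hz (u & v & Hu & ->)]; (split; [apply H; assumption|exists u, v; auto]).
Qed.
Lemma attempt_unique F g g' : attempt F g -> attempt F g' ->
  forall x y y', mem (op x y) g -> mem (op x y') g' -> y = y'.
Proof.
  intros A A' x; induction x as [x IH] using mem_ind; intros y y' H H'.
  destruct (A _ _ H) as [T ->], (A' _ _ H') as [T' ->].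
  f_equal; apply restr_agree; intros u v Hu; split; intros K.
  - destruct (T' u Hu) as [v' K']; rewrite (IH u Hu _ _ K K'); exact K'.
  - destruct (T u Hu) as [v' K']; rewrite <- (IH u Hu _ _ K' K); exact K'.
Qed.
Definition rec_graph F x y : Prop := exists g, attempt F g /\ mem (op x y) g.
Lemma rec_graph_unique F x y y' : rec_graph F x y -> rec_graph F x y' -> y = y'.
Proof. intros (g & A & H) (g' & A' & H'); exact (attempt_unique F g g' A A' x y y' H H'). Qed.
Lemma D2_rec_graph F : F2 F -> D2 (rec_graph F).
Proof. intros HF; unfold rec_graph, attempt; dd. Qed.
Hint Resolve D2_rec_graph : dfn.

Lemma rec_graph_step F x : F2 F -> (forall y, mem y x -> exists v, rec_graph F y v) ->
  exists h, (forall u v, mem (op u v) h <-> mem u x /\ rec_graph F u v) /\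
    (forall z, mem z h -> exists u v, z = op u v) /\
    rec_graph F x (F x h).
Proof.
  intros HF IH.
  (* Attempts have domains closed under members, so values on the members of [x] bring along values
     on the whole transitive closure. *)
  assert (IH' : forall y, mem y (tc x) -> exists v, rec_graph F y v).
  { assert (T : incl (tc x) (sep (tc x) (fun y => exists v, rec_graph F y v))).
    { apply tc_least.
      - intros y Hy z Hz; apply sepE in Hy; [|dd]; destruct Hy as [Hy (v & g & A & H)].
        apply sepE; [dd|]; split; [exact (trans_tc x y Hy z Hz)|].
        destruct (proj1 (A _ _ H) z Hz) as [v' K]; exists v', g; auto.
      - intros y Hy; apply sepE; [dd|]; split; [apply tc_incl, Hy|apply IH, Hy]. }
    intros y Hy; apply T in Hy; apply sepE in Hy; [|dd]; tauto. }
  destruct (replacement_rel (fun u w => exists v, w = op u v /\ rec_graph F u v) (tc x)) as [h Hh].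
  { dd. }
  { intros u w w' _ (v & -> & K) (v' & -> & K'); rewrite (rec_graph_unique F u v v' K K'); reflexivity. }
  assert (Eh : forall u v, mem (op u v) h <-> mem u (tc x) /\ rec_graph F u v).
  { intros u v; rewrite Hh; split.
    - intros (u' & Hu & v' & E & K); apply op_inj in E; destruct E; subst; auto.
    - intros [Hu K]; exists u; split; [exact Hu|exists v; auto]. }
  exists (restr h x); split; [|split].
  - intros u v; rewrite restr_op, Eh; split; [tauto|]; intros [Hu K].
    split; [split; [apply tc_incl|]|]; assumption.
  - intros z Hz; apply restrE in Hz; destruct Hz as [_ (u & v & _ & ->)]; eauto.
  (* Either some attempt already covers [x], or a pair for [x] can be added to [h] without a
     clash. *)
  - destruct (classic (exists v, rec_graph F x v)) as [(v & g & A & K)|N].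
    { exists g; split; [exact A|].
      destruct (A _ _ K) as [T E]; replace (F x (restr h x)) with v; [exact K|].
      rewrite E; f_equal; apply restr_agree; intros u w Hu; rewrite Eh; split.
      - intros Kw; split; [apply tc_incl, Hu|exists g; auto].
      - intros [_ Kw]; destruct (T u Hu) as [w' Kw'].
        rewrite (rec_graph_unique F u w w' Kw); [exact Kw'|exists g; auto]. }
    assert (Eg : forall u v, mem (op u v) (cup h (sg (op x (F x (restr h x))))) <->
       mem (op u v) h \/ (u = x /\ v = F x (restr h x))).
    { intros u v; rewrite cupE, sgE; split; (intros [K|K]; [tauto|right]).
      - apply op_inj in K; exact K.
      - destruct K; subst; reflexivity. }
    exists (cup h (sg (op x (F x (restr h x))))); split; [|apply Eg; auto].
    intros u v K; apply Eg in K; destruct K as [K|[-> ->]].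
    + pose proof K as K'; apply Eh in K'; destruct K' as [Hu (g & A & Kg)].
      destruct (A _ _ Kg) as [T E]; split.
      * intros u' Hu'; destruct (T u' Hu') as [v' Kv']; exists v'; apply Eg; left; apply Eh.
        split; [exact (trans_tc x u Hu u' Hu')|exists g; auto].
      * rewrite E; f_equal; apply restr_agree; intros u' v' Hu'; rewrite Eg, Eh; split.
        -- intros Kv'; left; split; [exact (trans_tc x u Hu u' Hu')|exists g; auto].
        -- intros [[_ Kv']|[-> _]].
           ++ destruct (T u' Hu') as [w' Kw'].
              rewrite (rec_graph_unique F u' v' w' Kv'); [exact Kw'|exists g; auto].
           ++ destruct (T x Hu') as [w' Kw']; exfalso; apply N; exists w', g; auto.
    + split.
      * intros u Hu; destruct (IH u Hu) as [v K]; exists v; apply Eg; left; apply Eh.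
        split; [apply tc_incl, Hu|exact K].
      * f_equal; apply restr_agree; intros u w Hu; rewrite Eg; split; [auto|].
        intros [K|[-> _]]; [exact K|destruct (mem_irr _ Hu)].
Qed.

Definition rec (F : V -> V -> V) x : V := the (rec_graph F x).
Lemma rec_graph_rec F x : F2 F -> rec_graph F x (rec F x).
Proof.
  intros HF; refine (the_spec _ _); induction x as [x IH] using mem_ind.
  destruct (rec_graph_step F x HF IH) as (h & _ & _ & H); eauto.
Qed.
Lemma rec_iff F x y : F2 F -> (y = rec F x <-> rec_graph F x y).
Proof.
  intros HF; split; [intros ->; apply rec_graph_rec, HF|].
  intros H; exact (rec_graph_unique F x _ _ H (rec_graph_rec F x HF)).
Qed.
Lemma F1_rec F : F2 F -> F1 (rec F).
Proof.
  intros HF; apply (D_iff (fun e => rec_graph F (e 1) (e 0))); [|dd].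
  intros e; symmetry; apply rec_iff, HF.
Qed.
Hint Resolve F1_rec : dfn.
Lemma recE F x : F2 F -> rec F x = F x (lam x (rec F)).
Proof.
  intros HF; symmetry; apply rec_iff; [exact HF|].
  destruct (rec_graph_step F x HF) as (h & H1 & H2 & H3).
  { intros y _; exists (rec F y); apply rec_graph_rec, HF. }
  replace (lam x (rec F)) with h; [exact H3|].
  apply zf_ext; intros z; rewrite lamE by dd; split.
  - intros Hz; destruct (H2 z Hz) as (u & v & ->); apply H1 in Hz; destruct Hz as [Hu K].
    exists u; split; [exact Hu|f_equal]; apply rec_iff; assumption.
  - intros (u & Hu & ->); apply H1; split; [exact Hu|apply rec_graph_rec, HF].
Qed.
Lemma DT_rec (F : (nat -> V) -> V -> V -> V) (t : (nat -> V) -> V) :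
  DT (fun e => F (fun n => e (S (S n))) (e 0) (e 1)) -> DT t ->
  DT (fun e => rec (F e) (t e)).
Proof.
  intros HF Ht.
  assert (HF2 : forall e, F2 (F e)).
  { intros e; exact (D_subst (fun n => match n with 0 => inl 0 | 1 => inl 1 | 2 => inl 2
      | S (S (S m)) => inr (e m) end) _ HF). }
  apply (D_iff (fun e => rec_graph (F (fun n => e (S n))) (t (fun n => e (S n))) (e 0))).
  { intros e; symmetry; apply rec_iff, HF2. }
  unfold rec_graph, attempt.
  apply D_ex, D_and; [|apply D_mem; [apply (F2_lift op); [dd_fact| |apply DT_var]|apply DT_var]].
  - do 2 apply D_all; apply D_imp; [dd|]; apply D_and; [dd|].
    apply D_eq; [apply DT_var|].
    apply (D_sub (fun e z => e 0 = F (fun n => e (S (S (S (S (S n)))))) (e 2) z)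
             (fun e => restr (e 3) (e 2))); [dd|].
    exact (D_ren (fun n => match n with 0 => 1 | 1 => 3 | 2 => 0 | S (S (S m)) => (6 + m) end) _ HF).
  - exact (DT_ren (fun n => S (S n)) _ Ht).
Qed.

Lemma tcE x z : mem z (tc x) <-> exists y, mem y x /\ (z = y \/ mem z (tc y)).
Proof.
  split.
  - intros Hz.
    assert (T : incl (tc x) (sep (tc x) (fun z => exists y, mem y x /\ (z = y \/ mem z (tc y))))).
    { pose proof F1_tc as HT. apply tc_least.
      - intros a Ha b Hb; apply sepE in Ha; [|dd]; destruct Ha as [Ha (y & Hy & K)].
        apply sepE; [dd|]; split; [exact (trans_tc x a Ha b Hb)|]; exists y; split; [exact Hy|right].
        destruct K as [->|K]; [apply tc_incl, Hb|exact (trans_tc y a K b Hb)].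
      - intros a Ha; apply sepE; [dd|]; split; [apply tc_incl, Ha|eauto]. }
    pose proof F1_tc as HT. apply T in Hz; apply sepE in Hz; [tauto|dd].
  - intros (y & Hy & [->|K]); [apply tc_incl, Hy|].
    apply (tc_least y (tc x)); [apply trans_tc| |exact K].
    exact (trans_tc x y (tc_incl x y Hy)).
Qed.

(* Unlike in [rec], the second argument of [F] at [x] is a function on the whole transitive closure of [x]. *)
Definition rect_tab (F : V -> V -> V) : V -> V :=
  rec (fun x h => cup (un (img x (fun y => ap h y))) (sg (op x (F x (un (img x (fun y => ap h y))))))).
Definition rect (F : V -> V -> V) x : V := F x (un (img x (rect_tab F))).
Lemma F1_rect_tab F : F2 F -> F1 (rect_tab F).
Proof. intros HF; apply F1_rec; dd; apply (DT_img (fun e => e 0) (fun e y => ap (e 1) y)); dd. Qed.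
Hint Resolve F1_rect_tab : dfn.
Lemma F1_rect F : F2 F -> F1 (rect F).
Proof. intros HF; unfold rect; dd; apply (DT_img (fun e => e 0) (fun e => rect_tab F)); dd. Qed.
Hint Resolve F1_rect : dfn.
Lemma rectE F x : F2 F -> rect F x = F x (lam (tc x) (rect F)).
Proof.
  intros HF.
  assert (TE : forall x, rect_tab F x = cup (un (img x (rect_tab F))) (sg (op x (rect F x)))).
  { intros y; unfold rect_tab at 1; rewrite recE.
    2:{ dd; apply (DT_img (fun e => e 0) (fun e y => ap (e 1) y)); dd. }
    fold (rect_tab F).
    replace (img y (fun z => ap (lam y (rect_tab F)) z)) with (img y (rect_tab F)); [reflexivity|].
    apply zf_ext; intros z; rewrite !imgE by dd.
    split; intros (u & Hu & ->); exists u; (split; [exact Hu|]); rewrite ap_lam by (dd || assumption); reflexivity. }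
  assert (UE : forall x, (forall y, mem y x -> rect_tab F y = lam (cup (tc y) (sg y)) (rect F)) ->
     un (img x (rect_tab F)) = lam (tc x) (rect F)).
  { intros y H; apply zf_ext; intros z; rewrite unE, lamE by dd; split.
    - intros (w & Hw & Hz); apply imgE in Hw; [|dd]; destruct Hw as (a & Ha & ->).
      rewrite H in Hz by exact Ha; apply lamE in Hz; [|dd]; destruct Hz as (b & Hb & ->).
      exists b; split; [|reflexivity]; apply tcE; exists a; rewrite cupE, sgE in Hb; tauto.
    - intros (b & Hb & ->); apply tcE in Hb; destruct Hb as (a & Ha & K).
      exists (rect_tab F a); split; [apply imgE; [dd|eauto]|].
      rewrite H by exact Ha; apply lam_op; [dd|]; rewrite cupE, sgE; tauto. }
  assert (K : forall x, rect_tab F x = lam (cup (tc x) (sg x)) (rect F)).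
  { intros y; induction y as [y IH] using mem_ind; rewrite TE, (UE y IH).
    apply zf_ext; intros z; rewrite cupE, sgE, !lamE by dd; split.
    - intros [(a & Ha & ->)| ->]; [exists a|exists y]; rewrite cupE, sgE; auto.
    - intros (a & Ha & ->); rewrite cupE, sgE in Ha; destruct Ha as [Ha| ->]; eauto. }
  unfold rect at 1; rewrite UE; auto.
Qed.
End Recursion.
#[global] Hint Resolve D1_trans F1_tc F1_rec F1_rect : dfn.
Ltac dd_ext ::=
  match goal with
  | |- DT (fun e => sep (@?x e) (@?A e)) => apply (DT_sep x A)
  | |- DT (fun e => img (@?x e) (@?A e)) => apply (DT_img x A)
  | |- DT (fun e => lam (@?x e) (@?A e)) => apply (DT_lam x A)
  | |- DT (fun e => rec (@?F e) (@?t e)) => apply (DT_rec F t)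
  end.

(** * Ordinals, ranks, choice and enumerations *)

Section Ordinals.
Context {V : zfc_model}.
Implicit Types x y z u v w f g s X : V.

Definition ord x : Prop := trans x /\ forall y, mem y x -> trans y.
Lemma D1_ord : D1 ord. Proof. unfold ord; dd. Qed.
Hint Resolve D1_ord : dfn.
Lemma ord_mem x y : ord x -> mem y x -> ord y.
Proof. intros [T H] Hy; split; [auto|]; intros z Hz; apply H, (T y Hy z Hz). Qed.
Lemma ord_trans x y z : ord z -> mem x y -> mem y z -> mem x z.
Proof. intros [T _] H K; exact (T y K x H). Qed.
Lemma ord_total x : ord x -> forall y, ord y -> mem x y \/ x = y \/ mem y x.
Proof.
  induction x as [x IHx] using mem_ind; intros Ox y.
  induction y as [y IHy] using mem_ind; intros Oy.
  destruct (classic (mem x y)) as [|N1]; [auto|]; destruct (classic (mem y x)) as [|N2]; [auto|].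
  right; left; apply zf_ext; intros z; split; intros Hz.
  - destruct (IHx z Hz (ord_mem _ _ Ox Hz) y Oy) as [K|[->|K]]; [exact K|tauto|].
    destruct (N2 (ord_trans _ _ _ Ox K Hz)).
  - destruct (IHy z Hz (ord_mem _ _ Oy Hz)) as [K|[<-|K]]; [|tauto|exact K].
    destruct (N1 (ord_trans _ _ _ Oy K Hz)).
Qed.
Lemma ord_incl x y : ord x -> ord y -> incl x y -> mem x y \/ x = y.
Proof.
  intros Ox Oy H; destruct (ord_total x Ox y Oy) as [K|[K|K]]; auto.
  destruct (mem_irr y (H y K)).
Qed.
Lemma ord_not_mem x y : ord x -> ord y -> ~ mem x y -> incl y x.
Proof.
  intros Ox Oy N; destruct (ord_total x Ox y Oy) as [K|[->|K]]; [tauto|intros z; auto|].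
  intros z Hz; exact (ord_trans _ _ _ Ox Hz K).
Qed.
Lemma ord_of_trans x : trans x -> (forall y, mem y x -> ord y) -> ord x.
Proof. intros T H; split; [exact T|]; intros y Hy; apply H, Hy. Qed.
Lemma ord_suc x : ord x -> ord (suc x).
Proof.
  intros Ox; apply ord_of_trans.
  - intros y Hy z Hz; apply sucE; apply sucE in Hy; destruct Hy as [Hy| ->]; [|auto].
    left; exact (ord_trans _ _ _ Ox Hz Hy).
  - intros y Hy; apply sucE in Hy; destruct Hy as [Hy| ->]; [exact (ord_mem _ _ Ox Hy)|exact Ox].
Qed.
Lemma ord_emp : ord emp.
Proof. split; intros y Hy; destruct (empE y Hy). Qed.
Lemma ord_least (A : V -> Prop) : (exists x, ord x /\ A x) ->
  exists x, ord x /\ A x /\ forall y, mem y x -> ~ A y.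
Proof.
  intros H; destruct (wf_min (fun x => ord x /\ A x) H) as (x & [Ox Ax] & K).
  exists x; split; [exact Ox|split; [exact Ax|]]; intros y Hy Ay.
  exact (K y Hy (conj (ord_mem _ _ Ox Hy) Ay)).
Qed.
Lemma mem_suc x : mem x (suc x). Proof. apply sucE; auto. Qed.
Lemma suc_inj x y : suc x = suc y -> x = y.
Proof.
  intros E.
  assert (H : mem x (suc y)) by (rewrite <- E; apply mem_suc).
  assert (K : mem y (suc x)) by (rewrite E; apply mem_suc).
  apply sucE in H, K. destruct H as [H|H]; [|exact H]; destruct K as [K|K]; [|auto].
  destruct (mem_asym _ _ H K).
Qed.

Lemma img_ext x F G : (forall u, mem u x -> F u = G u) -> F1 F -> F1 G -> img x F = img x G.
Proof.
  intros E HF HG; apply zf_ext; intros z; rewrite !imgE by dd.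
  split; intros (u & Hu & ->); exists u; rewrite E by exact Hu; auto.
Qed.

Definition rk : V -> V := rec (fun x h => un (img x (fun y => suc (ap h y)))).
Lemma F1_rk : F1 rk. Proof. unfold rk; dd. Qed.
Hint Resolve F1_rk : dfn.
Lemma rkE x z : mem z (rk x) <-> exists y, mem y x /\ mem z (suc (rk y)).
Proof.
  unfold rk at 1; rewrite recE by dd; fold rk; rewrite unE; split.
  - intros (w & Hw & Hz); apply imgE in Hw; [|dd]; destruct Hw as (y & Hy & ->).
    exists y; rewrite ap_lam in Hz by (dd || assumption); auto.
  - intros (y & Hy & Hz); exists (suc (rk y)); split; [|exact Hz].
    apply imgE; [dd|]; exists y; rewrite ap_lam by (dd || assumption); auto.
Qed.
Lemma ord_rk x : ord (rk x).
Proof.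
  induction x as [x IH] using mem_ind; apply ord_of_trans.
  - intros z Hz w Hw; apply rkE in Hz; destruct Hz as (y & Hy & Hz); apply rkE; exists y.
    split; [exact Hy|exact (ord_trans _ _ _ (ord_suc _ (IH y Hy)) Hw Hz)].
  - intros z Hz; apply rkE in Hz; destruct Hz as (y & Hy & Hz).
    exact (ord_mem _ _ (ord_suc _ (IH y Hy)) Hz).
Qed.
Definition Vr : V -> V := rec (fun x h => un (img x (fun y => pow (ap h y)))).
Lemma F1_Vr : F1 Vr. Proof. unfold Vr; dd. Qed.
Hint Resolve F1_Vr : dfn.
Lemma VrE x z : mem z (Vr x) <-> exists y, mem y x /\ incl z (Vr y).
Proof.
  unfold Vr at 1; rewrite recE by dd; fold Vr; rewrite unE; split.
  - intros (w & Hw & Hz); apply imgE in Hw; [|dd]; destruct Hw as (y & Hy & ->).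
    exists y; rewrite ap_lam in Hz by (dd || assumption); rewrite powE in Hz; auto.
  - intros (y & Hy & Hz); exists (pow (Vr y)); rewrite powE; split; [|exact Hz].
    apply imgE; [dd|]; exists y; rewrite ap_lam by (dd || assumption); auto.
Qed.
Lemma incl_Vr_rk x : incl x (Vr (rk x)).
Proof.
  induction x as [x IH] using mem_ind; intros y Hy; apply VrE; exists (rk y).
  split; [apply rkE; exists y; split; [exact Hy|apply mem_suc]|exact (IH y Hy)].
Qed.

(** Scott's trick: replacement is applied to the least [a] such that [Vr a] holds a witness, which
    is unique even when witnesses are not. *)
Lemma collection (R : V -> V -> Prop) x : D2 R ->
  exists Y, forall u, mem u x -> (exists v, R u v) -> exists v, mem v Y /\ R u v.
Proof.
  intros HR.
  destruct (replacement_rel (fun u a => ord a /\ (exists v, mem v (Vr a) /\ R u v) /\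
    forall b, mem b a -> ~ exists v, mem v (Vr b) /\ R u v) x) as [A HA].
  { dd. }
  { intros u a b _ (Oa & Ha & Ma) (Ob & Hb & Mb).
    destruct (ord_total a Oa b Ob) as [K|[K|K]]; [destruct (Mb a K Ha)|exact K|destruct (Ma b K Hb)]. }
  exists (un (img A Vr)); intros u Hu [v Hv].
  destruct (ord_least (fun a => exists v, mem v (Vr a) /\ R u v)) as (a & Oa & (w & Hw & Rw) & Ma).
  { exists (rk (sg v)); split; [apply ord_rk|exists v; split; [|exact Hv]].
    apply incl_Vr_rk, sgE; reflexivity. }
  exists w; split; [|exact Rw]; apply unE; exists (Vr a); split; [|exact Hw].
  apply imgE; [dd|]; exists a; split; [|reflexivity]; apply HA; exists u; eauto 10.
Qed.

(** The axiom of choice is given for disjoint families only, so each [y] is replaced by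
    [{y} × y]. *)
Lemma choice_set X : exists c, forall y, incl y X -> y <> emp ->
  exists! z, mem z y /\ mem (op y z) c.
Proof.
  destruct (zf_choice V (img (sep (pow X) (fun y => y <> emp)) (fun y => prod (sg y) y))) as [c Hc].
  - intros w Hw; apply imgE in Hw; [|dd]; destruct Hw as (y & Hy & ->).
    apply sepE in Hy; [|dd]; destruct (nonemp y (proj2 Hy)) as [z Hz].
    exists (op y z); apply prod_op; rewrite sgE; auto.
  - intros w w' z Hw Hw' Hz Hz'; apply imgE in Hw; [|dd]; apply imgE in Hw'; [|dd].
    destruct Hw as (y & Hy & ->), Hw' as (y' & Hy' & ->).
    apply prodE in Hz, Hz'; destruct Hz as (a & b & Ha & _ & ->), Hz' as (a' & b' & Ha' & _ & E).
    apply op_inj in E; rewrite sgE in *; destruct E; subst; reflexivity.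
  - exists c; intros y Hy Ny.
    destruct (Hc (prod (sg y) y)) as (w & [Hw Hwc] & Uw).
    { apply imgE; [dd|]; exists y; split; [|reflexivity]; apply sepE; [dd|]; rewrite powE; auto. }
    apply prodE in Hw; destruct Hw as (a & z & Ha & Hz & ->); apply sgE in Ha; subst a.
    exists z; split; [auto|]; intros z' [Hz' Hzc'].
    destruct (op_inj y z y z') as [_ E]; [|exact E].
    apply Uw; split; [apply prod_op; rewrite sgE; auto|exact Hzc'].
Qed.
Definition chs X : V := the (fun c => forall y, incl y X -> y <> emp ->
  exists! z, mem z y /\ mem (op y z) c).
Definition pick X y : V := un (sep y (fun z => mem (op y z) (chs X))).
Lemma pick_mem X y : incl y X -> (exists z, mem z y) -> mem (pick X y) y.
Proof.
  intros Hy [z0 Hz0].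
  assert (Ny : y <> emp) by (intros ->; exact (empE _ Hz0)).
  destruct (the_spec _ (choice_set X) y Hy Ny) as (z & [Hz Hc] & U); fold (chs X) in Hc, U.
  replace (pick X y) with z; [exact Hz|].
  unfold pick; apply zf_ext; intros w; rewrite unE; split.
  - intros Hw; exists z; split; [|exact Hw]; apply sepE; [dd|auto].
  - intros (z' & Hz' & Hw); apply sepE in Hz'; [|dd]; rewrite (U z' Hz'); exact Hw.
Qed.
Lemma F1_pick X : F1 (pick X).
Proof.
  unfold pick; apply (F1_lift un); [dd_fact|]; apply (DT_sep (fun e => e 0) (fun e z => mem (op (e 0) z) (chs X))); dd.
Qed.
Hint Resolve F1_pick : dfn.

Lemma choose (R : V -> V -> Prop) x : D2 R -> (forall u, mem u x -> exists v, R u v) ->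
  exists F, F1 F /\ forall u, mem u x -> R u (F u).
Proof.
  intros HR H; destruct (collection R x HR) as [Y HY].
  exists (fun u => pick Y (sep Y (R u))); split.
  - apply (F1_lift (pick Y)); [dd_fact|]; apply (DT_sep (fun _ => Y) (fun e => R (e 0))); dd.
  - intros u Hu.
    assert (K : mem (pick Y (sep Y (R u))) (sep Y (R u))).
    { apply pick_mem.
      - intros z Hz; apply sepE in Hz; [tauto|dd].
      - destruct (HY u Hu (H u Hu)) as (v & Hv & Rv); exists v; apply sepE; [dd|auto]. }
    apply sepE in K; [tauto|dd].
Qed.

(** Each choice depends on the whole history [lam a F]. The relation needs no separate argument for
    the stage, since the stage is the domain of the history. *)
Lemma dep_choice X th (R : V -> V -> Prop) : D2 R -> ord th ->
  (forall b F, mem b th -> F1 F -> (forall a, mem a b -> mem (F a) X /\ R (lam a F) (F a)) ->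
     exists x, mem x X /\ R (lam b F) x) ->
  exists F, F1 F /\ forall a, mem a th -> mem (F a) X /\ R (lam a F) (F a).
Proof.
  intros HR Oth H.
  set (F := rec (fun _ h => pick X (sep X (R h)))).
  assert (HF : F1 F).
  { apply F1_rec; apply (F1_lift (pick X)); [dd_fact|].
    apply (DT_sep (fun _ => X) (fun e => R (e 1))); dd. }
  exists F; split; [exact HF|].
  intros a; induction a as [a IH] using mem_ind; intros Ha.
  assert (E : F a = pick X (sep X (R (lam a F)))).
  { unfold F at 1; rewrite recE; [reflexivity|].
    apply (F1_lift (pick X)); [dd_fact|]; apply (DT_sep (fun _ => X) (fun e => R (e 1))); dd. }
  assert (K : mem (F a) (sep X (R (lam a F)))).
  { rewrite E; apply pick_mem.
    - intros z Hz; apply sepE in Hz; [tauto|dd].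
    - destruct (H a F Ha HF) as (x & Hx & Rx).
      + intros b Hb; apply IH; [exact Hb|exact (ord_trans _ _ _ Oth Hb Ha)].
      + exists x; apply sepE; [dd|auto]. }
  apply sepE in K; [exact K|dd].
Qed.

(** Burali-Forti: the ordinals in [A] would form an ordinal, hence a member of itself. *)
Lemma no_set_of_ordinals A : ~ forall a, ord a -> mem a A.
Proof.
  intros H; apply (mem_irr (sep A ord)); apply sepE; [dd|].
  assert (O : ord (sep A ord)).
  { apply ord_of_trans.
    - intros y Hy z Hz; apply sepE in Hy; [|dd]; apply sepE; [dd|].
      pose proof (ord_mem _ _ (proj2 Hy) Hz); auto.
    - intros y Hy; apply sepE in Hy; [tauto|dd]. }
  auto.
Qed.

(** Zermelo's recursion lists elements not yet listed. If it never ran out, sending each listed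
    element back to its index would make the ordinals a set. *)
Lemma well_order X : exists a G, ord a /\ F1 G /\ (forall b, mem b a -> mem (G b) X) /\
  (forall z, mem z X -> exists b, mem b a /\ z = G b) /\
  (forall b c, mem b a -> mem c a -> G b = G c -> b = c).
Proof.
  set (G := rec (fun x h => pick X (sep X (fun z => forall y, mem y x -> z <> ap h y)))).
  assert (H2 : F2 (fun x h => pick X (sep X (fun z => forall y, mem y x -> z <> ap h y)))).
  { apply (F1_lift (pick X)); [dd_fact|].
    apply (DT_sep (fun _ => X) (fun e z => forall y, mem y (e 0) -> z <> ap (e 1) y)); dd. }
  assert (HG : F1 G) by (apply F1_rec, H2).
  set (rest := fun a => sep X (fun z => forall y, mem y a -> z <> G y)).
  assert (restE : forall a z, mem z (rest a) <-> mem z X /\ forall y, mem y a -> z <> G y).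
  { intros a z; apply sepE; dd. }
  assert (GE : forall a, (exists z, mem z (rest a)) -> mem (G a) (rest a)).
  { intros a Ha; unfold G at 1; rewrite recE by exact H2; fold G.
    replace (sep X (fun z => forall y, mem y a -> z <> ap (lam a G) y)) with (rest a).
    - apply pick_mem; [|exact Ha]; intros z Hz; apply restE in Hz; tauto.
    - apply zf_ext; intros z; rewrite restE, sepE by dd.
      split; (intros [Hz K]; split; [exact Hz|]; intros y Hy; specialize (K y Hy)).
      + rewrite ap_lam; assumption.
      + rewrite ap_lam in K; assumption. }
  destruct (ord_least (fun a => ~ exists z, mem z (rest a))) as (a & Oa & Na & Ma).
  { apply NNPP; intros N.
    assert (N' : forall a, ord a -> mem (G a) (rest a)).
    { intros a Oa; apply GE, NNPP; intros K; apply N; exists a; auto. }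
    destruct (replacement_rel (fun z a => ord a /\ z = G a) X) as [A HA].
    { dd. }
    { intros z a b _ [Oa ->] [Ob E].
      destruct (ord_total a Oa b Ob) as [K|[K|K]]; [|exact K|].
      - pose proof (N' b Ob) as Q; apply restE in Q; destruct (proj2 Q a K); auto.
      - pose proof (N' a Oa) as Q; apply restE in Q; destruct (proj2 Q b K); auto. }
    apply (no_set_of_ordinals A); intros a Oa; apply HA; exists (G a).
    pose proof (N' a Oa) as Q; apply restE in Q; tauto. }
  assert (GR : forall b, mem b a -> mem (G b) (rest b)) by (intros b Hb; apply GE, NNPP, Ma, Hb).
  exists a, G; split; [exact Oa|split; [exact HG|split; [|split]]].
  - intros b Hb; pose proof (GR b Hb) as Q; apply restE in Q; tauto.
  - intros z Hz; apply NNPP; intros N; apply Na; exists z; apply restE; split; [exact Hz|].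
    intros y Hy E; apply N; eauto.
  - intros b c Hb Hc E.
    destruct (ord_total b (ord_mem _ _ Oa Hb) c (ord_mem _ _ Oa Hc)) as [K|[K|K]]; [|exact K|].
    + pose proof (GR c Hc) as Q; apply restE in Q; destruct (proj2 Q b K); auto.
    + pose proof (GR b Hb) as Q; apply restE in Q; destruct (proj2 Q c K); auto.
Qed.

Lemma ranking X : exists r, F1 r /\ (forall z, mem z X -> ord (r z)) /\
  (forall z z', mem z X -> mem z' X -> r z = r z' -> z = z').
Proof.
  destruct (well_order X) as (a & G & Oa & HG & _ & GS & _).
  destruct (choose (fun z b => mem b a /\ z = G b) X) as (r & Hr & K); [dd|exact GS|].
  exists r; split; [exact Hr|split].
  - intros z Hz; exact (ord_mem _ _ Oa (proj1 (K z Hz))).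
  - intros z z' Hz Hz' E; rewrite (proj2 (K z Hz)), (proj2 (K z' Hz')), E; reflexivity.
Qed.

Definition add a : V -> V := rec (fun x h => cup a (img x (fun y => ap h y))).
Lemma F2_add : F2 add. Proof. unfold add; dd. Qed.
Hint Resolve F2_add : dfn.
Lemma addE a x z : mem z (add a x) <-> mem z a \/ exists y, mem y x /\ z = add a y.
Proof.
  unfold add at 1; rewrite recE by dd; fold (add a); rewrite cupE, imgE by dd.
  split; (intros [K|(y & Hy & ->)]; [auto|right]); exists y; (split; [exact Hy|]);
    rewrite ap_lam by (dd || assumption); reflexivity.
Qed.
Lemma ord_add a x : ord a -> ord x -> ord (add a x).
Proof.
  intros Oa; induction x as [x IH] using mem_ind; intros Ox; apply ord_of_trans.
  - intros z Hz w Hw; apply addE; apply addE in Hz; destruct Hz as [Hz|(y & Hy & ->)].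
    + left; exact (ord_trans _ _ _ Oa Hw Hz).
    + apply addE in Hw; destruct Hw as [Hw|(y' & Hy' & ->)]; [auto|].
      right; exists y'; split; [exact (ord_trans _ _ _ Ox Hy' Hy)|reflexivity].
  - intros z Hz; apply addE in Hz; destruct Hz as [Hz|(y & Hy & ->)].
    + exact (ord_mem _ _ Oa Hz).
    + apply IH; [exact Hy|exact (ord_mem _ _ Ox Hy)].
Qed.
Lemma add_mono a x y : mem x y -> mem (add a x) (add a y).
Proof. intros H; apply addE; right; eauto. Qed.
Lemma add_mono_iff a x y : ord x -> ord y -> (mem (add a x) (add a y) <-> mem x y).
Proof.
  intros Ox Oy; split; [|apply add_mono]; intros H.
  destruct (ord_total x Ox y Oy) as [K|[->|K]]; [exact K|destruct (mem_irr _ H)|].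
  destruct (mem_asym _ _ H (add_mono a _ _ K)).
Qed.
Lemma add_emp a : add a emp = a.
Proof.
  apply zf_ext; intros z; rewrite addE; split; [|auto].
  intros [K|(y & Hy & _)]; [exact K|destruct (empE _ Hy)].
Qed.
Lemma add_suc a x : add a (suc x) = suc (add a x).
Proof.
  apply zf_ext; intros z; rewrite addE, sucE, addE; split.
  - intros [K|(y & Hy & ->)]; [auto|].
    apply sucE in Hy; destruct Hy as [Hy| ->]; [left; right; eauto|auto].
  - intros [[K|(y & Hy & ->)]| ->]; [auto| |]; right; [exists y|exists x]; rewrite sucE; auto.
Qed.
Lemma incl_add a x : incl a (add a x).
Proof. intros z Hz; apply addE; auto. Qed.
Lemma sub_ord a b : ord a -> ord b -> ~ mem b a -> exists x, ord x /\ b = add a x.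
Proof.
  intros Oa; induction b as [b IH] using mem_ind; intros Ob N.
  assert (IH' : forall c, mem c b -> ~ mem c a -> exists x, ord x /\ c = add a x).
  { intros c Hc; apply IH; [exact Hc|exact (ord_mem _ _ Ob Hc)]. }
  (* The difference consists of the [x] with [a + x < b]. The rank of [b] merely bounds it, as an
     ordinal is included in its rank. *)
  set (X := sep (rk b) (fun x => mem (add a x) b)).
  assert (Hrk : forall x, ord x -> incl x (rk x)).
  { intros x; induction x as [x IHx] using mem_ind; intros Ox y Hy; apply rkE; exists y.
    split; [exact Hy|]; apply sucE.
    assert (E : rk y = y \/ mem y (rk y)).
    { destruct (ord_incl y (rk y) (ord_mem _ _ Ox Hy) (ord_rk y) (IHx y Hy (ord_mem _ _ Ox Hy))); auto. }
    destruct E; auto. }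
  assert (Hge : forall x, ord x -> ~ mem (add a x) x).
  { intros x; induction x as [x IHx] using mem_ind; intros Ox H.
    exact (IHx (add a x) H (ord_mem _ _ Ox H) (add_mono a _ _ H)). }
  assert (HX : forall x, mem x X <-> ord x /\ mem (add a x) b).
  { intros x; unfold X; rewrite sepE by dd; split.
    - intros [H K]; split; [exact (ord_mem _ _ (ord_rk b) H)|exact K].
    - intros [Ox K]; split; [|exact K]; apply (Hrk b Ob).
      destruct (ord_total x Ox b Ob) as [Q|[->|Q]]; [exact Q|destruct (Hge b Ob K)|].
      destruct (Hge x Ox (ord_trans _ _ _ Ox K Q)). }
  assert (OX : ord X).
  { apply ord_of_trans.
    - intros y Hy z Hz; apply HX in Hy; apply HX; destruct Hy as [Oy Ky].
      split; [exact (ord_mem _ _ Oy Hz)|exact (ord_trans _ _ _ Ob (add_mono a _ _ Hz) Ky)].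
    - intros y Hy; apply HX in Hy; tauto. }
  exists X; split; [exact OX|]; apply zf_ext; intros z; rewrite addE; split.
  - intros Hz; destruct (classic (mem z a)) as [K|K]; [auto|right].
    destruct (IH' z Hz K) as (x & Ox & ->); exists x; split; [apply HX|]; auto.
  - intros [K|(x & Hx & ->)]; [|apply HX in Hx; tauto].
    exact (ord_not_mem b a Ob Oa N z K).
Qed.

(* The order type of the least indices, with its Mostowski collapse *)
Lemma enum_bij eta H : ord eta -> F1 H ->
  exists y c, ord y /\ incl y eta /\ F1 c /\
    (forall xi, mem xi eta -> mem (c (H xi)) y) /\
    (forall xi xi', mem xi eta -> mem xi' eta -> c (H xi) = c (H xi') -> H xi = H xi') /\
    (forall b, mem b y -> exists xi, mem xi eta /\ b = c (H xi)).
Proof.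
  intros Oe HH.
  set (fst := fun xi => forall z, mem z xi -> H z <> H xi).
  assert (Df : D1 fst) by (unfold fst; dd).
  set (C := rec (fun x h => img (sep x fst) (fun y => ap h y))).
  assert (HC2 : F2 (fun x h => img (sep x fst) (fun y => ap h y))).
  { apply (DT_img (fun e => sep (e 0) fst) (fun e y => ap (e 1) y)); [|dd].
    apply (DT_sep (fun e => e 0) (fun _ => fst)); dd. }
  assert (HC : F1 C) by (apply F1_rec, HC2).
  assert (CE : forall x z, mem z (C x) <-> exists y, mem y x /\ fst y /\ z = C y).
  { intros x z; unfold C at 1; rewrite recE by exact HC2; fold C; rewrite imgE by dd.
    split; intros (y & Hy & K).
    - apply sepE in Hy; [|dd]; destruct Hy as [Hy Fy].
      rewrite ap_lam in K by assumption; exists y; auto.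
    - destruct K as [Fy K]; exists y; rewrite ap_lam by assumption; split; [|exact K].
      apply sepE; [dd|auto]. }
  assert (CO : forall x, ord x -> ord (C x)).
  { intros x; induction x as [x IH] using mem_ind; intros Ox; apply ord_of_trans.
    - intros z Hz w Hw; apply CE in Hz; destruct Hz as (y & Hy & Fy & ->).
      apply CE in Hw; destruct Hw as (y' & Hy' & Fy' & ->); apply CE; exists y'.
      split; [exact (ord_trans _ _ _ Ox Hy' Hy)|auto].
    - intros z Hz; apply CE in Hz; destruct Hz as (y & Hy & _ & ->).
      apply IH; [exact Hy|exact (ord_mem _ _ Ox Hy)]. }
  assert (CL : forall x, ord x -> mem (C x) (suc x)).
  { intros x; induction x as [x IH] using mem_ind; intros Ox.
    assert (I : incl (C x) x).
    { intros z Hz; apply CE in Hz; destruct Hz as (y & Hy & _ & ->).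
      specialize (IH y Hy (ord_mem _ _ Ox Hy)); apply sucE in IH; destruct IH as [K|K];
        [exact (ord_trans _ _ _ Ox K Hy)|rewrite K; exact Hy]. }
    apply sucE; exact (ord_incl _ _ (CO x Ox) Ox I). }
  assert (CI : forall x y, ord x -> ord y -> fst x -> fst y -> C x = C y -> x = y).
  { intros x y Ox Oy Fx Fy E; destruct (ord_total x Ox y Oy) as [K|[K|K]]; [|exact K|].
    - destruct (mem_irr (C y)); rewrite <- E at 1; apply CE; eauto.
    - destruct (mem_irr (C x)); rewrite E at 1; apply CE; eauto. }
  assert (L : forall xi, mem xi eta -> exists xi', mem xi' eta /\ fst xi' /\ H xi' = H xi).
  { intros xi Hxi; destruct (wf_min (fun z => mem z eta /\ H z = H xi)) as (m & [Hm Em] & Km); [eauto|].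
    exists m; split; [exact Hm|split; [|exact Em]]; intros z Hz E.
    apply (Km z Hz); split; [exact (ord_trans _ _ _ Oe Hz Hm)|congruence]. }
  destruct (choose (fun u b => exists xi, mem xi eta /\ fst xi /\ H xi = u /\ b = C xi) (img eta H))
    as (c & Hc & Kc).
  { dd. }
  { intros u Hu; apply imgE in Hu; [|dd]; destruct Hu as (xi & Hxi & ->).
    destruct (L xi Hxi) as (m & ? & ? & ?); exists (C m), m; auto. }
  assert (Kc' : forall xi, mem xi eta -> exists m, mem m eta /\ fst m /\ H m = H xi /\ c (H xi) = C m).
  { intros xi Hxi; apply Kc, imgE; [dd|eauto]. }
  assert (CeE : forall z, mem z (C eta) <-> exists y, mem y eta /\ fst y /\ z = C y) by (apply CE).
  exists (C eta), c; split; [exact (CO _ Oe)|split; [|split; [exact Hc|split; [|split]]]].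
  - intros z Hz; apply CeE in Hz; destruct Hz as (y & Hy & _ & ->).
    pose proof (CL y (ord_mem _ _ Oe Hy)) as Q; apply sucE in Q.
    destruct Q as [Q| ->]; [exact (ord_trans _ _ _ Oe Q Hy)|exact Hy].
  - intros xi Hxi; destruct (Kc' xi Hxi) as (m & Hm & Fm & _ & ->); apply CeE; eauto.
  - intros xi xi' Hxi Hxi' E.
    destruct (Kc' xi Hxi) as (m & Hm & Fm & Em & E1), (Kc' xi' Hxi') as (m' & Hm' & Fm' & Em' & E2).
    rewrite <- Em, <- Em'; f_equal.
    apply CI; [exact (ord_mem _ _ Oe Hm)|exact (ord_mem _ _ Oe Hm')|exact Fm|exact Fm'|congruence].
  - intros b Hb; apply CeE in Hb; destruct Hb as (m & Hm & Fm & ->); exists m; split; [exact Hm|].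
    destruct (Kc' m Hm) as (m' & Hm' & Fm' & Em & ->); f_equal.
    destruct (ord_total m (ord_mem _ _ Oe Hm) m' (ord_mem _ _ Oe Hm')) as [K|[K|K]]; [|exact K|].
    + destruct (Fm' m K); auto.
    + destruct (Fm m' K); auto.
Qed.

End Ordinals.
#[global] Hint Resolve D1_ord F1_rk F1_Vr F1_pick F2_add : dfn.

(** * Satisfaction of the formulas *)

Section SatLogic.
Context {X : Type} (m q : X -> X -> Prop).
Lemma c_not a A : (sat m q a <-> A) -> (sat m q (fNot a) <-> ~ A).
Proof. simpl; tauto. Qed.
Lemma c_and a b A B : (sat m q a <-> A) -> (sat m q b <-> B) ->
  (sat m q (fAnd a b) <-> A /\ B).
Proof. simpl; tauto. Qed.
Lemma c_all a (A : X -> Prop) : (forall x, sat m q (a x) <-> A x) ->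
  (sat m q (fAll a) <-> forall x, A x).
Proof. intros E; simpl; split; intros H x; apply E, H. Qed.
Lemma c_imp a b A B : (sat m q a <-> A) -> (sat m q b <-> B) ->
  (sat m q (fImp a b) <-> (A -> B)).
Proof. simpl; intros H K; destruct (classic B); tauto. Qed.
Lemma c_or a b A B : (sat m q a <-> A) -> (sat m q b <-> B) ->
  (sat m q (fOr a b) <-> A \/ B).
Proof. simpl; intros H K; destruct (classic A); tauto. Qed.
Lemma c_iff a b A B : (sat m q a <-> A) -> (sat m q b <-> B) ->
  (sat m q (fIff a b) <-> (A <-> B)).
Proof. intros H K; apply c_and; apply c_imp; assumption. Qed.
Lemma c_ex a (A : X -> Prop) : (forall x, sat m q (a x) <-> A x) ->
  (sat m q (fEx a) <-> exists x, A x).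
Proof.
  intros E; simpl; split.
  - intros H; apply NNPP; intros N; apply H; intros x Hx; apply N; exists x; apply E, Hx.
  - intros [x Hx] H; apply (H x), E, Hx.
Qed.
End SatLogic.

Create HintDb satdb.
(** The connectives are defined from negation, conjunction and universal quantification. Read
    classically, each formula becomes the usual statement about sets. *)
Ltac st_step :=
  cbv beta;
  lazymatch goal with
  | |- sat _ _ (fMem _ _) <-> _ => reflexivity
  | |- sat _ _ (fEq _ _) <-> _ => reflexivity
  | |- sat _ _ (fAll _) <-> _ => apply c_all; intro
  | |- sat _ _ (fEx _) <-> _ => apply c_ex; intro
  | |- sat _ _ (fOr _ _) <-> _ => apply c_or
  | |- sat _ _ (fIff _ _) <-> _ => apply c_iff
  | |- sat _ _ (fImp _ _) <-> _ => apply c_imp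
  | |- sat _ _ (fAnd _ _) <-> _ => apply c_and
  | |- sat _ _ (fNot _) <-> _ => apply c_not
  | |- sat _ _ _ <-> _ => solve [ auto 2 with satdb nocore ]
  end.
Ltac st := repeat st_step.

Section Sat.
Context {V : zfc_model}.
Implicit Types x y z u v w f g s t r : V.

Lemma sat_sub x y : (V ⊨ sub x y) <-> incl x y.
Proof. unfold sub, incl; st. Qed.
Lemma sat_is_empty x : (V ⊨ is_empty x) <-> x = emp.
Proof.
  transitivity (forall z, ~ mem z x); [unfold is_empty; st|].
  split; [apply emp_unique|intros ->; apply empE].
Qed.
Lemma sat_is_upair z x y : (V ⊨ is_upair z x y) <-> z = up x y.
Proof.
  transitivity (forall w, mem w z <-> w = x \/ w = y); [unfold is_upair; st|].
  split; [intros H; apply zf_ext; intros w; rewrite H, upE; tauto|intros ->; apply upE].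
Qed.
Hint Resolve sat_sub sat_is_empty sat_is_upair : satdb.
Lemma sat_is_opair z x y : (V ⊨ is_opair z x y) <-> z = op x y.
Proof.
  transitivity (exists u v, u = up x x /\ v = up x y /\ z = up u v); [unfold is_opair; st|].
  split; [intros (u & v & -> & -> & ->); reflexivity|intros ->; eauto].
Qed.
Hint Resolve sat_is_opair : satdb.
Lemma sat_related r x y : (V ⊨ related r x y) <-> mem (op x y) r.
Proof.
  transitivity (exists z, z = op x y /\ mem z r); [unfold related; st|].
  split; [intros (z & -> & H); exact H|eauto].
Qed.
Hint Resolve sat_related : satdb.

Definition isfun f : Prop :=
  (forall z, mem z f -> exists x y, z = op x y) /\
  (forall x y z, mem (op x y) f /\ mem (op x z) f -> y = z).
Definition fn_on f x : Prop := isfun f /\ forall z, mem z x <-> exists y, mem (op z y) f.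
Definition fn_to f x y : Prop := fn_on f x /\ forall u v, mem (op u v) f -> mem v y.
Definition bij f x y : Prop :=
  fn_to f x y /\ (forall u v w, mem (op u w) f /\ mem (op v w) f -> u = v) /\
  (forall w, mem w y -> exists u, mem (op u w) f).
Lemma sat_is_fun f : (V ⊨ is_fun f) <-> isfun f. Proof. unfold is_fun, isfun; st. Qed.
Hint Resolve sat_is_fun : satdb.
Lemma sat_fun_on f x : (V ⊨ fun_on f x) <-> fn_on f x. Proof. unfold fun_on, fn_on; st. Qed.
Hint Resolve sat_fun_on : satdb.
Lemma sat_fun_to f x y : (V ⊨ fun_to f x y) <-> fn_to f x y. Proof. unfold fun_to, fn_to; st. Qed.
Hint Resolve sat_fun_to : satdb.
Lemma sat_is_bij f x y : (V ⊨ is_bij f x y) <-> bij f x y. Proof. unfold is_bij, bij; st. Qed.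
Definition pfun f x y : Prop :=
  isfun f /\ forall u v, mem (op u v) f -> mem u x /\ mem v y.
Lemma sat_partial_fun f x y : (V ⊨ partial_fun f x y) <-> pfun f x y.
Proof. unfold partial_fun, pfun; st. Qed.
Lemma sat_is_restr t r x : (V ⊨ is_restr t r x) <-> t = restr r x.
Proof.
  transitivity (forall z, mem z t <-> mem z r /\ exists u, mem u x /\ exists v, z = op u v);
    [unfold is_restr; st|].
  assert (E : forall z, (exists u, mem u x /\ exists v, z = op u v) <-> exists u v, mem u x /\ z = op u v).
  { intros z; split; [intros (u & Hu & v & K)|intros (u & v & Hu & K)]; eauto. }
  split.
  - intros H; apply zf_ext; intros z; rewrite H, restrE, E; tauto.
  - intros -> z; rewrite restrE, E; tauto.
Qed.
Hint Resolve sat_is_bij sat_is_restr : satdb.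

Lemma sat_is_trans x : (V ⊨ is_trans x) <-> trans x. Proof. unfold is_trans, trans; st. Qed.
Hint Resolve sat_is_trans : satdb.
Lemma sat_is_ord x : (V ⊨ is_ord x) <-> ord x. Proof. unfold is_ord, ord; st. Qed.
Lemma sat_is_succ y x : (V ⊨ is_succ y x) <-> y = suc x.
Proof.
  transitivity (forall z, mem z y <-> mem z x \/ z = x); [unfold is_succ; st|].
  split; [intros H; apply zf_ext; intros w; rewrite H, sucE; tauto|intros ->; apply sucE].
Qed.
Hint Resolve sat_is_ord sat_is_succ : satdb.
Definition lim x : Prop :=
  ord x /\ x <> emp /\ forall y, mem y x -> exists z, mem z x /\ mem y z.
Lemma sat_is_lim x : (V ⊨ is_lim x) <-> lim x. Proof. unfold is_lim, lim; st. Qed.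
Hint Resolve sat_is_lim : satdb.
Definition omega x : Prop := lim x /\ forall y, mem y x -> ~ lim y.
Lemma sat_is_omega x : (V ⊨ is_omega x) <-> omega x. Proof. unfold is_omega, omega; st. Qed.
Hint Resolve sat_is_omega : satdb.
Definition cardinal x : Prop := ord x /\ forall y, mem y x -> ~ exists g, bij g x y.
Lemma sat_is_card x : (V ⊨ is_card x) <-> cardinal x. Proof. unfold is_card, cardinal; st. Qed.
Definition clt x k : Prop := exists y, mem y k /\ exists g, bij g x y.
Lemma sat_card_lt x k : (V ⊨ card_lt x k) <-> clt x k. Proof. unfold card_lt, clt; st. Qed.
Hint Resolve sat_is_card sat_card_lt : satdb.
Definition regular k : Prop := forall x, mem x k -> forall g, fn_to g x k ->
  exists b, mem b k /\ forall u v, mem (op u v) g -> mem v b.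
Lemma sat_is_regular k : (V ⊨ is_regular k) <-> regular k.
Proof. unfold is_regular, regular; st. Qed.
Definition stronglim k : Prop := forall x, mem x k -> forall u,
  (forall y, mem y u <-> incl y x) -> clt u k.
Lemma sat_is_strong_limit k : (V ⊨ is_strong_limit k) <-> stronglim k.
Proof. unfold is_strong_limit, stronglim; st. Qed.
Hint Resolve sat_is_regular sat_is_strong_limit : satdb.
Definition inacc k : Prop :=
  cardinal k /\ (exists w, mem w k /\ omega w) /\ regular k /\ stronglim k.
Lemma sat_inaccessible k : (V ⊨ inaccessible k) <-> inacc k.
Proof. unfold inaccessible, inacc; st. Qed.
Definition istc t x : Prop := trans t /\ incl x t /\ forall u, trans u /\ incl x u -> incl t u.
Lemma sat_is_tc t x : (V ⊨ is_tc t x) <-> istc t x. Proof. unfold is_tc, istc; st. Qed.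
Definition cardsucc k x : Prop :=
  cardinal k /\ mem x k /\ forall y, mem y k -> cardinal y -> ~ mem x y.
Lemma sat_is_card_succ k x : (V ⊨ is_card_succ k x) <-> cardsucc k x.
Proof. unfold is_card_succ, cardsucc; st. Qed.
Hint Resolve sat_is_tc sat_is_card_succ : satdb.
Definition inH l x : Prop := exists k, cardsucc k l /\ exists t, istc t x /\ clt t k.
Lemma sat_in_H_succ l x : (V ⊨ in_H_succ l x) <-> inH l x.
Proof. unfold in_H_succ, inH; st. Qed.
Hint Resolve sat_in_H_succ : satdb.

Definition poset q a r : Prop :=
  q = op a r /\ a <> emp /\
  (forall z, mem z r -> exists x, mem x a /\ exists y, mem y a /\ z = op x y) /\
  (forall x, mem x a -> mem (op x x) r) /\
  (forall x y z, mem (op x y) r /\ mem (op y z) r -> mem (op x z) r).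
Lemma sat_is_poset q a r : (V ⊨ is_poset q a r) <-> poset q a r.
Proof. unfold is_poset, poset; st. Qed.
Definition stages t d : Prop :=
  incl t d /\ forall x, mem x d ->
    (x = emp -> ~ mem x t) /\ (lim x -> mem x t) /\
    (forall y, mem y d -> x = suc y -> (mem x t <-> ~ mem y t)).
Lemma sat_stages t d : (V ⊨ second_player_stages t d) <-> stages t d.
Proof. unfold second_player_stages, stages; st. Qed.
Definition desc a r b s : Prop :=
  fn_to s b a /\ forall x y u v, mem x y /\ mem (op x u) s /\ mem (op y v) s -> mem (op v u) r.
Lemma sat_descending a r b s : (V ⊨ descending a r b s) <-> desc a r b s.
Proof. unfold descending, desc; st. Qed.
Definition follow g t b s : Prop :=
  forall x, mem x b -> mem x t -> exists u v, u = restr s x /\ mem (op x v) s /\ mem (op u v) g.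
Lemma sat_follows g t b s : (V ⊨ follows g t b s) <-> follow g t b s.
Proof. unfold follows, follow; st. Qed.
Hint Resolve sat_is_poset sat_stages sat_descending sat_follows : satdb.
Definition sclosed a r d : Prop :=
  exists t, stages t d /\ exists g, isfun g /\ forall b, mem b d -> mem b t ->
    forall s, desc a r b s /\ follow g t b s ->
      exists p, mem p a /\ mem (op s p) g /\ forall x u, mem (op x u) s -> mem (op p u) r.
Lemma sat_strategically_closed a r d : (V ⊨ strategically_closed a r d) <-> sclosed a r d.
Proof. unfold strategically_closed, sclosed; st. Qed.
Hint Resolve sat_strategically_closed : satdb.
Definition ticket c l q a r : Prop :=
  poset q a r /\ inH l q /\ forall d, mem d c -> sclosed a r d.
Lemma sat_lottery_ticket c l q a r : (V ⊨ lottery_ticket c l q a r) <-> ticket c l q a r.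
Proof. unfold lottery_ticket, allowed_at, ticket; st. Qed.
Hint Resolve sat_lottery_ticket : satdb.
Definition lotsum (T : V -> V -> V -> Prop) a r : Prop :=
  (forall z, mem z a <-> z = emp \/ exists q b s p, T q b s /\ mem p b /\ z = op q p) /\
  (forall w, mem w r <-> exists y, mem y a /\ exists z, mem z a /\ w = op y z /\
     (z = emp \/ exists q b s p p', T q b s /\ y = op q p /\ z = op q p' /\ mem (op p p') s)).
Lemma sat_is_lottery_sum c l a r :
  (V ⊨ is_lottery_sum (lottery_ticket c l) a r) <-> lotsum (ticket c l) a r.
Proof. unfold is_lottery_sum, lotsum; st. Qed.
(** The one-element poset is the lottery sum of no posets at all. This lets the inactive stages of
    the iteration be treated together with the active ones. *)
Lemma sat_is_trivial_poset a r :
  (V ⊨ is_trivial_poset a r) <-> lotsum (fun _ _ _ => False) a r.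
Proof.
  transitivity ((forall z, mem z a <-> z = emp) /\
    (forall w, mem w r <-> exists y, mem y a /\ exists z, mem z a /\ w = op y z));
    [unfold is_trivial_poset; st|].
  assert (N : forall z, ~ exists q b s p : V, False /\ mem p b /\ z = op q p)
    by (intros z (q & b & s & p & F & _); exact F).
  unfold lotsum; split; intros [H K]; (split; [intros z; rewrite H; specialize (N z); tauto|]);
    intros w; rewrite K; split.
  - intros (y & Hy & z & Hz & E); exists y; split; [exact Hy|exists z].
    apply H in Hz as Hz'; auto.
  - intros (y & Hy & z & Hz & E & _); eauto.
  - intros (y & Hy & z & Hz & E & _); eauto.
  - intros (y & Hy & z & Hz & E); exists y; split; [exact Hy|exists z].
    apply H in Hz as Hz'; destruct Hz' as [Hz'|Hz']; [auto|destruct (N z Hz')].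
Qed.

Lemma fn_on_lam f x : fn_on f x <-> f = lam x (ap f).
Proof.
  split.
  - intros [[H1 H2] H3]; apply zf_ext; intros z; rewrite lamE by dd; split.
    + intros Hz; destruct (H1 z Hz) as (u & v & ->); exists u.
      split; [apply H3; eauto|f_equal]; symmetry; apply ap_eq; [exact Hz|].
      intros w Hw; apply (H2 u w v); auto.
    + intros (u & Hu & ->); apply H3 in Hu; destruct Hu as [v Hv].
      replace (ap f u) with v; [exact Hv|]; symmetry; apply ap_eq; [exact Hv|].
      intros w Hw; apply (H2 u w v); auto.
  - intros E; assert (Q : forall u v, mem (op u v) f <-> mem u x /\ v = ap f u)
      by (intros u v; rewrite E at 1; apply lam_op; dd).
    split; [split|].
    + intros z Hz; rewrite E in Hz; apply lamE in Hz; [|dd]; destruct Hz as (u & _ & ->); eauto.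
    + intros u v w [K1 K2]; apply Q in K1, K2; destruct K1 as [_ ->], K2 as [_ ->]; reflexivity.
    + intros z; split; [intros Hz; exists (ap f z); apply Q; auto|].
      intros [y Hy]; apply Q in Hy; tauto.
Qed.
Lemma fn_on_op f x u v : fn_on f x -> (mem (op u v) f <-> mem u x /\ v = ap f u).
Proof. intros H; apply fn_on_lam in H; rewrite H at 1; apply lam_op; dd. Qed.
Lemma fn_lam x F : F1 F -> fn_on (lam x F) x.
Proof.
  intros HF; apply fn_on_lam, lam_ext; [exact HF|dd|]; intros u Hu; rewrite ap_lam; auto.
Qed.
Lemma fn_restr f x y : fn_on f x -> incl y x -> restr f y = lam y (ap f).
Proof. intros H I; apply fn_on_lam in H; rewrite H at 1; apply restr_lam; [dd|exact I]. Qed.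

Lemma D2_fn_on : D2 fn_on. Proof. unfold fn_on, isfun; dd. Qed.
Hint Resolve D2_fn_on : dfn.
Lemma D3_fn_to : D3 fn_to. Proof. unfold fn_to; dd. Qed.
Lemma D1_lim : D1 lim. Proof. unfold lim; dd. Qed.
Hint Resolve D3_fn_to D1_lim : dfn.
End Sat.
#[global] Hint Resolve sat_sub sat_is_empty sat_is_upair sat_is_opair sat_related sat_is_fun sat_fun_on
  sat_fun_to sat_is_bij sat_is_restr sat_is_trans sat_is_ord sat_is_succ sat_is_lim sat_is_omega sat_is_card
  sat_card_lt sat_is_regular sat_is_strong_limit sat_is_tc sat_is_card_succ sat_in_H_succ sat_is_poset
  sat_stages sat_descending sat_follows sat_strategically_closed sat_lottery_ticket sat_inaccessible : satdb.
#[global] Hint Resolve D2_fn_on D3_fn_to D1_lim : dfn.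

(** * Definability of the forcing relation *)

Section Terms.
Context {V : zfc_model}.
Lemma D_scons (A : (nat -> V) -> Prop) t : DT t -> D A -> D (fun e => A (scons (t e) e)).
Proof.
  intros Ht HA; apply (D_sub (fun e x => A (scons x e)) t Ht).
  apply (D_iff A); [|exact HA]; intros e.
  replace (scons (e 0) (fun n => e (S n))) with e; [tauto|].
  apply functional_extensionality; intros [|n]; reflexivity.
Qed.
Lemma D_s3 (A : (nat -> V) -> Prop) t u v : DT t -> DT u -> DT v -> D A ->
  D (fun e => A (scons (t e) (scons (u e) (scons (v e) e)))).
Proof.
  intros Ht Hu Hv HA.
  refine (D_scons (fun e => A (scons (t (fun n => e (S n))) (scons (u (fun n => e (S n))) e))) v Hv _).
  refine (D_scons (fun e => A (scons (t (fun n => e (S (S n)))) e)) _ (DT_ren S _ Hu) _).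
  exact (D_scons A _ (DT_ren (fun n => S (S n)) _ Ht) HA).
Qed.
Lemma D_s5 (A : (nat -> V) -> Prop) t u v w x : DT t -> DT u -> DT v -> DT w -> DT x -> D A ->
  D (fun e => A (scons (t e) (scons (u e) (scons (v e) (scons (w e) (scons (x e) e)))))).
Proof.
  intros Ht Hu Hv Hw Hx HA.
  refine (D_s3 (fun e => A (scons (t (fun n => e (S (S (S n))))) (scons (u (fun n => e (S (S (S n))))) e)))
    v w x Hv Hw Hx _).
  refine (D_scons (fun e => A (scons (t (fun n => e (S (S (S (S n)))))) e)) _
    (DT_ren (fun n => S (S (S n))) _ Hu) _).
  exact (D_scons A _ (DT_ren (fun n => S (S (S (S n)))) _ Ht) HA).
Qed.
Lemma D_s8 (A : (nat -> V) -> Prop) t u v w x y z q :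
  DT t -> DT u -> DT v -> DT w -> DT x -> DT y -> DT z -> DT q -> D A ->
  D (fun e => A (scons (t e) (scons (u e) (scons (v e) (scons (w e) (scons (x e)
    (scons (y e) (scons (z e) (scons (q e) e))))))))).
Proof.
  intros Ht Hu Hv Hw Hx Hy Hz Hq HA.
  refine (D_s3 (fun e => let e' := fun n => e (S (S (S n))) in
    A (scons (t e') (scons (u e') (scons (v e') (scons (w e') (scons (x e') e))))))
    y z q Hy Hz Hq _); cbv zeta.
  apply (D_s5 A); try assumption; apply (DT_ren (fun n => S (S (S n)))); assumption.
Qed.
Definition D5 (A : V -> V -> V -> V -> V -> Prop) :=
  D (fun e => A (e 0) (e 1) (e 2) (e 3) (e 4)).
Lemma D5_lift A t u v w x : D5 A -> DT t -> DT u -> DT v -> DT w -> DT x ->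
  D (fun e => A (t e) (u e) (v e) (w e) (x e)).
Proof. intros HA Ht Hu Hv Hw Hx; exact (D_s5 _ t u v w x Ht Hu Hv Hw Hx HA). Qed.

Lemma in_nameE (s p t : V) : in_name s p t <-> mem (op s p) t.
Proof. apply sat_related. Qed.
Lemma pleE (P L p q : V) : ple P L p q <-> mem p P /\ mem q P /\ mem (op p q) L.
Proof. unfold ple; rewrite sat_related; tauto. Qed.
Lemma D3_in_name : D3 (@in_name V).
Proof. apply (D_iff (fun e => mem (op (e 0) (e 1)) (e 2))); [|dd]; intros; symmetry; apply in_nameE. Qed.
Lemma D4_ple : D4 (@ple V).
Proof.
  apply (D_iff (fun e => mem (e 2) (e 0) /\ mem (e 3) (e 0) /\ mem (op (e 2) (e 3)) (e 1))); [|dd].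
  intros; symmetry; apply pleE.
Qed.
Lemma in_name_tc (T s p t : V) : trans T -> mem t T -> in_name s p t -> mem s T.
Proof.
  intros HT Ht H; apply in_nameE in H.
  apply (HT (sg s)); [|apply sgE; reflexivity].
  apply (HT (op s p)); [|apply upE; auto]. exact (HT t Ht _ H).
Qed.
End Terms.
#[global] Hint Resolve D3_in_name D4_ple : dfn.

Ltac dd_app ::=
  match goal with
  | |- D (fun e => ?A (@?t e) (@?u e) (@?v e) (@?w e) (@?x e)) =>
      apply (D5_lift A t u v w x); [dd_fact | .. ]
  | |- D (fun e => ?A (@?t e) (@?u e) (@?v e) (@?w e)) =>
      apply (D4_lift A t u v w); [dd_fact | .. ]
  | |- D (fun e => ?A (@?t e) (@?u e) (@?v e)) => apply (D3_lift A t u v); [dd_fact | .. ]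
  | |- D (fun e => ?A (@?t e) (@?u e)) => apply (D2_lift A t u); [dd_fact | .. ]
  | |- D (fun e => ?A (@?t e)) => apply (D1_lift A t); [dd_fact | .. ]
  | |- DT (fun e => ?F (@?t e) (@?u e) (@?v e)) => apply (F3_lift F t u v); [dd_fact | .. ]
  | |- DT (fun e => ?F (@?t e) (@?u e)) => apply (F2_lift F t u); [dd_fact | .. ]
  | |- DT (fun e => ?F (@?t e)) => apply (F1_lift F t); [dd_fact | .. ]
  end.
Ltac dd ::= unfold D1, D2, D3, D4, D5, F1, F2, F3; repeat dd_step.

Section ForcesEq.
Context {V : zfc_model}.
Implicit Types (P L p q r s t u a : V).

(* one step of the recursion defining [forces_eq], with [K] for the recursive calls *)
Definition feq_step P L (K : V -> V -> V -> Prop) t t' p : Prop :=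
  (forall s u q, in_name s u t -> ple P L q p -> ple P L q u ->
     dense_below P L q (fun r => exists s' u', in_name s' u' t' /\ ple P L r u' /\ K s s' r)) /\
  (forall s' u' q, in_name s' u' t' -> ple P L q p -> ple P L q u' ->
     dense_below P L q (fun r => exists s u, in_name s u t /\ ple P L r u /\ K s s' r)).

Lemma feq_step_mono P L (K K' : V -> V -> V -> Prop) t t' p :
  (forall s u s' u' r, in_name s u t -> in_name s' u' t' -> mem r P -> K s s' r -> K' s s' r) ->
  feq_step P L K t t' p -> feq_step P L K' t t' p.
Proof.
  intros H [A B]; split.
  - intros s u q Hs Hqp Hqu q' Hq'; destruct (A s u q Hs Hqp Hqu q' Hq') as (r & Hr & s' & u' & Hs' & Hru & HK).
    exists r; split; [exact Hr|]; exists s', u'; split; [exact Hs'|split; [exact Hru|]].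
    apply (H s u s' u'); try assumption; apply Hr.
  - intros s' u' q Hs' Hqp Hqu q' Hq'; destruct (B s' u' q Hs' Hqp Hqu q' Hq') as (r & Hr & s & u & Hs & Hru & HK).
    exists r; split; [exact Hr|]; exists s, u; split; [exact Hs|split; [exact Hru|]].
    apply (H s u s' u'); try assumption; apply Hr.
Qed.
Lemma feq_rec_irr P L t (a : Acc (below V) t) : forall b t' p,
  forces_eq_rec P L t a t' p <-> forces_eq_rec P L t b t' p.
Proof.
  intros b t' p; rewrite (proof_irrelevance _ a b); tauto.
Qed.
Lemma forces_eqE P L t t' p :
  forces_eq P L t t' p <-> feq_step P L (forces_eq P L) t t' p.
Proof.
  unfold forces_eq at 1; destruct (below_wf V t) as [a]; simpl; split; intros [A B]; split.
  - intros s u q h H1 H2 q' H3; destruct (A s u h q H1 H2 q' H3) as (r & Hr & s' & u' & ? & ? & K).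
    exists r; split; [exact Hr|]; exists s', u'; unfold forces_eq; rewrite feq_rec_irr; eauto.
  - intros s' u' q H0 H1 H2 q' H3; destruct (B s' u' q H0 H1 H2 q' H3) as (r & Hr & s & u & h & ? & K).
    exists r; split; [exact Hr|]; exists s, u; unfold forces_eq; rewrite feq_rec_irr; eauto.
  - intros s u h q H1 H2 q' H3; destruct (A s u q h H1 H2 q' H3) as (r & Hr & s' & u' & ? & ? & K).
    exists r; split; [exact Hr|]; exists s', u'; rewrite feq_rec_irr; eauto.
  - intros s' u' q H0 H1 H2 q' H3; destruct (B s' u' q H0 H1 H2 q' H3) as (r & Hr & s & u & h & ? & K).
    exists r; split; [exact Hr|]; exists s, u, h; rewrite feq_rec_irr; eauto.
Qed.

(** Written with formulas of the model rather than with [op], so that it is definable uniformly in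
    all models. *)
Definition tri S s s' q : Prop := exists w, (V ⊨ is_opair w s' q) /\ (V ⊨ related S s w).
Lemma triE S s s' q : tri S s s' q <-> mem (op s (op s' q)) S.
Proof.
  unfold tri; split.
  - intros (w & Hw & K); apply sat_is_opair in Hw; apply sat_related in K; subst; exact K.
  - intros H; exists (op s' q); rewrite sat_is_opair, sat_related; auto.
Qed.
(** A set-sized fragment of the forcing relation for equality. Since every such table agrees with
    the true relation, the latter can be defined by the existence of a table. *)
Definition feq_table P L T S : Prop :=
  (forall x y, mem x T -> mem y x -> mem y T) /\
  forall s s' q, mem s T -> mem s' T -> mem q P -> (tri S s s' q <-> feq_step P L (tri S) s s' q).

Lemma feq_table_correct P L T S : feq_table P L T S ->
  forall s s' q, mem s T -> mem s' T -> mem q P -> (tri S s s' q <-> forces_eq P L s s' q).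
Proof.
  intros [HT HS] s; induction s as [s IH] using (well_founded_ind (below_wf V)).
  assert (HT' : trans T) by (intros x Hx y Hy; exact (HT x y Hx Hy)).
  intros s' q Hs Hs' Hq; rewrite HS, forces_eqE by assumption.
  split; apply feq_step_mono; intros a u a' u' r Ha Ha' Hr K;
    apply (IH a (in_name_below Ha)); try assumption;
    first [exact (in_name_tc T _ _ _ HT' Hs Ha)|exact (in_name_tc T _ _ _ HT' Hs' Ha')].
Qed.
Lemma feq_table_ex P L t t' : exists T S, feq_table P L T S /\ mem t T /\ mem t' T.
Proof.
  set (T := tc (up t t')).
  (* The value at [s] is the set of pairs [⟨s', q⟩] in [T × P] with [q ⊩ s = s']. The recursion must
     see the transitive closure, because the names occurring in [s] are not members of [s]. *)
  set (F := fun s h => sep (prod T P) (fun w => exists s' q, w = op s' q /\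
     feq_step P L (fun a a' r => mem (op a' r) (ap h a)) s s' q)).
  assert (HF : F2 F).
  { unfold F. apply (DT_sep (fun _ => prod T P) (fun e w => exists s' q, w = op s' q /\
       feq_step P L (fun a a' r => mem (op a' r) (ap (e 1) a)) (e 0) s' q)); [dd|].
    unfold feq_step, dense_below; dd. }
  assert (HR : F1 (rect F)) by (apply F1_rect, HF).
  set (S := sep (prod T (prod T P)) (fun z => exists s w, z = op s w /\ mem w (rect F s))).
  exists T, S; split; [|split; apply tc_incl, upE; auto].
  split; [intros x y Hx; apply (trans_tc _ x Hx)|].
  assert (TS : forall s s' q, mem s T -> mem s' T -> mem q P ->
     (tri S s s' q <-> mem (op s' q) (rect F s))).
  { intros s s' q Hs Hs' Hq; rewrite triE; unfold S; rewrite sepE by dd; split.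
    - intros [_ (a & w & E & K)]; apply op_inj in E; destruct E; subst; exact K.
    - intros K; split; [|eauto]; rewrite !prod_op; auto. }
  intros s s' q Hs Hs' Hq; rewrite TS by assumption; rewrite rectE by exact HF.
  unfold F at 1; rewrite sepE by (unfold feq_step, dense_below; dd).
  assert (C : forall K, feq_step P L (fun a a' r => mem (op a' r) (ap (lam (tc s) (rect F)) a)) s s' K <->
     feq_step P L (tri S) s s' K).
  { assert (Q : forall a u a' u' r, in_name a u s -> in_name a' u' s' -> mem r P ->
       (mem (op a' r) (ap (lam (tc s) (rect F)) a) <-> tri S a a' r)).
    { intros a u a' u' r Ha Ha' Hr; rewrite ap_lam.
      - rewrite TS; [reflexivity| | |exact Hr].
        + exact (in_name_tc T a u s (trans_tc _) Hs Ha).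
        + exact (in_name_tc T a' u' s' (trans_tc _) Hs' Ha').
      - exact HR.
      - apply in_nameE in Ha; apply (trans_tc s (sg a)); [|apply sgE; reflexivity].
        apply (trans_tc s (op a u)); [apply tc_incl, Ha|apply upE; auto]. }
    intros K; split; apply feq_step_mono; intros a u a' u' r Ha Ha' Hr;
      apply (Q a u a' u' r Ha Ha' Hr). }
  rewrite <- C; split.
  - intros [_ (a & b & E & K)]; apply op_inj in E; destruct E; subst; exact K.
  - intros K; split; [apply prod_op; auto|eauto].
Qed.
End ForcesEq.

Ltac ud_ext := fail.
Ltac ud_step :=
  cbv beta;
  first [ apply UD_mem | ud_ext
        | apply UD_sat; solve [ rf ]
        | apply UD_and | apply UD_not | apply UD_imp
        | apply UD_all | apply UD_ex ].
Ltac ud := repeat ud_step.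

Lemma UD_in_name i j k : UD (fun V e => in_name (e i) (e j) (e k)).
Proof. unfold in_name; ud. Qed.
Lemma UD_ple i j k l : UD (fun V e => ple (e i) (e j) (e k) (e l)).
Proof. unfold ple; ud. Qed.
Lemma UD_tri i j k l : UD (fun V e => tri (e i) (e j) (e k) (e l)).
Proof. unfold tri; ud. Qed.
Ltac ud_ext ::= first [ apply UD_in_name | apply UD_ple | apply UD_tri ].
Lemma UD_forces_eq i j k l m : UD (fun V e => forces_eq (e i) (e j) (e k) (e l) (e m)).
Proof.
  (* A table speaks only of elements of the poset; for any other condition [forces_eq] holds
     vacuously. *)
  apply (UD_iff (fun V e => mem (e m) (e i) -> exists T S, feq_table (e i) (e j) T S /\
     mem (e k) T /\ mem (e l) T /\ tri S (e k) (e l) (e m))).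
  - intros V e; split.
    + intros H; destruct (classic (mem (e m) (e i))) as [Hm|Hm].
      * destruct (H Hm) as (T & S & HS & Hk & Hl & K).
        exact (proj1 (feq_table_correct _ _ _ _ HS _ _ _ Hk Hl Hm) K).
      * apply forces_eqE; split; intros s u q _ [_ [Q _]]; destruct (Hm Q).
    + intros H Hm; destruct (feq_table_ex (e i) (e j) (e k) (e l)) as (T & S & HS & Hk & Hl).
      exists T, S; split; [exact HS|split; [exact Hk|split; [exact Hl|]]].
      exact (proj2 (feq_table_correct _ _ _ _ HS _ _ _ Hk Hl Hm) H).
  - unfold feq_table, feq_step, dense_below; ud.
Qed.
Lemma UD_forces_mem i j k l m : UD (fun V e => forces_mem (e i) (e j) (e k) (e l) (e m)).
Proof.
  unfold forces_mem, dense_below.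
  repeat first [ apply UD_forces_eq | ud_step ].
Qed.
Ltac ud_ext ::=
  first [ apply UD_in_name | apply UD_ple | apply UD_tri | apply UD_forces_eq | apply UD_forces_mem ].

(** Definability is obtained formula by formula, by an induction that takes place outside the
    models. *)
Lemma UD_forces_emb phi :
  UD (fun V e => forces (e 0) (e 1) (e 2) (emb phi (fun n => e (S (S (S n)))))).
Proof.
  induction phi as [i j|i j|a IH|a IHa b IHb|a IH]; simpl.
  - ud.
  - ud.
  - apply UD_all, UD_imp; [ud|]; apply UD_not.
    exact (UD_ren (fun n => match n with 0 => 1 | 1 => 2 | 2 => 0 | S m => S (S m) end) _ IH).
  - apply UD_and; assumption.
  - apply UD_all.
    apply (UD_iff (fun V e => forces (e 1) (e 2) (e 3) (emb a (fun n => e (match n with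
       0 => 0 | S m => S (S (S (S m))) end))))).
    + intros V e; simpl.
      replace (fun n => e (match n with 0 => 0 | S m => S (S (S (S m))) end))
        with (scons (e 0) (fun n => e (S (S (S (S n)))))); [tauto|].
      apply functional_extensionality; intros [|n]; reflexivity.
    + exact (UD_ren (fun n => match n with 0 => 1 | 1 => 2 | 2 => 3 | 3 => 0 | S (S (S (S m))) => S (S (S (S m))) end) _ IH).
Qed.
Lemma UD_forces (a : forall V : zfc_model, (nat -> V) -> form V) i j k : reified a ->
  UD (fun V e => forces (e i) (e j) (e k) (a V e)).
Proof.
  intros [phi H].
  apply (UD_iff (fun V e => forces (e i) (e j) (e k) (emb phi e))).
  { intros V e; rewrite H; tauto. }
  exact (UD_ren (fun n => match n with 0 => i | 1 => j | 2 => k | S (S (S m)) => m end) _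
    (UD_forces_emb phi)).
Qed.

Definition chk {V : zfc_model} (P : V) : V -> V :=
  rec (fun x h => prod (img x (fun y => ap h y)) P).
Section Check.
Context {V : zfc_model}.
Implicit Types (P x y z t : V).
Lemma F2_chk : F2 (@chk V).
Proof.
  unfold chk; apply (DT_rec (fun e x h => prod (img x (fun y => ap h y)) (e 0)) (fun e => e 1)); dd.
Qed.
Hint Resolve F2_chk : dfn.
Lemma chkE P x z : mem z (chk P x) <-> exists y p, mem y x /\ mem p P /\ z = op (chk P y) p.
Proof.
  unfold chk at 1; rewrite recE by dd; fold (chk P); rewrite prodE; split.
  - intros (a & p & Ha & Hp & ->); apply imgE in Ha; [|dd]; destruct Ha as (y & Hy & ->).
    exists y, p; rewrite ap_lam by (dd || assumption); auto.
  - intros (y & p & Hy & Hp & ->); exists (chk P y), p; split; [|auto].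
    apply imgE; [dd|]; exists y; rewrite ap_lam by (dd || assumption); auto.
Qed.
Lemma check_nameE P x t : check_name P x t <-> t = chk P x.
Proof.
  unfold check_name; generalize (below_wf V x) as a; revert t.
  induction x as [x IH] using mem_ind; intros t [a]; cbn [check_rec]; split.
  - intros H; apply zf_ext; intros z; rewrite H, chkE; split.
    + intros (y & h & s & p & K & Hp & E); apply (IH y h) in K; apply sat_is_opair in E; subst; eauto.
    + intros (y & p & Hy & Hp & ->); exists y, Hy, (chk P y), p.
      rewrite sat_is_opair, (IH y Hy); auto.
  - intros -> z; rewrite chkE; split.
    + intros (y & p & Hy & Hp & ->); exists y, Hy, (chk P y), p.
      rewrite sat_is_opair, (IH y Hy); auto.
    + intros (y & h & s & p & K & Hp & E); apply (IH y h) in K; apply sat_is_opair in E; subst; eauto.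
Qed.
End Check.
#[global] Hint Resolve F2_chk : dfn.
Lemma UD_check i j k : UD (fun V e => check_name (e i) (e j) (e k)).
Proof.
  (* The witness [g] records canonical names on a domain closed under members: an attempt at the
     recursion that defines [chk]. *)
  apply (UD_iff (fun V e => exists g, (forall x y, in_name x y g ->
     (forall x', mem x' x -> exists y', in_name x' y' g) /\
     (forall z, mem z y <-> exists x' y' p, mem x' x /\ in_name x' y' g /\ mem p (e i) /\ (V ⊨ is_opair z y' p)))
     /\ in_name (e j) (e k) g)).
  2:{ ud. }
  intros V e; rewrite check_nameE; split.
  - intros (g & H & K); revert K; generalize (e j) as x, (e k) as y.
    intros x; induction x as [x IH] using mem_ind; intros y K; destruct (H x y K) as [H1 H2].
    apply zf_ext; intros z; rewrite H2, chkE; split.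
    + intros (x' & y' & p & Hx' & Kx' & Hp & E); apply sat_is_opair in E.
      apply IH in Kx'; [|exact Hx']; subst; eauto.
    + intros (x' & p & Hx' & Hp & ->); destruct (H1 x' Hx') as [y' Ky'].
      exists x', y', p; rewrite sat_is_opair; split; [exact Hx'|split; [exact Ky'|split; [exact Hp|]]].
      rewrite (IH x' Hx' y' Ky'); reflexivity.
  - intros ->; exists (lam (cup (sg (e j)) (tc (e j))) (chk (e i))).
    assert (Q : forall x y, in_name x y (lam (cup (sg (e j)) (tc (e j))) (chk (e i))) <->
       (x = e j \/ mem x (tc (e j))) /\ y = chk (e i) x).
    { intros x y; rewrite in_nameE, lam_op, cupE, sgE by dd; tauto. }
    assert (T : forall x x', x = e j \/ mem x (tc (e j)) -> mem x' x -> mem x' (tc (e j))).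
    { intros x x' [->|Hx] Hx'; [apply tc_incl, Hx'|exact (trans_tc _ x Hx x' Hx')]. }
    split; [|apply Q; auto].
    intros x y K; apply Q in K; destruct K as [Hx ->]; split.
    + intros x' Hx'; exists (chk (e i) x'); apply Q; eauto.
    + intros z; rewrite chkE; split.
      * intros (x' & p & Hx' & Hp & ->); exists x', (chk (e i) x'), p; rewrite sat_is_opair, Q; eauto 10.
      * intros (x' & y' & p & Hx' & Ky' & Hp & E); apply sat_is_opair in E; apply Q in Ky'.
        destruct Ky' as [_ ->]; eauto.
Qed.

(** * The truth lemma *)

Lemma D5_forces_eq {V : zfc_model} : D5 (@forces_eq V).
Proof. exact (D_UD _ (UD_forces_eq 0 1 2 3 4)). Qed.
Lemma D5_forces_mem {V : zfc_model} : D5 (@forces_mem V).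
Proof. exact (D_UD _ (UD_forces_mem 0 1 2 3 4)). Qed.
#[global] Hint Resolve D5_forces_eq D5_forces_mem : dfn.

Definition preord {V : zfc_model} (P L : V) : Prop :=
  (forall p, mem p P -> ple P L p p) /\
  (forall p q r, ple P L p q -> ple P L q r -> ple P L p r).

Section Truth.
Context {V : zfc_model} (P L : V) (HP : preord P L).
Implicit Types (p q r s t u : V) (a : form V).
Local Notation "p ≤ q" := (ple P L p q) (at level 70).
Local Notation "p ⊩ a" := (forces P L p a) (at level 70).
Let le_refl p : mem p P -> p ≤ p := proj1 HP p.
Let le_trans p q r : p ≤ q -> q ≤ r -> p ≤ r := proj2 HP p q r.

Lemma forces_eq_mono t t' p q : q ≤ p -> forces_eq P L t t' p -> forces_eq P L t t' q.
Proof.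
  rewrite !forces_eqE; intros Hq [A B]; split; intros s u q' Hs Hq' Hu;
    [apply (A s u)|apply (B s u)]; eauto.
Qed.
Lemma forces_mono a : forall p q, q ≤ p -> p ⊩ a -> q ⊩ a.
Proof.
  induction a as [s t|s t|a IH|a IHa b IHb|a IH]; simpl; intros p q Hq H.
  - intros r Hr; apply H; eauto.
  - eapply forces_eq_mono; eauto.
  - intros r Hr; apply H; eauto.
  - destruct H; split; eauto.
  - intros x; eauto.
Qed.
Lemma forces_dense a : forall p, dense_below P L p (fun q => q ⊩ a) -> p ⊩ a.
Proof.
  induction a as [s t|s t|a IH|a IHa b IHb|a IH]; simpl; intros p H.
  - intros q Hq; destruct (H q Hq) as (r & Hr & K).
    destruct (K r (le_refl _ (proj1 Hr))) as (r' & Hr' & Q); exists r'; split; [eauto|exact Q].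
  - apply forces_eqE; split; intros a u q Ha Hq Hu q' Hq';
      destruct (H q' (le_trans _ _ _ Hq' Hq)) as (r & Hr & K); rewrite forces_eqE in K;
      destruct K as [K1 K2].
    + destruct (K1 a u r Ha (le_refl _ (proj1 Hr)) ltac:(eauto) r (le_refl _ (proj1 Hr))) as (r' & Hr' & Q).
      exists r'; split; [eauto|exact Q].
    + destruct (K2 a u r Ha (le_refl _ (proj1 Hr)) ltac:(eauto) r (le_refl _ (proj1 Hr))) as (r' & Hr' & Q).
      exists r'; split; [eauto|exact Q].
  - intros q Hq K; destruct (H q Hq) as (r & Hr & N).
    apply (N r (le_refl _ (proj1 Hr))); eapply forces_mono; eauto.
  - split; [apply IHa|apply IHb]; intros q Hq; destruct (H q Hq) as (r & Hr & K);
      exists r; tauto.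
  - intros x; apply IH; intros q Hq; destruct (H q Hq) as (r & Hr & K); exists r; auto.
Qed.
Lemma forces_decide a p : mem p P -> exists q, q ≤ p /\ (q ⊩ a \/ q ⊩ fNot a).
Proof.
  intros Hp; destruct (classic (exists q, q ≤ p /\ q ⊩ a)) as [(q & Hq & K)|N]; [eauto|].
  exists p; split; [auto|right]; intros q Hq K; apply N; eauto.
Qed.

Section Generic.
Context (G : V -> Prop) (HG : generic P L G).

Lemma gen_dense (A : V -> Prop) : D1 A -> (forall p, mem p P -> exists q, q ≤ p /\ A q) ->
  exists p, G p /\ A p.
Proof.
  intros HA H; destruct (generic_dense _ _ _ HG (sep P A)) as (p & Hp & K).
  - intros p Hp; apply sepE in Hp; tauto.
  - intros p Hp; destruct (H p Hp) as (q & Hq & K); exists q; split; [|exact Hq].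
    apply sepE; [exact HA|]; split; [apply Hq|exact K].
  - apply sepE in K; [|exact HA]; exists p; tauto.
Qed.
Lemma gen_below (A : V -> Prop) q : G q -> dense_below P L q A -> D1 A -> exists r, G r /\ A r /\ r ≤ q.
Proof.
  intros Hq H HA.
  (* Conditions in [A] below [q] together with those incompatible with [q] form a dense class; the
     latter cannot belong to [G], which contains [q]. *)
  destruct (gen_dense (fun r => (A r /\ r ≤ q) \/ forall r', r' ≤ r -> ~ r' ≤ q)) as (r & Hr & [K|K]).
  - dd.
  - intros p Hp; destruct (classic (exists r, r ≤ p /\ r ≤ q)) as [(r & Hrp & Hrq)|N].
    + destruct (H r Hrq) as (r' & Hr' & Ar'); exists r'; split; [eauto|left]; split; eauto.
    + exists p; split; [auto|right]; intros r' H1 H2; apply N; eauto.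
  - exists r; tauto.
  - destruct (generic_dir _ _ _ HG r q Hr Hq) as (r' & _ & H1 & H2); destruct (K r' H1 H2).
Qed.

Lemma ext_eqE t t' : ext_eq G t t' <->
  (forall s p, in_name s p t -> G p -> exists s' p', in_name s' p' t' /\ G p' /\ ext_eq G s s') /\
  (forall s' p', in_name s' p' t' -> G p' -> exists s p, in_name s p t /\ G p /\ ext_eq G s s').
Proof.
  assert (I : forall s (a b : Acc (below V) s) t', ext_eq_rec G s a t' -> ext_eq_rec G s b t')
    by (intros s a b; rewrite (proof_irrelevance _ a b); auto).
  unfold ext_eq at 1; destruct (below_wf V t) as [a]; cbn [ext_eq_rec].
  split; intros [A B]; split.
  - intros s p h Hp; destruct (A s p h Hp) as (s' & p' & ? & ? & K).
    exists s', p'; unfold ext_eq; eauto.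
  - intros s' p' h Hp; destruct (B s' p' h Hp) as (s & p & h' & ? & K).
    exists s, p; unfold ext_eq; eauto.
  - intros s p h Hp; destruct (A s p h Hp) as (s' & p' & ? & ? & K).
    exists s', p'; unfold ext_eq in K; eauto.
  - intros s' p' h Hp; destruct (B s' p' h Hp) as (s & p & h' & ? & K).
    exists s, p, h'; unfold ext_eq in K; eauto.
Qed.
Lemma below_ind (A : V -> Prop) : (forall t, (forall s, below V s t -> A s) -> A t) -> forall t, A t.
Proof. exact (well_founded_ind (below_wf V) A). Qed.
Lemma ext_eq_refl t : ext_eq G t t.
Proof.
  induction t as [t IH] using below_ind; apply ext_eqE.
  split; intros s p H Hp; exists s, p; pose proof (IH s (in_name_below H)); auto.
Qed.
Lemma ext_eq_sym t : forall t', ext_eq G t t' -> ext_eq G t' t.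
Proof.
  induction t as [t IH] using below_ind; intros t' H; apply ext_eqE in H; destruct H as [A B].
  apply ext_eqE; split.
  - intros s' p' K Hp; destruct (B s' p' K Hp) as (s & p & h & ? & Q).
    exists s, p; split; [exact h|split; [assumption|]]; exact (IH s (in_name_below h) s' Q).
  - intros s p K Hp; destruct (A s p K Hp) as (s' & p' & h & ? & Q).
    exists s', p'; split; [exact h|split; [assumption|]]; exact (IH s (in_name_below K) s' Q).
Qed.
Lemma ext_eq_trans t : forall t' t'', ext_eq G t t' -> ext_eq G t' t'' -> ext_eq G t t''.
Proof.
  induction t as [t IH] using below_ind; intros t' t'' H K; apply ext_eqE in H, K.
  destruct H as [A B], K as [A' B']; apply ext_eqE; split.
  - intros s p Hs Hp; destruct (A s p Hs Hp) as (s' & p' & Hs' & Hp' & Q).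
    destruct (A' s' p' Hs' Hp') as (s'' & p'' & Hs'' & Hp'' & Q').
    exists s'', p''; split; [assumption|split; [assumption|]]; exact (IH s (in_name_below Hs) _ _ Q Q').
  - intros s'' p'' Hs'' Hp''; destruct (B' s'' p'' Hs'' Hp'') as (s' & p' & Hs' & Hp' & Q').
    destruct (B s' p' Hs' Hp') as (s & p & Hs & Hp & Q).
    exists s, p; split; [assumption|split; [assumption|]]; exact (IH s (in_name_below Hs) _ _ Q Q').
Qed.

Lemma truth_eq t : forall t', (exists p, G p /\ forces_eq P L t t' p) <-> ext_eq G t t'.
Proof.
  induction t as [t IH] using below_ind; intros t'; split.
  - intros (p & Hp & K); apply forces_eqE in K; destruct K as [K1 K2]; apply ext_eqE; split.
    + intros s u Hs Hu; destruct (generic_dir _ _ _ HG p u Hp Hu) as (q & Hq & Hqp & Hqu).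
      destruct (gen_below _ q Hq (K1 s u q Hs Hqp Hqu) ltac:(dd)) as (r & Hr & (s' & u' & Hs' & Hru & Q) & _).
      exists s', u'; split; [exact Hs'|split; [exact (generic_up _ _ _ HG r u' Hr Hru)|]].
      apply (IH s (in_name_below Hs)); eauto.
    + intros s' u Hs' Hu; destruct (generic_dir _ _ _ HG p u Hp Hu) as (q & Hq & Hqp & Hqu).
      destruct (gen_below _ q Hq (K2 s' u q Hs' Hqp Hqu) ltac:(dd)) as (r & Hr & (s & v & Hs & Hru & Q) & _).
      exists s, v; split; [exact Hs|split; [exact (generic_up _ _ _ HG r v Hr Hru)|]].
      apply (IH s (in_name_below Hs)); eauto.
  - intros E; apply ext_eqE in E; destruct E as [E1 E2].
    (* Unless [p] forces equality, some extension puts an element into one of the names while no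
       condition below can match it with an element of the other. [E1] and [E2] exclude this in
       [G]. *)
    destruct (gen_dense (fun p => forces_eq P L t t' p \/
      (exists s u, in_name s u t /\ p ≤ u /\
         forall s' u' r, in_name s' u' t' -> r ≤ p -> r ≤ u' -> ~ forces_eq P L s s' r) \/
      (exists s' u', in_name s' u' t' /\ p ≤ u' /\
         forall s u r, in_name s u t -> r ≤ p -> r ≤ u -> ~ forces_eq P L s s' r)))
      as (p & Hp & [K|[(s & u & Hs & Hu & K)|(s' & u' & Hs' & Hu' & K)]]).
    + dd.
    + intros p Hp; destruct (classic (forces_eq P L t t' p)) as [Q|Q]; [eauto|].
      rewrite forces_eqE in Q; apply not_and_or in Q; destruct Q as [Q|Q].
      * apply NNPP; intros N; apply Q; intros s u q Hs Hqp Hqu q' Hq'.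
        apply NNPP; intros N'; apply N; exists q'; split; [eauto|right; left].
        exists s, u; split; [exact Hs|split; [eauto|]]; intros s' u' r Hs' Hr Hru F.
        apply N'; exists r; split; [exact Hr|exists s', u'; auto].
      * apply NNPP; intros N; apply Q; intros s' u' q Hs' Hqp Hqu q' Hq'.
        apply NNPP; intros N'; apply N; exists q'; split; [eauto|right; right].
        exists s', u'; split; [exact Hs'|split; [eauto|]]; intros s u r Hs Hr Hru F.
        apply N'; exists r; split; [exact Hr|exists s, u; auto].
    + eauto.
    + destruct (E1 s u Hs (generic_up _ _ _ HG p u Hp Hu)) as (s' & u' & Hs' & Gu' & Q).
      apply (IH s (in_name_below Hs)) in Q; destruct Q as (q & Gq & Q).
      destruct (generic_dir _ _ _ HG p q Hp Gq) as (r & Gr & Hrp & Hrq).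
      destruct (generic_dir _ _ _ HG r u' Gr Gu') as (r' & Gr' & Hrr & Hru).
      exfalso; apply (K s' u' r' Hs'); [eauto|eauto|eapply forces_eq_mono; [|exact Q]; eauto].
    + destruct (E2 s' u' Hs' (generic_up _ _ _ HG p u' Hp Hu')) as (s & u & Hs & Gu & Q).
      apply (IH s (in_name_below Hs)) in Q; destruct Q as (q & Gq & Q).
      destruct (generic_dir _ _ _ HG p q Hp Gq) as (r & Gr & Hrp & Hrq).
      destruct (generic_dir _ _ _ HG r u Gr Gu) as (r' & Gr' & Hrr & Hru).
      exfalso; apply (K s u r' Hs); [eauto|eauto|eapply forces_eq_mono; [|exact Q]; eauto].
Qed.
Lemma truth_mem s t : (exists p, G p /\ forces_mem P L s t p) <-> ext_mem G s t.
Proof.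
  split.
  - intros (p & Hp & K).
    destruct (gen_below _ p Hp K ltac:(dd)) as (r & Hr & (s' & u' & Hs' & Hru & Q) & _).
    exists s', u'; split; [exact Hs'|split; [exact (generic_up _ _ _ HG r u' Hr Hru)|]].
    apply truth_eq; eauto.
  - intros (s' & u & Hs & Gu & Q); apply truth_eq in Q; destruct Q as (q & Gq & Q).
    destruct (generic_dir _ _ _ HG u q Gu Gq) as (r & Gr & Hru & Hrq).
    exists r; split; [exact Gr|]; intros r' Hr'; exists r'.
    split; [apply le_refl, Hr'|]; exists s', u; split; [exact Hs|split; [eauto|]].
    eapply forces_eq_mono; [|exact Q]; eauto.
Qed.
Lemma D1_forces_emb phi e : D1 (fun p => p ⊩ emb phi e).
Proof.
  exact (D_subst (fun n => match n with 0 => inr P | 1 => inr L | 2 => inl 0 | S (S (S m)) => inr (e m) end)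
    _ (D_UD _ (UD_forces_emb phi))).
Qed.
Lemma D2_forces_emb phi e : D2 (fun p x => p ⊩ emb phi (scons x e)).
Proof.
  apply (D_iff (fun e' => e' 0 ⊩ emb phi (fun n => match n with 0 => e' 1 | S m => e m end))).
  { intros e'.
    replace (scons (e' 1) e) with (fun n => match n with 0 => e' 1 | S m => e m end);
      [tauto|apply functional_extensionality; intros [|n]; reflexivity]. }
  apply (D_iff (fun e' => e' 0 ⊩ emb phi (fun n => look (fun n => match n with 0 => inr P | 1 => inr L | 2 => inl 0
    | 3 => inl 1 | S (S (S (S m))) => inr (e m) end) e' (S (S (S n)))))).
  { intros e'.
    replace (fun n => look _ e' (S (S (S n)))) with (fun n => match n with 0 => e' 1 | S m => e m end);
      [tauto|apply functional_extensionality; intros [|n]; reflexivity]. }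
  exact (D_subst (fun n => match n with 0 => inr P | 1 => inr L | 2 => inl 0
    | 3 => inl 1 | S (S (S (S m))) => inr (e m) end) _ (D_UD _ (UD_forces_emb phi))).
Qed.
Lemma truth phi : forall e, (exists p, G p /\ p ⊩ emb phi e) <-> ext_sat G (emb phi e).
Proof.
  unfold ext_sat; induction phi as [i j|i j|a IH|a IHa b IHb|a IH]; intros e.
  - apply truth_mem.
  - apply truth_eq.
  - cbn [emb sat]; rewrite <- IH; split.
    + intros (p & Hp & K) (q & Hq & Q).
      destruct (generic_dir _ _ _ HG p q Hp Hq) as (r & _ & H1 & H2).
      exact (K r H1 (forces_mono _ _ _ H2 Q)).
    + intros N; pose proof (D1_forces_emb a e) as HD.
      destruct (gen_dense (fun p => p ⊩ emb a e \/ p ⊩ emb (vNot a) e)) as (p & Hp & [K|K]).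
      * pose proof (D1_forces_emb (vNot a) e). apply D_or; assumption.
      * intros p Hp; apply forces_decide, Hp.
      * destruct N; eauto.
      * exists p; auto.
  - cbn [emb sat]; rewrite <- IHa, <- IHb; split.
    + intros (p & Hp & K1 & K2); split; exists p; auto.
    + intros [(p & Hp & K1) (q & Hq & K2)].
      destruct (generic_dir _ _ _ HG p q Hp Hq) as (r & Hr & H1 & H2).
      exists r; split; [exact Hr|split; [exact (forces_mono _ _ _ H1 K1)|exact (forces_mono _ _ _ H2 K2)]].
  - cbn [emb sat]; split.
    + intros (p & Hp & K) x; apply IH; exists p; split; [exact Hp|apply K].
    (* Densely many conditions force the universal statement or force some instance to fail; the
       second kind contradicts [H]. *)
    + intros H; destruct (gen_dense (fun p => p ⊩ emb (vAll a) e \/ exists x, p ⊩ emb (vNot a) (scons x e)))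
        as (p & Hp & [K|[x K]]).
      * apply D_or; [apply D1_forces_emb|]; apply D_ex.
        exact (D_ren (fun n => match n with 0 => 1 | 1 => 0 | n => n end) _ (D2_forces_emb (vNot a) e)).
      * intros p Hp; destruct (classic (p ⊩ emb (vAll a) e)) as [Q|Q]; [eauto|].
        apply not_all_ex_not in Q; destruct Q as [x Q].
        apply NNPP; intros N; apply Q, forces_dense; intros q Hq; apply NNPP; intros N'.
        apply N; exists q; split; [exact Hq|right; exists x].
        intros r Hr Hf; apply N'; eauto.
      * eauto.
      * specialize (H x); apply IH in H; destruct H as (q & Hq & Q).
        destruct (generic_dir _ _ _ HG p q Hp Hq) as (r & _ & H1 & H2).
        exact (False_ind _ (K r H1 (forces_mono _ _ _ H2 Q))).
Qed.

(** * The generic extension as a model *)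

(* V[G] is the quotient of the names by the equality of their values. *)
Definition gcar : Type := {C : V -> Prop | exists t, C = ext_eq G t}.
Definition gval t : gcar := exist _ (ext_eq G t) (ex_intro _ t eq_refl).
Definition gmem (x y : gcar) : Prop := exists s t, x = gval s /\ y = gval t /\ ext_mem G s t.
Lemma gval_surj (x : gcar) : exists t, x = gval t.
Proof.
  destruct x as [C [t E]]; exists t; unfold gval; subst C; reflexivity.
Qed.
Lemma gval_eq s t : gval s = gval t <-> ext_eq G s t.
Proof.
  split.
  - intros E; assert (K : ext_eq G s = ext_eq G t) by exact (f_equal (@proj1_sig _ _) E).
    rewrite K; apply ext_eq_refl.
  - intros E; unfold gval.
    assert (K : ext_eq G s = ext_eq G t).
    { apply functional_extensionality; intros u; apply propositional_extensionality; split; intros Q.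
      - exact (ext_eq_trans _ _ _ (ext_eq_sym _ _ E) Q).
      - exact (ext_eq_trans _ _ _ E Q). }
    apply eq_sig_hprop; [intros; apply proof_irrelevance|exact K].
Qed.
Lemma gmem_val x t : gmem x (gval t) <-> exists s p, in_name s p t /\ G p /\ x = gval s.
Proof.
  split.
  - intros (s & t' & -> & E & (s' & p & Hs & Hp & Q)).
    apply gval_eq in E; apply ext_eqE in E; destruct E as [_ E].
    destruct (E s' p Hs Hp) as (s'' & p'' & Hs'' & Hp'' & Q').
    exists s'', p''; split; [exact Hs''|split; [exact Hp''|]]; apply gval_eq.
    exact (ext_eq_trans _ _ _ Q (ext_eq_sym _ _ Q')).
  - intros (s & p & Hs & Hp & ->); exists s, t; split; [reflexivity|split; [reflexivity|]].
    exists s, p; split; [exact Hs|split; [exact Hp|apply ext_eq_refl]].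
Qed.
Lemma gmem_ext s t : gmem (gval s) (gval t) <-> ext_mem G s t.
Proof.
  rewrite gmem_val; unfold ext_mem; split; intros (s' & p & Hs & Hp & E); exists s', p;
    rewrite gval_eq in *; auto.
Qed.
Lemma gsat phi : forall e, fol_sat gmem (fun n => gval (e n)) phi <-> ext_sat G (emb phi e).
Proof.
  unfold ext_sat; induction phi as [i j|i j|a IH|a IHa b IHb|a IH]; intros e; cbn [emb sat fol_sat].
  - apply gmem_ext.
  - apply gval_eq.
  - rewrite IH; tauto.
  - rewrite IHa, IHb; tauto.
  - assert (E : forall t, (fun n => gval (scons t e n)) = scons (gval t) (fun n => gval (e n)))
      by (intros t; apply functional_extensionality; intros [|n]; reflexivity).
    split.
    + intros H t; apply IH; rewrite E; apply H.
    + intros H x; destruct (gval_surj x) as [t ->]; rewrite <- E; apply IH, H.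
Qed.
Lemma gtruth phi e : fol_sat gmem (fun n => gval (e n)) phi <-> exists p, G p /\ p ⊩ emb phi e.
Proof. rewrite gsat; symmetry; apply truth. Qed.
Lemma genv (e : nat -> gcar) : exists e0, e = fun n => gval (e0 n).
Proof.
  exists (fun n => epsilon V_inh (fun t => e n = gval t)).
  apply functional_extensionality; intros n.
  exact (epsilon_spec V_inh (fun t => e n = gval t) (gval_surj (e n))).
Qed.
Lemma gtruth_mem s t : gmem (gval s) (gval t) <-> exists p, G p /\ forces_mem P L s t p.
Proof. rewrite gmem_ext; symmetry; apply truth_mem. Qed.
Lemma in_name_tc' s p t : in_name s p t -> mem s (tc t).
Proof.
  intros H; apply in_nameE in H; apply (trans_tc t (sg s)); [|apply sgE; reflexivity].
  apply (trans_tc t (op s p)); [apply tc_incl, H|apply upE; auto].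
Qed.
Lemma gmem_prod X x : gmem x (gval (prod X P)) <-> exists s, mem s X /\ x = gval s.
Proof.
  rewrite gmem_val; split.
  - intros (s & p & Hs & _ & ->); apply in_nameE, prod_op in Hs; exists s; tauto.
  - intros (s & Hs & ->); destruct (generic_nonempty _ _ _ HG) as [p Hp].
    exists s, p; rewrite in_nameE, prod_op; split; [|auto].
    split; [exact Hs|exact (generic_sub _ _ _ HG p Hp)].
Qed.

Lemma g_separation phi (e : nat -> gcar) x : exists a : gcar, forall z,
  gmem z a <-> gmem z x /\ fol_sat gmem (scons z e) phi.
Proof.
  destruct (genv e) as [e0 ->]; destruct (gval_surj x) as [t ->].
  pose proof (D2_forces_emb phi e0) as HD.
  assert (HA : D1 (fun z => exists s p, z = op s p /\ forces_mem P L s t p /\ p ⊩ emb phi (scons s e0))).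
  { apply D_ex, D_ex, D_and; [dd|apply D_and; [dd|]].
    exact (D_ren (fun n => match n with 0 => 0 | 1 => 1 | n => n end) _ HD). }
  exists (gval (sep (prod (tc t) P) (fun z => exists s p, z = op s p /\ forces_mem P L s t p /\ p ⊩ emb phi (scons s e0)))).
  assert (E : forall s, scons (gval s) (fun n => gval (e0 n)) = (fun n => gval (scons s e0 n)))
    by (intros s; apply functional_extensionality; intros [|n]; reflexivity).
  intros z; rewrite gmem_val; split.
  - intros (s & p & Hs & Hp & ->); apply in_nameE, sepE in Hs; [|exact HA].
    destruct Hs as [_ (s' & p' & Eq & K1 & K2)]; apply op_inj in Eq; destruct Eq; subst s' p'.
    rewrite E, gtruth, gtruth_mem; split; exists p; auto.
  - intros [Hz K]; apply gmem_val in Hz as Hz'; destruct Hz' as (s & u & Hs & Hu & ->).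
    rewrite E, gtruth in K; rewrite gtruth_mem in Hz; destruct K as (p & Gp & Kp), Hz as (q & Gq & Kq).
    destruct (generic_dir _ _ _ HG p q Gp Gq) as (r & Gr & H1 & H2).
    exists s, r; split; [|auto]; apply in_nameE, sepE; [exact HA|split].
    + apply prod_op; split; [exact (in_name_tc' _ _ _ Hs)|exact (generic_sub _ _ _ HG r Gr)].
    + exists s, r; split; [reflexivity|split; [exact (forces_mono (fMem s t) _ _ H2 Kq)|exact (forces_mono _ _ _ H1 Kp)]].
Qed.
Lemma g_replacement phi (e : nat -> gcar) x :
  (forall u v w : gcar, gmem u x -> fol_sat gmem (scons u (scons v e)) phi ->
     fol_sat gmem (scons u (scons w e)) phi -> v = w) ->
  exists a : gcar, forall v : gcar, gmem v a <-> exists u : gcar, gmem u x /\ fol_sat gmem (scons u (scons v e)) phi.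
Proof.
  intros Hf; destruct (genv e) as [e0 E0]; destruct (gval_surj x) as [t Et].
  (* For every name and condition, [Y] holds some name that the condition forces to be a value, if
     there is one. A single one suffices because [Hf] makes values unique in the extension. *)
  destruct (collection (fun w v => exists s p, w = op s p /\ p ⊩ emb phi (scons s (scons v e0))) (prod (tc t) P))
    as [Y HY].
  { apply D_ex, D_ex, D_and; [dd|].
    apply (D_iff (fun e' => e' 0 ⊩ emb phi (fun n => look (fun n => match n with 0 => inr P | 1 => inr L | 2 => inl 0
      | 3 => inl 1 | 4 => inl 3 | S (S (S (S (S m)))) => inr (e0 m) end) e' (S (S (S n)))))).
    - intros e'.
      replace (fun n => look _ e' (S (S (S n)))) with (scons (e' 1) (scons (e' 3) e0));
        [tauto|apply functional_extensionality; intros [|[|n]]; reflexivity].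
    - exact (D_subst (fun n => match n with 0 => inr P | 1 => inr L | 2 => inl 0
      | 3 => inl 1 | 4 => inl 3 | S (S (S (S (S m)))) => inr (e0 m) end) _ (D_UD _ (UD_forces_emb phi))). }
  (* The image is separated from the set of values of [Y]. The domain [x] is inserted as a parameter
     after [v], so the parameters of [phi] move up by one. *)
  set (psi := vNot (vAll (vNot (vAnd (vMem 0 2) (ren (fun n => match n with 0 => 0 | 1 => 1 | S m => S (S m) end) phi))))).
  assert (Hpsi : forall v, fol_sat gmem (scons v (scons x e)) psi <-> exists u : gcar, gmem u x /\ fol_sat gmem (scons u (scons v e)) phi).
  { intros v; unfold psi; cbn [fol_sat].
    assert (Q : forall u : gcar, fol_sat gmem (scons u (scons v (scons x e))) (ren (fun n => match n with 0 => 0 | 1 => 1 | S m => S (S m) end) phi)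
      <-> fol_sat gmem (scons u (scons v e)) phi).
    { intros u; rewrite fol_sat_ren.
      replace (fun n => scons u (scons v (scons x e)) (match n with 0 => 0 | 1 => 1 | S m => S (S m) end))
        with (scons u (scons v e)); [tauto|apply functional_extensionality; intros [|[|n]]; reflexivity]. }
    split.
    - intros N; apply NNPP; intros K; apply N; intros u [H1 H2]; apply K; exists u; rewrite <- Q; auto.
    - intros (u & H1 & H2) N; apply (N u); rewrite Q; auto. }
  destruct (g_separation psi (scons x e) (gval (prod Y P))) as [a Ha].
  exists a; intros v; rewrite Ha, Hpsi; split; [tauto|].
  intros (u & Hu & K); split; [|eauto]; subst x e.
  apply gmem_val in Hu as Hu'; destruct Hu' as (s & q & Hs & _ & ->).
  destruct (gval_surj v) as [v0 ->].
  assert (E : forall s v0, scons (gval s) (scons (gval v0) (fun n => gval (e0 n))) = (fun n => gval (scons s (scons v0 e0) n)))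
    by (intros; apply functional_extensionality; intros [|[|n]]; reflexivity).
  pose proof K as K'; rewrite E, gtruth in K'; destruct K' as (p & Gp & Kp).
  destruct (HY (op s p)) as (v1 & Hv1 & s1 & p1 & Eq & K1).
  { apply prod_op; split; [exact (in_name_tc' _ _ _ Hs)|exact (generic_sub _ _ _ HG p Gp)]. }
  { eauto 6. }
  apply op_inj in Eq; destruct Eq; subst s1 p1.
  apply gmem_prod; exists v1; split; [exact Hv1|].
  apply (Hf (gval s)); [exact Hu|exact K|]; rewrite E, gtruth; eauto.
Qed.
Lemma g_choice x :
  (forall y, gmem y x -> exists z, gmem z y) ->
  (forall y y' z, gmem y x -> gmem y' x -> gmem z y -> gmem z y' -> y = y') ->
  exists c, forall y, gmem y x -> exists! z, gmem z y /\ gmem z c.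
Proof.
  intros Hne Hdis; destruct (gval_surj x) as [t ->].
  set (Z := tc t); destruct (ranking Z) as (r & Hr & Or & Ir).
  (* From each [y] the member with the least-ranked name is chosen. A condition puts a name into the
     choice set only if it forces all earlier names out of [y]. *)
  set (first := fun s y p => forall s', mem s' Z -> mem (r s') (r s) -> p ⊩ fNot (fMem s' y)).
  assert (Dfirst : D3 first) by (unfold first; dd).
  assert (HA : D1 (fun w => exists s p y, w = op s p /\ forces_mem P L y t p /\ forces_mem P L s y p /\ first s y p)) by dd.
  exists (gval (sep (prod Z P) (fun w => exists s p y, w = op s p /\ forces_mem P L y t p /\ forces_mem P L s y p /\ first s y p))).
  intros y Hy; apply gmem_val in Hy as Hy'; destruct Hy' as (y0 & q0 & Hy0 & Gq0 & ->).
  assert (Ty : forall s : gcar, gmem s (gval y0) -> exists s0, mem s0 Z /\ s = gval s0).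
  { intros s Hs; apply gmem_val in Hs; destruct Hs as (s0 & p & Hs0 & _ & ->); exists s0; split; [|reflexivity].
    apply (in_name_tc Z s0 p y0); [apply trans_tc| |exact Hs0]; exact (in_name_tc' _ _ _ Hy0). }
  destruct (wf_min (fun b => exists s, mem s Z /\ b = r s /\ gmem (gval s) (gval y0))) as (b & (s & Hs & -> & Hsy) & Mb).
  { destruct (Hne _ Hy) as [z Hz]; destruct (Ty z Hz) as (s0 & Hs0 & ->); eauto. }
  exists (gval s); split; [split; [exact Hsy|]|].
  - destruct (gen_dense (fun p => first s y0 p \/ exists s', mem s' Z /\ mem (r s') (r s) /\ forces_mem P L s' y0 p))
      as (p & Gp & [K|(s' & Hs' & Hr' & K)]).
    + dd.
    + intros p Hp; destruct (classic (first s y0 p)) as [Q|Q]; [eauto|].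
      unfold first in Q; apply not_all_ex_not in Q; destruct Q as [s' Q].
      apply imply_to_and in Q; destruct Q as [Q1 Q]; apply imply_to_and in Q; destruct Q as [Q2 Q].
      apply not_all_ex_not in Q; destruct Q as [q Q]; apply imply_to_and in Q; destruct Q as [Q3 Q].
      exists q; split; [exact Q3|right; exists s'; split; [exact Q1|split; [exact Q2|apply NNPP, Q]]].
    + apply gtruth_mem in Hy, Hsy; destruct Hy as (p1 & G1 & K1), Hsy as (p2 & G2 & K2).
      destruct (generic_dir _ _ _ HG p1 p2 G1 G2) as (p3 & G3 & L1 & L2).
      destruct (generic_dir _ _ _ HG p p3 Gp G3) as (p4 & G4 & L3 & L4).
      apply gmem_val; exists s, p4; split; [|auto]; apply in_nameE, sepE; [exact HA|split].
      * apply prod_op; split; [exact Hs|exact (generic_sub _ _ _ HG _ G4)].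
      * exists s, p4, y0; split; [reflexivity|split; [|split]].
        -- apply (forces_mono (fMem y0 t) p1); eauto.
        -- apply (forces_mono (fMem s y0) p2); eauto.
        -- intros s' H1 H2; exact (forces_mono _ _ _ L3 (K s' H1 H2)).
    + destruct (Mb (r s') Hr'); exists s'; split; [exact Hs'|split; [reflexivity|]].
      apply gtruth_mem; eauto.
  - intros z [Hzy Hzc]; apply gmem_val in Hzc; destruct Hzc as (s1 & p & Hs1 & Gp & ->).
    apply in_nameE, sepE in Hs1; [|exact HA]; destruct Hs1 as [Hs1 (s2 & p2 & y1 & Eq & K1 & K2 & K3)].
    apply op_inj in Eq; destruct Eq; subst s2 p2; apply prod_op in Hs1; destruct Hs1 as [Hs1 _].
    assert (Ey : gval y1 = gval y0).
    { apply (Hdis _ _ (gval s1)); [apply gtruth_mem; eauto|exact Hy|apply gtruth_mem; eauto|exact Hzy]. }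
    f_equal.
    destruct (ord_total (r s) (Or s Hs) (r s1) (Or s1 Hs1)) as [K|[K|K]].
    + exfalso; specialize (K3 s Hs K); rewrite <- Ey in Hsy; apply gtruth_mem in Hsy.
      destruct Hsy as (q & Gq & Kq); destruct (generic_dir _ _ _ HG p q Gp Gq) as (q' & _ & L1 & L2).
      exact (K3 q' L1 (forces_mono (fMem s y1) _ _ L2 Kq)).
    + apply Ir; assumption.
    + destruct (Mb (r s1) K); eauto.
Qed.

(** The construction is transparent, so that elements of this model are by conversion values of
    names. *)
Definition gext : zfc_model.
Proof.
  refine {| carrier := gcar; mem := gmem; zf_separation := g_separation;
            zf_replacement := g_replacement; zf_choice := g_choice |}.
  - intros x; destruct (gval_surj x) as [t ->].
    induction t as [t IH] using below_ind; constructor; intros y Hy.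
    apply gmem_val in Hy; destruct Hy as (s & p & Hs & _ & ->); exact (IH s (in_name_below Hs)).
  - intros x y H; destruct (gval_surj x) as [s ->], (gval_surj y) as [t ->].
    apply gval_eq, ext_eqE; split.
    + intros s' p Hs Hp; assert (K : gmem (gval s') (gval t)) by (apply H, gmem_val; eauto).
      apply gmem_val in K; destruct K as (a & q & ? & ? & E); exists a, q; rewrite gval_eq in E; auto.
    + intros s' p Hs Hp; assert (K : gmem (gval s') (gval s)) by (apply H, gmem_val; eauto).
      apply gmem_val in K; destruct K as (a & q & ? & ? & E); exists a, q; symmetry in E.
      rewrite gval_eq in E; auto.
  - intros x y; destruct (gval_surj x) as [s ->], (gval_surj y) as [t ->].
    exists (gval (prod (up s t) P)); intros z; rewrite gmem_prod; split.
    + intros (u & Hu & ->); apply upE in Hu; destruct Hu; subst; auto.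
    + intros [->| ->]; [exists s|exists t]; rewrite upE; auto.
  - intros x; destruct (gval_surj x) as [t ->].
    destruct (g_separation (vNot (vAll (vNot (vAnd (vMem 0 2) (vMem 1 0))))) (fun _ => gval t)
      (gval (prod (tc t) P))) as [a Ha].
    exists a; intros z; rewrite Ha; cbn; split.
    + intros [_ N]; apply NNPP; intros K; apply N; intros y [H1 H2]; apply K; eauto.
    + intros (y & Hy & Hz); split; [|intros N; exact (N y (conj Hy Hz))].
      apply gmem_val in Hy; destruct Hy as (y0 & q & Hy0 & _ & ->).
      apply gmem_val in Hz; destruct Hz as (z0 & q' & Hz0 & _ & ->).
      apply gmem_prod; exists z0; split; [|reflexivity].
      exact (in_name_tc _ _ _ _ (trans_tc t) (in_name_tc' _ _ _ Hy0) Hz0).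
  - intros x; destruct (gval_surj x) as [t ->].
    (* Every subset of [t] in the extension has a name included in [tc t × P], so the names in the
       power set of that product suffice. *)
    destruct (g_separation (vAll (vNot (vAnd (vMem 0 1) (vNot (vMem 0 2))))) (fun _ => gval t)
      (gval (prod (pow (prod (tc t) P)) P))) as [a Ha].
    exists a; intros z; rewrite Ha; cbn; split.
    + intros [_ N] w Hw; apply NNPP; intros K; exact (N w (conj Hw K)).
    + intros H; split; [|intros w [H1 H2]; exact (H2 (H w H1))].
      destruct (gval_surj z) as [z0 ->]; apply gmem_prod.
      set (A := fun w => exists s p, w = op s p /\ forces_mem P L s z0 p).
      assert (HA : D1 A) by (unfold A; dd).
      exists (sep (prod (tc t) P) A); split; [apply powE; intros w Hw; apply sepE in Hw; tauto|].
      apply gval_eq, ext_eqE; split.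
      * intros s p Hs Hp; assert (K : gmem (gval s) (gval t)) by (apply H, gmem_val; eauto).
        apply gmem_val in K; destruct K as (s' & q & Hs' & Gq & E).
        assert (K : gmem (gval s) (gval z0)) by (apply gmem_val; eauto).
        rewrite E in K; apply gtruth_mem in K; destruct K as (p' & Gp' & K).
        exists s', p'; rewrite gval_eq in E; split; [|auto].
        apply in_nameE, sepE; [exact HA|]; split; [|exists s', p'; auto].
        apply prod_op; split; [exact (in_name_tc' _ _ _ Hs')|exact (generic_sub _ _ _ HG _ Gp')].
      * intros s p Hs Hp; apply in_nameE, sepE in Hs; [|exact HA].
        destruct Hs as [_ (s' & p' & Eq & K)]; apply op_inj in Eq; destruct Eq; subst s' p'.
        assert (Q : gmem (gval s) (gval z0)) by (apply gtruth_mem; eauto).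
        apply gmem_val in Q; destruct Q as (s' & q & Hs' & Gq & E); exists s', q.
        symmetry in E; rewrite gval_eq in E; auto.
  - destruct (zf_infinity V) as (a & (e & He & Ee) & Hs).
    assert (CE : forall x z, gmem z (gval (chk P x)) <-> exists y, mem y x /\ z = gval (chk P y)).
    { intros x z; rewrite gmem_val; split.
      - intros (s & p & H & _ & ->); apply in_nameE, chkE in H; destruct H as (y & q & Hy & _ & E).
        apply op_inj in E; destruct E; subst; eauto.
      - intros (y & Hy & ->); destruct (generic_nonempty _ _ _ HG) as [p Hp].
        exists (chk P y), p; split; [|auto]; apply in_nameE, chkE; exists y, p.
        split; [exact Hy|split; [exact (generic_sub _ _ _ HG p Hp)|reflexivity]]. }
    exists (gval (chk P a)); split.
    + exists (gval (chk P e)); split; [apply CE; eauto|]; intros z Hz; apply CE in Hz.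
      destruct Hz as (y & Hy & _); exact (Ee y Hy).
    + intros x Hx; apply CE in Hx; destruct Hx as (x0 & Hx0 & ->).
      destruct (Hs x0 Hx0) as (y & Hy & Ey); exists (gval (chk P y)); split; [apply CE; eauto|].
      intros z; rewrite !CE; split.
      * intros (w & Hw & ->); apply Ey in Hw; destruct Hw as [Hw| ->]; eauto.
      * intros [(w & Hw & ->)| ->]; [exists w|exists x0]; rewrite Ey; auto.
Defined.
End Generic.
End Truth.

(** * Countable elementary submodels *)

Definition countable (X : Type) : Prop := exists f : nat -> X, forall x, exists n, f n = x.

(** Here [k] bounds the depth of the decoding, and the pair of [k] and [n] is what codes a
    formula. *)
Fixpoint dec_fol (k n : nat) : fol :=
  match k with
  | 0 => vMem 0 0
  | S k => let (a, b) := of_nat n in let (i, j) := of_nat b in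
    match a with
    | 0 => vMem i j | 1 => vEq i j | 2 => vNot (dec_fol k b)
    | 3 => vAnd (dec_fol k i) (dec_fol k j) | _ => vAll (dec_fol k b)
    end
  end.
Lemma dec_fol_surj phi : exists k0, forall k, k0 <= k -> exists n, dec_fol k n = phi.
Proof.
  induction phi as [i j|i j|a [ka IH]|a [ka IHa] b [kb IHb]|a [ka IH]].
  - exists 1; intros [|k] Hk; [lia|]; exists (to_nat (0, to_nat (i, j))).
    cbn [dec_fol]; rewrite !cancel_of_to; reflexivity.
  - exists 1; intros [|k] Hk; [lia|]; exists (to_nat (1, to_nat (i, j))).
    cbn [dec_fol]; rewrite !cancel_of_to; reflexivity.
  - exists (S ka); intros [|k] Hk; [lia|]; destruct (IH k ltac:(lia)) as [n E].
    exists (to_nat (2, n)); cbn [dec_fol]; rewrite !cancel_of_to, E; destruct (of_nat n); reflexivity.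
  - exists (S (ka + kb)); intros [|k] Hk; [lia|].
    destruct (IHa k ltac:(lia)) as [n E], (IHb k ltac:(lia)) as [m F].
    exists (to_nat (3, to_nat (n, m))); cbn [dec_fol]; rewrite !cancel_of_to, E, F; reflexivity.
  - exists (S ka); intros [|k] Hk; [lia|]; destruct (IH k ltac:(lia)) as [n E].
    exists (to_nat (4, n)); cbn [dec_fol]; rewrite !cancel_of_to, E; destruct (of_nat n); reflexivity.
Qed.
Fixpoint dec_list (k n : nat) : list nat :=
  match k with
  | 0 => nil
  | S k => let (a, b) := of_nat n in cons a (dec_list k b)
  end.
Lemma dec_list_surj l : exists n, dec_list (length l) n = l.
Proof.
  induction l as [|a l [n IH]]; [exists 0; reflexivity|].
  exists (to_nat (a, n)); cbn [dec_list length]; rewrite cancel_of_to, IH; reflexivity.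
Qed.

Lemma fol_sat_bound phi : exists N, forall X (m : X -> X -> Prop) e e',
  (forall n, n < N -> e n = e' n) -> (fol_sat m e phi <-> fol_sat m e' phi).
Proof.
  induction phi as [i j|i j|a [N IH]|a [N IHa] b [M IHb]|a [N IH]]; cbn [fol_sat].
  - exists (S (i + j)); intros X m e e' H; rewrite !H by lia; tauto.
  - exists (S (i + j)); intros X m e e' H; rewrite !H by lia; tauto.
  - exists N; intros X m e e' H; rewrite (IH X m e e' H); tauto.
  - exists (N + M); intros X m e e' H.
    rewrite (IHa X m e e'), (IHb X m e e') by (intros; apply H; lia); tauto.
  - exists N; intros X m e e' H.
    assert (E : forall x n, n < N -> scons x e n = scons x e' n)
      by (intros x [|n] Hn; [reflexivity|apply H; lia]).
    split; intros K x; [apply (IH X m _ _ (E x))|apply (IH X m _ _ (fun n Hn => eq_sym (E x n Hn)))];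
      apply K.
Qed.

Section Hull.
Context {V : zfc_model} (par : nat -> V).
Let env (l : list V) (n : nat) : V := List.nth n l (par 0).
Definition skolem phi (l : list V) : V := the (fun x => fol_sat mem (scons x (env l)) phi).
Fixpoint hull_el (k n : nat) : V :=
  match k with
  | 0 => par n
  | S k => let (a, b) := of_nat n in let (a1, a2) := of_nat a in let (b1, b2) := of_nat b in
      skolem (dec_fol a1 a2) (List.map (hull_el k) (dec_list b1 b2))
  end.
Lemma hull_skolem k phi (l : list nat) :
  exists n, hull_el (S k) n = skolem phi (List.map (hull_el k) l).
Proof.
  destruct (dec_fol_surj phi) as [k0 H]; destruct (H k0 (le_n _)) as [n E].
  destruct (dec_list_surj l) as [m F].
  exists (to_nat (to_nat (k0, n), to_nat (length l, m))).
  cbn [hull_el]; rewrite !cancel_of_to, E, F; reflexivity.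
Qed.
(** The Skolem function of the formula [x = y] returns its parameter, so each generation contains
    the previous one. *)
Lemma hull_raise k n : exists n', hull_el (S k) n' = hull_el k n.
Proof.
  destruct (hull_skolem k (vEq 0 1) (cons n nil)) as [n' E]; exists n'; rewrite E.
  apply the_unique; [reflexivity|]; intros y Hy; exact Hy.
Qed.
Lemma hull_raise_le j k n : j <= k -> exists n', hull_el k n' = hull_el j n.
Proof.
  induction 1 as [|k _ [n' IH]]; [eauto|].
  destruct (hull_raise k n') as [n'' E]; exists n''; congruence.
Qed.
Definition in_hull (x : V) : Prop := exists k n, hull_el k n = x.
Lemma in_hull_skolem phi l : List.Forall in_hull l -> in_hull (skolem phi l).
Proof.
  intros H.
  assert (K : exists k l', List.map (hull_el k) l' = l).
  { induction H as [|x l (j & n & Ex) _ (k & l' & E)]; [exists 0, nil; reflexivity|].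
    destruct (hull_raise_le j (j + k) n ltac:(lia)) as [n' En'].
    assert (K : exists l'', List.map (hull_el (j + k)) l'' = List.map (hull_el k) l').
    { clear E; induction l' as [|a l' [l'' IH]]; [exists nil; reflexivity|].
      destruct (hull_raise_le k (j + k) a ltac:(lia)) as [a' Ea]; exists (cons a' l''); simpl; congruence. }
    destruct K as [l'' E'']; exists (j + k), (cons n' l''); simpl; congruence. }
  destruct K as (k & l' & <-); destruct (hull_skolem k phi l') as [n E]; exists (S k), n; exact E.
Qed.

Definition hull : Type := {x : V | in_hull x}.
Definition hmem (x y : hull) : Prop := mem (proj1_sig x) (proj1_sig y).
Lemma hull_eq (x y : hull) : x = y <-> proj1_sig x = proj1_sig y.
Proof.
  split; [intros ->; reflexivity|]; intros E; apply eq_sig_hprop; [|exact E].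
  intros; apply proof_irrelevance.
Qed.
(** The Tarski-Vaught argument: if a universal statement fails, a Skolem function returns a
    counterexample inside the hull. Only finitely many variables matter, so a list of parameters is
    enough. *)
Lemma hull_elem phi : forall e : nat -> hull,
  fol_sat hmem e phi <-> fol_sat mem (fun n => proj1_sig (e n)) phi.
Proof.
  induction phi as [i j|i j|a IH|a IHa b IHb|a IH]; intros e; cbn [fol_sat].
  - reflexivity.
  - apply hull_eq.
  - rewrite IH; tauto.
  - rewrite IHa, IHb; tauto.
  - assert (E : forall x, (fun n => proj1_sig (scons x e n)) = scons (proj1_sig x) (fun n => proj1_sig (e n)))
      by (intros x; apply functional_extensionality; intros [|n]; reflexivity).
    split; [|intros H x; apply IH; rewrite E; apply H].
    intros H; apply NNPP; intros N; apply not_all_ex_not in N; destruct N as [x N].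
    destruct (fol_sat_bound a) as [B HB].
    set (l := List.map (fun n => proj1_sig (e n)) (List.seq 0 B)).
    assert (El : forall x n, n < S B -> scons x (fun n => proj1_sig (e n)) n = scons x (env l) n).
    { intros y [|n] Hn; [reflexivity|]; simpl; unfold env, l.
      assert (Hn' : n < B) by lia.
      rewrite List.nth_indep with (d' := proj1_sig (e 0)) by (rewrite List.length_map, List.length_seq; exact Hn').
      rewrite List.map_nth with (f := fun n => proj1_sig (e n)), List.seq_nth by exact Hn'; reflexivity. }
    assert (Hl : in_hull (skolem (vNot a) l)).
    { apply in_hull_skolem; unfold l; apply List.Forall_forall; intros y Hy.
      apply List.in_map_iff in Hy; destruct Hy as (n & <- & _); exact (proj2_sig (e n)). }
    assert (K : fol_sat mem (scons (skolem (vNot a) l) (env l)) (vNot a)).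
    { refine (the_spec (fun x => fol_sat mem (scons x (env l)) (vNot a)) _); exists x; intros Q; apply N.
      apply (HB V mem _ _ (fun n Hn => El x n (Nat.lt_lt_succ_r _ _ Hn))); exact Q. }
    apply K. specialize (H (exist _ _ Hl)); apply IH in H; rewrite E in H; simpl in H.
    apply (HB V mem _ _ (fun n Hn => El _ n (Nat.lt_lt_succ_r _ _ Hn))); exact H.
Qed.
Lemma hull_sat (a : forall X : Type, (nat -> X) -> form X) (e : nat -> hull) : reified a ->
  (sat hmem eq (a hull e) <-> V ⊨ a V (fun n => proj1_sig (e n))).
Proof. intros [phi H]; rewrite !H, !sat_emb; apply hull_elem. Qed.
Lemma emb_ren {X} phi : forall f (e : nat -> X), emb (ren f phi) e = emb phi (fun n => e (f n)).
Proof.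
  induction phi as [i j|i j|a IH|a IHa b IHb|a IH]; intros f e; simpl.
  - reflexivity.
  - reflexivity.
  - rewrite IH; reflexivity.
  - rewrite IHa, IHb; reflexivity.
  - f_equal; apply functional_extensionality; intros x; rewrite IH; f_equal.
    apply functional_extensionality; intros [|n]; reflexivity.
Qed.
Lemma rf_emb phi f (g : forall X : Type, (nat -> X) -> nat -> X) :
  (forall X e n, g X e n = e (f n)) -> reified (fun (X : Type) e => emb phi (g X e)).
Proof.
  intros H; exists (ren f phi); intros X e; rewrite emb_ren; f_equal.
  apply functional_extensionality; intros n; apply H.
Qed.

(** The hull need not be transitive, but the notion of model asks only for a well-founded
    extensional structure. Extensionality, like the other axioms, is transferred by elementarity. *)
Definition hull_model : zfc_model.
Proof.
  refine {| carrier := hull; mem := hmem |}.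
  - apply (wf_inverse_image _ _ mem (@proj1_sig V in_hull)), mem_wf.
  - intros x y H.
    refine (proj1 (c_imp hmem eq (fAll (fun z => fIff (fMem z x) (fMem z y))) (fEq x y)
      (forall z, hmem z x <-> hmem z y) (x = y) _ _) _ H); try solve [st].
    refine (proj2 (hull_sat (fun X e => fImp (fAll (fun z => fIff (fMem z (e 0)) (fMem z (e 1)))) (fEq (e 0) (e 1)))
      (scons x (fun _ => y)) _) _); [rf|].
    refine (proj2 (c_imp _ _ _ _ (forall z, mem z (proj1_sig x) <-> mem z (proj1_sig y)) (proj1_sig x = proj1_sig y) _ _) _);
      try solve [st].
    apply zf_ext.
  - intros x y.
    refine (proj1 (c_ex hmem eq (fun a => fAll (fun z => fIff (fMem z a) (fOr (fEq z x) (fEq z y)))) _ _) _);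
      [intros a; st|].
    refine (proj2 (hull_sat (fun X e => fEx (fun a => fAll (fun z => fIff (fMem z a) (fOr (fEq z (e 0)) (fEq z (e 1))))))
      (scons x (fun _ => y)) _) _); [rf|].
    refine (proj2 (c_ex _ _ _ (fun a => forall z, mem z a <-> z = proj1_sig x \/ z = proj1_sig y) _) _); [intros a; st|].
    apply zf_pair.
  - intros x.
    refine (proj1 (c_ex hmem eq (fun a => fAll (fun z => fIff (fMem z a) (fEx (fun y => fAnd (fMem y x) (fMem z y))))) _ _) _);
      [intros a; st|].
    refine (proj2 (hull_sat (fun X e => fEx (fun a => fAll (fun z => fIff (fMem z a) (fEx (fun y => fAnd (fMem y (e 0)) (fMem z y))))))
      (fun _ => x) _) _); [rf|].
    refine (proj2 (c_ex _ _ _ (fun a => forall z, mem z a <-> exists y, mem y (proj1_sig x) /\ mem z y) _) _); [intros a; st|].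
    apply zf_union.
  - intros x.
    refine (proj1 (c_ex hmem eq (fun a => fAll (fun z => fIff (fMem z a) (fAll (fun w => fImp (fMem w z) (fMem w x))))) _ _) _);
      [intros a; st|].
    refine (proj2 (hull_sat (fun X e => fEx (fun a => fAll (fun z => fIff (fMem z a) (fAll (fun w => fImp (fMem w z) (fMem w (e 0)))))))
      (fun _ => x) _) _); [rf|].
    refine (proj2 (c_ex _ _ _ (fun a => forall z, mem z a <-> forall w, mem w z -> mem w (proj1_sig x)) _) _); [intros a; st|].
    apply zf_power.
  - set (inf := fun (X : Type) (a : X) => fAnd (fEx (fun x => fAnd (fMem x a) (fAll (fun z => fNot (fMem z x)))))
       (fAll (fun x => fImp (fMem x a) (fEx (fun y => fAnd (fMem y a) (fAll (fun z => fIff (fMem z y) (fOr (fMem z x) (fEq z x))))))))).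
    refine (proj1 (c_ex hmem eq (inf hull) _ _) _); [intros a; unfold inf; st|].
    refine (proj2 (hull_sat (fun X e => fEx (inf X)) (fun _ => exist _ (par 0) (ex_intro _ 0 (ex_intro _ 0 eq_refl))) _) _);
      [rf|].
    refine (proj2 (c_ex _ _ _ (fun a => (exists x, mem x a /\ forall z, ~ mem z x) /\
      (forall x, mem x a -> exists y, mem y a /\ forall z, mem z y <-> mem z x \/ z = x)) _) _); [intros a; unfold inf; st|].
    apply zf_infinity.
  - intros phi e x.
    refine (proj1 (c_ex hmem eq (fun a => fAll (fun z => fIff (fMem z a) (fAnd (fMem z x) (emb phi (scons z e))))) _ _) _);
      [intros a; st; apply sat_emb|].
    refine (proj2 (hull_sat (fun X e => fEx (fun a => fAll (fun z => fIff (fMem z a) (fAnd (fMem z (e 0))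
       (emb phi (scons z (fun n => e (S n)))))))) (scons x e) _) _).
    { unfold fEx, fIff, fImp; repeat rf_step;
        apply (rf_emb phi (fun n => match n with 0 => 0 | S m => S (S (S m)) end)); intros X e' [|n]; reflexivity. }
    refine (proj2 (c_ex _ _ _ (fun a => forall z, mem z a <-> mem z (proj1_sig x) /\ fol_sat mem (scons z (fun n => proj1_sig (e n))) phi) _) _);
      [intros a; st; apply sat_emb|].
    apply zf_separation.
  - intros phi e x.
    set (frm := fun (X : Type) (e : nat -> X) =>
      fImp (fAll (fun u => fAll (fun v => fAll (fun w => fImp (fMem u (e 0)) (fImp (emb phi (scons u (scons v (fun n => e (S n)))))
             (fImp (emb phi (scons u (scons w (fun n => e (S n))))) (fEq v w)))))))
        (fEx (fun a => fAll (fun v => fIff (fMem v a) (fEx (fun u => fAnd (fMem u (e 0)) (emb phi (scons u (scons v (fun n => e (S n))))))))))).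
    assert (Rf : @reified Type (fun X => X) frm).
    { unfold frm, fEx, fIff, fImp; repeat rf_step.
      - apply (rf_emb phi (fun n => match n with 0 => 2 | 1 => 1 | S (S m) => 4 + m end)); intros X e' [|[|n]]; reflexivity.
      - apply (rf_emb phi (fun n => match n with 0 => 2 | 1 => 0 | S (S m) => 4 + m end)); intros X e' [|[|n]]; reflexivity.
      - apply (rf_emb phi (fun n => match n with 0 => 0 | 1 => 1 | S (S m) => 4 + m end)); intros X e' [|[|n]]; reflexivity.
      - apply (rf_emb phi (fun n => match n with 0 => 0 | 1 => 1 | S (S m) => 4 + m end)); intros X e' [|[|n]]; reflexivity. }
    pose proof (proj2 (hull_sat frm (scons x e) Rf)) as K.
    assert (KV : V ⊨ frm V (fun n => proj1_sig (scons x e n))).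
    { refine (proj2 (c_imp _ _ _ _ _ _ _ _) (zf_replacement V phi (fun n => proj1_sig (e n)) (proj1_sig x)));
        st; apply sat_emb. }
    specialize (K KV); revert K.
    refine (proj1 (c_imp _ _ _ _ _ _ _ _)); st; apply sat_emb.
  - intros x.
    set (frm := fun (X : Type) (e : nat -> X) =>
      fImp (fAll (fun y => fImp (fMem y (e 0)) (fEx (fun z => fMem z y))))
        (fImp (fAll (fun y => fAll (fun y' => fAll (fun z => fImp (fMem y (e 0)) (fImp (fMem y' (e 0)) (fImp (fMem z y) (fImp (fMem z y') (fEq y y'))))))))
          (fEx (fun c => fAll (fun y => fImp (fMem y (e 0)) (fEx (fun z => fAnd (fAnd (fMem z y) (fMem z c))
             (fAll (fun z' => fImp (fAnd (fMem z' y) (fMem z' c)) (fEq z z')))))))))).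
    assert (Rf : @reified Type (fun X => X) frm) by rf.
    pose proof (proj2 (hull_sat frm (fun _ => x) Rf)) as K.
    assert (KV : V ⊨ frm V (fun n => proj1_sig x)).
    { refine (proj2 (c_imp _ _ _ _ _ _ _ _) (zf_choice V (proj1_sig x))); st. }
    specialize (K KV); revert K.
    refine (proj1 (c_imp _ _ _ _ _ _ _ _)); st.
Defined.
Lemma hull_countable : countable hull_model.
Proof.
  exists (fun n => let (k, m) := of_nat n in
    exist in_hull (hull_el k m) (ex_intro _ k (ex_intro _ m eq_refl)) : hull_model).
  intros [x (k & m & E)]; exists (to_nat (k, m)); rewrite cancel_of_to; apply hull_eq; exact E.
Qed.
End Hull.

(** The hull is generated by the parameters [e] themselves, so the same formula can be read in it
    with the same parameters. *)
Lemma reflect_countable (A : forall V : zfc_model, (nat -> V) -> Prop) : UD A ->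
  (forall V : zfc_model, countable V -> forall e, ~ A V e) -> forall V e, ~ A V e.
Proof.
  intros [phi H] K V e HA.
  apply (K (hull_model e) (hull_countable e)
    (fun n => exist _ (e n) (ex_intro _ 0 (ex_intro _ n eq_refl)))).
  apply H; apply (hull_elem e phi); apply H; exact HA.
Qed.

Section Countable.
Context {V : zfc_model} (HV : countable V) (P L : V) (HP : preord P L).
(** Rasiowa-Sikorski: [f] enumerates all sets of the model, dense or not, and step [n] enters the
    [n]-th one whenever it has an element below the current condition. *)
Lemma generic_exists p : mem p P -> exists G, generic P L G /\ G p.
Proof.
  intros Hp; destruct HV as [f Hf].
  set (next := fun n q => epsilon V_inh (fun r => ple P L r q /\
    ((exists r', mem r' (f n) /\ ple P L r' q) -> mem r (f n)))).
  set (seq := fix seq n := match n with 0 => p | S n => next n (seq n) end).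
  assert (N : forall n q, mem q P -> ple P L (next n q) q /\
     ((exists r', mem r' (f n) /\ ple P L r' q) -> mem (next n q) (f n))).
  { intros n q Hq; unfold next; apply epsilon_spec.
    destruct (classic (exists r', mem r' (f n) /\ ple P L r' q)) as [(r & K1 & K2)|K].
    - exists r; auto.
    - exists q; split; [apply HP, Hq|tauto]. }
  assert (S1 : forall n, mem (seq n) P).
  { intros n; induction n as [|n IH]; [exact Hp|]; exact (proj1 (proj1 (N n _ IH))). }
  assert (S2 : forall n m, n <= m -> ple P L (seq m) (seq n)).
  { intros n m Hm; induction Hm as [|m _ IH]; [apply HP, S1|].
    exact (proj2 HP _ _ _ (proj1 (N m _ (S1 m))) IH). }
  exists (fun q => exists n, ple P L (seq n) q); split; [|exists 0; apply HP, Hp].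
  constructor.
  - intros q [n Hn]; apply Hn.
  - exists p, 0; apply HP, Hp.
  - intros q r [n Hn] Hqr; exists n; exact (proj2 HP _ _ _ Hn Hqr).
  - intros q r [n Hn] [m Hm]; exists (seq (n + m)).
    split; [exists (n + m); apply HP, S1|].
    split; [apply (proj2 HP _ (seq n))|apply (proj2 HP _ (seq m))]; try assumption; apply S2; lia.
  - intros E H1 H2; destruct (Hf E) as [n <-].
    exists (seq (S n)); split; [exists (S n); apply HP, S1|].
    simpl; apply N; [apply S1|]; destruct (H2 (seq n) (S1 n)) as (q & ? & ?); eauto.
Qed.
End Countable.

Section Semantics.
Context {V : zfc_model} (P L : V) (HP : preord P L).
Lemma gext_sat (a : forall V : zfc_model, (nat -> V) -> form V) G (HG : generic P L G) e : reified a ->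
  (gext P L HP G HG ⊨ a (gext P L HP G HG) (fun n => gval G (e n))) <-> ext_sat G (a V e).
Proof.
  intros [phi H]; rewrite H, (H V e).
  rewrite <- (gsat G phi e); apply (@sat_emb (gcar G)).
Qed.
Lemma gext_truth (a : forall V : zfc_model, (nat -> V) -> form V) G (HG : generic P L G) e : reified a ->
  (gext P L HP G HG ⊨ a (gext P L HP G HG) (fun n => gval G (e n))) <-> exists p, G p /\ forces P L p (a V e).
Proof.
  intros R; rewrite gext_sat by exact R; destruct R as [phi H]; rewrite H; symmetry; apply truth; assumption.
Qed.
(** If [p] did not force the formula, some condition below would force its negation, and
    countability supplies a generic filter through that one. Facts about names can thus be proved
    inside extensions instead of through the forcing clauses. *)
Lemma forces_sem (HV : countable V) (a : forall V : zfc_model, (nat -> V) -> form V) p e : reified a -> mem p P ->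
  (forces P L p (a V e) <-> forall G (HG : generic P L G), G p ->
     gext P L HP G HG ⊨ a (gext P L HP G HG) (fun n => gval G (e n))).
Proof.
  intros R Hp; split.
  - intros K G HG Gp; apply gext_truth; eauto.
  - intros H; apply forces_dense; [exact HP|]; intros q Hq.
    destruct (forces_decide P L HP (a V e) q (proj1 Hq)) as (r & Hr & [K|K]); [eauto|exfalso].
    destruct (generic_exists HV P L HP r (proj1 Hr)) as (G & HG & Gr).
    assert (Gp : G p).
    { apply (generic_up _ _ _ HG r); [exact Gr|exact (proj2 HP _ _ _ Hr Hq)]. }
    specialize (H G HG Gp); apply gext_truth in H; [|exact R]; destruct H as (s & Gs & Ks).
    destruct (generic_dir _ _ _ HG r s Gr Gs) as (u & _ & H1 & H2).
    exact (K u H1 (forces_mono P L HP _ _ _ H2 Ks)).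
Qed.
End Semantics.

(** * Values of names *)

Lemma lim_not_suc {V : zfc_model} (x y : V) : lim x -> x <> suc y.
Proof.
  intros (O & _ & H) ->; destruct (H y (mem_suc y)) as (z & Hz & K).
  apply sucE in Hz; destruct Hz as [Hz| ->]; [exact (mem_asym _ _ K Hz)|exact (mem_irr _ K)].
Qed.
Lemma ord_cases {V : zfc_model} (x : V) : ord x -> x = emp \/ lim x \/ exists y, ord y /\ x = suc y.
Proof.
  intros O; destruct (classic (x = emp)) as [|N]; [auto|right].
  destruct (classic (forall y, mem y x -> exists z, mem z x /\ mem y z)) as [K|K];
    [left; split; auto|right].
  apply not_all_ex_not in K; destruct K as [y K]; apply imply_to_and in K; destruct K as [Hy K].
  assert (Oy := ord_mem _ _ O Hy); exists y; split; [exact Oy|].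
  apply zf_ext; intros z; rewrite sucE; split.
  - intros Hz; destruct (ord_total z (ord_mem _ _ O Hz) y Oy) as [Q|[Q|Q]]; auto.
    destruct K; eauto.
  - intros [Hz| ->]; [exact (ord_trans _ _ _ O Hz Hy)|exact Hy].
Qed.

Section Values.
Context {V : zfc_model} (P L : V) (HP : preord P L).
Implicit Types (p q r s t u x y z : V).

Definition upn s t : V := prod (up s t) P.
Definition opn s t : V := upn (upn s s) (upn s t).
Lemma F2_upn : F2 upn. Proof. unfold upn; dd. Qed.
Hint Resolve F2_upn : dfn.
Lemma F2_opn : F2 opn. Proof. unfold opn; dd. Qed.
Hint Resolve F2_opn : dfn.
(** A name for the sequence of length [b] whose term at [x] is the value of the name [F x]. *)
Definition seqn (b : V) (F : V -> V) : V := prod (img b (fun x => opn (chk P x) (F x))) P.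

Section OneGeneric.
Context {G : V -> Prop} (HG : generic P L G).
Local Notation M := (gext P L HP G HG).
Definition gv (t : V) : M := gval G t.
Definition gj (x : V) : M := gv (chk P x).

Lemma gv_surj (x : M) : exists t, x = gv t. Proof. exact (gval_surj G x). Qed.
Lemma gv_mem (x : M) t : mem x (gv t) <-> exists s p, mem (op s p) t /\ G p /\ x = gv s.
Proof.
  refine (iff_trans (gmem_val G x t) _).
  split; intros (s & p & H & K); exists s, p; rewrite in_nameE in *; auto.
Qed.
Lemma gv_prod X (x : M) : mem x (gv (prod X P)) <-> exists s, mem s X /\ x = gv s.
Proof. exact (gmem_prod P L G HG X x). Qed.
Lemma gj_mem x (y : M) : mem y (gj x) <-> exists x', mem x' x /\ y = gj x'.
Proof.
  unfold gj; rewrite gv_mem; split.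
  - intros (s & p & H & _ & ->); apply chkE in H; destruct H as (x' & q & Hx & _ & E).
    apply op_inj in E; destruct E; subst; eauto.
  - intros (x' & Hx & ->); destruct (generic_nonempty _ _ _ HG) as [p Gp].
    exists (chk P x'), p; split; [|auto]; apply chkE; exists x', p.
    split; [exact Hx|split; [exact (generic_sub _ _ _ HG p Gp)|reflexivity]].
Qed.
Lemma gj_inj x : forall y, gj x = gj y -> x = y.
Proof.
  induction x as [x IH] using mem_ind; intros y E; apply zf_ext; intros z; split; intros Hz.
  - assert (K : mem (gj z) (gj y)) by (rewrite <- E; apply gj_mem; eauto).
    apply gj_mem in K; destruct K as (w & Hw & K); rewrite (IH z Hz w K); exact Hw.
  - assert (K : mem (gj z) (gj x)) by (rewrite E; apply gj_mem; eauto).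
    apply gj_mem in K; destruct K as (w & Hw & K); rewrite <- (IH w Hw z); auto.
Qed.
Lemma gj_mem_iff x y : mem (gj x) (gj y) <-> mem x y.
Proof.
  rewrite gj_mem; split; [|eauto]; intros (z & Hz & E); apply gj_inj in E; subst; exact Hz.
Qed.
Lemma gj_emp : gj emp = emp.
Proof. apply emp_unique; intros z Hz; apply gj_mem in Hz; destruct Hz as (y & Hy & _); exact (empE _ Hy). Qed.
Lemma gj_suc x : gj (suc x) = suc (gj x).
Proof.
  apply zf_ext; intros z; rewrite gj_mem, sucE, gj_mem; split.
  - intros (y & Hy & ->); apply sucE in Hy; destruct Hy as [Hy| ->]; eauto.
  - intros [(y & Hy & ->)| ->]; [exists y|exists x]; rewrite sucE; auto.
Qed.
Lemma gj_trans x : trans x -> trans (gj x).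
Proof.
  intros T y Hy z Hz; apply gj_mem in Hy; destruct Hy as (y' & Hy & ->).
  apply gj_mem in Hz; destruct Hz as (z' & Hz & ->); apply gj_mem; exists z'.
  split; [exact (T y' Hy z' Hz)|reflexivity].
Qed.
Lemma gj_ord x : ord x -> ord (gj x).
Proof.
  intros [T H]; split; [apply gj_trans, T|]; intros y Hy; apply gj_mem in Hy.
  destruct Hy as (y' & Hy & ->); apply gj_trans, H, Hy.
Qed.
Lemma gj_lim x : ord x -> (lim (gj x) <-> lim x).
Proof.
  intros O; split.
  - intros (_ & N & H); split; [exact O|split].
    + intros ->; exact (N gj_emp).
    + intros y Hy; destruct (H (gj y)) as (z & Hz & K); [apply gj_mem_iff, Hy|].
      apply gj_mem in Hz; destruct Hz as (z' & Hz & ->); exists z'; rewrite gj_mem_iff in K; auto.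
  - intros (_ & N & H); split; [apply gj_ord, O|split].
    + intros E; apply N, gj_inj; rewrite gj_emp; exact E.
    + intros y Hy; apply gj_mem in Hy; destruct Hy as (y' & Hy & ->).
      destruct (H y' Hy) as (z & Hz & K); exists (gj z); rewrite !gj_mem_iff; auto.
Qed.
Lemma gj_omega x : omega x -> omega (gj x).
Proof.
  intros [Lx H]; assert (O := proj1 Lx); split; [apply gj_lim; assumption|].
  intros y Hy K; apply gj_mem in Hy; destruct Hy as (y' & Hy & ->).
  apply (H y' Hy); apply gj_lim; [exact (ord_mem _ _ O Hy)|exact K].
Qed.
Lemma gj_stages t d : ord d -> stages t d -> stages (gj t) (gj d).
Proof.
  intros Od [I H]; split.
  - intros x Hx; apply gj_mem in Hx; destruct Hx as (y & Hy & ->); apply gj_mem_iff, I, Hy.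
  - intros x Hx; apply gj_mem in Hx; destruct Hx as (z & Hz & ->); destruct (H z Hz) as (A & B & C).
    rewrite gj_mem_iff; split; [|split].
    + rewrite <- gj_emp; intros E; apply gj_inj in E; auto.
    + intros K; apply gj_lim in K; [auto|exact (ord_mem _ _ Od Hz)].
    + intros y Hy E; apply gj_mem in Hy; destruct Hy as (w & Hw & ->); rewrite !gj_mem_iff.
      apply C; [exact Hw|]; rewrite <- gj_suc in E; exact (gj_inj _ _ E).
Qed.
Lemma gv_upn s t : gv (upn s t) = up (gv s) (gv t).
Proof.
  apply zf_ext; intros z; unfold upn; rewrite gv_prod, upE; split.
  - intros (a & Ha & ->); apply upE in Ha; destruct Ha; subst; auto.
  - intros [->| ->]; [exists s|exists t]; rewrite upE; auto.
Qed.
Lemma gv_opn s t : gv (opn s t) = op (gv s) (gv t).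
Proof. unfold opn; rewrite !gv_upn; reflexivity. Qed.
Lemma gv_seqn b F (z : M) : F1 F ->
  (mem z (gv (seqn b F)) <-> exists x, mem x b /\ z = op (gj x) (gv (F x))).
Proof.
  intros HF; unfold seqn; rewrite gv_prod; split.
  - intros (s & Hs & ->); apply imgE in Hs; [|dd]; destruct Hs as (x & Hx & ->).
    exists x; rewrite gv_opn; auto.
  - intros (x & Hx & ->); exists (opn (chk P x) (F x)); rewrite gv_opn; split; [|reflexivity].
    apply imgE; [dd|eauto].
Qed.
Lemma gen_below' (A : V -> Prop) q : G q -> dense_below P L q A -> D1 A -> exists r, G r /\ A r /\ ple P L r q.
Proof. intros; apply gen_below; assumption. Qed.
End OneGeneric.

Context (HV : countable V).
Lemma fo1 (a : forall W : zfc_model, W -> form W) p x :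
  reified (fun W e => a W (e 0)) -> mem p P ->
  (forces P L p (a V x) <-> forall G (HG : generic P L G), G p -> gext P L HP G HG ⊨ a _ (gv HG x)).
Proof. intros R Hp; exact (forces_sem P L HP HV (fun W e => a W (e 0)) p (fun _ => x) R Hp). Qed.
Lemma fo2 (a : forall W : zfc_model, W -> W -> form W) p x y :
  reified (fun W e => a W (e 0) (e 1)) -> mem p P ->
  (forces P L p (a V x y) <-> forall G (HG : generic P L G), G p ->
     gext P L HP G HG ⊨ a _ (gv HG x) (gv HG y)).
Proof.
  intros R Hp; exact (forces_sem P L HP HV (fun W e => a W (e 0) (e 1)) p (scons x (fun _ => y)) R Hp).
Qed.
Lemma fo3 (a : forall W : zfc_model, W -> W -> W -> form W) p x y z :
  reified (fun W e => a W (e 0) (e 1) (e 2)) -> mem p P ->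
  (forces P L p (a V x y z) <-> forall G (HG : generic P L G), G p ->
     gext P L HP G HG ⊨ a _ (gv HG x) (gv HG y) (gv HG z)).
Proof.
  intros R Hp; exact (forces_sem P L HP HV (fun W e => a W (e 0) (e 1) (e 2)) p
    (scons x (scons y (fun _ => z))) R Hp).
Qed.
Lemma fo4 (a : forall W : zfc_model, W -> W -> W -> W -> form W) p x y z w :
  reified (fun W e => a W (e 0) (e 1) (e 2) (e 3)) -> mem p P ->
  (forces P L p (a V x y z w) <-> forall G (HG : generic P L G), G p ->
     gext P L HP G HG ⊨ a _ (gv HG x) (gv HG y) (gv HG z) (gv HG w)).
Proof.
  intros R Hp; exact (forces_sem P L HP HV (fun W e => a W (e 0) (e 1) (e 2) (e 3)) p
    (scons x (scons y (scons z (fun _ => w)))) R Hp).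
Qed.
Lemma fo5 (a : forall W : zfc_model, W -> W -> W -> W -> W -> form W) p x y z w v :
  reified (fun W e => a W (e 0) (e 1) (e 2) (e 3) (e 4)) -> mem p P ->
  (forces P L p (a V x y z w v) <-> forall G (HG : generic P L G), G p ->
     gext P L HP G HG ⊨ a _ (gv HG x) (gv HG y) (gv HG z) (gv HG w) (gv HG v)).
Proof.
  intros R Hp; exact (forces_sem P L HP HV (fun W e => a W (e 0) (e 1) (e 2) (e 3) (e 4)) p
    (scons x (scons y (scons z (scons w (fun _ => v))))) R Hp).
Qed.
Lemma fo_mem p s t : mem p P ->
  (forces P L p (fMem s t) <-> forall G (HG : generic P L G), G p -> mem (gv HG s) (gv HG t)).
Proof. apply (fo2 (fun W => fMem)); rf. Qed.
Lemma fo_eq p s t : mem p P ->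
  (forces P L p (fEq s t) <-> forall G (HG : generic P L G), G p -> gv HG s = gv HG t).
Proof. apply (fo2 (fun W => fEq)); rf. Qed.
Lemma fo_emp p t : mem p P ->
  (forces P L p (is_empty t) <-> forall G (HG : generic P L G), G p -> gv HG t = emp).
Proof.
  intros Hp; rewrite (fo1 (fun W => is_empty)); [|rf|exact Hp].
  split; intros H G HG Gp; apply sat_is_empty, H, Gp.
Qed.
Lemma fo_rel p r s t : mem p P ->
  (forces P L p (related r s t) <-> forall G (HG : generic P L G), G p -> mem (op (gv HG s) (gv HG t)) (gv HG r)).
Proof.
  intros Hp; rewrite (fo3 (fun W => related)); [|rf|exact Hp].
  split; intros H G HG Gp; apply sat_related, H, Gp.
Qed.

(* Mixing along a ranking of [P], without a maximal antichain: a condition [e] below [c] and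
   incompatible with all earlier conditions carrying a value gets the value chosen for [c]. *)
Lemma mixing (W : V -> V -> Prop) r : D2 W ->
  (forall c0, ple P L c0 r -> exists c x, ple P L c c0 /\ W c x) ->
  exists u, forall G (HG : generic P L G), G r -> exists c x, G c /\ W c x /\ gv HG u = gv HG x.
Proof.
  intros DW dens.
  set (Wd := sep P (fun c => ple P L c r /\ exists x, W c x)).
  assert (WdE : forall c, mem c Wd <-> ple P L c r /\ exists x, W c x).
  { intros c; unfold Wd; rewrite sepE by dd; split; [tauto|]; intros K; split; [apply K|exact K]. }
  destruct (choose W Wd DW) as (X & HX & KX).
  { intros c Hc; apply WdE in Hc; tauto. }
  destruct (ranking P) as (rho & Hrho & Orho & Irho).
  set (first := fun e c => mem c Wd /\ ple P L e c /\
    forall c', mem c' Wd -> mem (rho c') (rho c) -> forall d, ple P L d e -> ~ ple P L d c').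
  assert (Df : D2 first) by (unfold first; dd).
  (* The elements of the name chosen for [c], with their conditions strengthened to ones at which
     [c] is the selected condition. *)
  set (A := fun z => exists s e c w, z = op s e /\ first e c /\ mem (op s w) (X c) /\ ple P L e w).
  assert (DA : D1 A) by (unfold A; dd).
  set (u := sep (prod (tc (img Wd X)) P) A).
  assert (first_eq : forall G (HG : generic P L G) e e' c c', G e -> G e' -> first e c -> first e' c' -> c = c').
  { intros G HG e e' c c' Ge Ge' (Hc & Hec & F) (Hc' & Hec' & F').
    destruct (generic_dir _ _ _ HG e e' Ge Ge') as (d & _ & Hd & Hd').
    destruct (ord_total (rho c) (Orho c (proj1 (proj2 Hec))) (rho c') (Orho c' (proj1 (proj2 Hec')))) as [K|[K|K]].
    - destruct (F' c Hc K d Hd'); exact (proj2 HP _ _ _ Hd Hec).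
    - apply Irho; [apply Hec|apply Hec'|exact K].
    - destruct (F c' Hc' K d Hd); exact (proj2 HP _ _ _ Hd' Hec'). }
  exists u; intros G HG Gr.
  destruct (gen_below' HG (fun e => exists c, first e c) r Gr) as (e & Ge & (c & Fc) & _); [|dd|].
  { intros c0 Hc0.
    destruct (wf_min (fun a => exists c, mem c Wd /\ a = rho c /\ exists d, ple P L d c /\ ple P L d c0))
      as (a & (c & Hc & -> & d & Hdc & Hdc0) & Ma).
    { destruct (dens c0 Hc0) as (c & x & Hc & Wc); exists (rho c), c; split; [apply WdE; split; [|eauto]|].
      - exact (proj2 HP _ _ _ Hc Hc0).
      - split; [reflexivity|exists c; split; [apply HP, Hc|exact Hc]]. }
    exists d; split; [exact Hdc0|exists c; split; [exact Hc|split; [exact Hdc|]]].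
    intros c' Hc' Hr d' Hd' K; apply (Ma (rho c') Hr); exists c'; split; [exact Hc'|split; [reflexivity|]].
    exists d'; split; [exact K|exact (proj2 HP _ _ _ Hd' Hdc0)]. }
  pose proof Fc as (Hc & Hec & F).
  exists c, (X c); split; [exact (generic_up _ _ _ HG e c Ge Hec)|split; [apply KX, Hc|]].
  apply zf_ext; intros y; rewrite !gv_mem; split.
  - intros (s & e' & Hs & Ge' & ->); apply sepE in Hs; [|exact DA]; destruct Hs as [_ (s' & e1 & c1 & w & E & F1' & Hw & Hew)].
    apply op_inj in E; destruct E; subst s' e1.
    rewrite (first_eq G HG e e' c c1 Ge Ge' Fc F1').
    exists s, w; split; [exact Hw|split; [exact (generic_up _ _ _ HG e' w Ge' Hew)|reflexivity]].
  - intros (s & w & Hs & Gw & ->); destruct (generic_dir _ _ _ HG e w Ge Gw) as (d & Gd & Hd & Hdw).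
    exists s, d; split; [|auto]; apply sepE; [exact DA|split].
    + apply prod_op; split; [|exact (generic_sub _ _ _ HG d Gd)].
      apply (in_name_tc _ s w (X c)); [apply trans_tc| |apply in_nameE, Hs].
      apply tc_incl, imgE; [exact HX|eauto].
    + exists s, d, c, w; split; [reflexivity|split; [|auto]]; split; [exact Hc|split].
      * exact (proj2 HP _ _ _ Hd Hec).
      * intros c' Hc' Hr d' Hd'; apply (F c' Hc' Hr); exact (proj2 HP _ _ _ Hd' Hd).
Qed.

(** A mixed name is arbitrary, whereas a condition of the iteration takes its value from the domain
    of [Q]; fullness supplies an equivalent name there. *)
Lemma mixing_full (W : V -> V -> Prop) Q r : D2 W -> mem r P -> full_name P L Q ->
  (forall c0, ple P L c0 r -> exists c x, ple P L c c0 /\ W c x) ->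
  (forall c x, W c x -> mem c P -> forces P L c (fMem x Q)) ->
  exists s, name_dom P Q s /\ forces P L r (fMem s Q) /\
    forall G (HG : generic P L G), G r -> exists c x, G c /\ W c x /\ gv HG s = gv HG x.
Proof.
  intros DW Hr Hfull dens HQ.
  destruct (mixing W r DW dens) as (u & Hu).
  assert (uQ : forces P L r (fMem u Q)).
  { apply fo_mem; [exact Hr|]; intros G HG Gr; destruct (Hu G HG Gr) as (c & x & Gc & Wc & ->).
    assert (Hc := generic_sub _ _ _ HG c Gc).
    exact (proj1 (fo_mem c x Q Hc) (HQ c x Wc Hc) G HG Gc). }
  destruct (Hfull r u Hr uQ) as (s & Hs & E).
  rewrite fo_eq in E by exact Hr.
  exists s; split; [exact Hs|split].
  - apply fo_mem; [exact Hr|]; intros G HG Gr; rewrite <- (E G HG Gr).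
    exact (proj1 (fo_mem r u Q Hr) uQ G HG Gr).
  - intros G HG Gr; rewrite <- (E G HG Gr); exact (Hu G HG Gr).
Qed.

End Values.

(** * Lottery sums *)

Section Stages.
Context {N : zfc_model}.
Implicit Types x y z t d : N.
(** The clauses decide by recursion who moves at a stage. Strategies for different tickets therefore
    refer to the same set of stages. *)
Lemma stages_unique t t' d : ord d -> stages t d -> stages t' d -> t = t'.
Proof.
  intros Od [I H] [I' H'].
  assert (K : forall x, mem x d -> (mem x t <-> mem x t')).
  { intros x; induction x as [x IH] using mem_ind; intros Hx.
    destruct (H x Hx) as (A1 & A2 & A3), (H' x Hx) as (B1 & B2 & B3).
    destruct (ord_cases x (ord_mem _ _ Od Hx)) as [E|[E|(y & _ & E)]].
    - pose proof (A1 E); pose proof (B1 E); tauto.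
    - pose proof (A2 E); pose proof (B2 E); tauto.
    - assert (Hy : mem y x) by (rewrite E; apply mem_suc).
      assert (Hyd := ord_trans _ _ _ Od Hy Hx).
      rewrite (A3 y Hyd E), (B3 y Hyd E), (IH y Hy Hyd); tauto. }
  apply zf_ext; intros x; split; intros Hx; apply K; auto.
Qed.
Lemma stages_ex d : ord d -> exists t, stages t d.
Proof.
  intros Od.
  (* [F x] is to be nonempty exactly when the second player moves at [x]. *)
  set (C := fun x h => lim x \/ exists y, mem y x /\ x = suc y /\ ap h y = emp).
  set (F := rec (fun x h => sep (sg emp) (fun _ => C x h))).
  assert (H2 : F2 (fun x h => sep (sg emp) (fun _ => C x h))).
  { apply (DT_sep (fun _ => sg emp) (fun e _ => C (e 0) (e 1))); unfold C; dd. }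
  assert (HF : F1 F) by (apply F1_rec, H2).
  assert (FE : forall x, F x <> emp <-> lim x \/ exists y, mem y x /\ x = suc y /\ F y = emp).
  { intros x; assert (E : F x = sep (sg emp) (fun _ => C x (lam x F))) by exact (recE _ x H2).
    assert (K : C x (lam x F) <-> lim x \/ exists y, mem y x /\ x = suc y /\ F y = emp).
    { unfold C; split; (intros [K|(y & Hy & K)]; [auto|right; exists y]);
        (split; [exact Hy|]); rewrite ap_lam in * by assumption; exact K. }
    rewrite <- K, E; split.
    - intros Q; destruct (nonemp _ Q) as [z Hz]; apply sepE in Hz; [tauto|dd].
    - intros Q Q'; apply (empE (V := N) emp); rewrite <- Q' at 2; apply sepE; [dd|].
      rewrite sgE; auto. }
  exists (sep d (fun x => F x <> emp)); split; [intros x Hx; apply sepE in Hx; [tauto|dd]|].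
  assert (TE : forall x, mem x d -> (mem x (sep d (fun x => F x <> emp)) <-> F x <> emp)).
  { intros x Hx; rewrite sepE by dd; tauto. }
  intros x Hx; split; [|split].
  - intros -> K; apply (TE _ Hx), FE in K; destruct K as [(_ & K & _)|(y & Hy & _)]; [exact (K eq_refl)|exact (empE _ Hy)].
  - intros K; apply (TE _ Hx), FE; auto.
  - intros y Hy E; rewrite (TE x Hx), (TE y Hy), FE; split.
    + intros [K|(y' & _ & E' & K)]; [destruct (lim_not_suc x y K E)|].
      rewrite E in E'; apply suc_inj in E'; subst y'; tauto.
    + intros K; right; exists y; split; [rewrite E; apply mem_suc|split; [exact E|apply NNPP, K]].
Qed.
Lemma add_ge a x : ord x -> ~ mem (add a x) x.
Proof.
  induction x as [x IH] using mem_ind; intros Ox H.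
  exact (IH _ H (ord_mem _ _ Ox H) (add_mono a _ _ H)).
Qed.
Lemma lim_add a x : ord a -> lim x -> lim (add a x).
Proof.
  intros Oa (Ox & Nx & Lx); split; [exact (ord_add a x Oa Ox)|].
  destruct (nonemp x Nx) as [z0 Hz0]; split.
  - intros E; apply (empE (V := N) (add a z0)); rewrite <- E; apply add_mono, Hz0.
  - intros y Hy; apply addE in Hy; destruct Hy as [Hy|(z & Hz & ->)].
    + exists (add a z0); split; [apply add_mono, Hz0|apply incl_add, Hy].
    + destruct (Lx z Hz) as (z' & Hz' & K); exists (add a z'); split; apply add_mono; assumption.
Qed.
(** Restarting the game at a stage [a] of the first player leaves the alternation unchanged, since
    [a] then plays the part of stage 0. *)
Lemma stages_add t d a z : ord d -> ord a -> stages t d -> ~ mem a t -> ord z -> mem (add a z) d ->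
  (mem (add a z) t <-> mem z t).
Proof.
  intros Od Oa [I H] Na; induction z as [z IH] using mem_ind; intros Oz Hz.
  assert (Hzd : forall z, ord z -> mem (add a z) d -> mem z d).
  { intros x Ox Hx; destruct (ord_total x Ox d Od) as [K|[->|K]]; [exact K|destruct (add_ge a d Od Hx)|].
    destruct (add_ge a x Ox); exact (ord_trans _ _ _ Ox Hx K). }
  destruct (H _ Hz) as (A1 & A2 & A3), (H _ (Hzd z Oz Hz)) as (B1 & B2 & B3).
  destruct (ord_cases z Oz) as [E|[E|(y & Oy & E)]].
  - pose proof (B1 E); subst z; rewrite add_emp; tauto.
  - pose proof (B2 E); pose proof (A2 (lim_add a z Oa E)); tauto.
  - assert (Hy : mem y z) by (rewrite E; apply mem_suc).
    assert (Kd : mem (add a y) d) by exact (ord_trans _ _ _ Od (add_mono a _ _ Hy) Hz).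
    rewrite (A3 (add a y) Kd); [|rewrite E; apply add_suc].
    rewrite (B3 y (Hzd y Oy Kd) E), (IH y Hy Oy Kd); tauto.
Qed.
End Stages.

(* The strategy passes (plays the top element ∅) as long as the first player does: this keeps the supports of
   the coordinatewise answers bounded at the direct limit stages. *)
Definition good_strategy {X : Type} (t d a r g : X) : form X :=
  fAnd (is_fun g) (fAll (fun b => fImp (fMem b d) (fImp (fMem b t) (fAll (fun s =>
    fImp (fAnd (descending a r b s) (follows g t b s))
      (fEx (fun p => fAnd (fMem p a) (fAnd (related g s p)
        (fAnd (fAll (fun x => fAll (fun u => fImp (related s x u) (related r p u))))
          (fImp (fAll (fun x => fAll (fun u => fImp (related s x u) (is_empty u)))) (is_empty p))))))))))).
Definition gstrat {N : zfc_model} (t d a r g : N) : Prop :=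
  isfun g /\ forall b, mem b d -> mem b t -> forall s, desc a r b s /\ follow g t b s ->
    exists p, mem p a /\ mem (op s p) g /\ (forall x u, mem (op x u) s -> mem (op p u) r) /\
      ((forall x u, mem (op x u) s -> u = emp) -> p = emp).
Lemma sat_good_strategy {N : zfc_model} (t d a r g : N) :
  (N ⊨ good_strategy t d a r g) <-> gstrat t d a r g.
Proof. unfold good_strategy, gstrat; st. Qed.

Section Lottery.
Context {N : zfc_model} (T : N -> N -> N -> Prop) (A R : N).
Context (HL : lotsum T A R) (HT : forall q a r, T q a r -> poset q a r).
Implicit Types x y z u v p q a r b s g : N.

Lemma lot_emp : mem emp A. Proof. apply (proj1 HL); auto. Qed.
Lemma lot_top x : mem x A -> mem (op x emp) R.
Proof. intros Hx; apply (proj2 HL); exists x; split; [exact Hx|]; exists emp; auto using lot_emp. Qed.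
Lemma lot_dom x y : mem (op x y) R -> mem x A /\ mem y A.
Proof.
  intros H; apply (proj2 HL) in H; destruct H as (x' & Hx & y' & Hy & E & _).
  apply op_inj in E; destruct E; subst; auto.
Qed.
Lemma lot_pair x y : mem (op x y) R -> y = emp \/
  exists q b s p p', T q b s /\ x = op q p /\ y = op q p' /\ mem (op p p') s.
Proof.
  intros H; apply (proj2 HL) in H; destruct H as (x' & Hx & y' & Hy & E & K).
  apply op_inj in E; destruct E; subst; exact K.
Qed.
Lemma lot_mk q b s p p' : T q b s -> mem (op p p') s -> mem (op (op q p) (op q p')) R.
Proof.
  intros HTq H; destruct (HT _ _ _ HTq) as (_ & _ & Hs & _).
  destruct (Hs _ H) as (x & Hx & y & Hy & E); apply op_inj in E; destruct E; subst x y.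
  apply (proj2 HL); exists (op q p); split; [apply (proj1 HL); right; exists q, b, s, p; auto|].
  exists (op q p'); split; [apply (proj1 HL); right; exists q, b, s, p'; auto|].
  split; [reflexivity|right; exists q, b, s, p, p'; auto].
Qed.
Lemma lot_refl x : mem x A -> mem (op x x) R.
Proof.
  intros Hx; apply (proj1 HL) in Hx as Hx'; destruct Hx' as [->|(q & b & s & p & K & Hp & ->)].
  - apply lot_top, lot_emp.
  - apply (lot_mk q b s p p K); apply HT in K; apply K, Hp.
Qed.
Lemma T_same q b s b' s' : T q b s -> T q b' s' -> b = b' /\ s = s'.
Proof.
  intros H H'; apply HT in H, H'; destruct H as [E _], H' as [E' _]; rewrite E in E'.
  exact (op_inj _ _ _ _ E').
Qed.
Lemma lot_trans x y z : mem (op x y) R -> mem (op y z) R -> mem (op x z) R.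
Proof.
  intros H K; destruct (lot_pair y z K) as [->|(q & b & s & p & p' & K1 & -> & -> & K2)].
  - apply lot_top, (lot_dom _ _ H).
  - destruct (lot_pair _ _ H) as [E|(q' & b' & s' & p1 & p2 & K3 & -> & E & K4)]; [destruct (op_nonemp _ _ E)|].
    apply op_inj in E; destruct E; subst q' p2; destruct (T_same _ _ _ _ _ K1 K3); subst b' s'.
    apply (lot_mk q b s); [exact K1|]; apply HT in K1; destruct K1 as (_ & _ & _ & _ & Tr).
    apply (Tr p1 p p'); auto.
Qed.

Section Strategy.
Context (d t : N) (Od : ord d) (Ht : stages t d).
Context (HS : forall q a r, T q a r -> sclosed a r d).

(** Stated without [T], which is an arbitrary class here and need not be definable; the poset is
    recovered from [q]. *)
Definition ticket_strat q g : Prop := exists a r, q = op a r /\ isfun g /\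
  forall b, mem b d -> mem b t -> forall s, desc a r b s /\ follow g t b s ->
    exists p, mem p a /\ mem (op s p) g /\ forall x u, mem (op x u) s -> mem (op p u) r.
Lemma D2_ticket_strat : D2 ticket_strat.
Proof. unfold ticket_strat, desc, follow, isfun; dd. Qed.

(* The play of the game on the ticket [q], when [q] is chosen at stage [i] of the play [s]. *)
Definition shift s i q : N :=
  sep (prod d (un (un (un (un s))))) (fun w => exists z p, w = op z p /\ mem (op (add i z) (op q p)) s).
Lemma shift_op s i q z p : mem (op z p) (shift s i q) <-> mem z d /\ mem (op (add i z) (op q p)) s.
Proof.
  unfold shift; rewrite sepE by dd; rewrite prod_op; split.
  - intros [[Hz _] (z' & p' & E & K)]; apply op_inj in E; destruct E; subst; auto.
  - intros [Hz K]; split; [split; [exact Hz|]|eauto]; exact (mem_op_r _ _ _ (mem_op_r _ _ _ K)).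
Qed.
Lemma shift_pair s i q w : mem w (shift s i q) -> exists z p, w = op z p.
Proof. intros H; apply sepE in H; [|dd]; destruct H as [_ (z & p & E & _)]; eauto. Qed.
Lemma F3_shift : F3 shift.
Proof. unfold shift; dd. Qed.
Hint Resolve F3_shift : dfn.

(** The second player passes until the first player picks a ticket [q], and from then on follows a
    strategy for [q] in the shifted play. The choice is final, because only conditions of [q] lie
    below a condition of [q]. *)
Lemma lottery_gstrat : exists g, gstrat t d A R g.
Proof.
  set (Qs := sep (un (un A)) (fun q => exists u, mem (op q u) A)).
  assert (HQ : forall q u, mem (op q u) A -> mem q Qs).
  { intros q u H; apply sepE; [dd|]; split; [exact (mem_op_l _ _ _ H)|eauto]. }
  assert (inA : forall q u, mem (op q u) A -> exists a r, T q a r /\ mem u a).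
  { intros q u H; apply (proj1 HL) in H; destruct H as [E|(q' & a & r & p & K & Hp & E)];
      [destruct (op_nonemp _ _ E)|]; apply op_inj in E; destruct E; subst; eauto. }
  destruct (choose ticket_strat Qs D2_ticket_strat) as (Gm & HGm & KGm).
  { intros q Hq; apply sepE in Hq; [|dd]; destruct Hq as [_ (u & Hu)].
    destruct (inA q u Hu) as (a & r & K & _); destruct (HS q a r K) as (t' & Ht' & g & Hg & Kg).
    rewrite (stages_unique t' t d Od Ht' Ht) in *.
    exists g, a, r; split; [apply (HT _ _ _ K)|auto]. }
  assert (KG : forall q a r, T q a r -> mem q Qs -> isfun (Gm q) /\
    forall b, mem b d -> mem b t -> forall s, desc a r b s /\ follow (Gm q) t b s ->
    exists p, mem p a /\ mem (op s p) (Gm q) /\ forall x u, mem (op x u) s -> mem (op p u) r).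
  { intros q a r K Hq; destruct (KGm q Hq) as (a' & r' & E & K').
    destruct (HT _ _ _ K) as [E' _]; rewrite E in E'; apply op_inj in E'; destruct E'; subst; exact K'. }
  (* Either only the top has been played so far, or [i] is the first stage with another move and
     that move lies in the ticket [q]. *)
  set (answer := fun s y => isfun s /\ ((y = emp /\ forall j v, mem (op j v) s -> v = emp) \/
    exists i q u p, mem (op i (op q u)) s /\ (forall j v, mem j i -> mem (op j v) s -> v = emp) /\
      mem (op (shift s i q) p) (Gm q) /\ y = op q p)).
  assert (Da : D2 answer) by (unfold answer, isfun; dd).
  set (g := sep (prod (pow (prod d A)) A) (fun w => exists s y, w = op s y /\ answer s y)).
  assert (gE : forall s y, mem (op s y) g <-> incl s (prod d A) /\ mem y A /\ answer s y).
  { intros s y; unfold g; rewrite sepE by dd; rewrite prod_op, powE; split.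
    - intros [[H1 H2] (s' & y' & E & K)]; apply op_inj in E; destruct E; subst; auto.
    - intros (H1 & H2 & H3); split; [auto|eauto]. }
  assert (first_eq : forall s i q u i' q' u', incl s (prod d A) -> isfun s ->
     mem (op i (op q u)) s -> (forall j v, mem j i -> mem (op j v) s -> v = emp) ->
     mem (op i' (op q' u')) s -> (forall j v, mem j i' -> mem (op j v) s -> v = emp) -> i = i' /\ q = q' /\ u = u').
  { intros s i q u i' q' u' Is Fs H F H' F'.
    assert (Oi : ord i) by (apply Is, prod_op in H; exact (ord_mem _ _ Od (proj1 H))).
    assert (Oi' : ord i') by (apply Is, prod_op in H'; exact (ord_mem _ _ Od (proj1 H'))).
    assert (i = i').
    { destruct (ord_total i Oi i' Oi') as [K|[K|K]]; [|exact K|].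
      - destruct (op_nonemp _ _ (F' i _ K H)).
      - destruct (op_nonemp _ _ (F i' _ K H')). }
    subst i'; split; [reflexivity|]; apply op_inj; exact (proj2 Fs i _ _ (conj H H')). }
  assert (isfg : isfun g).
  { split.
    - intros z Hz; apply sepE in Hz; [|dd]; destruct Hz as [_ (s & y & E & _)]; eauto.
    - intros s y y' [H H']; apply gE in H, H'; destruct H as (Is & Hy & Fs & K), H' as (_ & Hy' & _ & K').
      destruct K as [[-> K]|(i & q & u & p & K1 & K2 & K3 & ->)], K' as [[-> K']|(i' & q' & u' & p' & K1' & K2' & K3' & ->)].
      + reflexivity.
      + destruct (op_nonemp _ _ (K _ _ K1')).
      + destruct (op_nonemp _ _ (K' _ _ K1)).
      + destruct (first_eq s i q u i' q' u' Is Fs K1 K2 K1' K2') as (-> & -> & ->); f_equal.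
        destruct (inA q' p Hy) as (a & r & Kt & _); destruct (KG q' a r Kt (HQ _ _ Hy)) as [Fg _].
        exact (proj2 Fg _ _ _ (conj K3 K3')). }
  exists g; split; [exact isfg|]; intros b Hb Hbt s [Hd Hf].
  destruct Hd as [[Fon Fto] Fdesc]; pose proof Fon as [Fs Fdom].
  assert (Ob := ord_mem _ _ Od Hb).
  assert (sval : forall x u, mem (op x u) s -> mem x b /\ mem u A)
    by (intros x u K; split; [apply Fdom; eauto|exact (Fto _ _ K)]).
  assert (Is : incl s (prod d A)).
  { intros z Hz; destruct (proj1 Fs z Hz) as (x & u & ->); destruct (sval x u Hz) as [Hx Hu].
    apply prod_op; split; [exact (ord_trans _ _ _ Od Hx Hb)|exact Hu]. }
  destruct (classic (forall x u, mem (op x u) s -> u = emp)) as [Hall|Hall].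
  { exists emp; split; [apply lot_emp|split; [|split]].
    - apply gE; split; [exact Is|split; [apply lot_emp|]]; split; [exact Fs|auto].
    - intros x u K; rewrite (Hall x u K); apply lot_top, lot_emp.
    - auto. }
  destruct (wf_min (fun i => exists v, mem (op i v) s /\ v <> emp)) as (i & (v & Hiv & Nv) & Mi).
  { apply not_all_ex_not in Hall; destruct Hall as [x Hall]; apply not_all_ex_not in Hall.
    destruct Hall as [u Hall]; apply imply_to_and in Hall; eauto. }
  assert (Fi : forall j v, mem j i -> mem (op j v) s -> v = emp).
  { intros j w Hj K; apply NNPP; intros Q; apply (Mi j Hj); eauto. }
  destruct (sval i v Hiv) as [Hib HvA].
  assert (exists q u a r, v = op q u /\ T q a r /\ mem u a) as (q & u0 & a & r & -> & Kt & Hu0).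
  { apply (proj1 HL) in HvA; destruct HvA as [E|(q & a & r & p & K & Hp & E)]; [tauto|eauto 10]. }
  assert (HqQ : mem q Qs) by exact (HQ _ _ HvA).
  destruct (KG q a r Kt HqQ) as [Fg Kg].
  destruct (HT _ _ _ Kt) as (Eq & Na & Rdom & Rrefl & Rtrans).
  assert (Oi := ord_mem _ _ Ob Hib).
  assert (later : forall z w, ord z -> mem (op (add i z) w) s -> exists p, w = op q p /\ mem p a).
  { intros z w Oz K; destruct (classic (z = emp)) as [->|Nz].
    - rewrite add_emp in K; exists u0; split; [exact (proj2 Fs i _ _ (conj K Hiv))|exact Hu0].
    - assert (Hz : mem emp z).
      { destruct (nonemp z Nz) as [y Hy]; destruct (ord_total emp ord_emp z Oz) as [Q|[Q|Q]];
          [exact Q|subst; tauto|destruct (empE _ Q)]. }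
      assert (Hi : mem i (add i z)) by (rewrite <- (add_emp i) at 1; apply add_mono, Hz).
      pose proof (Fdesc _ _ _ _ (conj Hi (conj Hiv K))) as Q; apply lot_pair in Q.
      destruct Q as [Q|(q' & a' & r' & p & p' & K1 & -> & E & K2)]; [destruct (op_nonemp _ _ Q)|].
      apply op_inj in E; destruct E; subst q' p'; destruct (T_same _ _ _ _ _ Kt K1); subst a' r'.
      exists p; split; [reflexivity|]; destruct (Rdom _ K2) as (p1 & Hp1 & p2 & _ & E).
      apply op_inj in E; destruct E; subst; exact Hp1. }
  assert (order : forall z z' p p', mem z z' -> mem (op (add i z) (op q p)) s ->
     mem (op (add i z') (op q p')) s -> mem (op p' p) r).
  { intros z z' p p' Hz K K'; pose proof (Fdesc _ _ _ _ (conj (add_mono i _ _ Hz) (conj K K'))) as Q.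
    apply lot_pair in Q; destruct Q as [Q|(q' & a' & r' & p1 & p2 & K1 & E1 & E2 & K2)]; [destruct (op_nonemp _ _ Q)|].
    apply op_inj in E1, E2; destruct E1, E2; subst; destruct (T_same _ _ _ _ _ Kt K1); subst; exact K2. }
  (* The first real move is not made by the second player, who answers a play of tops with the top.
     Hence the shifted game starts at a stage of the first player. *)
  assert (Nit : ~ mem i t).
  { intros Hit; destruct (Hf i Hib Hit) as (w & v & -> & Kv & Kg').
    rewrite (proj2 Fs i _ _ (conj Kv Hiv)) in Kg'; apply gE in Kg'; destruct Kg' as (_ & _ & _ & [[E _]|(j & q' & u' & p & K & _)]).
    - exact (op_nonemp _ _ E).
    - apply restr_op in K; destruct K as [K Hj]; exact (op_nonemp _ _ (Fi j _ Hj K)). }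
  (* [b'] is the length of the play since the ticket was chosen. *)
  destruct (sub_ord i b Oi Ob (mem_asym _ _ Hib)) as (b' & Ob' & Eb).
  assert (Hb' : mem b' d).
  { destruct (ord_total b' Ob' d Od) as [K|[->|K]]; [exact K| |].
    - rewrite Eb in Hb; destruct (add_ge i d Od Hb).
    - rewrite Eb in Hb; destruct (add_ge i b' Ob'); exact (ord_trans _ _ _ Ob' Hb K). }
  assert (Ozd : forall z, mem z d -> ord z) by (intros z; apply ord_mem, Od).
  assert (sdom : forall z, mem z d -> (mem z b' <-> mem (add i z) b))
    by (intros z Hz; rewrite Eb; symmetry; apply add_mono_iff; auto).
  set (s' := shift s i q).
  assert (Fon' : fn_on s' b').
  { split; [split|].
    - apply shift_pair.
    - intros x y z [H1 H2]; apply shift_op in H1, H2.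
      destruct (op_inj q y q z); [|assumption]; exact (proj2 Fs _ _ _ (conj (proj2 H1) (proj2 H2))).
    - intros z; split.
      + intros Hz; assert (Hzd := ord_trans _ _ _ Od Hz Hb'); apply (sdom z Hzd) in Hz.
        apply Fdom in Hz; destruct Hz as [w Hw]; destruct (later z w (Ozd z Hzd) Hw) as (p & -> & _).
        exists p; apply shift_op; auto.
      + intros [p K]; apply shift_op in K; destruct K as [Hz K]; apply (sdom z Hz), Fdom; eauto. }
  assert (Hd' : desc a r b' s').
  { split; [split; [exact Fon'|]|].
    - intros z p K; apply shift_op in K; destruct K as [Hz K]; destruct (later z _ (Ozd z Hz) K) as (p' & E & Hp').
      apply op_inj in E; destruct E; subst; exact Hp'.
    - intros z z' p p' (Hz & K & K'); apply shift_op in K, K'; exact (order z z' p p' Hz (proj2 K) (proj2 K')). }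
  assert (Hf' : follow (Gm q) t b' s').
  { intros x Hx Hxt; assert (Hxd := ord_trans _ _ _ Od Hx Hb').
    assert (Hxb : mem (add i x) b) by (apply sdom; assumption).
    assert (Hxt' : mem (add i x) t).
    { apply (stages_add t d i x Od Oi Ht Nit (Ozd x Hxd)); [exact (ord_trans _ _ _ Od Hxb Hb)|exact Hxt]. }
    destruct (Hf _ Hxb Hxt') as (w & v & -> & Kv & Kgv).
    apply gE in Kgv; destruct Kgv as (Ir & HvA' & Fr & Kv').
    assert (Nx : x <> emp).
    { intros ->; destruct Ht as [_ Ht']; exact (proj1 (Ht' emp Hxd) eq_refl Hxt). }
    assert (Hix : mem (op i (op q u0)) (restr s (add i x))).
    { apply restr_op; split; [exact Hiv|]; rewrite <- (add_emp i) at 1; apply add_mono.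
      destruct (ord_total emp ord_emp x (Ozd x Hxd)) as [Q|[Q|Q]]; [exact Q|subst; tauto|destruct (empE _ Q)]. }
    destruct Kv' as [[-> Kv']|(i' & q' & u' & p & K1 & K2 & K3 & ->)]; [destruct (op_nonemp _ _ (Kv' _ _ Hix))|].
    destruct (first_eq _ i q u0 i' q' u' Ir Fr Hix) as (<- & <- & <-); [|exact K1|exact K2|].
    { intros j v Hj K; apply restr_op in K; exact (Fi j v Hj (proj1 K)). }
    exists (shift (restr s (add i x)) i q), p; split; [|split; [apply shift_op; auto|exact K3]].
    apply zf_ext; intros z.
    assert (Q : forall z p, mem (op z p) (shift (restr s (add i x)) i q) <-> mem (op z p) s' /\ mem z x).
    { intros y p'; unfold s'; rewrite !shift_op, restr_op; split.
      - intros (Hy & K & Hyx); split; [auto|]; exact (proj1 (add_mono_iff i y x (Ozd y Hy) (Ozd x Hxd)) Hyx).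
      - intros ((Hy & K) & Hyx); split; [exact Hy|split; [exact K|apply add_mono, Hyx]]. }
    split; intros Hz.
    - destruct (shift_pair _ _ _ _ Hz) as (y & p' & ->); apply restr_op, Q, Hz.
    - apply restrE in Hz; destruct Hz as [Hz (y & p' & Hy & ->)]; apply Q; auto. }
  assert (Hbt' : mem b' t).
  { rewrite Eb in Hbt, Hb; exact (proj1 (stages_add t d i b' Od Oi Ht Nit Ob' Hb) Hbt). }
  destruct (Kg b' Hb' Hbt' s' (conj Hd' Hf')) as (p & Hp & Kp & Lp).
  assert (HpA : mem (op q p) A) by (apply (proj1 HL); right; exists q, a, r, p; auto).
  exists (op q p); split; [exact HpA|split; [|split]].
  - apply gE; split; [exact Is|split; [exact HpA|split; [exact Fs|right]]].
    exists i, q, u0, p; auto.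
  - intros x u K; destruct (classic (u = emp)) as [->|Nu]; [apply lot_top, HpA|].
    destruct (sval x u K) as [Hxb _].
    destruct (sub_ord i x Oi (ord_mem _ _ Ob Hxb)) as (z & Oz & ->).
    { intros Hx; exact (Nu (Fi x u Hx K)). }
    destruct (later z u Oz K) as (p' & -> & _).
    apply (lot_mk q a r p p' Kt), (Lp z), shift_op; split; [|exact K].
    apply (ord_trans _ b' _ Od); [|exact Hb']; rewrite Eb in Hxb; apply (add_mono_iff i); assumption.
  - intros Q; destruct (op_nonemp _ _ (Q _ _ Hiv)).
Qed.
End Strategy.
End Lottery.

(** * Codes of sets of small hereditary cardinality *)

(** The relation [E] on [Y] codes a transitive set [T]: a partial map [e] from [Y] onto [T] carries
    [E] to membership, and [xi] is mapped to [t]. As [e] need be neither injective nor total, any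
    way of covering [T] by [Y] gives a code. *)
Definition is_code {X : Type} (Y E xi t : X) : form X :=
  fEx (fun T => fEx (fun e => fAnd (is_trans T) (fAnd
    (fAnd (fAll (fun x => fAll (fun y => fAll (fun z => fImp (fAnd (related e x y) (related e x z)) (fEq y z)))))
      (fAnd (fAll (fun x => fAll (fun y => fImp (related e x y) (fAnd (fMem x Y) (fMem y T)))))
        (fAll (fun y => fImp (fMem y T) (fEx (fun x => related e x y))))))
    (fAnd (related e xi t)
      (fAll (fun a => fAll (fun b => fIff (related E a b)
        (fEx (fun x => fEx (fun y => fAnd (related e a x) (fAnd (related e b y) (fMem x y)))))))))))).

Section Codes.
Context {N : zfc_model}.
Implicit Types x y z k l e g q t u v w Y E : N.
Definition psurj e Y (T : N) : Prop :=
  (forall x y z, mem (op x y) e /\ mem (op x z) e -> y = z) /\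
  (forall x y, mem (op x y) e -> mem x Y /\ mem y T) /\
  (forall y, mem y T -> exists x, mem (op x y) e).
Definition codes Y E xi t : Prop :=
  exists T e, trans T /\ psurj e Y T /\ mem (op xi t) e /\
    forall a b, mem (op a b) E <-> exists x y, mem (op a x) e /\ mem (op b y) e /\ mem x y.
Lemma sat_is_code Y E xi t : (N ⊨ is_code Y E xi t) <-> codes Y E xi t.
Proof. unfold is_code, codes, psurj; st. Qed.

(** This is the uniqueness of the Mostowski collapse, by induction along membership. *)
Lemma codes_unique Y E xi t t' : codes Y E xi t -> codes Y E xi t' -> t = t'.
Proof.
  intros (T & e & HT & (F & B & S) & Ht & HE) (T' & e' & HT' & (F' & B' & S') & Ht' & HE').
  enough (Q : forall x a x', mem (op a x) e -> mem (op a x') e' -> x = x') by exact (Q t xi t' Ht Ht').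
  intros x; induction x as [x IH] using mem_ind; intros a x' H H'; apply zf_ext; intros z; split; intros Hz.
  - assert (HzT : mem z T) by exact (HT x (proj2 (B _ _ H)) z Hz).
    destruct (S z HzT) as [b Hb].
    assert (K : mem (op b a) E) by (apply HE; eauto).
    apply HE' in K; destruct K as (z' & x'' & Hz' & Hx'' & K).
    rewrite (F' a x'' x' (conj Hx'' H')) in K; rewrite (IH z Hz b z' Hb Hz'); exact K.
  - assert (HzT : mem z T') by exact (HT' x' (proj2 (B' _ _ H')) z Hz).
    destruct (S' z HzT) as [b Hb].
    assert (K : mem (op b a) E) by (apply HE'; eauto).
    apply HE in K; destruct K as (z' & x'' & Hz' & Hx'' & K).
    rewrite (F a x'' x (conj Hx'' H)) in K; rewrite <- (IH z' K b z Hz' Hb); exact K.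
Qed.
Lemma codes_ex Y (T : N) e t : trans T -> psurj e Y T -> mem t T ->
  exists E xi, incl E (prod Y Y) /\ mem xi Y /\ codes Y E xi t.
Proof.
  intros HT (F & B & S) Ht; destruct (S t Ht) as [xi Hxi].
  set (E := sep (prod Y Y) (fun w => exists a b x y, w = op a b /\ mem (op a x) e /\ mem (op b y) e /\ mem x y)).
  exists E, xi; split; [intros w Hw; apply sepE in Hw; [tauto|dd]|split; [apply (B _ _ Hxi)|]].
  exists T, e; split; [exact HT|split; [split; auto|split; [exact Hxi|]]].
  intros a b; unfold E; rewrite sepE by dd; split.
  - intros [_ (a' & b' & x & y & Eq & K)]; apply op_inj in Eq; destruct Eq; subst; eauto.
  - intros (x & y & Hx & Hy & K); split; [|eauto 10].
    apply prod_op; split; [apply (B _ _ Hx)|apply (B _ _ Hy)].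
Qed.

Lemma psurj_comp e Y (T : N) g U : psurj e Y T -> bij g U T -> exists e', psurj e' Y U.
Proof.
  intros (F & B & S) (((Fg & Dg) & Rg) & Ig & Sg).
  set (e' := sep (prod Y U) (fun w => exists x u v, w = op x u /\ mem (op x v) e /\ mem (op u v) g)).
  assert (E : forall x u, mem (op x u) e' <-> exists v, mem (op x v) e /\ mem (op u v) g).
  { intros x u; unfold e'; rewrite sepE by dd; split.
    - intros [_ (x' & u' & v & Eq & K)]; apply op_inj in Eq; destruct Eq; subst; eauto.
    - intros (v & K1 & K2); split; [|eauto 8]; apply prod_op; split; [apply (B _ _ K1)|apply Dg; eauto]. }
  exists e'; split; [|split].
  - intros x u u' [K K']; apply E in K, K'; destruct K as (v & K1 & K2), K' as (v' & K1' & K2').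
    rewrite (F x v v' (conj K1 K1')) in K2; exact (Ig _ _ _ (conj K2 K2')).
  - intros x u K; apply E in K; destruct K as (v & K1 & K2); split; [apply (B _ _ K1)|apply Dg; eauto].
  - intros u Hu; apply Dg in Hu; destruct Hu as [v Hv]; destruct (S v (Rg _ _ Hv)) as [x Hx].
    exists x; apply E; eauto.
Qed.
(** A least counterexample would be a cardinal, hence not above [l], hence included in [l], where
    the identity serves. *)
Lemma cardsucc_psurj k l y : cardsucc k l -> mem y k -> exists e, psurj e l y.
Proof.
  intros ((Ok & _) & Hl & Hk) Hy; apply NNPP; intros Ny.
  destruct (wf_min (fun y => mem y k /\ ~ exists e, psurj e l y)) as (m & [Hm Nm] & Mm); [eauto|].
  assert (Om := ord_mem _ _ Ok Hm); assert (Ol := ord_mem _ _ Ok Hl).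
  assert (Cm : cardinal m).
  { split; [exact Om|]; intros z Hz [g Hg]; apply (Mm z Hz); split; [exact (ord_trans _ _ _ Ok Hz Hm)|].
    intros [e He]; apply Nm; exact (psurj_comp e l z g m He Hg). }
  assert (I : incl m l) by exact (ord_not_mem l m Ol Om (Hk m Hm Cm)).
  apply Nm; exists (lam m (fun x => x)).
  assert (E : forall x y, mem (op x y) (lam m (fun x => x)) <-> mem x m /\ y = x)
    by (intros; apply lam_op; dd).
  split; [|split].
  - intros x a b [K K']; apply E in K, K'; destruct K as [_ ->], K' as [_ ->]; reflexivity.
  - intros x a K; apply E in K; destruct K as [K ->]; auto.
  - intros x Hx; exists x; apply E; auto.
Qed.
Lemma inH_psurj l q : inH l q -> exists T e, trans T /\ incl q T /\ psurj e l T.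
Proof.
  intros (k & Hk & t & (Tt & It & _) & y & Hy & g & Hg).
  destruct (cardsucc_psurj k l y Hk Hy) as [e He].
  destruct (psurj_comp e l y g t He Hg) as [e' He']; exists t, e'; auto.
Qed.
Lemma psurj_extend e Y (T : N) z : trans T -> psurj e Y T -> incl z T ->
  exists T' e', trans T' /\ mem z T' /\ incl T T' /\ psurj e' (suc Y) T'.
Proof.
  intros HT (F & B & S) Hz; exists (cup T (sg z)), (cup e (sg (op Y z))).
  assert (E : forall x y, mem (op x y) (cup e (sg (op Y z))) <-> mem (op x y) e \/ (x = Y /\ y = z)).
  { intros x y; rewrite cupE, sgE; split; (intros [K|K]; [auto|right]).
    - apply op_inj, K.
    - destruct K; subst; reflexivity. }
  split; [|split; [rewrite cupE, sgE; auto|split; [intros w Hw; apply cupE; auto|split; [|split]]]].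
  - intros x Hx w Hw; apply cupE; left; apply cupE in Hx; rewrite sgE in Hx.
    destruct Hx as [Hx| ->]; [exact (HT x Hx w Hw)|exact (Hz w Hw)].
  - intros x a b [K K']; apply E in K, K'; destruct K as [K|[-> ->]], K' as [K'|[Ex ->]].
    + eauto.
    + subst x; destruct (mem_irr _ (proj1 (B _ _ K))).
    + destruct (mem_irr _ (proj1 (B _ _ K'))).
    + reflexivity.
  - intros x a K; rewrite sucE, cupE, sgE; apply E in K; destruct K as [K|[-> ->]]; [|auto].
    destruct (B _ _ K); auto.
  - intros y Hy; apply cupE in Hy; rewrite sgE in Hy; destruct Hy as [Hy| ->].
    + destruct (S y Hy) as [x Hx]; exists x; apply E; auto.
    + exists Y; apply E; auto.
Qed.
(** The four points added to [l] code [q], [{q}], [{q, p}] and [⟨q, p⟩], the sets needed beyond a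
    transitive set that includes [q]. *)
Definition suc4 (l : N) : N := suc (suc (suc (suc l))).
Lemma lottery_codes (T : N -> N -> N -> Prop) A R l t : lotsum T A R ->
  (forall q a r, T q a r -> poset q a r /\ inH l q) -> mem t A ->
  exists E xi, incl E (prod (suc4 l) (suc4 l)) /\ mem xi (suc4 l) /\ codes (suc4 l) E xi t.
Proof.
  intros HL HT Ht; apply (proj1 HL) in Ht; destruct Ht as [->|(q & a & r & p & K & Hp & ->)].
  - apply (codes_ex (suc4 l) (sg emp) (sg (op l emp))).
    + intros x Hx; apply sgE in Hx; subst x; intros z Hz; destruct (empE _ Hz).
    + assert (E : forall x y, mem (op x y) (sg (op l emp)) <-> x = l /\ y = emp).
      { intros x y; rewrite sgE; split; [apply op_inj|intros [-> ->]; reflexivity]. }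
      split; [|split].
      * intros x y z [K K']; apply E in K, K'; destruct K, K'; subst; reflexivity.
      * intros x y K; apply E in K; destruct K as [-> ->]; unfold suc4; rewrite !sucE, sgE; tauto.
      * intros y Hy; apply sgE in Hy; exists l; apply E; auto.
    + apply sgE; reflexivity.
  - destruct (HT _ _ _ K) as [(Eq & _) Hq]; destruct (inH_psurj l q Hq) as (T0 & e0 & HT0 & I0 & P0).
    assert (Ha : mem a T0).
    { apply (HT0 (sg a)); [apply I0; rewrite Eq; apply upE; auto|apply sgE; reflexivity]. }
    assert (HpT : mem p T0) by exact (HT0 a Ha p Hp).
    destruct (psurj_extend e0 _ T0 q HT0 P0 I0) as (T1 & e1 & HT1 & M1 & I1 & P1).
    destruct (psurj_extend e1 _ T1 (sg q) HT1 P1) as (T2 & e2 & HT2 & M2 & I2 & P2).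
    { intros z Hz; apply sgE in Hz; subst; exact M1. }
    destruct (psurj_extend e2 _ T2 (up q p) HT2 P2) as (T3 & e3 & HT3 & M3 & I3 & P3).
    { intros z Hz; apply upE in Hz; destruct Hz as [-> | ->]; auto. }
    destruct (psurj_extend e3 _ T3 (op q p) HT3 P3) as (T4 & e4 & HT4 & M4 & I4 & P4).
    { intros z Hz; apply upE in Hz; destruct Hz as [-> | ->]; auto. }
    exact (codes_ex _ T4 e4 _ HT4 P4 M4).
Qed.
End Codes.

(** * Small sets *)

Section Small.
Context {V : zfc_model}.
Implicit Types x y z c d X Y Z : V.
(** Size below [c], in the form of a covering by an ordinal below [c]. The covering need be neither
    injective nor confined to [X], which spares all cardinal arithmetic. *)
Definition sml c X : Prop := exists a, mem a c /\ exists g, forall z, mem z X -> exists i, mem i a /\ z = ap g i.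
Lemma D2_sml : D2 sml. Proof. unfold sml; dd. Qed.

Lemma sml_fun c X a F : F1 F -> mem a c -> (forall z, mem z X -> exists i, mem i a /\ z = F i) -> sml c X.
Proof.
  intros HF Ha H; exists a; split; [exact Ha|exists (lam a F)]; intros z Hz.
  destruct (H z Hz) as (i & Hi & ->); exists i; rewrite ap_lam; auto.
Qed.
Lemma sml_sub c X Y : sml c X -> incl Y X -> sml c Y.
Proof. intros (a & Ha & g & H) I; exists a; split; [exact Ha|exists g; auto]. Qed.
Lemma sml_ord c a : mem a c -> sml c a.
Proof. intros Ha; apply (sml_fun c a a (fun x => x)); [dd|exact Ha|eauto]. Qed.
Lemma sml_rel c X Y (R : V -> V -> Prop) : D2 R -> sml c X ->
  (forall y, mem y Y -> exists x, mem x X /\ R x y) ->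
  (forall x y y', mem y Y -> mem y' Y -> R x y -> R x y' -> y = y') -> sml c Y.
Proof.
  intros HR (a & Ha & g & H) HY Hf.
  destruct (choose (fun i v => (exists y, mem y Y /\ R (ap g i) y) -> mem v Y /\ R (ap g i) v) a) as (F & HF & KF).
  { dd. }
  { intros i Hi; destruct (classic (exists y, mem y Y /\ R (ap g i) y)) as [[y K]|K]; [eauto|exists emp; tauto]. }
  apply (sml_fun c Y a F HF Ha); intros y Hy; destruct (HY y Hy) as (x & Hx & Rx).
  destruct (H x Hx) as (i & Hi & ->); exists i; split; [exact Hi|].
  destruct (KF i Hi) as [K1 K2]; [eauto|]; exact (Hf (ap g i) y (F i) Hy K1 Rx K2).
Qed.
Lemma sml_img c X F : F1 F -> sml c X -> sml c (img X F).
Proof.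
  intros HF HX; apply (sml_rel c X _ (fun x y => y = F x)); [dd|exact HX| |].
  - intros y Hy; apply imgE in Hy; assumption.
  - intros x y y' _ _ -> ->; reflexivity.
Qed.

Section Inacc.
Context (c : V) (Hc : inacc c).
Lemma inacc_ord : ord c. Proof. apply Hc. Qed.
Lemma inacc_emp : mem emp c.
Proof.
  destruct Hc as (_ & (w & Hw & Lw) & _); destruct Lw as [(Ow & Nw & _) _].
  destruct (nonemp w Nw) as [z Hz]; assert (Oz := ord_mem _ _ Ow Hz).
  destruct (ord_total emp ord_emp w Ow) as [K|[<-|K]]; [|tauto|destruct (empE _ K)].
  exact (ord_trans _ _ _ inacc_ord K Hw).
Qed.
Lemma regular_bound a F : F1 F -> mem a c -> (forall i, mem i a -> mem (F i) c) ->
  exists b, mem b c /\ forall i, mem i a -> mem (F i) b.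
Proof.
  intros HF Ha H; destruct (proj1 (proj2 (proj2 Hc)) a Ha (lam a F)) as (b & Hb & K).
  - split; [apply fn_lam, HF|]; intros u v Q; apply lam_op in Q; [|exact HF]; destruct Q as [Q ->]; auto.
  - exists b; split; [exact Hb|]; intros i Hi; apply (K i), lam_op; auto.
Qed.
Lemma inacc_suc a : mem a c -> mem (suc a) c.
Proof.
  intros Ha; assert (Oc := inacc_ord); assert (Oa := ord_mem _ _ Oc Ha).
  destruct (ord_total (suc a) (ord_suc a Oa) c Oc) as [K|[K|K]]; [exact K| |].
  - exfalso; destruct (proj1 (proj2 Hc)) as (w & Hw & (Ow & Nw & Lw) & _).
    destruct (nonemp w Nw) as [z Hz].
    (* If [c] were the successor of [a], the constant map with value [a] on omega would be unbounded
       in [c]. *)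
    destruct (regular_bound w (fun _ => a)) as (b & Hb & Q); [dd|exact Hw|auto|].
    specialize (Q z Hz); rewrite <- K in Hb; apply sucE in Hb; destruct Hb as [Hb| ->].
    + exact (mem_asym _ _ Q Hb).
    + exact (mem_irr _ Q).
  - exfalso; apply sucE in K; destruct K as [K| ->]; [exact (mem_asym _ _ K Ha)|exact (mem_irr _ Ha)].
Qed.
Lemma sml_bound X (H : V -> V -> Prop) : D2 H -> sml c X -> (forall z, mem z X -> exists d, mem d c /\ H z d) ->
  exists b, mem b c /\ forall z, mem z X -> exists d, mem d b /\ H z d.
Proof.
  intros DH (a & Ha & g & Hg) K.
  destruct (choose (fun i d => mem d c /\ ((exists d, mem d c /\ H (ap g i) d) -> H (ap g i) d)) a) as (F & HF & KF).
  { dd. }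
  { intros i Hi; destruct (classic (exists d, mem d c /\ H (ap g i) d)) as [(d & Q)|Q].
    - exists d; tauto.
    - exists emp; split; [apply inacc_emp|tauto]. }
  destruct (regular_bound a F HF Ha) as (b & Hb & Q); [intros i Hi; apply KF, Hi|].
  exists b; split; [exact Hb|]; intros z Hz; destruct (Hg z Hz) as (i & Hi & ->).
  exists (F i); split; [exact (Q i Hi)|apply KF; auto].
Qed.
Lemma sml_bounded X : sml c X -> incl X c -> exists b, mem b c /\ incl X b.
Proof.
  intros HX I; destruct (sml_bound X (fun z d => z = d) ltac:(dd) HX) as (b & Hb & K); [eauto|].
  exists b; split; [exact Hb|]; intros z Hz; destruct (K z Hz) as (d & Hd & ->); exact Hd.
Qed.
(** A subset of [X] is recovered from the set of its indices, and [c] is a strong limit. *)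
Lemma sml_pow X : sml c X -> sml c (pow X).
Proof.
  intros (a & Ha & g & Hg).
  destruct (proj2 (proj2 (proj2 Hc)) a Ha (pow a) (powE a)) as (y & Hy & h & ((_ & Hd) & Hr) & Hi & Hs).
  apply (sml_fun c (pow X) y (fun i => sep X (fun z => exists B, mem (op B i) h /\ exists j, mem j B /\ z = ap g j)));
    [dd|exact Hy|].
  intros Z HZ; apply powE in HZ.
  set (B := sep a (fun j => mem (ap g j) Z)).
  assert (BE : forall j, mem j B <-> mem j a /\ mem (ap g j) Z) by (intros j; unfold B; rewrite sepE by dd; tauto).
  assert (HB : mem B (pow a)) by (apply powE; intros j Hj; apply BE in Hj; tauto).
  apply Hd in HB; destruct HB as [i Hi'].
  exists i; split; [exact (Hr B i Hi')|].
  apply zf_ext; intros z; rewrite sepE by dd; split.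
  - intros Hz; split; [auto|exists B; split; [exact Hi'|]].
    destruct (Hg z (HZ z Hz)) as (j & Hj & ->); exists j; rewrite BE; auto.
  - intros [_ (B' & HB' & j & Hj & ->)]; rewrite (Hi _ _ _ (conj HB' Hi')) in Hj; apply BE in Hj; tauto.
Qed.
(** The pairs lie in the double power set of the larger ordinal, so closure under power sets
    replaces the multiplication of cardinals. *)
Lemma sml_prod_ord a b : mem a c -> mem b c -> sml c (prod a b).
Proof.
  intros Ha Hb; assert (Oc := inacc_ord).
  assert (K : exists m, mem m c /\ incl a m /\ incl b m).
  { destruct (ord_total a (ord_mem _ _ Oc Ha) b (ord_mem _ _ Oc Hb)) as [K|[->|K]].
    - exists b; split; [exact Hb|split; intros z Hz; [exact (ord_trans _ _ _ (ord_mem _ _ Oc Hb) Hz K)|exact Hz]].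
    - exists b; split; [exact Hb|split; intros z Hz; exact Hz].
    - exists a; split; [exact Ha|split; intros z Hz; [exact Hz|exact (ord_trans _ _ _ (ord_mem _ _ Oc Ha) Hz K)]]. }
  destruct K as (m & Hm & Ia & Ib).
  apply (sml_sub c (pow (pow m))); [apply sml_pow, sml_pow, sml_ord, Hm|].
  intros w Hw; apply prodE in Hw; destruct Hw as (u & v & Hu & Hv & ->).
  apply powE; intros x Hx; apply powE; intros y Hy; apply upE in Hx; destruct Hx as [-> | ->].
  - apply sgE in Hy; subst; auto.
  - apply upE in Hy; destruct Hy; subst; auto.
Qed.
(** Regularity bounds the sizes of all members by a single [b]; after choosing coverings, the union
    is indexed by a product of two ordinals. *)
Lemma sml_union Z : sml c Z -> (forall X, mem X Z -> sml c X) -> sml c (un Z).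
Proof.
  intros HZ HX.
  destruct (sml_bound Z (fun X a => exists g, forall z, mem z X -> exists i, mem i a /\ z = ap g i)) as (b & Hb & K).
  { dd. }
  { exact HZ. }
  { intros X HX'; destruct (HX X HX') as (a & Ha & Q); eauto. }
  destruct (choose (fun X g => forall z, mem z X -> exists i, mem i b /\ z = ap g i) Z) as (Gm & HG & KG).
  { dd. }
  { intros X HX'; destruct (K X HX') as (a & Ha & g & Q); exists g; intros z Hz.
    destruct (Q z Hz) as (i & Hi & ->); exists i; split; [|reflexivity].
    exact (ord_trans _ _ _ (ord_mem _ _ inacc_ord Hb) Hi Ha). }
  destruct HZ as (a & Ha & h & Hh).
  apply (sml_rel c (prod a b) _ (fun w z => exists i j, w = op i j /\ z = ap (Gm (ap h i)) j)).
  - dd.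
  - apply sml_prod_ord; assumption.
  - intros z Hz; apply unE in Hz; destruct Hz as (X & HX' & Hz); destruct (Hh X HX') as (i & Hi & ->).
    destruct (KG _ HX' z Hz) as (j & Hj & ->); exists (op i j); split; [apply prod_op; auto|eauto].
  - intros w z z' _ _ (i & j & -> & ->) (i' & j' & E & ->); apply op_inj in E; destruct E; subst; reflexivity.
Qed.
Lemma sml_prod X Y : sml c X -> sml c Y -> sml c (prod X Y).
Proof.
  intros (a & Ha & g & Hg) (b & Hb & h & Hh).
  apply (sml_rel c (prod a b) _ (fun w z => exists i j, w = op i j /\ z = op (ap g i) (ap h j))).
  - dd.
  - apply sml_prod_ord; assumption.
  - intros z Hz; apply prodE in Hz; destruct Hz as (u & v & Hu & Hv & ->).
    destruct (Hg u Hu) as (i & Hi & ->), (Hh v Hv) as (j & Hj & ->).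
    exists (op i j); split; [apply prod_op; auto|eauto].
  - intros w z z' _ _ (i & j & -> & ->) (i' & j' & E & ->); apply op_inj in E; destruct E; subst; reflexivity.
Qed.
End Inacc.
End Small.
#[global] Hint Resolve D2_sml : dfn.

Lemma rf_lottery : reified (fun (W : zfc_model) (e : nat -> W) => is_lottery_sum (lottery_ticket (e 0) (e 1)) (e 2) (e 3)).
Proof. rf. Qed.

(** * The iteration *)

Section Sel.
Context {V : zfc_model}.
Implicit Types g x y b c p q : V.
(** Definition by cases as a set operation, so that functions built with it are definable: [x] if
    [b ∈ g], and [y] otherwise. *)
Definition sel g b x y : V := un (cup (sep (sg x) (fun _ => mem b g)) (sep (sg y) (fun _ => ~ mem b g))).
Lemma sel_in g b x y : mem b g -> sel g b x y = x.
Proof.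
  intros H; unfold sel; apply zf_ext; intros z; rewrite unE; split.
  - intros (w & Hw & Hz); rewrite cupE, !sepE, !sgE in Hw by dd; destruct Hw as [[-> _]|[_ K]]; tauto.
  - intros Hz; exists x; split; [|exact Hz]; rewrite cupE, !sepE, !sgE by dd; auto.
Qed.
Lemma sel_out g b x y : ~ mem b g -> sel g b x y = y.
Proof.
  intros H; unfold sel; apply zf_ext; intros z; rewrite unE; split.
  - intros (w & Hw & Hz); rewrite cupE, !sepE, !sgE in Hw by dd; destruct Hw as [[_ K]|[-> _]]; tauto.
  - intros Hz; exists y; split; [|exact Hz]; rewrite cupE, !sepE, !sgE by dd; auto.
Qed.
Lemma DT_sel (g b x y : (nat -> V) -> V) : DT g -> DT b -> DT x -> DT y ->
  DT (fun e => sel (g e) (b e) (x e) (y e)).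
Proof.
  intros Hg Hb Hx Hy; unfold sel; apply (F1_lift un); [dd_fact|]; apply (F2_lift cup); [dd_fact| |].
  - apply (DT_sep (fun e => sg (x e)) (fun e _ => mem (b e) (g e))); [dd|].
    apply D_mem; apply (DT_ren S); assumption.
  - apply (DT_sep (fun e => sg (y e)) (fun e _ => ~ mem (b e) (g e))); [dd|].
    apply D_not, D_mem; apply (DT_ren S); assumption.
Qed.
Lemma restr_id p c : fn_on p c -> restr p c = p.
Proof. intros H; rewrite (fn_restr p c c H) by (intros z; auto); symmetry; apply fn_on_lam, H. Qed.
Lemma restr_restr p b b' : incl b b' -> restr (restr p b') b = restr p b.
Proof.
  intros I; apply zf_ext; intros z; rewrite !restrE; split.
  - intros [[H _] K]; auto.
  - intros [H (u & v & Hu & ->)]; split; [split; [exact H|]|]; exists u, v; auto.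
Qed.
Lemma fn_on_restr p c b : fn_on p c -> incl b c -> fn_on (restr p b) b.
Proof. intros H I; rewrite (fn_restr p c b H I); apply fn_lam; dd. Qed.
Lemma ap_restr p c b x : fn_on p c -> incl b c -> mem x b -> ap (restr p b) x = ap p x.
Proof. intros H I Hx; rewrite (fn_restr p c b H I); apply ap_lam; [dd|exact Hx]. Qed.
Lemma fn_ext p q c : fn_on p c -> fn_on q c -> (forall b, mem b c -> ap p b = ap q b) -> p = q.
Proof.
  intros Hp Hq E; apply fn_on_lam in Hp, Hq; rewrite Hp, Hq; apply lam_ext; [dd|dd|exact E].
Qed.
End Sel.
Ltac dd_ext ::=
  match goal with
  | |- DT (fun e => sep (@?x e) (@?A e)) => apply (DT_sep x A)
  | |- DT (fun e => img (@?x e) (@?A e)) => apply (DT_img x A)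
  | |- DT (fun e => lam (@?x e) (@?A e)) => apply (DT_lam x A)
  | |- DT (fun e => rec (@?F e) (@?t e)) => apply (DT_rec F t)
  | |- DT (fun e => sel (@?g e) (@?b e) (@?x e) (@?y e)) => apply (DT_sel g b x y)
  | |- D (fun e => forces (@?P e) (@?L e) (@?p e) (fEq (@?s e) (@?t e))) =>
      change (D (fun e => forces_eq (P e) (L e) (s e) (t e) (p e)))
  | |- D (fun e => forces (@?P e) (@?L e) (@?p e) (fMem (@?s e) (@?t e))) =>
      change (D (fun e => forces_mem (P e) (L e) (s e) (t e) (p e)))
  end.

Section Iteration.
Context {V : zfc_model} (HV : countable V) (k f Ps Ls Qs Rs : V).
Context (Hk : inacc k) (Hf : pfun f k k) (HI : lottery_iteration k f Ps Ls Qs Rs).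
Implicit Types a b c d g p q r s t u x y z l : V.

Let Ok : ord k := inacc_ord k Hk.
Definition Pb b := ap Ps b.
Definition Lb b := ap Ls b.
Definition Qb b := ap Qs b.
Definition Rb b := ap Rs b.
Lemma F1_Pb : F1 Pb. Proof. unfold Pb; dd. Qed.
Lemma F1_Lb : F1 Lb. Proof. unfold Lb; dd. Qed.
Lemma F1_Qb : F1 Qb. Proof. unfold Qb; dd. Qed.
Lemma F1_Rb : F1 Rb. Proof. unfold Rb; dd. Qed.
Hint Resolve F1_Pb F1_Lb F1_Qb F1_Rb : dfn.
Lemma iter_fns : fn_on Ps (suc k) /\ fn_on Ls (suc k) /\ fn_on Qs k /\ fn_on Rs k.
Proof.
  destruct (iter_Ps _ _ _ _ _ _ HI) as (k' & H1 & H2 & H3), (iter_Qs _ _ _ _ _ _ HI) as [H4 H5].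
  apply sat_is_succ in H1; subst k'; apply sat_fun_on in H2, H3, H4, H5; auto.
Qed.
Lemma Ps_rel b P : mem b (suc k) -> ((V ⊨ related Ps b P) <-> P = Pb b).
Proof. intros Hb; rewrite sat_related, (fn_on_op _ _ _ _ (proj1 iter_fns)); unfold Pb; tauto. Qed.
Lemma Ls_rel b P : mem b (suc k) -> ((V ⊨ related Ls b P) <-> P = Lb b).
Proof. intros Hb; rewrite sat_related, (fn_on_op _ _ _ _ (proj1 (proj2 iter_fns))); unfold Lb; tauto. Qed.
Lemma Qs_rel b P : mem b k -> ((V ⊨ related Qs b P) <-> P = Qb b).
Proof. intros Hb; rewrite sat_related, (fn_on_op _ _ _ _ (proj1 (proj2 (proj2 iter_fns)))); unfold Qb; tauto. Qed.
Lemma Rs_rel b P : mem b k -> ((V ⊨ related Rs b P) <-> P = Rb b).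
Proof. intros Hb; rewrite sat_related, (fn_on_op _ _ _ _ (proj2 (proj2 (proj2 iter_fns)))); unfold Rb; tauto. Qed.
Lemma suck_ord c : mem c (suc k) -> ord c.
Proof. apply ord_mem, ord_suc, Ok. Qed.
Lemma suck_mem b c : mem c (suc k) -> mem b c -> mem b k.
Proof.
  intros Hc Hb; apply sucE in Hc; destruct Hc as [Hc| ->]; [exact (ord_trans _ _ _ Ok Hb Hc)|exact Hb].
Qed.
Lemma k_suck b : mem b k -> mem b (suc k). Proof. rewrite sucE; auto. Qed.
Lemma suck_incl b c : mem c (suc k) -> mem b c -> incl b c.
Proof. intros Hc Hb; exact (proj1 (suck_ord c Hc) b Hb). Qed.

Definition domQ b t : Prop := name_dom (Pb b) (Qb b) t.
Definition empf b t : Prop := forced (Pb b) (Lb b) (is_empty t).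
Lemma D2_domQ : D2 domQ. Proof. unfold domQ, name_dom; dd. Qed.
Lemma D2_empf : D2 empf. Proof. unfold empf, forced; dd. Qed.
Hint Resolve D2_domQ D2_empf : dfn.

Definition cond c p : Prop :=
  fn_on p c /\
  (forall b, mem b c -> mem (restr p b) (Pb b) /\ domQ b (ap p b) /\
     forces (Pb b) (Lb b) (restr p b) (fMem (ap p b) (Qb b))) /\
  (inacc c -> exists d, mem d c /\ forall b, mem b c -> ~ mem b d -> empf b (ap p b)).
Lemma condE c p : mem c (suc k) -> (mem p (Pb c) <-> cond c p).
Proof.
  intros Hc; rewrite (iter_cond _ _ _ _ _ _ HI c (Pb c)) by (apply Ps_rel; auto).
  unfold iteration_condition, cond; rewrite sat_fun_on, sat_inaccessible.
  split; intros (H1 & H2 & H3); (split; [exact H1|split]).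
  - intros b Hb; assert (Hbk := suck_mem _ _ Hc Hb).
    apply (H2 b (Pb b) (Lb b) (Qb b) (restr p b) (ap p b)); try assumption.
    + apply Ps_rel; auto using k_suck.
    + apply Ls_rel; auto using k_suck.
    + apply Qs_rel; auto.
    + apply sat_is_restr; reflexivity.
    + apply sat_related, (fn_on_op _ _ _ _ H1); auto.
  - intros Ic; destruct (H3 Ic) as (d & Hd & K); exists d; split; [exact Hd|]; intros b Hb Nb.
    assert (Hbk := suck_mem _ _ Hc Hb).
    apply (K b); try assumption.
    + apply Ps_rel; auto using k_suck.
    + apply Ls_rel; auto using k_suck.
    + apply sat_related, (fn_on_op _ _ _ _ H1); auto.
  - intros b P L Q r t Hb KP KL KQ Kr Kt; assert (Hbk := suck_mem _ _ Hc Hb).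
    apply Ps_rel in KP; [|auto using k_suck]; apply Ls_rel in KL; [|auto using k_suck].
    apply Qs_rel in KQ; [|auto]; apply sat_is_restr in Kr; apply sat_related, (fn_on_op _ _ _ _ H1) in Kt.
    destruct Kt as [_ ->]; subst; apply H2, Hb.
  - intros Ic; destruct (H3 Ic) as (d & Hd & K); exists d; split; [exact Hd|].
    intros b P L t Hb Nb KP KL Kt; assert (Hbk := suck_mem _ _ Hc Hb).
    apply Ps_rel in KP; [|auto using k_suck]; apply Ls_rel in KL; [|auto using k_suck].
    apply sat_related, (fn_on_op _ _ _ _ H1) in Kt; destruct Kt as [_ ->]; subst; apply K; assumption.
Qed.
Definition le c p q : Prop := ple (Pb c) (Lb c) p q.
Lemma D3_le : D3 le. Proof. unfold le; dd. Qed.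
Hint Resolve D3_le : dfn.
Lemma leE c p q : mem c (suc k) -> (le c p q <-> mem p (Pb c) /\ mem q (Pb c) /\
  forall b, mem b c -> forces (Pb b) (Lb b) (restr p b) (related (Rb b) (ap p b) (ap q b))).
Proof.
  intros Hc; unfold le; rewrite pleE.
  assert (E : mem (op p q) (Lb c) <-> mem p (Pb c) /\ mem q (Pb c) /\ iteration_le Ps Ls Rs c p q).
  { rewrite (iter_order _ _ _ _ _ _ HI c (Pb c) (Lb c)) by (apply Ps_rel || apply Ls_rel; auto).
    split; [|intros (H1 & H2 & H3); exists p, q; rewrite sat_is_opair; auto].
    intros (p' & q' & H1 & H2 & E & H3); apply sat_is_opair in E; apply op_inj in E; destruct E; subst; auto. }
  rewrite E.
  assert (K : mem p (Pb c) -> mem q (Pb c) -> (iteration_le Ps Ls Rs c p q <->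
    forall b, mem b c -> forces (Pb b) (Lb b) (restr p b) (related (Rb b) (ap p b) (ap q b)))).
  { intros Hp Hq; apply (condE c p Hc) in Hp; apply (condE c q Hc) in Hq.
    destruct Hp as [Fp _], Hq as [Fq _]; split.
    - intros H b Hb; assert (Hbk := suck_mem _ _ Hc Hb).
      apply (H b (Pb b) (Lb b) (Rb b) (restr p b) (ap p b) (ap q b)); try assumption.
      + apply Ps_rel; auto using k_suck.
      + apply Ls_rel; auto using k_suck.
      + apply Rs_rel; auto.
      + apply sat_is_restr; reflexivity.
      + apply sat_related, (fn_on_op _ _ _ _ Fp); auto.
      + apply sat_related, (fn_on_op _ _ _ _ Fq); auto.
    - intros H b P L R r t u Hb KP KL KR Kr Kt Ku; assert (Hbk := suck_mem _ _ Hc Hb).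
      apply Ps_rel in KP; [|auto using k_suck]; apply Ls_rel in KL; [|auto using k_suck].
      apply Rs_rel in KR; [|auto]; apply sat_is_restr in Kr.
      apply sat_related, (fn_on_op _ _ _ _ Fp) in Kt; apply sat_related, (fn_on_op _ _ _ _ Fq) in Ku.
      destruct Kt as [_ ->], Ku as [_ ->]; subst; apply H, Hb. }
  tauto.
Qed.
Lemma cond_fn c p : mem c (suc k) -> mem p (Pb c) -> fn_on p c.
Proof. intros Hc Hp; apply (condE c p Hc) in Hp; apply Hp. Qed.
Lemma cond_restr c b p : mem c (suc k) -> mem b c -> mem p (Pb c) -> mem (restr p b) (Pb b).
Proof. intros Hc Hb Hp; apply (condE c p Hc) in Hp; destruct Hp as (_ & H & _); apply H, Hb. Qed.
Lemma cond_restr' c b p : mem c (suc k) -> mem b (suc c) -> mem p (Pb c) -> mem (restr p b) (Pb b).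
Proof.
  intros Hc Hb Hp; apply sucE in Hb; destruct Hb as [Hb| ->]; [exact (cond_restr c b p Hc Hb Hp)|].
  rewrite (restr_id p c); [exact Hp|exact (cond_fn c p Hc Hp)].
Qed.
Lemma le_restr c b p q : mem c (suc k) -> mem b (suc c) -> le c p q -> le b (restr p b) (restr q b).
Proof.
  intros Hc Hb H; apply (leE c p q Hc) in H; destruct H as (Hp & Hq & H).
  assert (Oc := suck_ord c Hc).
  assert (I : incl b c).
  { apply sucE in Hb; destruct Hb as [Hb| ->]; [exact (suck_incl b c Hc Hb)|intros z; auto]. }
  assert (Hbk : mem b (suc k)).
  { apply sucE in Hb; destruct Hb as [Hb| ->]; [|exact Hc]; apply k_suck, (suck_mem b c Hc Hb). }
  apply leE; [exact Hbk|split; [|split]].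
  - exact (cond_restr' c b p Hc Hb Hp).
  - exact (cond_restr' c b q Hc Hb Hq).
  - intros b' Hb'; rewrite restr_restr by exact (suck_incl b' b Hbk Hb').
    rewrite (ap_restr p c b b'), (ap_restr q c b b'); auto using cond_fn.
Qed.

(* [T] is the class of tickets at stage [b]; it is empty at the inactive stages. *)
Lemma stage_lottery b (PO : preord (Pb b) (Lb b)) : mem b k ->
  forall G (HG : generic (Pb b) (Lb b) G), exists T,
    lotsum T (gv (Pb b) (Lb b) PO HG (Qb b)) (gv (Pb b) (Lb b) PO HG (Rb b)) /\
    (forall v w o, T v w o -> poset v w o) /\
    (forall v w o, T v w o -> forall d, mem d b -> sclosed w o (gj (Pb b) (Lb b) PO HG d)) /\
    (forall l, active_stage f b l -> forall v w o, T v w o -> inH (gj (Pb b) (Lb b) PO HG l) v) /\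
    ((~ exists l, active_stage f b l) -> forall v w o, ~ T v w o).
Proof.
  intros Hb G HG.
  destruct (iter_stage _ _ _ _ _ _ HI b (Pb b) (Lb b) (Qb b) (Rb b) Hb) as (_ & HA & HT).
  { apply Ps_rel; auto using k_suck. }
  { apply Ls_rel; auto using k_suck. }
  { apply Qs_rel; auto. }
  { apply Rs_rel; auto. }
  destruct (generic_nonempty _ _ _ HG) as [p Gp]; assert (Hp := generic_sub _ _ _ HG p Gp).
  destruct (classic (exists l, active_stage f b l)) as [[l Hl]|N].
  - destruct (HA l Hl) as (c' & l' & Ec & El & K); apply check_nameE in Ec, El; subst c' l'.
    specialize (K p Hp).
    rewrite (fo4 (Pb b) (Lb b) PO HV (fun W n m Q R => is_lottery_sum (lottery_ticket n m) Q R)) in K;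
      [|exact rf_lottery|exact Hp].
    specialize (K G HG Gp); apply sat_is_lottery_sum in K.
    exists (ticket (gj (Pb b) (Lb b) PO HG b) (gj (Pb b) (Lb b) PO HG l)).
    split; [exact K|split; [|split; [|split]]].
    + intros q a r Q; apply Q.
    + intros q a r Q d Hd; apply Q, gj_mem_iff, Hd.
    + intros l' Hl' q a r Q; replace l' with l; [apply Q|].
      destruct Hl as [Hl _], Hl' as [Hl' _]; apply sat_related in Hl, Hl'.
      destruct Hf as [[_ Ff] _]; exact (Ff b l l' (conj Hl Hl')).
    + intros N; destruct N; eauto.
  - specialize (HT N p Hp).
    rewrite (fo2 (Pb b) (Lb b) PO HV (fun W Q R => is_trivial_poset Q R)) in HT; [|rf|exact Hp].
    specialize (HT G HG Gp); apply sat_is_trivial_poset in HT.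
    exists (fun _ _ _ => False); split; [exact HT|split; [|split; [|split]]]; tauto.
Qed.

(** The order at stage [c] is checked in extensions by earlier stages, and the truth lemma there
    requires that they are preorders already. Off [k + 1] the poset is empty, which removes a side
    condition. *)
Lemma PO c : preord (Pb c) (Lb c).
Proof.
  induction c as [c IH] using mem_ind.
  destruct (classic (mem c (suc k))) as [Hc|Nc].
  2:{ assert (E : Pb c = emp).
      { unfold Pb, ap; apply emp_unique; intros z Hz; apply unE in Hz; destruct Hz as (y & Hy & _).
        apply sepE in Hy; [|dd]; destruct Hy as [_ Hy]; apply Nc; apply (proj1 iter_fns); eauto. }
      split.
      - intros p Hp; rewrite E in Hp; destruct (empE _ Hp).
      - intros p q r Hp; destruct Hp as [Hp _]; rewrite E in Hp; destruct (empE _ Hp). }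
  split.
  - intros p Hp; apply (leE c p p Hc); split; [exact Hp|split; [exact Hp|]]; intros b Hb.
    assert (Hbk := suck_mem _ _ Hc Hb); pose proof Hp as Hp'; apply (condE c p Hc) in Hp'.
    destruct Hp' as (_ & Hp' & _); destruct (Hp' b Hb) as (H1 & _ & H2).
    apply (fo_rel _ _ (IH b Hb) HV); [exact H1|]; intros G HG Gp.
    destruct (stage_lottery b (IH b Hb) Hbk G HG) as (T & HL & HT & _).
    apply (lot_refl T _ _ HL HT).
    exact (proj1 (fo_mem _ _ (IH b Hb) HV _ _ _ H1) H2 G HG Gp).
  - intros p q r Hpq Hqr; apply (leE c p q Hc) in Hpq as (Hp & Hq & H); apply (leE c q r Hc) in Hqr as Hqr'.
    destruct Hqr' as (_ & Hr & H'); apply (leE c p r Hc); split; [exact Hp|split; [exact Hr|]]; intros b Hb.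
    assert (Hbk := suck_mem _ _ Hc Hb).
    assert (H1 := cond_restr c b p Hc Hb Hp); assert (H2 := cond_restr c b q Hc Hb Hq).
    assert (L : le b (restr p b) (restr q b)).
    { apply (le_restr c b p q Hc); [apply sucE; auto|]; apply leE; auto. }
    apply (fo_rel _ _ (IH b Hb) HV); [exact H1|]; intros G HG Gp.
    destruct (stage_lottery b (IH b Hb) Hbk G HG) as (T & HL & HT & _).
    apply (lot_trans T _ _ HL HT _ (gv (Pb b) (Lb b) (IH b Hb) HG (ap q b))).
    + exact (proj1 (fo_rel _ _ (IH b Hb) HV _ _ _ _ H1) (H b Hb) G HG Gp).
    + exact (proj1 (fo_rel _ _ (IH b Hb) HV _ _ _ _ H2) (H' b Hb) G HG (generic_up _ _ _ HG _ _ Gp L)).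
Qed.
Lemma le_refl c p : mem p (Pb c) -> le c p p. Proof. apply PO. Qed.
Lemma le_trans c p q r : le c p q -> le c q r -> le c p r. Proof. apply PO. Qed.
Definition gen c (G : V -> Prop) := generic (Pb c) (Lb c) G.
Definition vl {c G} (HG : gen c G) t := gv (Pb c) (Lb c) (PO c) HG t.
Definition vj {c G} (HG : gen c G) x := gj (Pb c) (Lb c) (PO c) HG x.
Lemma vl_mem c G (HG : gen c G) v t : mem v (vl HG t) <-> exists s p, mem (op s p) t /\ G p /\ v = vl HG s.
Proof. exact (gv_mem (Pb c) (Lb c) (PO c) HG v t). Qed.
Lemma vl_emp c G (HG : gen c G) : vl HG emp = emp.
Proof. apply emp_unique; intros z Hz; apply vl_mem in Hz; destruct Hz as (s & p & Hs & _); exact (empE _ Hs). Qed.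
Lemma vj_mem c G (HG : gen c G) x v : mem v (vj HG x) <-> exists y, mem y x /\ v = vj HG y.
Proof. exact (gj_mem (Pb c) (Lb c) (PO c) HG x v). Qed.
Lemma vj_mem_iff c G (HG : gen c G) x y : mem (vj HG x) (vj HG y) <-> mem x y.
Proof. exact (gj_mem_iff (Pb c) (Lb c) (PO c) HG x y). Qed.
Lemma vj_inj c G (HG : gen c G) x y : vj HG x = vj HG y -> x = y.
Proof. exact (gj_inj (Pb c) (Lb c) (PO c) HG x y). Qed.
Lemma vj_ord c G (HG : gen c G) x : ord x -> ord (vj HG x).
Proof. exact (gj_ord (Pb c) (Lb c) (PO c) HG x). Qed.
Lemma vj_stages c G (HG : gen c G) t d : ord d -> stages t d -> stages (vj HG t) (vj HG d).
Proof. exact (gj_stages (Pb c) (Lb c) (PO c) HG t d). Qed.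
Lemma gen_up c G (HG : gen c G) p q : G p -> le c p q -> G q.
Proof. intros; eapply (generic_up _ _ _ HG); eauto. Qed.
Lemma f_mem c p s t : mem p (Pb c) ->
  (forces (Pb c) (Lb c) p (fMem s t) <-> forall G (HG : gen c G), G p -> mem (vl HG s) (vl HG t)).
Proof. apply (fo_mem _ _ (PO c) HV). Qed.
Lemma f_eq c p s t : mem p (Pb c) ->
  (forces (Pb c) (Lb c) p (fEq s t) <-> forall G (HG : gen c G), G p -> vl HG s = vl HG t).
Proof. apply (fo_eq _ _ (PO c) HV). Qed.
Lemma f_rel c p r s t : mem p (Pb c) ->
  (forces (Pb c) (Lb c) p (related r s t) <-> forall G (HG : gen c G), G p -> mem (op (vl HG s) (vl HG t)) (vl HG r)).
Proof. apply (fo_rel _ _ (PO c) HV). Qed.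
Lemma empfE b t : empf b t <-> forall G (HG : gen b G), vl HG t = emp.
Proof.
  unfold empf, forced; split.
  - intros H G HG; destruct (generic_nonempty _ _ _ HG) as [p Gp].
    assert (Hp := generic_sub _ _ _ HG p Gp).
    exact (proj1 (fo_emp _ _ (PO b) HV p t Hp) (H p Hp) G HG Gp).
  - intros H p Hp; apply (fo_emp _ _ (PO b) HV p t Hp); intros G HG _; apply H.
Qed.
Lemma cond_val c p b : mem c (suc k) -> mem p (Pb c) -> mem b c ->
  forall G (HG : gen b G), G (restr p b) -> mem (vl HG (ap p b)) (vl HG (Qb b)).
Proof.
  intros Hc Hp Hb G HG Gp; apply (condE c p Hc) in Hp; destruct Hp as (_ & H & _).
  destruct (H b Hb) as (H1 & _ & H2); exact (proj1 (f_mem b _ _ _ H1) H2 G HG Gp).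
Qed.
Lemma le_val c p q b : mem c (suc k) -> le c p q -> mem b c ->
  forall G (HG : gen b G), G (restr p b) -> mem (op (vl HG (ap p b)) (vl HG (ap q b))) (vl HG (Rb b)).
Proof.
  intros Hc H Hb G HG Gp; apply (leE c p q Hc) in H; destruct H as (Hp & _ & H).
  exact (proj1 (f_rel b _ _ _ _ (cond_restr c b p Hc Hb Hp)) (H b Hb) G HG Gp).
Qed.
Lemma le_intro c p q : mem c (suc k) -> mem p (Pb c) -> mem q (Pb c) ->
  (forall b G (HG : gen b G), mem b c -> G (restr p b) ->
     mem (op (vl HG (ap p b)) (vl HG (ap q b))) (vl HG (Rb b))) -> le c p q.
Proof.
  intros Hc Hp Hq H; apply (leE c p q Hc); split; [exact Hp|split; [exact Hq|]]; intros b Hb.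
  apply f_rel; [exact (cond_restr c b p Hc Hb Hp)|]; intros G HG; apply H, Hb.
Qed.
Lemma stage_full b : mem b k -> full_name (Pb b) (Lb b) (Qb b).
Proof.
  intros Hb; apply (iter_stage _ _ _ _ _ _ HI b (Pb b) (Lb b) (Qb b) (Rb b) Hb);
    [apply Ps_rel|apply Ls_rel|apply Qs_rel|apply Rs_rel]; auto using k_suck.
Qed.
Section Stage.
Context (b : V) (Hb : mem b k) (G : V -> Prop) (HG : gen b G).
Lemma val_refl v : mem v (vl HG (Qb b)) -> mem (op v v) (vl HG (Rb b)).
Proof. destruct (stage_lottery b (PO b) Hb G HG) as (T & HL & HT & _); exact (lot_refl T _ _ HL HT v). Qed.
Lemma val_emp : mem emp (vl HG (Qb b)).
Proof. destruct (stage_lottery b (PO b) Hb G HG) as (T & HL & HT & _); exact (lot_emp T _ _ HL). Qed.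
Lemma val_top v : mem v (vl HG (Qb b)) -> mem (op v emp) (vl HG (Rb b)).
Proof. destruct (stage_lottery b (PO b) Hb G HG) as (T & HL & HT & _); exact (lot_top T _ _ HL v). Qed.
Lemma val_inactive v : ~ (exists l, active_stage f b l) -> mem v (vl HG (Qb b)) -> v = emp.
Proof.
  intros N Hx; destruct (stage_lottery b (PO b) Hb G HG) as (T & HL & _ & _ & _ & HN).
  apply (proj1 HL) in Hx; destruct Hx as [->|(q & a & r & p & K & _)]; [reflexivity|destruct (HN N _ _ _ K)].
Qed.
End Stage.

(** * Supports, construction of conditions, and the largest condition *)

Definition support_ok c p : Prop :=
  forall c', mem c' (suc c) -> inacc c' ->
    exists d, mem d c' /\ forall b, mem b c' -> ~ mem b d -> empf b (ap p b).
Lemma cond_support c p : mem c (suc k) -> mem p (Pb c) -> support_ok c p.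
Proof.
  intros Hc Hp c' Hc' Ic; assert (Hp' := cond_restr' c c' p Hc Hc' Hp).
  assert (Hk' : mem c' (suc k)).
  { apply sucE in Hc'; destruct Hc' as [Hc'| ->]; [apply k_suck, (suck_mem c' c Hc Hc')|exact Hc]. }
  assert (I : incl c' c).
  { apply sucE in Hc'; destruct Hc' as [Hc'| ->]; [exact (suck_incl c' c Hc Hc')|intros z; auto]. }
  apply (condE c' _ Hk') in Hp'; destruct Hp' as (_ & _ & H); destruct (H Ic) as (d & Hd & K).
  exists d; split; [exact Hd|]; intros b Hb Nb; specialize (K b Hb Nb).
  rewrite (ap_restr p c c' b) in K; auto using cond_fn.
Qed.
(** Each coordinate may be checked under the assumption that the part before it is a condition;
    induction on [c] supplies that assumption. *)
Lemma cond_intro c p : mem c (suc k) -> fn_on p c -> support_ok c p ->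
  (forall b, mem b c -> mem (restr p b) (Pb b) ->
     domQ b (ap p b) /\ forces (Pb b) (Lb b) (restr p b) (fMem (ap p b) (Qb b))) ->
  mem p (Pb c).
Proof.
  revert p; induction c as [c IH] using mem_ind; intros p Hc Fp Sp H; apply (condE c p Hc).
  assert (Oc := suck_ord c Hc).
  split; [exact Fp|split; [|intros Ic; exact (Sp c (mem_suc c) Ic)]].
  intros b Hb; assert (I := suck_incl b c Hc Hb).
  assert (Hr : mem (restr p b) (Pb b)); [|split; [exact Hr|exact (H b Hb Hr)]].
  assert (Hbk := k_suck b (suck_mem b c Hc Hb)).
  apply (IH b Hb); [exact Hbk|exact (fn_on_restr p c b Fp I)| |].
  - intros c' Hc' Ic; destruct (Sp c') as (d & Hd & K); [|exact Ic|].
    + apply sucE; left; apply sucE in Hc'; destruct Hc' as [Hc'| ->]; [exact (ord_trans _ _ _ Oc Hc' Hb)|exact Hb].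
    + exists d; split; [exact Hd|]; intros x Hx Nx; rewrite (ap_restr p c b x Fp I); [exact (K x Hx Nx)|].
      apply sucE in Hc'; destruct Hc' as [Hc'| ->]; [exact (ord_trans _ _ _ (ord_mem _ _ Oc Hb) Hx Hc')|exact Hx].
  - intros x Hx; assert (Ix := suck_incl x b Hbk Hx); rewrite restr_restr by exact Ix; rewrite (ap_restr p c b x Fp I Hx).
    apply H, I, Hx.
Qed.

Lemma top_of b e : mem b (suc k) -> F1 e -> (forall x, mem x b -> domQ x (e x) /\ empf x (e x)) ->
  mem (lam b e) (Pb b) /\ forall p, mem p (Pb b) -> le b p (lam b e).
Proof.
  intros Hbk He Ke.
  assert (Etop : mem (lam b e) (Pb b)).
  { apply cond_intro; [exact Hbk|apply fn_lam, He| |].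
    - intros c' Hc' Ic; exists emp; split; [apply inacc_emp, Ic|]; intros x Hx _.
      assert (Hxb : mem x b).
      { apply sucE in Hc'; destruct Hc' as [Hc'| ->]; [exact (ord_trans _ _ _ (suck_ord b Hbk) Hx Hc')|exact Hx]. }
      rewrite ap_lam by assumption; apply Ke, Hxb.
    - intros x Hx Hr; rewrite ap_lam by assumption; split; [apply Ke, Hx|].
      apply f_mem; [exact Hr|]; intros G HG _; destruct (Ke x Hx) as [_ K]; rewrite empfE in K; rewrite K.
      apply (val_emp x (suck_mem x b Hbk Hx)). }
  split; [exact Etop|].
  intros p Hp; apply (le_intro b p _ Hbk Hp Etop); intros x G HG Hx Gp.
  rewrite ap_lam by assumption; destruct (Ke x Hx) as [_ K]; rewrite empfE in K; rewrite K.
  apply (val_top x (suck_mem x b Hbk Hx)); exact (cond_val b p x Hbk Hp Hx G HG Gp).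
Qed.
(** The empty name need not lie in the domain of an iterand, so names of the top are obtained from
    fullness. Fullness gives equality only below the condition built so far, and therefore that
    condition has to be the largest one. *)
Lemma tops : exists e, F1 e /\ forall b, mem b k -> domQ b (e b) /\ empf b (e b).
Proof.
  apply (choose (fun b x => domQ b x /\ empf b x)); [dd|].
  intros b; induction b as [b IH] using mem_ind; intros Hb; assert (Hbk := k_suck b Hb).
  destruct (choose (fun b x => domQ b x /\ empf b x) b) as (e & He & Ke); [dd| |].
  { intros b' Hb'; exact (IH b' Hb' (suck_mem b' b Hbk Hb')). }
  destruct (top_of b e Hbk He Ke) as [Etop top].
  destruct (stage_full b Hb (lam b e) emp Etop) as (s & Hs & Es).
  { apply f_mem; [exact Etop|]; intros G HG _; rewrite vl_emp; apply (val_emp b Hb). }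
  exists s; split; [exact Hs|]; apply empfE; intros G HG.
  destruct (generic_nonempty _ _ _ HG) as [p Gp].
  rewrite f_eq in Es by exact Etop.
  rewrite <- (Es G HG (gen_up b G HG p _ Gp (top p (generic_sub _ _ _ HG p Gp)))).
  apply vl_emp.
Qed.

(** * Gluing a condition of an initial segment to the tail of a condition *)

Definition glue c g a q : V := lam c (fun b => sel g b (ap a b) (ap q b)).
Lemma glue_fn c g a q : fn_on (glue c g a q) c.
Proof. unfold glue; apply fn_lam; dd. Qed.
Lemma glue_in c g a q b : mem b c -> mem b g -> ap (glue c g a q) b = ap a b.
Proof. intros Hc Hg; unfold glue; rewrite ap_lam by (dd || assumption); apply sel_in, Hg. Qed.
Lemma glue_out c g a q b : mem b c -> ~ mem b g -> ap (glue c g a q) b = ap q b.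
Proof. intros Hc Hg; unfold glue; rewrite ap_lam by (dd || assumption); apply sel_out, Hg. Qed.
Lemma glue_restr_lo c g a q b : mem c (suc k) -> mem g (suc c) -> fn_on a g -> mem b (suc g) ->
  restr (glue c g a q) b = restr a b.
Proof.
  intros Hc Hg Fa Hb; assert (Oc := suck_ord c Hc); assert (Og := ord_mem _ _ (ord_suc c Oc) Hg).
  assert (Igc : incl g c) by (apply sucE in Hg; destruct Hg as [Hg| ->]; [exact (proj1 Oc g Hg)|intros z; auto]).
  assert (Ibg : incl b g) by (apply sucE in Hb; destruct Hb as [Hb| ->]; [exact (proj1 Og b Hb)|intros z; auto]).
  assert (Ibc : incl b c) by (intros z Hz; apply Igc, Ibg, Hz).
  apply (fn_ext _ _ b).
  - apply (fn_on_restr _ c); [apply glue_fn|exact Ibc].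
  - apply (fn_on_restr _ g); [exact Fa|exact Ibg].
  - intros x Hx; rewrite (ap_restr _ c b x (glue_fn _ _ _ _) Ibc Hx), (ap_restr a g b x Fa Ibg Hx).
    apply glue_in; auto.
Qed.
Lemma glue_restr_hi c g a q b : mem c (suc k) -> mem b c -> fn_on q c ->
  restr (glue c g a q) b = glue b g a (restr q b).
Proof.
  intros Hc Hb Fq; assert (I := suck_incl b c Hc Hb).
  apply (fn_ext _ _ b).
  - apply (fn_on_restr _ c); [apply glue_fn|exact I].
  - apply glue_fn.
  - intros x Hx; rewrite (ap_restr _ c b x (glue_fn _ _ _ _) I Hx).
    destruct (classic (mem x g)) as [K|K].
    + rewrite !glue_in; auto.
    + rewrite !glue_out; auto; symmetry; apply (ap_restr q c b x Fq I Hx).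
Qed.
(** Beyond [g] the values of [q] stay legitimate because the glued restriction lies below that of
    [q], by induction. The support at an inaccessible stage is that of [q], enlarged to [g], if the
    stage is above [g], and that of [a] otherwise. *)
Lemma glue_cond g a : mem g (suc k) -> mem a (Pb g) -> forall c q, mem c (suc k) -> mem g (suc c) -> mem q (Pb c) ->
  le g a (restr q g) -> mem (glue c g a q) (Pb c) /\ le c (glue c g a q) q.
Proof.
  intros Hg Ha c; induction c as [c IH] using mem_ind; intros q Hc Hgc Hq Hle.
  assert (Oc := suck_ord c Hc); assert (Og := suck_ord g Hg).
  assert (Fq := cond_fn c q Hc Hq); assert (Fa := cond_fn g a Hg Ha).
  assert (hi : forall b, mem b c -> ~ mem b g -> restr (glue c g a q) b = glue b g a (restr q b) /\
     mem (glue b g a (restr q b)) (Pb b) /\ le b (glue b g a (restr q b)) (restr q b)).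
  { intros b Hb Nb; split; [apply glue_restr_hi; assumption|].
    assert (Hbk := suck_mem b c Hc Hb).
    assert (Hgb : mem g (suc b)).
    { apply sucE; destruct (ord_total g Og b (ord_mem _ _ Oc Hb)) as [K|[K|K]]; tauto. }
    apply (IH b Hb); [apply k_suck, Hbk|exact Hgb|exact (cond_restr c b q Hc Hb Hq)|].
    rewrite restr_restr; [exact Hle|].
    apply sucE in Hgb; destruct Hgb as [K| ->]; [exact (proj1 (ord_mem _ _ Oc Hb) g K)|intros z; auto]. }
  assert (lo : forall b, mem b g -> restr (glue c g a q) b = restr a b)
    by (intros b Hb; apply glue_restr_lo; auto; apply sucE; auto).
  assert (Hglue : mem (glue c g a q) (Pb c)).
  { apply cond_intro; [exact Hc|apply glue_fn| |].
    - intros c' Hc' Ic.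
      assert (Ic' : incl c' c).
      { apply sucE in Hc'; destruct Hc' as [Hc'| ->]; [exact (suck_incl c' c Hc Hc')|intros z; auto]. }
      assert (Oc' := ord_mem _ _ (ord_suc c Oc) Hc').
      destruct (classic (mem g c')) as [K|K].
      + destruct (cond_support c q Hc Hq c' Hc' Ic) as (d & Hd & Q).
        assert (M : exists m, mem m c' /\ incl d m /\ incl g m).
        { assert (Od := ord_mem _ _ Oc' Hd).
          destruct (ord_total d Od g Og) as [D|[D|D]].
          - exists g; split; [exact K|split; [exact (proj1 Og d D)|intros z; auto]].
          - subst g; exists d; split; [exact Hd|split; intros z; auto].
          - exists d; split; [exact Hd|split; [intros z; auto|exact (proj1 Od g D)]]. }
        destruct M as (m & Hm & Im1 & Im2); exists m; split; [exact Hm|]; intros b Hb Nb.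
        rewrite glue_out; [apply Q; auto|apply Ic', Hb|auto].
      + assert (Hcg : mem c' (suc g)).
        { apply sucE; destruct (ord_total c' Oc' g Og) as [D|[D|D]]; tauto. }
        destruct (cond_support g a Hg Ha c' Hcg Ic) as (d & Hd & Q).
        exists d; split; [exact Hd|]; intros b Hb Nb; rewrite glue_in; [apply Q; assumption|apply Ic', Hb|].
        apply sucE in Hcg; destruct Hcg as [D| ->]; [exact (ord_trans _ _ _ Og Hb D)|exact Hb].
    - intros b Hb Hr; destruct (classic (mem b g)) as [K|K].
      + rewrite glue_in by assumption; rewrite lo by exact K.
        apply (condE g a Hg) in Ha; destruct Ha as (_ & Q & _); apply (Q b K).
      + rewrite glue_out by assumption; pose proof Hq as Hq'; apply (condE c q Hc) in Hq'.
        destruct Hq' as (_ & Q & _); destruct (Q b Hb) as (_ & Q1 & Q2); split; [exact Q1|].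
        destruct (hi b Hb K) as (E & _ & Hl); rewrite E; exact (forces_mono _ _ (PO b) _ _ _ Hl Q2). }
  split; [exact Hglue|]; apply le_intro; [exact Hc|exact Hglue|exact Hq|]; intros b G HG Hb Gb.
  assert (Hbk := suck_mem b c Hc Hb).
  destruct (classic (mem b g)) as [K|K].
  - rewrite glue_in by assumption; rewrite lo in Gb by exact K.
    pose proof (le_val g a _ b Hg Hle K G HG Gb) as Q.
    rewrite (ap_restr q c g b) in Q; [exact Q|exact Fq| |exact K].
    apply sucE in Hgc; destruct Hgc as [D| ->]; [exact (suck_incl g c Hc D)|intros z; auto].
  - rewrite glue_out by assumption; apply (val_refl b Hbk).
    destruct (hi b Hb K) as (E & _ & Hl); rewrite E in Gb.
    exact (cond_val c q b Hc Hq Hb G HG (gen_up b G HG _ _ Gb Hl)).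
Qed.

Lemma glue_restr c g a q : mem c (suc k) -> mem g (suc c) -> fn_on a g -> restr (glue c g a q) g = a.
Proof.
  intros Hc Hg Fa; rewrite glue_restr_lo; auto using mem_suc; apply restr_id, Fa.
Qed.
(** So [glue c g a q] is the weakest condition below [q] whose initial segment is below [a]. *)
Lemma glue_le c g a q p : mem c (suc k) -> mem g (suc c) -> mem q (Pb c) -> le g a (restr q g) ->
  le c p q -> le g (restr p g) a -> le c p (glue c g a q).
Proof.
  intros Hc Hg Hq Haq Hpq Hpa; assert (Oc := suck_ord c Hc).
  assert (Hgk : mem g (suc k)).
  { apply sucE in Hg; destruct Hg as [Hg| ->]; [apply k_suck, (suck_mem g c Hc Hg)|exact Hc]. }
  assert (I : incl g c) by (apply sucE in Hg; destruct Hg as [D| ->]; [exact (suck_incl g c Hc D)|intros z; auto]).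
  assert (Hp : mem p (Pb c)) by apply Hpq.
  destruct (glue_cond g a Hgk (proj1 Haq) c q Hc Hg Hq Haq) as [Hglue _].
  apply le_intro; [exact Hc|exact Hp|exact Hglue|]; intros b G HG Hb Gp.
  destruct (classic (mem b g)) as [K|K].
  - rewrite glue_in by assumption.
    assert (Gp' : G (restr (restr p g) b)) by (rewrite restr_restr; [exact Gp|exact (suck_incl b g Hgk K)]).
    pose proof (le_val g _ _ b Hgk Hpa K G HG Gp') as Q.
    rewrite (ap_restr p c g b) in Q; [exact Q|exact (cond_fn c p Hc Hp)|exact I|exact K].
  - rewrite glue_out by assumption; exact (le_val c p q b Hc Hpq Hb G HG Gp).
Qed.
Lemma glue_cond' c g a q : mem c (suc k) -> mem g (suc c) -> mem q (Pb c) -> le g a (restr q g) ->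
  mem (glue c g a q) (Pb c) /\ le c (glue c g a q) q /\ restr (glue c g a q) g = a.
Proof.
  intros Hc Hg Hq Haq.
  assert (Hgk : mem g (suc k)).
  { apply sucE in Hg; destruct Hg as [Hg| ->]; [apply k_suck, (suck_mem g c Hc Hg)|exact Hc]. }
  destruct (glue_cond g a Hgk (proj1 Haq) c q Hc Hg Hq Haq) as [H1 H2].
  split; [exact H1|split; [exact H2|]]; apply glue_restr; auto; exact (cond_fn g a Hgk (proj1 Haq)).
Qed.

(** ** Small initial segments *)

Definition domset b : V := sep (un (un (Qb b))) (fun t => domQ b t).
Lemma domsetE b t : mem t (domset b) <-> domQ b t.
Proof.
  unfold domset; rewrite sepE by dd; split; [tauto|]; intros H; split; [|exact H].
  destruct H as (p & _ & H); apply in_nameE in H; exact (mem_op_l _ _ _ H).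
Qed.
Lemma F1_domset : F1 domset. Proof. unfold domset; dd. Qed.
Hint Resolve F1_domset : dfn.

Definition inQ b r t : Prop := forces (Pb b) (Lb b) r (fMem t (Qb b)).
Lemma D3_inQ : D3 inQ. Proof. unfold inQ; dd. Qed.
Hint Resolve D3_inQ : dfn.
(* conditions, and names in [dom(Q_b)], coded up to equivalence by elements of a small set *)
Definition small_seg c g cd : Prop :=
  sml c (img (Pb g) (fun p => ap cd p)) /\
  forall p q, mem p (Pb g) -> mem q (Pb g) -> ap cd p = ap cd q -> le g p q.
Definition small_coord c b K : Prop :=
  sml c (img (domset b) (fun t => ap K t)) /\
  forall r t u, mem r (Pb b) -> domQ b t -> domQ b u -> inQ b r t -> inQ b r u ->
    ap K t = ap K u -> forces (Pb b) (Lb b) r (fEq t u).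
Lemma D3_small_coord : D3 small_coord.
Proof. unfold small_coord; dd. Qed.
Hint Resolve D3_small_coord : dfn.

(** A name is recovered from which conditions force it to have which codes. A code of an element of
    the lottery sum is a relation on the small set [Y] with a point of [Y], so it has a nice name,
    and up to equivalence of conditions there are few nice names. *)
Lemma coord_small c b cd : inacc c -> mem b k -> small_seg c b cd ->
  (forall l, active_stage f b l -> mem l c) -> exists K, small_coord c b K.
Proof.
  intros Ic Hb [Scd Ecd] Hl.
  assert (exists l, mem l c /\ forall l', active_stage f b l' -> l' = l) as (l & Hlc & Ul).
  { destruct (classic (exists l, active_stage f b l)) as [[l H]|N].
    - exists l; split; [apply Hl, H|]; intros l' H'; destruct H as [H _], H' as [H' _].
      apply sat_related in H, H'; destruct Hf as [[_ Ff] _]; exact (Ff b l' l (conj H' H)).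
    (* At an inactive stage any element of [c] will do, since the lottery sum consists of the top
       alone. *)
    - exists emp; split; [apply inacc_emp, Ic|]; intros l' H'; destruct N; eauto. }
  set (Y := suc4 l).
  assert (HY : mem Y c) by (unfold Y, suc4; repeat apply (inacc_suc c Ic); exact Hlc).
  set (C := img (Pb b) (fun p => ap cd p)).
  assert (CE : forall p, mem p (Pb b) -> mem (ap cd p) C) by (intros p Hp; apply imgE; [dd|eauto]).
  set (pr := fun x y => opn (Pb b) (chk (Pb b) x) (chk (Pb b) y)).
  assert (Dpr : F2 pr).
  { unfold pr; apply (F2_lift (opn (Pb b))); [apply F2_opn| |]; dd. }
  (* [nm a] is the nice name given by [a]: it receives the pair [⟨x, y⟩] when the filter contains a
     condition whose code is paired with [⟨x, y⟩] in [a]. *)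
  set (nm := fun a => sep (prod (un (img Y (fun x => img Y (fun y => pr x y)))) (Pb b))
     (fun z => exists x y d, z = op (pr x y) d /\ mem x Y /\ mem y Y /\ mem (op (ap cd d) (op x y)) a)).
  assert (Dnm : F1 nm) by (unfold nm; dd).
  assert (nmE : forall a G (HG : gen b G) v, mem v (vl HG (nm a)) <-> exists x y d,
     mem x Y /\ mem y Y /\ G d /\ mem (op (ap cd d) (op x y)) a /\ v = op (vj HG x) (vj HG y)).
  { intros a G HG v; rewrite vl_mem; split.
    - intros (s & p & Hs & Gp & ->); unfold nm in Hs; apply sepE in Hs; [|dd].
      destruct Hs as [_ (x & y & d & E & Hx & Hy & K)]; apply op_inj in E; destruct E; subst s d.
      exists x, y, p; repeat (split; [assumption|]); apply (gv_opn (Pb b) (Lb b) (PO b) HG).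
    - intros (x & y & d & Hx & Hy & Gd & K & ->); exists (pr x y), d.
      split; [|split; [exact Gd|symmetry; apply (gv_opn (Pb b) (Lb b) (PO b) HG)]].
      unfold nm; apply sepE; [dd|]; split; [|exists x, y, d; auto].
      apply prod_op; split; [|exact (generic_sub _ _ _ HG d Gd)].
      apply unE; exists (img Y (fun y => pr x y)); split; apply imgE; dd; eauto. }
  set (cdf := fun d a xi t => forces (Pb b) (Lb b) d (is_code (chk (Pb b) Y) (nm a) (chk (Pb b) xi) t)).
  assert (Dcdf : D4 cdf).
  { apply (D_s8 (fun e => forces (e 0) (e 1) (e 2) (is_code (e 3) (e 4) (e 5) (e 6)))
      (fun _ => Pb b) (fun _ => Lb b) (fun e => e 0) (fun _ => chk (Pb b) Y) (fun e => nm (e 1))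
      (fun e => chk (Pb b) (e 2)) (fun e => e 3) (fun e => e 3)); [dd|dd|dd|dd|dd|dd|dd|dd|].
    apply (D_UD (fun V e => forces (e 0) (e 1) (e 2) (is_code (e 3) (e 4) (e 5) (e 6)))), UD_forces; rf. }
  (* The code of a name records which conditions force it to be coded by which nice name and
     point. *)
  set (Kt := fun t => sep (prod C (prod (pow (prod C (prod Y Y))) Y))
    (fun z => exists d a xi, z = op (ap cd d) (op a xi) /\ mem d (Pb b) /\ cdf d a xi t)).
  assert (DKt : F1 Kt) by (unfold Kt; dd).
  exists (lam (domset b) Kt); split.
  { apply (sml_sub c (pow (prod C (prod (pow (prod C (prod Y Y))) Y)))).
    - assert (SY := sml_ord c Y HY). repeat first [apply (sml_pow c Ic) | apply (sml_prod c Ic) | assumption].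
    - intros z Hz; apply imgE in Hz; [|dd]; destruct Hz as (t & Ht & ->).
      rewrite ap_lam by assumption; apply powE; intros w Hw; apply sepE in Hw; [tauto|dd]. }
  intros r t u Hr Ht Hu HtQ HuQ E.
  rewrite !ap_lam in E by (assumption || (apply domsetE; assumption)).
  apply f_eq; [exact Hr|]; intros G HG Gr.
  unfold inQ in HtQ, HuQ; rewrite f_mem in HtQ, HuQ by exact Hr.
  destruct (stage_lottery b (PO b) Hb G HG) as (T & HL & HT & _ & HTl & HTn).
  destruct (lottery_codes T _ _ (vj HG l) (vl HG t) HL) as (Ev & xv & IE & Hxv & Kcode).
  { intros v w o K; split; [exact (HT _ _ _ K)|].
    destruct (classic (exists l', active_stage f b l')) as [[l' Hl']|N].
    - rewrite <- (Ul l' Hl'); exact (HTl l' Hl' _ _ _ K).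
    - destruct (HTn N _ _ _ K). }
  { exact (HtQ G HG Gr). }
  assert (EY : suc4 (vj HG l) = vj HG Y).
  { unfold suc4, Y, vj, suc4; rewrite !gj_suc; reflexivity. }
  rewrite EY in *.
  destruct (gv_surj (Pb b) (Lb b) (PO b) HG Ev) as [En EEn].
  apply (gj_mem (Pb b) (Lb b) (PO b) HG) in Hxv; destruct Hxv as (xi & Hxi & ->).
  (* The nice name of the actual relation [Ev], read off from its name [En]. Its value is [Ev]
     because conditions with equal codes are equivalent. *)
  set (a := sep (prod C (prod Y Y)) (fun z => exists d x y, z = op (ap cd d) (op x y) /\ mem d (Pb b) /\
     forces_mem (Pb b) (Lb b) (pr x y) En d)).
  assert (aE : forall z x y, mem (op z (op x y)) a <-> mem x Y /\ mem y Y /\ exists d, z = ap cd d /\ mem d (Pb b) /\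
     forces_mem (Pb b) (Lb b) (pr x y) En d).
  { intros z x y; unfold a; rewrite sepE by dd; rewrite !prod_op; split.
    - intros [(_ & Hx & Hy) (d & x' & y' & Eq & Hd & K)]; apply op_inj in Eq; destruct Eq as [-> Eq].
      apply op_inj in Eq; destruct Eq; subst; eauto 6.
    - intros (Hx & Hy & d & -> & Hd & K); split; [auto|eauto 8]. }
  assert (Eva : vl HG (nm a) = Ev).
  { apply zf_ext; intros v; rewrite nmE; split.
    - intros (x & y & d & Hx & Hy & Gd & K & ->); apply aE in K; destruct K as (_ & _ & d' & Ed & Hd' & K).
      assert (Gd' : G d').
      { apply (gen_up b G HG d); [exact Gd|]; apply Ecd; [exact (generic_sub _ _ _ HG d Gd)|exact Hd'|exact Ed]. }
      pose proof (proj1 (f_mem b d' (pr x y) En Hd') K G HG Gd') as Q.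
      rewrite EEn; unfold vl, pr in Q; rewrite gv_opn in Q; exact Q.
    - intros Hv; pose proof (IE v Hv) as Hv'; apply prodE in Hv'; destruct Hv' as (x' & y' & Hx & Hy & Ev').
      apply (gj_mem (Pb b) (Lb b) (PO b) HG) in Hx, Hy; destruct Hx as (x & Hx & ->), Hy as (y & Hy & ->).
      assert (Q : mem (gv (Pb b) (Lb b) (PO b) HG (pr x y)) (gv (Pb b) (Lb b) (PO b) HG En)).
      { unfold pr; rewrite gv_opn, <- EEn; unfold gj in Ev'; rewrite <- Ev'; exact Hv. }
      apply (gtruth_mem (Pb b) (Lb b) (PO b) G HG) in Q; destruct Q as (d & Gd & K).
      exists x, y, d; split; [exact Hx|split; [exact Hy|split; [exact Gd|split; [|exact Ev']]]].
      apply aE; split; [exact Hx|split; [exact Hy|exists d; split; [reflexivity|split; [|exact K]]]].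
      exact (generic_sub _ _ _ HG d Gd). }
  assert (Rc : reified (fun (W : zfc_model) (e : nat -> W) => is_code (e 0) (e 1) (e 2) (e 3))) by rf.
  assert (K1 : gext (Pb b) (Lb b) (PO b) G HG ⊨ is_code (vj HG Y) (vl HG (nm a)) (vj HG xi) (vl HG t)).
  { rewrite Eva; apply sat_is_code; exact Kcode. }
  apply (gext_truth (Pb b) (Lb b) (PO b) (fun W e => is_code (e 0) (e 1) (e 2) (e 3)) G HG
    (scons (chk (Pb b) Y) (scons (nm a) (scons (chk (Pb b) xi) (fun _ => t)))) Rc) in K1.
  destruct K1 as (p & Gp & K1).
  assert (Hp := generic_sub _ _ _ HG p Gp).
  assert (M : mem (op (ap cd p) (op a xi)) (Kt t)).
  { unfold Kt; apply sepE; [dd|]; split; [|exists p, a, xi; auto].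
    rewrite !prod_op; split; [exact (CE p Hp)|split; [|exact Hxi]].
    apply powE; intros z Hz; unfold a in Hz; apply sepE in Hz; [tauto|dd]. }
  (* The same entry occurs in the code of [u], so a condition of the filter forces the same relation
     and point to code [u]; and codes determine what they code. *)
  rewrite E in M; unfold Kt in M; apply sepE in M; [|dd].
  destruct M as [_ (d & a' & xi' & Eq & Hd & K2)]; apply op_inj in Eq; destruct Eq as [Ed Eq].
  apply op_inj in Eq; destruct Eq; subst a' xi'.
  assert (Gd : G d) by exact (gen_up b G HG p d Gp (Ecd p d Hp Hd Ed)).
  unfold cdf in K2; rewrite (fo4 (Pb b) (Lb b) (PO b) HV (fun W => is_code)) in K2; [|exact Rc|exact Hd].
  specialize (K2 G HG Gd); apply sat_is_code in K2.
  change (codes (vj HG Y) (vl HG (nm a)) (vj HG xi) (vl HG u)) in K2; rewrite Eva in K2.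
  exact (codes_unique _ _ _ _ _ Kcode K2).
Qed.

(** A condition is coded by the sequence of the codes of its coordinates. Equal codes make two
    values equal only below a condition forcing both into the iterand, so equivalence is obtained by
    a further induction along the coordinates. *)
Lemma seg_small c : inacc c -> mem c (suc k) -> forall g, mem g c ->
  (forall b l, mem b g -> active_stage f b l -> mem l c) -> exists cd, small_seg c g cd.
Proof.
  intros Ic Hck g; induction g as [g IH] using mem_ind; intros Hg Hl.
  assert (Oc := suck_ord c Hck).
  assert (Hgk : mem g (suc k)) by (apply k_suck, (suck_mem g c Hck Hg)).
  destruct (choose (small_coord c) g) as (Kf & DKf & HKf).
  { dd. }
  { intros b Hb; destruct (IH b Hb) as [cd Hcd].
    - exact (ord_trans _ _ _ Oc Hb Hg).
    - intros b' l Hb'; apply Hl; exact (ord_trans _ _ _ (ord_mem _ _ Oc Hg) Hb' Hb).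
    - apply (coord_small c b cd Ic (suck_mem b g Hgk Hb) Hcd); intros l; apply Hl, Hb. }
  set (code := fun p => lam g (fun b => ap (Kf b) (ap p b))).
  assert (Dcode : F1 code) by (unfold code; dd).
  exists (lam (Pb g) code); split.
  - set (U := un (img g (fun b => img (domset b) (fun t => ap (Kf b) t)))).
    apply (sml_sub c (pow (prod g U))).
    + apply (sml_pow c Ic), (sml_prod c Ic); [apply sml_ord, Hg|].
      apply (sml_union c Ic).
      * apply sml_img; [dd|apply sml_ord, Hg].
      * intros X HX; apply imgE in HX; [|dd]; destruct HX as (b & Hb & ->); apply HKf, Hb.
    + intros z Hz; apply imgE in Hz; [|dd]; destruct Hz as (p & Hp & ->); rewrite ap_lam by assumption.
      apply powE; intros w Hw; unfold code in Hw; apply lamE in Hw; [|dd]; destruct Hw as (b & Hb & ->).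
      apply prod_op; split; [exact Hb|]; apply unE; exists (img (domset b) (fun t => ap (Kf b) t)).
      split; apply imgE; [dd|eauto|dd|].
      exists (ap p b); split; [|reflexivity]; apply domsetE.
      apply (condE g p Hgk) in Hp; destruct Hp as (_ & Q & _); apply (Q b Hb).
  - intros p q Hp Hq E; rewrite !ap_lam in E by assumption.
    assert (Eb : forall b, mem b g -> ap (Kf b) (ap p b) = ap (Kf b) (ap q b)).
    { intros b Hb; assert (Q : ap (code p) b = ap (code q) b) by (rewrite E; reflexivity).
      unfold code in Q; rewrite !ap_lam in Q by (dd || assumption); exact Q. }
    assert (H : forall b, mem b (suc g) -> le b (restr p b) (restr q b)).
    { intros b; induction b as [b IHb] using mem_ind; intros Hb.
      assert (Og := suck_ord g Hgk).
      assert (Hbk : mem b (suc k)).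
      { apply sucE in Hb; destruct Hb as [Hb| ->]; [apply k_suck, (suck_mem b g Hgk Hb)|exact Hgk]. }
      assert (I : incl b g) by (apply sucE in Hb; destruct Hb as [D| ->]; [exact (suck_incl b g Hgk D)|intros z; auto]).
      apply le_intro; [exact Hbk|exact (cond_restr' g b p Hgk Hb Hp)|exact (cond_restr' g b q Hgk Hb Hq)|].
      intros x G HG Hx Gx; assert (Ix := suck_incl x b Hbk Hx).
      rewrite restr_restr in Gx by exact Ix.
      assert (Hxg := I x Hx).
      rewrite (ap_restr p g b x), (ap_restr q g b x) by (assumption || eauto using cond_fn).
      assert (Lx : le x (restr p x) (restr q x)) by (apply (IHb x Hx), sucE; auto).
      apply (condE g p Hgk) in Hp as Hp'; destruct Hp' as (_ & Qp & _); destruct (Qp x Hxg) as (P1 & P2 & P3).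
      apply (condE g q Hgk) in Hq as Hq'; destruct Hq' as (_ & Qq & _); destruct (Qq x Hxg) as (R1 & R2 & R3).
      assert (Heq : forces (Pb x) (Lb x) (restr p x) (fEq (ap p x) (ap q x))).
      { destruct (HKf x Hxg) as [_ Q]; apply Q; try assumption.
        - exact (forces_mono _ _ (PO x) _ _ _ Lx R3).
        - exact (Eb x Hxg). }
      rewrite f_eq in Heq by exact P1; rewrite <- (Heq G HG Gx).
      apply (val_refl x (suck_mem x g Hgk Hxg)); exact (cond_val g p x Hgk Hp Hxg G HG Gx). }
    specialize (H g (mem_suc g)); rewrite !restr_id in H by (eauto using cond_fn); exact H.
Qed.

(** ** Conditions built coordinatewise *)

Lemma fn_on_unique s b b' : fn_on s b -> fn_on s b' -> b = b'.
Proof. intros [_ H] [_ H']; apply zf_ext; intros z; rewrite H, H'; tauto. Qed.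
Lemma suck_max c x y : mem c (suc k) -> mem x c -> mem y c -> exists m, mem m c /\ incl x m /\ incl y m.
Proof.
  intros Hc Hx Hy; assert (Oc := suck_ord c Hc); assert (Ox := ord_mem _ _ Oc Hx); assert (Oy := ord_mem _ _ Oc Hy).
  destruct (ord_total x Ox y Oy) as [D|[D|D]].
  - exists y; split; [exact Hy|split; [exact (proj1 Oy x D)|intros z; auto]].
  - subst y; exists x; split; [exact Hx|split; intros z; auto].
  - exists x; split; [exact Hx|split; [intros z; auto|exact (proj1 Ox y D)]].
Qed.
Lemma not_mem_suc b g : mem b (suc k) -> mem g (suc k) -> ~ mem b g -> mem g (suc b).
Proof.
  intros Hb Hg N; apply sucE.
  destruct (ord_total g (suck_ord g Hg) b (suck_ord b Hb)) as [D|[D|D]]; tauto.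
Qed.
Lemma suc_incl b c : mem c (suc k) -> mem b (suc c) -> incl b c.
Proof. intros Hc Hb; apply sucE in Hb; destruct Hb as [D| ->]; [exact (suck_incl b c Hc D)|intros z; auto]. Qed.
Lemma suc_suck b c : mem c (suc k) -> mem b (suc c) -> mem b (suc k).
Proof. intros Hc Hb; apply sucE in Hb; destruct Hb as [D| ->]; [apply k_suck, (suck_mem b c Hc D)|exact Hc]. Qed.

(** One hypothesis supplies the next coordinate, the other bounds the support at inaccessible
    stages. Since both are stated through [Rl], each use can make [Rl] prescribe the value [e b] at
    the coordinates that are to stay idle. *)
Lemma tail_build g r (Rl : V -> V -> V -> Prop) : D3 Rl -> mem g k -> mem r (Pb g) ->
  (forall b p, mem b k -> ~ mem b g -> mem p (Pb b) -> restr p g = r ->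
     (forall x, mem x b -> ~ mem x g -> Rl x (restr p x) (ap p x)) ->
     exists x, domQ b x /\ inQ b p x /\ Rl b p x) ->
  (forall c p, inacc c -> mem c (suc k) -> mem g c -> fn_on p c ->
     (forall x, mem x c -> ~ mem x g -> Rl x (restr p x) (ap p x)) ->
     exists d, mem d c /\ forall b, mem b c -> ~ mem b d -> empf b (ap p b)) ->
  exists q, mem q (Pb k) /\ restr q g = r /\ forall b, mem b k -> ~ mem b g -> Rl b (restr q b) (ap q b).
Proof.
  intros DR Hg Hr step supp.
  assert (Hgk := k_suck g Hg); assert (Fr := cond_fn g r Hgk Hr).
  (* The history [s] determines the coordinate [b] as its domain. Below [g] the values of [r] are
     copied; from [g] on the requirement is conditional on [s] being a condition that extends [r],
     and [claim] shows that it always is. *)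
  set (R := fun s x => exists b, fn_on s b /\ ((mem b g /\ x = ap r b) \/
     (~ mem b g /\ (mem s (Pb b) -> restr s g = r -> domQ b x /\ inQ b s x /\ Rl b s x)))).
  assert (DR2 : D2 R) by (unfold R; dd).
  assert (claim : forall F, F1 F -> forall b, mem b (suc k) -> (forall a, mem a b -> R (lam a F) (F a)) ->
    mem (lam b F) (Pb b) /\ (mem g (suc b) -> restr (lam b F) g = r) /\
    forall x, mem x b -> ~ mem x g -> domQ x (F x) /\ inQ x (lam x F) (F x) /\ Rl x (lam x F) (F x)).
  { intros F HF b; induction b as [b IH] using mem_ind; intros Hb HR.
    assert (Ob := suck_ord b Hb).
    assert (lo : forall x, mem x b -> mem x g -> F x = ap r x).
    { intros x Hx Hxg; destruct (HR x Hx) as (b' & Hb' & [[_ E]|[N _]]);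
        rewrite (fn_on_unique _ _ _ Hb' (fn_lam x F HF)) in *; tauto. }
    assert (hi : forall x, mem x b -> ~ mem x g -> domQ x (F x) /\ inQ x (lam x F) (F x) /\ Rl x (lam x F) (F x)).
    { intros x Hx Nx; assert (Hxk := suck_mem x b Hb Hx).
      destruct (IH x Hx (k_suck x Hxk)) as (Q1 & Q2 & _).
      { intros a Ha; apply HR, (ord_trans _ _ _ Ob Ha Hx). }
      destruct (HR x Hx) as (b' & Hb' & [[Q _]|[_ Q]]);
        rewrite (fn_on_unique _ _ _ Hb' (fn_lam x F HF)) in *; [tauto|].
      apply Q; [exact Q1|]; apply Q2, not_mem_suc; auto using k_suck. }
    assert (Rg : mem g (suc b) -> restr (lam b F) g = r).
    { intros Hgb; rewrite restr_lam by (assumption || exact (suc_incl g b Hb Hgb)).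
      apply (fn_ext _ _ g); [apply fn_lam, HF|exact Fr|]; intros x Hx; rewrite ap_lam by assumption.
      apply lo; [apply (suc_incl g b Hb Hgb), Hx|exact Hx]. }
    split; [|split; [exact Rg|exact hi]].
    destruct (classic (mem b (suc g))) as [Hbg|Nbg].
    - assert (E : lam b F = restr r b).
      { apply (fn_ext _ _ b); [apply fn_lam, HF|exact (fn_on_restr r g b Fr (suc_incl b g Hgk Hbg))|].
        intros x Hx; rewrite ap_lam, (ap_restr r g b x Fr (suc_incl b g Hgk Hbg) Hx) by assumption.
        apply lo; [exact Hx|apply (suc_incl b g Hgk Hbg), Hx]. }
      rewrite E; exact (cond_restr' g b r Hgk Hbg Hr).
    - assert (Hgb : mem g b).
      { destruct (ord_total g (suck_ord g Hgk) b Ob) as [D|[D|D]]; [exact D| |];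
          destruct Nbg; apply sucE; auto. }
      apply cond_intro; [exact Hb|apply fn_lam, HF| |].
      + intros c Hc Ic; assert (Icb := suc_incl c b Hb Hc); assert (Hck := suc_suck c b Hb Hc).
        destruct (classic (mem g c)) as [Hgc|Ngc].
        * destruct (supp c (lam c F) Ic Hck Hgc (fn_lam c F HF)) as (d & Hd & K).
          { intros x Hx Nx; rewrite restr_lam by (assumption || exact (suck_incl x c Hck Hx)).
            rewrite ap_lam by assumption; apply hi; auto. }
          exists d; split; [exact Hd|]; intros x Hx Nx; specialize (K x Hx Nx).
          rewrite ap_lam in * by auto; exact K.
        * assert (Hcg := not_mem_suc g c Hgk Hck Ngc).
          destruct (cond_support g r Hgk Hr c Hcg Ic) as (d & Hd & K).
          exists d; split; [exact Hd|]; intros x Hx Nx; rewrite ap_lam by auto.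
          rewrite lo; [exact (K x Hx Nx)|auto|exact (suc_incl c g Hgk Hcg x Hx)].
      + intros x Hx _; rewrite restr_lam by (assumption || exact (suck_incl x b Hb Hx)).
        rewrite ap_lam by assumption.
        destruct (classic (mem x g)) as [Hxg|Nx]; [|split; apply (hi x Hx Nx)].
        apply (condE g r Hgk) in Hr as Hr'; destruct Hr' as (_ & Q & _); destruct (Q x Hxg) as (_ & Q1 & Q2).
        rewrite (lo x Hx Hxg); split; [exact Q1|].
        replace (lam x F) with (restr r x); [exact Q2|].
        assert (Ixg := suck_incl x g Hgk Hxg).
        apply (fn_ext _ _ x); [exact (fn_on_restr r g x Fr Ixg)|apply fn_lam, HF|].
        intros y Hy; rewrite ap_lam, (ap_restr r g x y Fr Ixg Hy) by assumption.
        symmetry; apply lo; [exact (ord_trans _ _ _ Ob Hy Hx)|exact (Ixg y Hy)]. }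
  destruct (dep_choice (un (img k (fun b => domset b))) k R DR2 Ok) as (F & HF & KF).
  { intros b F Hb HF H; assert (Hbk := k_suck b Hb).
    assert (inX : forall x, domQ b x -> mem x (un (img k (fun b => domset b)))).
    { intros x Hx; apply unE; exists (domset b); split; [apply imgE; [dd|eauto]|apply domsetE, Hx]. }
    destruct (claim F HF b Hbk) as (Q1 & Q2 & Q3); [intros a Ha; apply H, Ha|].
    destruct (classic (mem b g)) as [Hbg|Nb].
    - exists (ap r b); split.
      + apply inX; apply (condE g r Hgk) in Hr as Hr'; destruct Hr' as (_ & Q & _); apply (Q b Hbg).
      + exists b; split; [apply fn_lam, HF|auto].
    - destruct (step b (lam b F) Hb Nb Q1) as (x & H1 & H2 & H3).
      + apply Q2, not_mem_suc; auto.
      + intros x Hx Nx; rewrite restr_lam by (assumption || exact (suck_incl x b Hbk Hx)).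
        rewrite ap_lam by assumption; apply Q3; assumption.
      + exists x; split; [apply inX, H1|exists b; split; [apply fn_lam, HF|auto]]. }
  destruct (claim F HF k (mem_suc k)) as (Q1 & Q2 & Q3); [intros a Ha; apply KF, Ha|].
  exists (lam k F); split; [exact Q1|split; [apply Q2, Hgk|]].
  intros b Hb Nb; rewrite restr_lam by (assumption || exact (suck_incl b k (mem_suc k) Hb)).
  rewrite ap_lam by assumption; apply Q3; assumption.
Qed.

(** Equivalence classes of conditions. Unlike the conditions themselves, they form a small set. *)
Definition cls g a : V := sep (Pb g) (fun a' => le g a a' /\ le g a' a).
Lemma F2_cls : F2 cls. Proof. unfold cls; dd. Qed.
Hint Resolve F2_cls : dfn.
Lemma cls_le g a a' : mem a (Pb g) -> cls g a = cls g a' -> le g a a'.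
Proof.
  intros Ha E; assert (K : mem a (cls g a)) by (apply sepE; [dd|]; auto using le_refl).
  rewrite E in K; apply sepE in K; [tauto|dd].
Qed.
Lemma cls_eq g a a' : le g a a' -> le g a' a -> cls g a = cls g a'.
Proof.
  intros H K; apply zf_ext; intros z; unfold cls; rewrite !sepE by dd.
  split; intros (Hz & H1 & H2); eauto using le_trans.
Qed.
Lemma cls_small c g : inacc c -> mem c (suc k) -> mem g c ->
  (forall b l, mem b g -> active_stage f b l -> mem l c) -> sml c (img (Pb g) (fun a => cls g a)).
Proof.
  intros Ic Hc Hg Hl; destruct (seg_small c Ic Hc g Hg Hl) as (cd & S & K).
  apply (sml_rel c (img (Pb g) (fun p => ap cd p)) _ (fun z X => exists a, mem a (Pb g) /\ z = ap cd a /\ X = cls g a)).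
  - dd.
  - exact S.
  - intros X HX; apply imgE in HX; [|dd]; destruct HX as (a & Ha & ->).
    exists (ap cd a); split; [apply imgE; [dd|eauto]|eauto].
  - intros z X X' _ _ (a & Ha & -> & ->) (a' & Ha' & E & ->); apply cls_eq; apply K; auto.
Qed.
Lemma active_k b l : active_stage f b l -> mem l k.
Proof. intros [H _]; apply sat_related in H; apply (proj2 Hf b l H). Qed.

(** * Amalgamation over an initial segment, and distributivity of the tail *)

Section Core.
Context (e : V -> V) (De : F1 e) (Ke : forall b, mem b k -> domQ b (e b) /\ empf b (e b)).
Lemma vl_e b G (HG : gen b G) : mem b k -> vl HG (e b) = emp.
Proof. intros Hb; destruct (Ke b Hb) as [_ K]; rewrite empfE in K; apply K. Qed.

(* The mixed condition [q'] is, below each of the conditions [a ≤ q↾g] of a dense set, at least as strong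
   as the chosen element [qf z] of [U]. *)
Lemma step_lemma g q (U : V -> Prop) : mem g k -> mem q (Pb k) -> D1 U ->
  (forall p p', U p -> le k p' p -> U p') -> (forall p, le k p q -> exists p', le k p' p /\ U p') ->
  exists q', le k q' q /\ restr q' g = restr q g /\
    forall a, le g a (restr q g) -> exists a', le g a' a /\ U (glue k g a' q').
Proof.
  intros Hg Hq DU Uopen dens.
  assert (Hkk := mem_suc k); assert (Hgk := k_suck g Hg); assert (Hgs : mem g (suc k)) by exact Hgk.
  set (r := restr q g); assert (Hr : mem r (Pb g)) by exact (cond_restr k g q Hkk Hg Hq).
  (* The members of [U] are indexed by the classes of their initial segments, so that there are few
     indices. *)
  set (Z := sep (img (Pb g) (fun a => cls g a)) (fun z => exists p, le k p q /\ U p /\ cls g (restr p g) = z)).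
  assert (ZE : forall z, mem z Z -> exists p, le k p q /\ U p /\ cls g (restr p g) = z).
  { intros z Hz; unfold Z in Hz; apply sepE in Hz; [tauto|dd]. }
  assert (ZI : forall p, le k p q -> U p -> mem (cls g (restr p g)) Z).
  { intros p Hp Up; unfold Z; apply sepE; [dd|]; split; [|eauto]; apply imgE; [dd|].
    exists (restr p g); split; [exact (cond_restr k g p Hkk Hg (proj1 Hp))|reflexivity]. }
  destruct (choose (fun z p => le k p q /\ U p /\ cls g (restr p g) = z) Z) as (qf & Dqf & Kqf); [dd|exact ZE|].
  destruct (ranking Z) as (rho & Drho & Orho & Irho).
  (* Here [z] is the first index whose chosen condition has an initial segment compatible with [a],
     and [a] lies below that segment. Such [a] play the part of a maximal antichain. *)
  set (A := fun a z => mem z Z /\ le g a (restr (qf z) g) /\ le g a r /\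
     forall z', mem z' Z -> mem (rho z') (rho z) -> forall d, le g d a -> ~ le g d (restr (qf z') g)).
  assert (DA : D2 A) by (unfold A; dd).
  assert (Adens : forall a0, le g a0 r -> exists a z, le g a a0 /\ A a z).
  { intros a0 Ha0.
    destruct (glue_cond' k g a0 q Hkk Hgs Hq Ha0) as (H1 & H2 & H3).
    destruct (dens _ H2) as (p & Hp & Up).
    assert (Hpq : le k p q) by (eapply le_trans; eauto).
    assert (Hpa : le g (restr p g) a0).
    { rewrite <- H3; exact (le_restr k g _ _ Hkk Hgs Hp). }
    destruct (wf_min (fun x => exists z, mem z Z /\ x = rho z /\ exists d, le g d (restr (qf z) g) /\ le g d a0))
      as (x & (z & Hz & -> & d & Hd1 & Hd2) & Mx).
    { set (z := cls g (restr p g)); assert (Hz : mem z Z) by (apply ZI; assumption).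
      exists (rho z), z; split; [exact Hz|split; [reflexivity|exists (restr p g); split; [|exact Hpa]]].
      apply cls_le; [exact (cond_restr k g p Hkk Hg (proj1 Hp))|symmetry; apply (Kqf z Hz)]. }
    exists d, z; split; [exact Hd2|]; split; [exact Hz|split; [exact Hd1|split; [exact (le_trans g _ _ _ Hd2 Ha0)|]]].
    intros z' Hz' Hlt d' Hd' Q; apply (Mx (rho z') Hlt); exists z'; split; [exact Hz'|split; [reflexivity|]].
    exists d'; split; [exact Q|exact (le_trans g _ _ _ Hd' Hd2)]. }
  assert (Auniq : forall a z a' z' d, A a z -> A a' z' -> le g d a -> le g d a' -> z = z').
  { intros a z a' z' d (Hz & Ha & _ & F) (Hz' & Ha' & _ & F') Hd Hd'.
    destruct (ord_total (rho z) (Orho z Hz) (rho z') (Orho z' Hz')) as [K|[K|K]].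
    - exact (False_ind _ (F' z Hz K d Hd' (le_trans g _ _ _ Hd Ha))).
    - apply Irho; assumption.
    - exact (False_ind _ (F z' Hz' K d Hd (le_trans g _ _ _ Hd' Ha'))). }
  (* The coordinates at which the amalgam takes the default value, to keep its support bounded: the
     inactive ones, and those at which no chosen condition does anything. *)
  set (deflt := fun b => ~ (exists l, active_stage f b l) \/ forall z, mem z Z -> empf b (ap (qf z) b)).
  assert (Ddef : D1 deflt) by (unfold deflt, active_stage; dd).
  set (Rl := fun b p x => (deflt b -> x = e b) /\
    (forall a z, A a z -> forces (Pb b) (Lb b) (glue b g a p) (related (Rb b) x (ap (qf z) b))) /\
    forces (Pb b) (Lb b) p (related (Rb b) x (ap q b))).
  assert (DRl : D3 Rl) by (unfold Rl, glue; dd).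
  assert (part : forall b p, mem b (suc k) -> mem g (suc b) -> mem p (Pb b) -> restr p g = r ->
    (forall x, mem x b -> ~ mem x g -> Rl x (restr p x) (ap p x)) ->
    le b p (restr q b) /\ forall a z, A a z -> le b (glue b g a p) (restr (qf z) b)).
  { intros b p Hb Hgb Hp Er HR.
    assert (Igb := suc_incl g b Hb Hgb); assert (Fp := cond_fn b p Hb Hp).
    assert (Fq := cond_fn k q Hkk Hq); assert (Ibk := suc_incl b k Hkk Hb).
    assert (Hqb : mem (restr q b) (Pb b)) by exact (cond_restr' k b q Hkk Hb Hq).
    split.
    - apply le_intro; [exact Hb|exact Hp|exact Hqb|]; intros x G HG Hx Gx; assert (Hxk := suck_mem x b Hb Hx).
      rewrite (ap_restr q k b x Fq Ibk Hx).
      destruct (classic (mem x g)) as [Hxg|Nx].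
      + assert (Ex : ap p x = ap q x).
        { rewrite <- (ap_restr p b g x Fp Igb Hxg), Er; unfold r.
          apply (ap_restr q k g x Fq); [exact (suck_incl g k Hkk Hg)|exact Hxg]. }
        rewrite <- Ex; apply (val_refl x Hxk); exact (cond_val b p x Hb Hp Hx G HG Gx).
      + destruct (HR x Hx Nx) as (_ & _ & Q).
        exact (proj1 (f_rel x _ _ _ _ (cond_restr b x p Hb Hx Hp)) Q G HG Gx).
    - intros a z HA; pose proof HA as (Hz & Haz & Har & _); destruct (Kqf z Hz) as (Hzq & _ & _).
      assert (Hqz : mem (qf z) (Pb k)) by apply Hzq.
      destruct (glue_cond' b g a p Hb Hgb Hp) as (G1 & G2 & G3); [rewrite Er; exact Har|].
      apply le_intro; [exact Hb|exact G1|exact (cond_restr' k b _ Hkk Hb Hqz)|].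
      intros x G HG Hx Gx; assert (Hxk := suck_mem x b Hb Hx).
      rewrite (ap_restr _ k b x (cond_fn k _ Hkk Hqz) Ibk Hx).
      destruct (classic (mem x g)) as [Hxg|Nx].
      + rewrite glue_in by assumption.
        assert (Fa := cond_fn g a Hgk (proj1 Haz)).
        rewrite glue_restr_lo in Gx; [|exact Hb|exact Hgb|exact Fa|apply sucE; auto].
        pose proof (le_val g a _ x Hgk Haz Hxg G HG Gx) as Q.
        rewrite (ap_restr _ k g x (cond_fn k _ Hkk Hqz)) in Q; [exact Q|exact (suck_incl g k Hkk Hg)|exact Hxg].
      + rewrite glue_out by assumption; destruct (HR x Hx Nx) as (_ & Q & _); specialize (Q a z HA).
        rewrite <- (glue_restr_hi b g a p x Hb Hx Fp) in Q.
        exact (proj1 (f_rel x _ _ _ _ (cond_restr b x _ Hb Hx G1)) Q G HG Gx). }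
  destruct (tail_build g r Rl DRl Hg Hr) as (q' & Hq' & Er' & HR').
  - intros b p Hb Nb Hp Er HR; assert (Hbk := k_suck b Hb).
    assert (Hgb := not_mem_suc b g Hbk Hgk Nb).
    destruct (part b p Hbk Hgb Hp Er HR) as [Lq Lz].
    assert (gl : forall a z, A a z -> mem (glue b g a p) (Pb b) /\ le b (glue b g a p) p /\ restr (glue b g a p) g = a).
    { intros a z (Hz & Haz & Har & _); apply glue_cond'; auto; rewrite Er; exact Har. }
    assert (dens' : forall c0, le b c0 p -> exists c a z, le b c c0 /\ A a z /\ le b c (glue b g a p)).
    { intros c0 Hc0.
      assert (H0 : le g (restr c0 g) r) by (rewrite <- Er; exact (le_restr b g c0 p Hbk Hgb Hc0)).
      destruct (Adens _ H0) as (a & z & Ha & HA).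
      destruct (glue_cond' b g a c0 Hbk Hgb (proj1 Hc0) Ha) as (C1 & C2 & C3).
      exists (glue b g a c0), a, z; split; [exact C2|split; [exact HA|]].
      apply glue_le; auto.
      - rewrite Er; apply HA.
      - eapply le_trans; eauto.
      - rewrite C3; apply le_refl; apply HA. }
    assert (meets : forall G (HG : gen b G), G p -> exists a z, A a z /\ G (glue b g a p)).
    { intros G HG Gp.
      destruct (gen_below (Pb b) (Lb b) (PO b) G HG (fun c => exists a z, A a z /\ le b c (glue b g a p)) p Gp)
        as (c & Gc & (a & z & HA & Hc) & _).
      - intros c0 Hc0; destruct (dens' c0 Hc0) as (c & a & z & H1 & H2 & H3); exists c; split; [exact H1|eauto].
      - unfold glue; dd.
      - exists a, z; split; [exact HA|exact (gen_up b G HG _ _ Gc Hc)]. }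
    assert (zval : forall a z G (HG : gen b G), A a z -> G (glue b g a p) -> G (restr (qf z) b) /\ mem (vl HG (ap (qf z) b)) (vl HG (Qb b)) /\
       mem (op (vl HG (ap (qf z) b)) (vl HG (ap q b))) (vl HG (Rb b))).
    { intros a z G HG HA Ga; assert (Gz := gen_up b G HG _ _ Ga (Lz a z HA)).
      pose proof HA as (Hz & _); destruct (Kqf z Hz) as (Hzq & _); split; [exact Gz|split].
      - exact (cond_val k (qf z) b Hkk (proj1 Hzq) Hb G HG Gz).
      - exact (le_val k (qf z) q b Hkk Hzq Hb G HG Gz). }
    destruct (classic (deflt b)) as [Hd|Nd].
    + exists (e b); split; [apply (Ke b Hb)|split].
      * apply f_mem; [exact Hp|]; intros G HG _; rewrite vl_e by exact Hb; apply (val_emp b Hb).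
      * assert (zemp : forall a z G (HG : gen b G), A a z -> G (glue b g a p) -> vl HG (ap (qf z) b) = emp).
        { intros a z G HG HA Ga; destruct (zval a z G HG HA Ga) as (_ & Q & _).
          destruct Hd as [Hd|Hd]; [exact (val_inactive b Hb G HG _ Hd Q)|].
          specialize (Hd z (proj1 HA)); rewrite empfE in Hd; apply Hd. }
        split; [auto|split].
        -- intros a z HA; apply f_rel; [apply (gl a z HA)|]; intros G HG Ga.
           rewrite (zemp a z G HG HA Ga), vl_e by exact Hb; apply (val_top b Hb), (val_emp b Hb).
        -- apply f_rel; [exact Hp|]; intros G HG Gp; destruct (meets G HG Gp) as (a & z & HA & Ga).
           rewrite vl_e by exact Hb; rewrite <- (zemp a z G HG HA Ga); apply (zval a z G HG HA Ga).
    + destruct (mixing_full (Pb b) (Lb b) (PO b) HV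
        (fun c x => exists a z, A a z /\ le b c (glue b g a p) /\ x = ap (qf z) b) (Qb b) p) as (s & Hs1 & Hs2 & Hs3).
      * unfold glue; dd.
      * exact Hp.
      * exact (stage_full b Hb).
      * intros c0 Hc0; destruct (dens' c0 Hc0) as (c & a & z & H1 & H2 & H3); exists c, (ap (qf z) b); eauto 8.
      * intros c x (a & z & HA & Hc & ->) Hcb; apply f_mem; [exact Hcb|]; intros G HG Gc.
        apply (zval a z G HG HA), (gen_up b G HG c); assumption.
      * exists s; split; [exact Hs1|split; [exact Hs2|split; [tauto|split]]].
        -- intros a z HA; destruct (gl a z HA) as (G1 & G2 & G3); apply f_rel; [exact G1|]; intros G HG Ga.
           destruct (Hs3 G HG (gen_up b G HG _ _ Ga G2)) as (c & x & Gc & (a' & z' & HA' & Hc & ->) & E).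
           assert (Ga' := gen_up b G HG _ _ Gc Hc).
           destruct (generic_dir _ _ _ HG _ _ Ga Ga') as (d & _ & D1 & D2).
           destruct (gl a' z' HA') as (_ & _ & G3').
           (* Both initial segments are met below [d], and two antichain elements with a common
              extension have the same index. *)
           assert (z = z').
           { apply (Auniq a z a' z' (restr d g) HA HA').
             - rewrite <- G3; exact (le_restr b g _ _ Hbk Hgb D1).
             - rewrite <- G3'; exact (le_restr b g _ _ Hbk Hgb D2). }
           subst z'; change (vl HG s = vl HG (ap (qf z) b)) in E; rewrite E.
           apply (val_refl b Hb), (zval a z G HG HA Ga).
        -- apply f_rel; [exact Hp|]; intros G HG Gp.
           destruct (Hs3 G HG Gp) as (c & x & Gc & (a & z & HA & Hc & ->) & E).
           change (vl HG s = vl HG (ap (qf z) b)) in E; rewrite E.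
           apply (zval a z G HG HA), (gen_up b G HG c); assumption.
  - intros c p Ic Hc Hgc Fp HR.
    (* If [f] sends some active [b0 < g] outside [c], then no stage from [g] up to [c] is closed
       under [f], so all of them are inactive. Otherwise [P_g] is small relative to [c], and
       regularity of [c] bounds the supports of all chosen conditions. *)
    destruct (classic (exists b0 l, mem b0 g /\ active_stage f b0 l /\ ~ mem l c)) as [(b0 & l & H0 & Hl & Nl)|N].
    + exists g; split; [exact Hgc|]; intros b Hb Nb; destruct (HR b Hb Nb) as (Q & _).
      assert (Hbk := suck_mem b c Hc Hb).
      rewrite Q; [apply (Ke b Hbk)|]; left; intros [l' [_ Hl']]; apply Nl.
      assert (Hgb := not_mem_suc b g (k_suck b Hbk) Hgk Nb).
      apply (ord_trans _ b _ (suck_ord c Hc)); [|exact Hb].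
      apply (Hl' b0 l); [exact (suc_incl g b (k_suck b Hbk) Hgb b0 H0)|apply Hl].
    + assert (SZ : sml c Z).
      { apply (sml_sub c (img (Pb g) (fun a => cls g a))).
        - apply (cls_small c g Ic Hc Hgc); intros b l Hb Hl; apply NNPP; intros Nl; apply N; eauto.
        - intros z Hz; unfold Z in Hz; apply sepE in Hz; [tauto|dd]. }
      destruct (sml_bound c Ic Z (fun z d => forall b, mem b c -> ~ mem b d -> empf b (ap (qf z) b))) as (b1 & Hb1 & K).
      * dd.
      * exact SZ.
      * intros z Hz; destruct (Kqf z Hz) as (Hzq & _); exact (cond_support k (qf z) Hkk (proj1 Hzq) c Hc Ic).
      * destruct (suck_max c g b1 Hc Hgc Hb1) as (m & Hm & I1 & I2).
        exists m; split; [exact Hm|]; intros b Hb Nb; destruct (HR b Hb) as (Q & _); [auto|].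
        rewrite Q; [apply (Ke b (suck_mem b c Hc Hb))|]; right; intros z Hz; destruct (K z Hz) as (d & Hd & Kd).
        apply Kd; [exact Hb|]; intros Hbd; apply Nb, I2.
        exact (ord_trans _ _ _ (ord_mem _ _ (suck_ord c Hc) Hb1) Hbd Hd).
  - destruct (part k q' Hkk Hgs Hq' Er' HR') as [Lq Lz].
    rewrite (restr_id q k (cond_fn k q Hkk Hq)) in Lq.
    exists q'; split; [exact Lq|split; [exact Er'|]]; intros a0 Ha0.
    destruct (Adens a0 Ha0) as (a & z & Ha & HA); exists a; split; [exact Ha|].
    pose proof HA as (Hz & _); destruct (Kqf z Hz) as (Hzq & Uz & _).
    apply (Uopen (qf z)); [exact Uz|]; pose proof (Lz a z HA) as Q.
    rewrite (restr_id (qf z) k (cond_fn k _ Hkk (proj1 Hzq))) in Q; exact Q.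
Qed.

(** The ordinal [d + ω] stays below [k], since regularity bounds the sums [d + n]. *)
Lemma limit_above d : mem d k -> exists th, mem th k /\ lim th /\ incl d th.
Proof.
  intros Hd; assert (Od := ord_mem _ _ Ok Hd).
  destruct (proj1 (proj2 Hk)) as (w & Hw & Lw & Nw); assert (Ow := proj1 Lw).
  assert (H : forall n, mem n w -> mem (add d n) k).
  { intros n; induction n as [n IH] using mem_ind; intros Hn.
    destruct (ord_cases n (ord_mem _ _ Ow Hn)) as [->|[K|(m & _ & ->)]].
    - rewrite add_emp; exact Hd.
    - destruct (Nw n Hn K).
    - rewrite add_suc; apply (inacc_suc k Hk), IH; [apply mem_suc|exact (ord_trans _ _ _ Ow (mem_suc m) Hn)]. }
  destruct (regular_bound k Hk w (add d)) as (b & Hb & K); [dd|exact Hw|exact H|].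
  assert (Ob := ord_mem _ _ Ok Hb).
  exists (add d w); split; [|split; [exact (lim_add d w Od Lw)|apply incl_add]].
  assert (Hemp : mem emp w).
  { destruct (ord_total emp ord_emp w Ow) as [Q|[Q|Q]]; [exact Q|destruct Lw as (_ & N & _); subst w; tauto|destruct (empE _ Q)]. }
  assert (I : incl (add d w) b).
  { intros z Hz; apply addE in Hz; destruct Hz as [Hz|(n & Hn & ->)]; [|exact (K n Hn)].
    specialize (K emp Hemp); rewrite add_emp in K; exact (ord_trans _ _ _ Ob Hz K). }
  destruct (ord_incl _ _ (ord_add d w Od Ow) Ob I) as [Q| ->]; [exact (ord_trans _ _ _ Ok Q Hb)|exact Hb].
Qed.

(** At a stage [b] above [d], being allowed means strategic closure for length [d]. The strategies
    found in various extensions are mixed below the largest condition, so that one name works in all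
    of them. *)
Lemma strategies d t : ord d -> stages t d -> exists sgm, F1 sgm /\
  forall b, mem b k -> mem d b -> forall G (HG : gen b G),
    gstrat (vj HG t) (vj HG d) (vl HG (Qb b)) (vl HG (Rb b)) (vl HG (sgm b)).
Proof.
  intros Od Ht.
  set (gs := fun b p x => forces (Pb b) (Lb b) p (good_strategy (chk (Pb b) t) (chk (Pb b) d) (Qb b) (Rb b) x)).
  assert (Rg : reified (fun (W : zfc_model) (e : nat -> W) => good_strategy (e 0) (e 1) (e 2) (e 3) (e 4))) by rf.
  assert (Dgs : D3 gs).
  { apply (D_s8 (fun e => forces (e 0) (e 1) (e 2) (good_strategy (e 3) (e 4) (e 5) (e 6) (e 7)))
      (fun e => Pb (e 0)) (fun e => Lb (e 0)) (fun e => e 1) (fun e => chk (Pb (e 0)) t) (fun e => chk (Pb (e 0)) d)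
      (fun e => Qb (e 0)) (fun e => Rb (e 0)) (fun e => e 2)); [dd|dd|dd|dd|dd|dd|dd|dd|].
    apply (D_UD (fun V e => forces (e 0) (e 1) (e 2) (good_strategy (e 3) (e 4) (e 5) (e 6) (e 7)))), UD_forces; rf. }
  assert (sem : forall b p x, mem p (Pb b) -> (gs b p x <-> forall G (HG : gen b G), G p ->
     gstrat (vj HG t) (vj HG d) (vl HG (Qb b)) (vl HG (Rb b)) (vl HG x))).
  { intros b p x Hp; unfold gs; rewrite (fo5 (Pb b) (Lb b) (PO b) HV (fun W => good_strategy)) by (exact Rg || exact Hp).
    split; intros H G HG Gp; apply sat_good_strategy; exact (H G HG Gp). }
  destruct (choose (fun b x => mem d b -> forall p, mem p (Pb b) -> gs b p x) k) as (sgm & Ds & Ks).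
  - dd.
  - intros b Hb; assert (Hbk := k_suck b Hb).
    destruct (classic (mem d b)) as [Hdb|N]; [|exists emp; tauto].
    destruct (top_of b e Hbk De) as [Etop top]; [intros x Hx; apply Ke, (suck_mem x b Hbk Hx)|].
    assert (DW : D2 (fun c x => gs b c x)).
    { exact (D_subst (fun n => match n with 0 => inr b | 1 => inl 0 | _ => inl 1 end) _ Dgs). }
    destruct (mixing (Pb b) (Lb b) (PO b) (fun c x => gs b c x) (lam b e) DW) as (u & Hu).
    + intros c0 Hc0; destruct (generic_exists HV (Pb b) (Lb b) (PO b) c0 (proj1 Hc0)) as (G & HG & G0).
      destruct (stage_lottery b (PO b) Hb G HG) as (T & HL & HT & HS & _).
      destruct (lottery_gstrat T _ _ HL HT (vj HG d) (vj HG t)) as (gm & Hgm).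
      * exact (vj_ord b G HG d Od).
      * exact (vj_stages b G HG t d Od Ht).
      * intros v w o K; exact (HS v w o K d Hdb).
      * destruct (gv_surj (Pb b) (Lb b) (PO b) HG gm) as [x Ex]; rewrite Ex in Hgm.
        apply sat_good_strategy in Hgm.
        apply (gext_truth (Pb b) (Lb b) (PO b) (fun W e => good_strategy (e 0) (e 1) (e 2) (e 3) (e 4)) G HG
          (scons (chk (Pb b) t) (scons (chk (Pb b) d) (scons (Qb b) (scons (Rb b) (fun _ => x))))) Rg) in Hgm.
        destruct Hgm as (p & Gp & Kp); destruct (generic_dir _ _ _ HG p c0 Gp G0) as (c & Gc & H1 & H2).
        exists c, x; split; [exact H2|exact (forces_mono _ _ (PO b) _ _ _ H1 Kp)].
    + exists u; intros _ p Hp; apply sem; [exact Hp|]; intros G HG Gp.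
      destruct (Hu G HG (gen_up b G HG p _ Gp (top p Hp))) as (c & x & Gc & Wc & E).
      assert (Hc := generic_sub _ _ _ HG c Gc); apply (proj1 (sem b c x Hc) Wc G HG) in Gc.
      unfold vl; rewrite E; exact Gc.
  - exists sgm; split; [exact Ds|]; intros b Hb Hdb G HG.
    destruct (generic_nonempty _ _ _ HG) as [p Gp]; assert (Hp := generic_sub _ _ _ HG p Gp).
    exact (proj1 (sem b p _ Hp) (Ks b Hb Hdb p Hp) G HG Gp).
Qed.

(* A play [F] of length [xi ∈ t] of the game on the tail from [g] on, whose moves at the stages in [t] are given
   coordinatewise by the strategies [sgm], is answered coordinatewise. *)
Section Answer.
Context (d t g r : V) (sgm : V -> V).
Context (Od : ord d) (Hdg : mem d g) (Hg : mem g k) (Hr : mem r (Pb g)) (Ds : F1 sgm).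
Context (Ks : forall b, mem b k -> mem d b -> forall G (HG : gen b G),
    gstrat (vj HG t) (vj HG d) (vl HG (Qb b)) (vl HG (Rb b)) (vl HG (sgm b))).
Definition play (F : V -> V) xi b : V := seqn (Pb b) xi (fun z => ap (F z) b).
Lemma play_ext F F' xi b : F1 F -> F1 F' -> (forall z, mem z xi -> F z = F' z) -> play F xi b = play F' xi b.
Proof.
  intros HF HF' E; unfold play, seqn; f_equal; unfold opn, upn; apply img_ext; [|dd|dd].
  intros u Hu; rewrite E by exact Hu; reflexivity.
Qed.
Lemma play_mem F xi b G (HG : gen b G) v : F1 F ->
  (mem v (vl HG (play F xi b)) <-> exists z, mem z xi /\ v = op (vj HG z) (vl HG (ap (F z) b))).
Proof. intros HF; apply (gv_seqn (Pb b) (Lb b) (PO b) HG); dd. Qed.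
Definition obeys F xi : Prop := forall b, mem b k -> ~ mem b g ->
  forces (Pb b) (Lb b) (restr (F xi) b) (related (sgm b) (play F xi b) (ap (F xi) b)).

Lemma answer F xi : F1 F -> mem xi d -> mem xi t ->
  (forall z, mem z xi -> mem (F z) (Pb k) /\ restr (F z) g = r) ->
  (forall z z', mem z xi -> mem z' z -> le k (F z) (F z')) ->
  (forall z, mem z xi -> mem z t -> obeys F z) ->
  exists q, mem q (Pb k) /\ restr q g = r /\ (forall z, mem z xi -> le k q (F z)) /\
    forall b, mem b k -> ~ mem b g -> forces (Pb b) (Lb b) (restr q b) (related (sgm b) (play F xi b) (ap q b)).
Proof.
  intros HF Hxd Hxt HFz Hdec Hob.
  assert (Hkk := mem_suc k); assert (Hgk := k_suck g Hg).
  assert (Oxi := ord_mem _ _ Od Hxd).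
  assert (Dpl : F1 (play F xi)) by (unfold play, seqn, opn, upn; dd).
  assert (HFk : forall z, mem z xi -> mem (F z) (Pb k)) by (intros z Hz; apply HFz, Hz).
  (* At a coordinate where only tops have been played the strategy passes, so the answer may be the
     fixed name [e b]. This keeps the support of the answer bounded. *)
  set (quiet := fun b => forall z, mem z xi -> empf b (ap (F z) b)).
  assert (Dq : D1 quiet) by (unfold quiet; dd).
  set (Rl := fun b p x => (quiet b -> x = e b) /\
    forces (Pb b) (Lb b) p (related (sgm b) (play F xi b) x) /\
    forall z, mem z xi -> forces (Pb b) (Lb b) p (related (Rb b) x (ap (F z) b))).
  assert (DRl : D3 Rl) by (unfold Rl; dd).
  assert (part : forall b p, mem b (suc k) -> mem g (suc b) -> mem p (Pb b) -> restr p g = r ->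
    (forall x, mem x b -> ~ mem x g -> Rl x (restr p x) (ap p x)) ->
    forall z, mem z xi -> le b p (restr (F z) b)).
  { intros b p Hb Hgb Hp Er HR z Hz; assert (Fz := cond_fn k _ Hkk (HFk z Hz)).
    assert (Igb := suc_incl g b Hb Hgb); assert (Ibk := suc_incl b k Hkk Hb); assert (Fp := cond_fn b p Hb Hp).
    apply le_intro; [exact Hb|exact Hp|exact (cond_restr' k b _ Hkk Hb (HFk z Hz))|].
    intros x G HG Hx Gx; assert (Hxk := suck_mem x b Hb Hx); rewrite (ap_restr _ k b x Fz Ibk Hx).
    destruct (classic (mem x g)) as [Hxg|Nx].
    - assert (Ex : ap p x = ap (F z) x).
      { rewrite <- (ap_restr p b g x Fp Igb Hxg), Er, <- (proj2 (HFz z Hz)).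
        apply (ap_restr _ k g x Fz); [exact (suck_incl g k Hkk Hg)|exact Hxg]. }
      rewrite <- Ex; apply (val_refl x Hxk); exact (cond_val b p x Hb Hp Hx G HG Gx).
    - destruct (HR x Hx Nx) as (_ & _ & Q).
      exact (proj1 (f_rel x _ _ _ _ (cond_restr b x p Hb Hx Hp)) (Q z Hz) G HG Gx). }
  destruct (tail_build g r Rl DRl Hg Hr) as (q & Hq & Er & HR).
  - intros b p Hb Nb Hp Er HR; assert (Hbk := k_suck b Hb).
    assert (Hgb := not_mem_suc b g Hbk Hgk Nb).
    assert (Hdb : mem d b).
    { apply sucE in Hgb; destruct Hgb as [Q| <-]; [exact (ord_trans _ _ _ (suck_ord b Hbk) Hdg Q)|exact Hdg]. }
    assert (Lz := part b p Hbk Hgb Hp Er HR).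
    (* In an extension whose filter contains the part of the answer before [b], the moves at [b]
       form a descending play that follows the strategy, so the strategy has a reply. *)
    assert (resp : forall G (HG : gen b G), G p -> exists v, mem v (vl HG (Qb b)) /\
      mem (op (vl HG (play F xi b)) v) (vl HG (sgm b)) /\
      (forall z, mem z xi -> mem (op v (vl HG (ap (F z) b))) (vl HG (Rb b))) /\ (quiet b -> v = emp)).
    { intros G HG Gp.
      assert (Gz : forall z, mem z xi -> G (restr (F z) b)) by (intros z Hz; exact (gen_up b G HG _ _ Gp (Lz z Hz))).
      destruct (Ks b Hb Hdb G HG) as [Fs Kst].
      assert (pm : forall v, mem v (vl HG (play F xi b)) <-> exists z, mem z xi /\ v = op (vj HG z) (vl HG (ap (F z) b)))
        by (intros v; apply play_mem, HF).
      assert (pop : forall v w, mem (op v w) (vl HG (play F xi b)) <-> exists z, mem z xi /\ v = vj HG z /\ w = vl HG (ap (F z) b)).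
      { intros v w; rewrite pm; split; intros (z & Hz & E); exists z; split; auto.
        - apply op_inj, E.
        - destruct E as [-> ->]; reflexivity. }
      destruct (Kst (vj HG xi)) with (s := vl HG (play F xi b)) as (v & Hv & Kv & Lv & Ev).
      - apply vj_mem_iff, Hxd.
      - apply vj_mem_iff, Hxt.
      - split; [split; [split; [split; [split|]|]|]|].
        + intros v Hv; apply pm in Hv; destruct Hv as (z & _ & ->); eauto.
        + intros v w w' [H1 H2]; apply pop in H1, H2; destruct H1 as (z & _ & -> & ->), H2 as (z' & _ & E & ->).
          apply vj_inj in E; subst; reflexivity.
        + intros v; split.
          * intros Hv; apply vj_mem in Hv; destruct Hv as (z & Hz & ->); exists (vl HG (ap (F z) b)); apply pop; eauto.
          * intros [w Hw]; apply pop in Hw; destruct Hw as (z & Hz & -> & _); apply vj_mem_iff, Hz.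
        + intros v w Hw; apply pop in Hw; destruct Hw as (z & Hz & _ & ->).
          exact (cond_val k _ b Hkk (HFk z Hz) Hb G HG (Gz z Hz)).
        + intros v v' w w' (Hvv & H1 & H2); apply pop in H1, H2.
          destruct H1 as (z & Hz & -> & ->), H2 as (z' & Hz' & -> & ->); apply vj_mem_iff in Hvv.
          exact (le_val k _ _ b Hkk (Hdec z' z Hz' Hvv) Hb G HG (Gz z' Hz')).
        + intros v Hv Hvt; apply vj_mem in Hv; destruct Hv as (z & Hz & ->); apply vj_mem_iff in Hvt.
          exists (vl HG (play F z b)), (vl HG (ap (F z) b)); split; [|split; [apply pop; eauto|]].
          * apply zf_ext; intros v; rewrite restrE, pm, play_mem by exact HF; split.
            -- intros (z' & Hz' & ->); split; [exists z'; split; [exact (ord_trans _ _ _ Oxi Hz' Hz)|reflexivity]|].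
               exists (vj HG z'), (vl HG (ap (F z') b)); split; [apply vj_mem_iff, Hz'|reflexivity].
            -- intros [(z' & Hz' & ->) (v' & w & Hv & E)]; apply op_inj in E; destruct E as [<- _].
               apply vj_mem_iff in Hv; eauto.
          * pose proof (Hob z Hz Hvt b Hb Nb) as Q.
            exact (proj1 (f_rel b _ _ _ _ (cond_restr k b _ Hkk Hb (HFk z Hz))) Q G HG (Gz z Hz)).
      - exists v; split; [exact Hv|split; [exact Kv|split]].
        + intros z Hz; apply (Lv (vj HG z)), pop; eauto.
        + intros Hqt; apply Ev; intros x u Hu; apply pop in Hu; destruct Hu as (z & Hz & _ & ->).
          specialize (Hqt z Hz); rewrite empfE in Hqt; apply Hqt. }
    assert (isf : forall G (HG : gen b G), isfun (vl HG (sgm b))) by (intros G HG; apply (Ks b Hb Hdb G HG)).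
    assert (fin : forall x, forces (Pb b) (Lb b) p (related (sgm b) (play F xi b) x) ->
       forall z, mem z xi -> forces (Pb b) (Lb b) p (related (Rb b) x (ap (F z) b))).
    { intros x Hx z Hz; rewrite f_rel in Hx by exact Hp; apply f_rel; [exact Hp|]; intros G HG Gp.
      destruct (resp G HG Gp) as (v & _ & Kv & Lv & _).
      rewrite (proj2 (isf G HG) _ _ _ (conj (Hx G HG Gp) Kv)); exact (Lv z Hz). }
    destruct (classic (quiet b)) as [Hqt|Nq].
    + assert (Q : forces (Pb b) (Lb b) p (related (sgm b) (play F xi b) (e b))).
      { apply f_rel; [exact Hp|]; intros G HG Gp; destruct (resp G HG Gp) as (v & _ & Kv & _ & Ev).
        rewrite vl_e by exact Hb; rewrite <- (Ev Hqt); exact Kv. }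
      exists (e b); split; [apply (Ke b Hb)|split; [|split; [auto|split; [exact Q|exact (fin _ Q)]]]].
      apply f_mem; [exact Hp|]; intros G HG _; rewrite vl_e by exact Hb; apply (val_emp b Hb).
    + destruct (mixing_full (Pb b) (Lb b) (PO b) HV
        (fun c x => inQ b c x /\ forces (Pb b) (Lb b) c (related (sgm b) (play F xi b) x)) (Qb b) p) as (s & Hs1 & Hs2 & Hs3).
      * dd.
      * exact Hp.
      * exact (stage_full b Hb).
      (* In an extension through [c0] the reply has some name, and a condition below [c0] forces
         that name to be the reply. *)
      * intros c0 Hc0; destruct (generic_exists HV (Pb b) (Lb b) (PO b) c0 (proj1 Hc0)) as (G & HG & G0).
        destruct (resp G HG (gen_up b G HG _ _ G0 Hc0)) as (v & Hv & Kv & _).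
        destruct (gv_surj (Pb b) (Lb b) (PO b) HG v) as [x ->].
        apply (gtruth_mem (Pb b) (Lb b) (PO b) G HG) in Hv; destruct Hv as (p1 & G1 & K1).
        apply sat_related in Kv.
        apply (gext_truth (Pb b) (Lb b) (PO b) (fun W e => related (e 0) (e 1) (e 2)) G HG
          (scons (sgm b) (scons (play F xi b) (fun _ => x))) ltac:(rf)) in Kv.
        destruct Kv as (p2 & G2 & K2).
        destruct (generic_dir _ _ _ HG p1 p2 G1 G2) as (p3 & G3 & H1 & H2).
        destruct (generic_dir _ _ _ HG p3 c0 G3 G0) as (p4 & G4 & H3 & H4).
        exists p4, x; split; [exact H4|split].
        -- exact (forces_mono _ _ (PO b) (fMem x (Qb b)) _ _ (le_trans b _ _ _ H3 H1) K1).
        -- exact (forces_mono _ _ (PO b) _ _ _ (le_trans b _ _ _ H3 H2) K2).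
      * intros c x [K _] _; exact K.
      * assert (Q : forces (Pb b) (Lb b) p (related (sgm b) (play F xi b) s)).
        { apply f_rel; [exact Hp|]; intros G HG Gp; destruct (Hs3 G HG Gp) as (c & x & Gc & [_ K] & E).
          change (vl HG s = vl HG x) in E; rewrite E.
          exact (proj1 (f_rel b _ _ _ _ (generic_sub _ _ _ HG c Gc)) K G HG Gc). }
        exists s; split; [exact Hs1|split; [exact Hs2|split; [tauto|split; [exact Q|exact (fin _ Q)]]]].
  - intros c p Ic Hc Hgc Fp HR; assert (Oc := suck_ord c Hc).
    (* Fewer than [c] moves have been made, as [xi < d < g < c], so their supports below [c] have a
       common bound. *)
    destruct (sml_bound c Ic xi (fun z d => forall b, mem b c -> ~ mem b d -> empf b (ap (F z) b))) as (b1 & Hb1 & K).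
    + dd.
    + apply sml_ord; exact (ord_trans _ _ _ Oc (ord_trans _ _ _ (suck_ord g Hgk) Hxd Hdg) Hgc).
    + intros z Hz; exact (cond_support k (F z) Hkk (HFk z Hz) c Hc Ic).
    + destruct (suck_max c g b1 Hc Hgc Hb1) as (m & Hm & I1 & I2).
      exists m; split; [exact Hm|]; intros b Hb Nb; destruct (HR b Hb) as (Q & _); [auto|].
      rewrite Q; [apply (Ke b (suck_mem b c Hc Hb))|]; intros z Hz; destruct (K z Hz) as (d' & Hd' & Kd).
      apply Kd; [exact Hb|]; intros Hbd; apply Nb, I2; exact (ord_trans _ _ _ (ord_mem _ _ Oc Hb1) Hbd Hd').
  - exists q; split; [exact Hq|split; [exact Er|split]].
    + intros z Hz; pose proof (part k q Hkk Hgk Hq Er HR z Hz) as Q.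
      rewrite (restr_id (F z) k (cond_fn k _ Hkk (HFk z Hz))) in Q; exact Q.
    + intros b Hb Nb; apply (HR b Hb Nb).
Qed.
End Answer.

(* The tail of the iteration from [g] on adds no sequences of length [dl], in combinatorial form. *)
Lemma tail_distributive dl : mem dl k -> exists g, mem g k /\
  forall p0 (U : V -> V -> Prop), mem p0 (Pb k) -> D2 U ->
  (forall x p p', U x p -> le k p' p -> U x p') ->
  (forall x p, mem x dl -> le k p p0 -> exists p', le k p' p /\ U x p') ->
  forall p, le k p p0 -> exists q, le k q p /\
    forall x a, mem x dl -> le g a (restr q g) -> exists a', le g a' a /\ U x (glue k g a' q).
Proof.
  intros Hdl; assert (Hkk := mem_suc k).
  destruct (limit_above dl Hdl) as (th & Hth & Lth & Ith); assert (Oth := proj1 Lth).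
  (* The length exceeds [th] by one, so that the limit [th] is itself a stage of the game, at which
     the second player finds a bound of all earlier moves. Starting the tail at [g = d + 1] gives
     [d ∈ b] for each of its coordinates [b]. *)
  set (d := suc th); assert (Od : ord d) by exact (ord_suc th Oth).
  assert (Hdk : mem d k) by exact (inacc_suc k Hk th Hth).
  set (g := suc d); assert (Hg : mem g k) by exact (inacc_suc k Hk d Hdk).
  assert (Hdg : mem d g) by apply mem_suc.
  destruct (stages_ex d Od) as [t Ht].
  destruct (strategies d t Od Ht) as (sgm & Ds & Ks).
  exists g; split; [exact Hg|]; intros p0 U Hp0 DU Uopen dens p Hpp; assert (Hp : mem p (Pb k)) by apply Hpp.
  set (r := restr p g); assert (Hr : mem r (Pb g)) by exact (cond_restr k g p Hkk Hg Hp).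
  assert (Hgs : mem g (suc k)) by exact (k_suck g Hg).
  (* At stages in [t] the second player follows the strategies; at the others the first player takes
     care of dense sets. An index [x] in [t] is served at the next stage, hence the alternatives
     [x = xi] and [xi = suc x]. *)
  set (Nx := fun xi s q => le k q p /\ restr q g = r /\ (forall z, mem z xi -> le k q (ap s z)) /\
    (mem xi t -> forall b, mem b k -> ~ mem b g ->
       forces (Pb b) (Lb b) (restr q b) (related (sgm b) (play (fun z => ap s z) xi b) (ap q b))) /\
    (~ mem xi t -> forall x a, mem x dl -> (x = xi \/ xi = suc x) -> le g a r ->
       exists a', le g a' a /\ U x (glue k g a' q))).
  assert (DNx : D3 Nx) by (unfold Nx, play, seqn, opn, upn, glue; dd).
  destruct (dep_choice (Pb k) d (fun s q => exists xi, fn_on s xi /\ Nx xi s q)) as (F & HF & KF).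
  - dd.
  - exact Od.
  - intros xi F Hxi HF H.
    assert (H' : forall z, mem z xi -> mem (F z) (Pb k) /\ Nx z (lam z F) (F z)).
    { intros z Hz; destruct (H z Hz) as (H1 & b & H2 & H3).
      rewrite (fn_on_unique _ _ _ H2 (fn_lam z F HF)) in H3; auto. }
    assert (Oxi := ord_mem _ _ Od Hxi).
    assert (dec : forall z z', mem z xi -> mem z' z -> le k (F z) (F z')).
    { intros z z' Hz Hz'; destruct (H' z Hz) as (_ & _ & _ & Q & _); specialize (Q z' Hz').
      rewrite ap_lam in Q by assumption; exact Q. }
    assert (ex : exists q, Nx xi (lam xi F) q).
    { destruct (classic (mem xi t)) as [Hxt|Nxt].
      - destruct (answer d t g r sgm Od Hdg Hg Hr Ds Ks F xi HF Hxi Hxt) as (q & Hq & Er & Lq & Kq).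
        + intros z Hz; destruct (H' z Hz) as (H1 & _ & H2 & _); auto.
        + exact dec.
        + intros z Hz Hzt b Hb Nb; destruct (H' z Hz) as (_ & _ & _ & _ & Q & _).
          specialize (Q Hzt b Hb Nb); rewrite (play_ext _ F z b) in Q; [exact Q|dd|exact HF|].
          intros z' Hz'; rewrite ap_lam; auto.
        + exists q; split; [|split; [exact Er|split; [|split; [|tauto]]]].
          (* Stage 0 belongs to the first player, so when the second player moves there is already a
             move below [p]. *)
          * assert (Hemp : mem emp xi).
            { destruct (ord_total emp ord_emp xi Oxi) as [Q|[Q|Q]]; [exact Q| |destruct (empE _ Q)].
              subst xi; destruct (proj1 (proj2 Ht emp Hxi) eq_refl Hxt). }
            apply (le_trans k _ (F emp)); [exact (Lq emp Hemp)|]; apply (H' emp Hemp).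
          * intros z Hz; rewrite ap_lam by assumption; exact (Lq z Hz).
          * intros _ b Hb Nb; rewrite (play_ext _ F xi b); [exact (Kq b Hb Nb)|dd|exact HF|].
            intros z' Hz'; rewrite ap_lam; auto.
      - assert (exists q0, le k q0 p /\ restr q0 g = r /\ forall z, mem z xi -> le k q0 (F z)) as (q0 & L0 & E0 & Lz).
        { destruct (ord_cases xi Oxi) as [->|[K|(y & Oy & ->)]].
          - exists p; split; [apply le_refl, Hp|split; [reflexivity|]]; intros z Hz; destruct (empE _ Hz).
          - destruct Nxt; exact (proj1 (proj2 (proj2 Ht xi Hxi)) K).
          - destruct (H' y (mem_suc y)) as (Q0 & Q1 & Q2 & _).
            exists (F y); split; [exact Q1|split; [exact Q2|]]; intros z Hz; apply sucE in Hz as Hz'.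
            destruct Hz' as [Hz'| ->]; [exact (dec y z (mem_suc y) Hz')|apply le_refl, Q0]. }
        (* At most two dense sets are due at stage [xi]; their intersection is treated as one. *)
        destruct (step_lemma g q0 (fun q => forall x, mem x dl -> (x = xi \/ xi = suc x) -> U x q)) as (q & Lq & Er & Kq).
        + exact Hg.
        + apply L0.
        + dd.
        + intros q q' HU Hq' x Hx Kx; apply (Uopen x q); [exact (HU x Hx Kx)|exact Hq'].
        + assert (one : forall x q, le k q q0 -> exists q', le k q' q /\ (mem x dl -> U x q')).
          { intros x q Hq; destruct (classic (mem x dl)) as [Hx|N].
            - destruct (dens x q Hx) as (q' & ? & ?); [|eauto].
              exact (le_trans k _ _ _ Hq (le_trans k _ _ _ L0 Hpp)).
            - exists q; split; [apply le_refl, Hq|tauto]. }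
          intros q Hq; destruct (one xi q Hq) as (q1 & L1 & U1).
          destruct (classic (exists y, xi = suc y)) as [[y Ey]|N].
          * destruct (one y q1 (le_trans k _ _ _ L1 Hq)) as (q2 & L2 & U2).
            exists q2; split; [exact (le_trans k _ _ _ L2 L1)|]; intros x Hx [-> |Ex].
            -- exact (Uopen _ _ _ (U1 Hx) L2).
            -- rewrite Ey in Ex; apply suc_inj in Ex; subst y; exact (U2 Hx).
          * exists q1; split; [exact L1|]; intros x Hx [-> |Ex]; [exact (U1 Hx)|destruct N; eauto].
        + exists q; split; [exact (le_trans k _ _ _ Lq L0)|split; [congruence|split; [|split; [tauto|]]]].
          * intros z Hz; rewrite ap_lam by assumption; exact (le_trans k _ _ _ Lq (Lz z Hz)).
          * intros _ x a Hx Kx Ha; rewrite <- E0 in Ha; destruct (Kq a Ha) as (a' & La & Ua); exists a'; auto. }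
    destruct ex as [q Hq]; exists q; split; [apply Hq|exists xi; split; [apply fn_lam, HF|exact Hq]].
  - assert (KF' : forall z, mem z d -> mem (F z) (Pb k) /\ Nx z (lam z F) (F z)).
    { intros z Hz; destruct (KF z Hz) as (H1 & b & H2 & H3).
      rewrite (fn_on_unique _ _ _ H2 (fn_lam z F HF)) in H3; auto. }
    assert (Hthd : mem th d) by apply mem_suc.
    destruct (KF' th Hthd) as (Fth & L & Er & Lz & _).
    (* The move at [th] lies below all earlier ones, so each reduction obtained for some [F xi]
       passes to it by gluing. *)
    exists (F th); split; [exact L|]; intros x a Hx Ha; rewrite Er in Ha.
    assert (Hxth := Ith x Hx).
    assert (exists xi, mem xi th /\ ~ mem xi t /\ (x = xi \/ xi = suc x)) as (xi & Hxi & Nxi & Kxi).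
    { assert (Hxd : mem x d) by exact (ord_trans _ _ _ Od Hxth Hthd).
      destruct (classic (mem x t)) as [Hxt|N]; [|eauto].
      assert (Hsx : mem (suc x) th).
      { destruct (proj2 (proj2 Lth) x Hxth) as (y & Hy & Hxy); assert (Oy := ord_mem _ _ Oth Hy).
        destruct (ord_total (suc x) (ord_suc x (ord_mem _ _ Oth Hxth)) y Oy) as [Q|[Q|Q]].
        - exact (ord_trans _ _ _ Oth Q Hy).
        - rewrite Q; exact Hy.
        - apply sucE in Q; destruct Q as [Q| ->]; [destruct (mem_asym _ _ Hxy Q)|destruct (mem_irr _ Hxy)]. }
      exists (suc x); split; [exact Hsx|split; [|auto]]; intros K.
      apply (proj2 (proj2 (proj2 Ht (suc x) (ord_trans _ _ _ Od Hsx Hthd))) x Hxd eq_refl); assumption. }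
    assert (Hxid := ord_trans _ _ _ Od Hxi Hthd).
    destruct (KF' xi Hxid) as (_ & _ & Exi & _ & _ & Q).
    destruct (Q Nxi x a Hx Kxi Ha) as (a' & La & Ua); exists a'; split; [exact La|].
    assert (Lxi : le k (F th) (F xi)) by (specialize (Lz xi Hxi); rewrite ap_lam in Lz by assumption; exact Lz).
    assert (Har : le g a' r) by exact (le_trans g _ _ _ La Ha).
    apply (Uopen x (glue k g a' (F xi)) _ Ua).
    destruct (glue_cond' k g a' (F th) Hkk Hgs Fth) as (G1 & G2 & G3); [rewrite Er; exact Har|].
    apply glue_le; auto.
    + apply Lxi.
    + rewrite Exi; exact Har.
    + exact (le_trans k _ _ _ G2 Lxi).
    + rewrite G3; apply le_refl, La.
Qed.
End Core.

(** ** Inaccessibility in the extension *)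

Section Extension.
Context (G : V -> Prop) (HG : gen k G).
Local Notation M := (gext (Pb k) (Lb k) (PO k) G HG).
Let Hkk : mem k (suc k) := mem_suc k.

(* [G] contains a condition which reduces all the dense sets [U x] to dense subsets of [P_g] *)
Lemma reduce_dense dl : mem dl k -> exists g, mem g k /\ forall p0 (U : V -> V -> Prop), G p0 -> D2 U ->
  (forall x p p', U x p -> le k p' p -> U x p') ->
  (forall x p, mem x dl -> le k p p0 -> exists p', le k p' p /\ U x p') ->
  exists q, G q /\ le k q p0 /\ forall x, mem x dl -> exists a, le g a (restr q g) /\ U x (glue k g a q) /\ G (glue k g a q).
Proof.
  intros Hdl; destruct tops as (e & De & Ke).
  destruct (tail_distributive e De Ke dl Hdl) as (g & Hg & K); exists g; split; [exact Hg|].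
  intros p0 U G0 DU Uopen dens; assert (Hgs := k_suck g Hg).
  assert (Hp0 := generic_sub _ _ _ HG p0 G0).
  destruct (gen_below (Pb k) (Lb k) (PO k) G HG (fun q => mem q (Pb k) /\
    forall x a, mem x dl -> le g a (restr q g) -> exists a', le g a' a /\ U x (glue k g a' q)) p0 G0) as (q & Gq & [Hq Kq] & Lq).
  { intros p Hp; destruct (K p0 U Hp0 DU Uopen dens p Hp) as (q & Lq & Kq).
    exists q; split; [exact Lq|split; [apply Lq|exact Kq]]. }
  { unfold glue; dd. }
  exists q; split; [exact Gq|split; [exact Lq|]]; intros x Hx.
  destruct (gen_below (Pb k) (Lb k) (PO k) G HG (fun c => exists a, le g a (restr q g) /\ U x (glue k g a q) /\
    le k c (glue k g a q)) q Gq) as (c & Gc & (a & Ha & Ua & Lc) & _).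
  { intros c0 Hc0; destruct (Kq x (restr c0 g) Hx) as (a & La & Ua).
    { exact (le_restr k g c0 q Hkk Hgs Hc0). }
    assert (Haq : le g a (restr q g)) by exact (le_trans g _ _ _ La (le_restr k g c0 q Hkk Hgs Hc0)).
    destruct (glue_cond' k g a c0 Hkk Hgs (proj1 Hc0) La) as (C1 & C2 & C3).
    exists (glue k g a c0); split; [exact C2|exists a; split; [exact Haq|split; [exact Ua|]]].
    apply glue_le; auto.
    - exact (le_trans k _ _ _ C2 Hc0).
    - rewrite C3; apply le_refl, La. }
  { unfold glue; dd. }
  exists a; split; [exact Ha|split; [exact Ua|exact (gen_up k G HG _ _ Gc Lc)]].
Qed.
(** What [glue k g a q] forces depends only on the class of [a], which makes classes usable as
    indices. *)
Lemma cls_glue g a a' q : mem g k -> mem q (Pb k) -> le g a (restr q g) -> mem a' (Pb g) -> cls g a = cls g a' ->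
  le g a' (restr q g) /\ le k (glue k g a' q) (glue k g a q).
Proof.
  intros Hg Hq Ha Ha' E; assert (Hgs := k_suck g Hg); assert (L := cls_le g a' a Ha' (eq_sym E)).
  assert (L' : le g a' (restr q g)) by exact (le_trans g _ _ _ L Ha).
  split; [exact L'|]; destruct (glue_cond' k g a' q Hkk Hgs Hq L') as (C1 & C2 & C3).
  apply glue_le; auto; rewrite C3; exact L.
Qed.
Lemma cls_small_k g : mem g k -> sml k (img (Pb g) (fun a => cls g a)).
Proof. intros Hg; apply (cls_small k g Hk Hkk Hg); intros b l _; apply active_k. Qed.

Lemma ext_regular : regular (vj HG k).
Proof.
  intros x Hx gn Hgn; apply vj_mem in Hx; destruct Hx as (dl & Hdl & ->).
  destruct (gv_surj (Pb k) (Lb k) (PO k) HG gn) as [w ->].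
  assert (Rf : reified (fun (W : zfc_model) (e : nat -> W) => fun_to (e 0) (e 1) (e 2))) by rf.
  assert (Hgn' : M ⊨ fun_to (vl HG w) (vj HG dl) (vj HG k)) by (apply sat_fun_to; exact Hgn).
  apply (gext_truth (Pb k) (Lb k) (PO k) (fun W e => fun_to (e 0) (e 1) (e 2)) G HG
    (scons w (scons (chk (Pb k) dl) (fun _ => chk (Pb k) k))) Rf) in Hgn'.
  destruct Hgn' as (p0 & G0 & K0); assert (Hp0 := generic_sub _ _ _ HG p0 G0).
  change (forces (Pb k) (Lb k) p0 (fun_to w (chk (Pb k) dl) (chk (Pb k) k))) in K0.
  rewrite (fo3 (Pb k) (Lb k) (PO k) HV (fun W => fun_to)) in K0 by (exact Rf || exact Hp0).
  assert (fn : forall G' (HG' : gen k G'), G' p0 -> fn_to (vl HG' w) (vj HG' dl) (vj HG' k)).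
  { intros G' HG' G0'; apply sat_fun_to; exact (K0 G' HG' G0'). }
  clear K0 Hgn.
  set (val := fun x p y => forces (Pb k) (Lb k) p (related w (chk (Pb k) x) (chk (Pb k) y))).
  assert (Dval : D3 val) by (unfold val; dd).
  assert (valE : forall x p y, mem p (Pb k) -> (val x p y <-> forall G' (HG' : gen k G'), G' p ->
     mem (op (vj HG' x) (vj HG' y)) (vl HG' w))) by (intros; apply f_rel; assumption).
  destruct (reduce_dense dl Hdl) as (g & Hg & red); assert (Hgs := k_suck g Hg).
  destruct (red p0 (fun x p => exists y, mem y k /\ val x p y) G0) as (q & Gq & Lq & Kq).
  { dd. }
  { intros x p p' (y & Hy & K) L; exists y; split; [exact Hy|exact (forces_mono _ _ (PO k) _ _ _ L K)]. }
  { intros x p Hx Hp; destruct (generic_exists HV (Pb k) (Lb k) (PO k) p (proj1 Hp)) as (G' & HG' & Gp').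
    destruct (fn G' HG' (gen_up k G' HG' _ _ Gp' Hp)) as [[_ Hdom] Hran].
    destruct (proj1 (Hdom (vj HG' x)) (proj2 (vj_mem_iff k G' HG' x dl) Hx)) as [v Hv].
    pose proof (Hran _ _ Hv) as Hv'; apply vj_mem in Hv'; destruct Hv' as (y & Hy & ->).
    apply sat_related in Hv.
    apply (gext_truth (Pb k) (Lb k) (PO k) (fun W e => related (e 0) (e 1) (e 2)) G' HG'
      (scons w (scons (chk (Pb k) x) (fun _ => chk (Pb k) y))) ltac:(rf)) in Hv.
    destruct Hv as (p1 & G1 & K1); destruct (generic_dir _ _ _ HG' p1 p G1 Gp') as (p2 & _ & L1 & L2).
    exists p2; split; [exact L2|exists y; split; [exact Hy|exact (forces_mono _ _ (PO k) _ _ _ L1 K1)]]. }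
  assert (Hq := generic_sub _ _ _ HG q Gq).
  (* A place [x] together with a class determines at most one value; [B] collects the values that
     occur. *)
  set (H := fun v y => exists x a, v = op x (cls g a) /\ le g a (restr q g) /\ val x (glue k g a q) y).
  assert (DH : D2 H) by (unfold H, glue; dd).
  set (B := sep k (fun y => exists v, mem v (prod dl (img (Pb g) (fun a => cls g a))) /\ H v y)).
  assert (BE : forall y, mem y B <-> mem y k /\ exists v, mem v (prod dl (img (Pb g) (fun a => cls g a))) /\ H v y)
    by (intros y; unfold B; rewrite sepE by dd; tauto).
  destruct (sml_bounded k Hk B) as (b & Hb & Ib).
  { apply (sml_rel k (prod dl (img (Pb g) (fun a => cls g a))) _ H DH).
    - apply (sml_prod k Hk); [apply sml_ord, Hdl|apply cls_small_k, Hg].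
    - intros y Hy; apply BE in Hy; tauto.
    (* Conditions of the same class glue to equivalent conditions, and a generic filter through one
       of these shows that they cannot force two values at [x]. *)
    - intros v y y' _ _ (x & a & -> & Ha & K) (x' & a' & E & Ha' & K'); apply op_inj in E; destruct E as [<- E].
      destruct (cls_glue g a' a q Hg Hq Ha' (proj1 Ha) (eq_sym E)) as [_ L].
      destruct (glue_cond' k g a q Hkk Hgs Hq Ha) as (C1 & C2 & _).
      destruct (generic_exists HV (Pb k) (Lb k) (PO k) _ C1) as (G' & HG' & Ga).
      assert (Ga' := gen_up k G' HG' _ _ Ga L).
      destruct (fn G' HG') as [[[_ Ff] _] _].
      { exact (gen_up k G' HG' _ _ Ga (le_trans k _ _ _ C2 Lq)). }
      apply (vj_inj k G' HG'); apply (Ff (vj HG' x)); split.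
      + exact (proj1 (valE x _ y C1) K G' HG' Ga).
      + exact (proj1 (valE x _ y' (proj1 (proj2 L))) K' G' HG' Ga'). }
  { intros y Hy; apply BE in Hy; tauto. }
  exists (vj HG b); split; [apply vj_mem_iff, Hb|]; intros u v Huv.
  destruct (fn G HG G0) as [[[_ Ff] Hdom] Hran].
  assert (Hu : mem u (vj HG dl)) by (apply Hdom; eauto).
  apply vj_mem in Hu; destruct Hu as (x & Hx & ->).
  destruct (Kq x Hx) as (a & Ha & (y & Hy & K) & Ga).
  assert (E : v = vj HG y).
  { apply (Ff (vj HG x)); split; [exact Huv|].
    exact (proj1 (valE x _ y (generic_sub _ _ _ HG _ Ga)) K G HG Ga). }
  rewrite E; apply vj_mem_iff, Ib, BE; split; [exact Hy|exists (op x (cls g a)); split; [|exists x, a; auto]].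
  apply prod_op; split; [exact Hx|apply imgE; [dd|exists a; split; [apply Ha|reflexivity]]].
Qed.

Lemma ext_stronglim : stronglim (vj HG k).
Proof.
  intros x Hx u Hu; apply vj_mem in Hx; destruct Hx as (dl & Hdl & ->).
  destruct (reduce_dense dl Hdl) as (g & Hg & red); assert (Hgs := k_suck g Hg).
  set (C := img (Pb g) (fun a => cls g a)).
  (* A ground model set [s] of pairs of a class and an element of [dl] yields a name of a subset of
     [dl]: [x] enters when some condition in the filter has an initial segment whose class is paired
     with [x]. *)
  set (sn := fun s => sep (prod (img dl (fun x => chk (Pb k) x)) (Pb k))
    (fun z => exists x p, z = op (chk (Pb k) x) p /\ mem x dl /\ mem (op (cls g (restr p g)) x) s)).
  assert (Dsn : F1 sn) by (unfold sn; dd).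
  assert (snE : forall s v, mem v (vl HG (sn s)) <-> exists x p, mem x dl /\ G p /\ mem (op (cls g (restr p g)) x) s /\ v = vj HG x).
  { intros s v; rewrite vl_mem; split.
    - intros (n & p & Hn & Gp & ->); unfold sn in Hn; apply sepE in Hn; [|dd].
      destruct Hn as [_ (x & p' & E & Hx & K)]; apply op_inj in E; destruct E; subst n p'; exists x, p; auto.
    - intros (x & p & Hx & Gp & K & ->); exists (chk (Pb k) x), p; split; [|split; [exact Gp|reflexivity]].
      unfold sn; apply sepE; [dd|]; split; [|exists x, p; auto].
      apply prod_op; split; [apply imgE; [dd|eauto]|exact (generic_sub _ _ _ HG p Gp)]. }
  (* Once [q] reduces the decisions about [v] to [P_g], the set [v] is given by the classes of those
     [a] whose gluing to [q] forces [x] into [v]. *)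
  assert (all : forall v, incl v (vj HG dl) -> exists s, incl s (prod C dl) /\ v = vl HG (sn s)).
  { intros v Iv; destruct (gv_surj (Pb k) (Lb k) (PO k) HG v) as [w Ew].
    destruct (generic_nonempty _ _ _ HG) as [p0 G0].
    set (dec := fun x p => forces (Pb k) (Lb k) p (fMem (chk (Pb k) x) w)).
    assert (Ddec : D2 dec) by (unfold dec; dd).
    destruct (red p0 (fun x p => dec x p \/ forces (Pb k) (Lb k) p (fNot (fMem (chk (Pb k) x) w))) G0) as (q & Gq & Lq & Kq).
    { dd. }
    { intros x p p' [K|K] L; [left|right]; exact (forces_mono _ _ (PO k) _ _ _ L K). }
    { intros x p Hx Hp; exact (forces_decide (Pb k) (Lb k) (PO k) _ p (proj1 Hp)). }
    assert (Hq := generic_sub _ _ _ HG q Gq).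
    assert (decE : forall x p, G p -> dec x p -> mem (vj HG x) v).
    { intros x p Gp K; rewrite Ew; exact (proj1 (f_mem k p _ _ (generic_sub _ _ _ HG p Gp)) K G HG Gp). }
    set (s := sep (prod C dl) (fun z => exists a x, z = op (cls g a) x /\ le g a (restr q g) /\ dec x (glue k g a q))).
    assert (sE : forall c x, mem (op c x) s <-> mem x dl /\ exists a, c = cls g a /\ le g a (restr q g) /\ dec x (glue k g a q)).
    { intros c x; unfold s; rewrite sepE by (unfold glue; dd); rewrite prod_op; split.
      - intros [[_ Hx] (a & x' & E & K)]; apply op_inj in E; destruct E; subst; eauto.
      - intros [Hx (a & -> & Ha & K)]; split; [split; [|exact Hx]|eauto].
        apply imgE; [dd|exists a; split; [apply Ha|reflexivity]]. }
    exists s; split; [intros z Hz; unfold s in Hz; apply sepE in Hz; [tauto|unfold glue; dd]|].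
    apply zf_ext; intros z; rewrite snE; split.
    - intros Hz; pose proof (Iv z Hz) as Hz'; apply vj_mem in Hz'; destruct Hz' as (x & Hx & ->).
      destruct (Kq x Hx) as (a & Ha & K & Ga).
      destruct (glue_cond' k g a q Hkk Hgs Hq Ha) as (C1 & C2 & C3).
      exists x, (glue k g a q); split; [exact Hx|split; [exact Ga|split; [|reflexivity]]].
      rewrite C3; apply sE; split; [exact Hx|exists a; split; [reflexivity|split; [exact Ha|]]].
      destruct K as [K|K]; [exact K|exfalso].
      rewrite Ew in Hz; apply (gtruth_mem (Pb k) (Lb k) (PO k) G HG) in Hz; destruct Hz as (p & Gp & Q).
      destruct (generic_dir _ _ _ HG p _ Gp Ga) as (p' & _ & L1 & L2).
      exact (K p' L2 (forces_mono _ _ (PO k) (fMem (chk (Pb k) x) w) _ _ L1 Q)).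
    - intros (x & p & Hx & Gp & K & ->); apply sE in K; destruct K as (_ & a & E & Ha & K).
      destruct (generic_dir _ _ _ HG p q Gp Gq) as (p' & Gp' & L1 & L2).
      assert (La : le g (restr p' g) a).
      { apply (le_trans g _ (restr p g)); [exact (le_restr k g _ _ Hkk Hgs L1)|].
        apply cls_le; [exact (cond_restr k g p Hkk Hg (proj1 (proj2 L1)))|exact E]. }
      apply (decE x (glue k g a q)); [|exact K]; apply (gen_up k G HG p'); [exact Gp'|].
      apply glue_le; auto. }
  assert (S : sml k (pow (prod C dl))).
  { apply (sml_pow k Hk), (sml_prod k Hk); [apply cls_small_k, Hg|apply sml_ord, Hdl]. }
  destruct S as (eta & Heta & h & Hh).
  (* The short ground model enumeration of the sets [s] becomes a name for an enumeration of all
     subsets of [dl] in the extension. *)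
  set (W := seqn (Pb k) eta (fun i => sn (ap h i))).
  set (H := fun xi : M => ap (vl HG W) xi).
  assert (DH : F1 H) by (unfold H; dd).
  assert (HE : forall i, mem i eta -> H (vj HG i) = vl HG (sn (ap h i))).
  { intros i Hi; unfold H; apply ap_eq.
    - apply (gv_seqn (Pb k) (Lb k) (PO k) HG); [dd|]; exists i; split; [exact Hi|reflexivity].
    - intros v Hv; apply (gv_seqn (Pb k) (Lb k) (PO k) HG) in Hv; [|dd]; destruct Hv as (i' & Hi' & E).
      apply op_inj in E; destruct E as [E ->]; apply vj_inj in E; subst i'; reflexivity. }
  assert (uE : forall v, mem v u <-> exists xi, mem xi (vj HG eta) /\ v = H xi).
  { intros v; rewrite Hu; split.
    - intros Iv; destruct (all v Iv) as (s & Is & ->); destruct (Hh s) as (i & Hi & ->); [apply powE, Is|].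
      exists (vj HG i); split; [apply vj_mem_iff, Hi|symmetry; apply HE, Hi].
    - intros (xi & Hxi & ->); apply vj_mem in Hxi; destruct Hxi as (i & Hi & ->); rewrite (HE i Hi).
      intros z Hz; apply snE in Hz; destruct Hz as (x & p & Hx & _ & _ & ->); apply vj_mem_iff, Hx. }
  assert (Oe : ord (vj HG eta)) by (apply vj_ord, (ord_mem _ _ Ok Heta)).
  (* The notion of smaller cardinality asks for a bijection, so repetitions in the enumeration have
     to be removed. *)
  destruct (enum_bij (vj HG eta) H Oe DH) as (y & c & Oy & Iy & Dc & Cy & Ci & Cs).
  exists y; split.
  { assert (Q : mem (vj HG eta) (vj HG k)) by (apply vj_mem_iff, Heta).
    destruct (ord_incl _ _ Oy Oe Iy) as [K| ->]; [|exact Q].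
    exact (ord_trans _ _ _ (vj_ord k G HG k Ok) K Q). }
  exists (lam u c); split; [split; [apply fn_lam, Dc|]|split].
  - intros v z K; apply lam_op in K; [|exact Dc]; destruct K as [Hv ->]; apply uE in Hv.
    destruct Hv as (xi & Hxi & ->); exact (Cy xi Hxi).
  - intros v v' z [K K']; apply lam_op in K, K'; try exact Dc; destruct K as [Hv ->], K' as [Hv' E].
    apply uE in Hv, Hv'; destruct Hv as (xi & Hxi & ->), Hv' as (xi' & Hxi' & ->); exact (Ci xi xi' Hxi Hxi' E).
  - intros z Hz; destruct (Cs z Hz) as (xi & Hxi & ->); exists (H xi); apply lam_op; [exact Dc|].
    split; [apply uE; eauto|reflexivity].
Qed.

Lemma ext_inacc : inacc (vj HG k).
Proof.
  assert (Oj := vj_ord k G HG k Ok); assert (Rj := ext_regular).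
  split; [|split; [|split; [exact Rj|exact ext_stronglim]]].
  - split; [exact Oj|]; intros y Hy [g (((Fg & Dg) & Rg) & Ig & Sg)].
    (* The inverse of the bijection would map the smaller ordinal [y] onto [k], which regularity
       forbids. *)
    set (h := sep (prod y (vj HG k)) (fun z : M => exists a b : M, z = op b a /\ mem (op a b) g)).
    assert (hE : forall a b : M, mem (op b a) h <-> mem (op a b) g).
    { intros a b; unfold h; rewrite sepE by dd; split.
      - intros [_ (a' & b' & E & K)]; apply op_inj in E; destruct E; subst; exact K.
      - intros K; split; [|eauto]; apply prod_op; split; [exact (Rg _ _ K)|apply Dg; eauto]. }
    destruct (Rj y Hy h) as (b & Hb & K).
    + split; [split; [split|]|].
      * intros z Hz; unfold h in Hz; apply sepE in Hz; [|dd]; destruct Hz as [_ (a & b & E & _)]; eauto.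
      * intros v a a' [K K']; apply hE in K, K'; exact (Ig _ _ _ (conj K K')).
      * intros z; split; [intros Hz; destruct (Sg z Hz) as [a Ha]; exists a; apply hE, Ha|].
        intros [a Ha]; apply hE in Ha; exact (Rg _ _ Ha).
      * intros v a Ha; apply hE in Ha; apply Dg; eauto.
    + pose proof Hb as Hb'; apply Dg in Hb'; destruct Hb' as [v Hv]; apply hE in Hv.
      exact (mem_irr _ (K _ _ Hv)).
  - destruct (proj1 (proj2 Hk)) as (w & Hw & Ow); exists (vj HG w); split; [apply vj_mem_iff, Hw|].
    exact (gj_omega (Pb k) (Lb k) (PO k) HG w Ow).
Qed.
End Extension.
End Iteration.

(** * Reduction to countable models *)

Section CountableCase.
Context {V : zfc_model} (HV : countable V) (k f P L : V).
Context (Hk : V ⊨ inaccessible k) (Hf : V ⊨ partial_fun f k k) (HP : lottery_preparation k f P L).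
Lemma preparation_preord : preord P L.
Proof.
  destruct HP as (Ps & Ls & Qs & Rs & HI & HPk & HLk).
  apply sat_inaccessible in Hk; apply sat_partial_fun in Hf.
  apply (Ps_rel k f Ps Ls Qs Rs HI k P (mem_suc k)) in HPk.
  apply (Ls_rel k f Ps Ls Qs Rs HI k L (mem_suc k)) in HLk; subst P L.
  eapply PO; eassumption.
Qed.
Lemma preparation_inaccessible G : generic P L G -> ext_sat G (inaccessible (chk P k)).
Proof.
  intros HG; destruct HP as (Ps & Ls & Qs & Rs & HI & HPk & HLk).
  apply sat_inaccessible in Hk; apply sat_partial_fun in Hf.
  apply (Ps_rel k f Ps Ls Qs Rs HI k P (mem_suc k)) in HPk.
  apply (Ls_rel k f Ps Ls Qs Rs HI k L (mem_suc k)) in HLk; subst P L.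
  pose proof (ext_inacc HV k f Ps Ls Qs Rs Hk Hf HI G HG) as K.
  apply sat_inaccessible in K.
  refine (proj1 (gext_sat _ _ _ (fun W e => inaccessible (e 0)) G HG (fun _ => chk (Pb Ps k) k) _) K).
  rf.
Qed.
End CountableCase.

Lemma reified_ren (a : forall W : zfc_model, (nat -> W) -> form W) (r : nat -> nat) :
  reified a -> reified (fun (W : zfc_model) e => a W (fun n => e (r n))).
Proof. intros [phi H]; exists (ren r phi); intros W e; rewrite H, emb_ren; reflexivity. Qed.
Lemma rf_ticket i j m n :
  reified (fun (W : zfc_model) (e : nat -> W) => is_lottery_sum (lottery_ticket (e i) (e j)) (e m) (e n)).
Proof.
  exact (reified_ren _ (fun x => match x with 0 => i | 1 => j | 2 => m | _ => n end) rf_lottery).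
Qed.
Ltac ud_ext ::=
  first [ apply UD_in_name | apply UD_ple | apply UD_forces_eq | apply UD_forces_mem | apply UD_check
        | apply UD_forces; first [ apply rf_ticket | solve [ rf ] ] ].

Lemma UD_preord i j : UD (fun V e => preord (e i) (e j)).
Proof. unfold preord; ud. Qed.
Lemma UD_stage i j m n o q : UD (fun V e => lottery_stage (e i) (e j) (e m) (e n) (e o) (e q)).
Proof. unfold lottery_stage, full_name, name_dom, active_stage, forced; ud. Qed.
Lemma UD_condition i j m n o : UD (fun V e => iteration_condition (e i) (e j) (e m) (e n) (e o)).
Proof. unfold iteration_condition, name_dom, forced; ud. Qed.
Lemma UD_le i j m n o q : UD (fun V e => iteration_le (e i) (e j) (e m) (e n) (e o) (e q)).
Proof. unfold iteration_le; ud. Qed.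
Lemma UD_preparation i j m n : UD (fun V e => lottery_preparation (e i) (e j) (e m) (e n)).
Proof.
  unfold lottery_preparation; do 4 apply UD_ex; apply UD_and; [|ud].
  (* The record is unfolded into a conjunction, which the definability lemmas can take apart. *)
  apply (UD_iff (fun V e => let k := e (4 + i) in let f := e (4 + j) in
    let Ps := e 3 in let Ls := e 2 in let Qs := e 1 in let Rs := e 0 in
    (exists k', (V ⊨ is_succ k' k) /\ (V ⊨ fun_on Ps k') /\ (V ⊨ fun_on Ls k')) /\
    ((V ⊨ fun_on Qs k) /\ (V ⊨ fun_on Rs k)) /\
    (forall c P, (V ⊨ related Ps c P) ->
      forall p, mem p P <-> iteration_condition Ps Ls Qs c p) /\
    (forall c P L, (V ⊨ related Ps c P) -> (V ⊨ related Ls c L) ->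
      forall w, mem w L <->
        exists p q, mem p P /\ mem q P /\ (V ⊨ is_opair w p q) /\
          iteration_le Ps Ls Rs c p q) /\
    (forall c P L Q R, mem c k ->
      (V ⊨ related Ps c P) -> (V ⊨ related Ls c L) ->
      (V ⊨ related Qs c Q) -> (V ⊨ related Rs c R) ->
      lottery_stage f c P L Q R))).
  - intros V e; split.
    + intros (A & B & C & D' & E); constructor; assumption.
    + intros [A B C D' E]; exact (conj A (conj B (conj C (conj D' E)))).
  - cbv zeta; repeat first [ apply UD_stage | apply UD_condition | apply UD_le | ud_step ].
Qed.

Theorem theorem3p3 (V : zfc_model) (k f : V)
    (hk : V ⊨ inaccessible k)
    (hf : V ⊨ partial_fun f k k)
    (hdom : V ⊨ unbounded_dom f k)
    (P L : V) (hP : lottery_preparation k f P L)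
    (G : V -> Prop) (hG : generic P L G) :
  exists k' : V, check_name P k k' /\ ext_sat G (inaccessible k').
Proof.
  clear hdom; exists (chk P k); split; [apply check_nameE; reflexivity|].
  assert (PO : preord P L).
  (* That the preparation is a preorder was itself proved with generic filters over countable
     models. It needs its own reflection before the truth lemma is available for [G]. *)
  { apply NNPP; intros N; revert V k f hk hf P L hP G hG N.
    enough (K : forall (V : zfc_model) (e : nat -> V), ~ ((V ⊨ inaccessible (e 0)) /\ (V ⊨ partial_fun (e 1) (e 0) (e 0)) /\
      lottery_preparation (e 0) (e 1) (e 2) (e 3) /\ ~ preord (e 2) (e 3))).
    { intros V k f hk hf P L hP G hG N.
      apply (K V (scons k (scons f (scons P (fun _ => L))))); auto. }
    apply reflect_countable.
    - repeat first [ apply UD_preparation | apply UD_preord | ud_step ].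
    - intros V HV e (H1 & H2 & H3 & H4); apply H4.
      exact (preparation_preord HV _ _ _ _ H1 H2 H3). }
  apply NNPP; intros N.
  assert (Rf : reified (fun (W : zfc_model) (e : nat -> W) => fNot (inaccessible (e 0)))) by rf.
  (* A failure in the extension is forced by some condition. That statement no longer mentions [G],
     which is not an element of the model and could not be reflected. *)
  assert (T : exists p, G p /\ forces P L p (fNot (inaccessible (chk P k)))).
  { apply (gext_truth P L PO (fun W e => fNot (inaccessible (e 0))) G hG (fun _ => chk P k) Rf).
    apply (gext_sat P L PO (fun W e => fNot (inaccessible (e 0))) G hG (fun _ => chk P k) Rf); exact N. }
  destruct T as (p & Gp & Kp); assert (Hp := generic_sub _ _ _ hG p Gp).
  clear N G hG Gp.
  enough (K : forall (V : zfc_model) (e : nat -> V), ~ ((V ⊨ inaccessible (e 0)) /\ (V ⊨ partial_fun (e 1) (e 0) (e 0)) /\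
      lottery_preparation (e 0) (e 1) (e 2) (e 3) /\ check_name (e 2) (e 0) (e 4) /\ mem (e 5) (e 2) /\
      forces (e 2) (e 3) (e 5) (fNot (inaccessible (e 4))))).
  { apply (K V (scons k (scons f (scons P (scons L (scons (chk P k) (fun _ => p))))))); cbn [scons].
    exact (conj hk (conj hf (conj hP (conj (proj2 (check_nameE P k _) eq_refl) (conj Hp Kp))))). }
  apply reflect_countable.
  - repeat first [ apply UD_preparation | ud_step ].
  - intros W HW e (H1 & H2 & H3 & H4 & H5 & H6); apply check_nameE in H4.
    assert (PO' := preparation_preord HW _ _ _ _ H1 H2 H3).
    (* Over the countable model there is a generic filter through the offending condition, and in
       its extension [k] would be both inaccessible and not. *)
    destruct (generic_exists HW _ _ PO' _ H5) as (G & HG & Gp).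
    pose proof (preparation_inaccessible HW _ _ _ _ H1 H2 H3 G HG) as Q; rewrite <- H4 in Q.
    refine (proj1 (gext_sat _ _ PO' (fun W e => fNot (inaccessible (e 0))) G HG (fun _ => e 4) Rf) _ Q).
    apply (gext_truth _ _ PO' (fun W e => fNot (inaccessible (e 0))) G HG (fun _ => e 4) Rf).
    exists (e 5); auto.
Qed.
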